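(* Let $\Sigma\Subset\mathbb{S}$ be a nonempty open set, $\varphi\in U_\Sigma^+$ and $\phi\in U_\Sigma^-$. Then $\tau_{pm}(\varphi)$ is the unique function in $L^2(\mathbb S)$ such that the field $\mathbf f=B_+\varphi+B_-\tau_{pm}(\varphi)$ is tangent and divergence-free on $\Sigma$, and $\tau_{mp}(\phi)$ is the unique function in $L^2(\mathbb S)/\langle1\rangle$ such that the field $\mathbf g=B_+\tau_{mp}(\phi)+B_-\phi$ is tangent and divergence-free on $\Sigma$.
   Context: Let $d\ge 3$, let $\mathbb S$ be the unit sphere in $\mathbb R^d$ with surface measure $\omega$, $\omega_d=\omega(\mathbb S)$, and outward unit normal field $\mathbf n$. $L^2(\mathbb S)$ is the space of square-integrable functions on $\mathbb S$ and $L^2(\mathbb S,\mathbb R^d)$ the space of square-integrable $\mathbb R^d$-valued vector fields on $\mathbb S$, with canonical inner products. For a subspace $H\subseteq L^2(\mathbb S)$, $H/\langle 1\rangle$ denotes the subspace $\{f\in H:\langle f,1\rangle=0\}$ of functions with zero mean. $\nabla_{\mathbb S}$ is the surface gradient, $I$ the identity. $\Sigma\Subset\mathbb S$ means that $\Sigma$ and its closure $\overline\Sigma$ are both proper subsets of $\mathbb S$. For open $\Sigma\subseteq\mathbb S$, $L^2(\Sigma)\subseteq L^2(\mathbb S)$ is the subspace of functions vanishing a.e. outside $\Sigma$, $P=P_\Sigma$ is the orthogonal projection of $L^2(\mathbb S)$ onto $L^2(\Sigma)$, and $C_c^\infty(\Sigma)$ is the set of smooth functions on $\mathbb S$ with compact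 support in $\Sigma$. A field $\mathbf f\in L^2(\mathbb S,\mathbb R^d)$ is tangent on $\Sigma$ if $\mathbf n\cdot\mathbf f=0$ a.e. on $\Sigma$; then $\operatorname{div}_{\mathbb S}(\mathbf f)|_\Sigma=0$ (divergence-free on $\Sigma$) means $\int_\Sigma \mathbf f\cdot\nabla_{\mathbb S}\varphi\,d\omega=0$ for all $\varphi\in C_c^\infty(\Sigma)$. Layer potentials, for $f\in L^2(\mathbb S)$ and $x\in\mathbb S$: $Sf(x)=\frac{-1}{\omega_d(d-2)}\int_{\mathbb S}\frac{f(y)}{|x-y|^{d-2}}d\omega(y)$ and $Kf(x)=\mathrm{p.v.}\,\frac{-1}{\omega_d}\int_{\mathbb S}\frac{\mathbf n(y)\cdot(x-y)}{|x-y|^{d}}f(y)\,d\omega(y)$. The operator $S$ maps $L^2(\mathbb S)$ bijectively and boundedly onto the Sobolev space $W^{1,2}(\mathbb S)$. Define bounded operators $B_+:L^2(\mathbb S)/\langle1\rangle\to L^2(\mathbb S,\mathbb R^d)$, $B_+f=\mathbf n\,(K-\tfrac12I)f+\nabla_{\mathbb S}Sf$, and $B_-:L^2(\mathbb S)\to L^2(\mathbb S,\mathbb R^d)$, $B_-f=\mathbf n\,(K+\tfrac12I)f+\nabla_{\mathbb S}Sf$. Define $\mathcal D_\Sigma=\{f\in L^2(\mathbb S): \operatorname{div}_{\mathbb S}(\nabla_{\mathbb S}Sf)|_\Sigma=0\}$, $U_\Sigma^+=\{f\in L^2(\mathbb S): Pf=P(K+\tfrac12I)g\text{ for some }g\in\mathcal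 D_\Sigma\}/\langle1\rangle$, and $U_\Sigma^-=\{f\in L^2(\mathbb S): Pf=P(K-\tfrac12I)g\text{ for some }g\in\mathcal D_\Sigma/\langle1\rangle\}$. The operators $P(K+\tfrac12I):\mathcal D_\Sigma\to L^2(\Sigma)$ and $P(K-\tfrac12I):\mathcal D_\Sigma/\langle1\rangle\to L^2(\Sigma)$ are injective, and $[\,\cdot\,]^{-1}$ denotes their inverses on their ranges. Define $\tau_{pm}:L^2(\mathbb S)/\langle1\rangle\supseteq U_\Sigma^+\to L^2(\mathbb S)$, $\tau_{pm}(f)=[P(K+\tfrac12I)]^{-1}Pf-f$, and $\tau_{mp}:L^2(\mathbb S)\supseteq U_\Sigma^-\to L^2(\mathbb S)/\langle1\rangle$, $\tau_{mp}(f)=-[P(K-\tfrac12I)]^{-1}Pf-f+m(f)$, where $m(f)=\frac1{\omega_d}\int_{\mathbb S}f\,d\omega$ is the mean of $f$ viewed as a constant function. *)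

(* Defs.v *)
From HB Require Import structures.
From mathcomp Require Import all_boot all_order all_algebra.
From mathcomp Require Import all_classical all_reals all_analysis measurable_realfun.

Set Implicit Arguments.
Unset Strict Implicit.
Unset Printing Implicit Defensive.

Import Order.TTheory GRing.Theory Num.Theory.
Import numFieldNormedType.Exports.

Local Open Scope classical_set_scope.
Local Open Scope ring_scope.

(* The sigma-algebra on R^n is the product (= Borel) sigma-algebra, generated
   by the coordinate functions, as the library does for n-tuples. *)
Definition rV_display : measure_display.
Proof. exact: default_measure_display. Qed.

Section measurable_rV.
Context {R : realType} (n : nat).

Let coord (i : 'I_n) (x : 'rV[R]_n) : R := x 0 i.

Let rV_set0 : g_sigma_preimage coord set0.
Proof. exact: sigma_algebra0. Qed.

Let rV_setC A : g_sigma_preimage coord A -> g_sigma_preimage coord (~` A).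
Proof. exact: sigma_algebraC. Qed.

Let rV_bigcup (F : (set _)^nat) : (forall i, g_sigma_preimage coord (F i)) ->
  g_sigma_preimage coord (\bigcup_i F i).
Proof. exact: sigma_algebra_bigcup. Qed.

HB.instance Definition _ := @isMeasurable.Build rV_display 'rV[R]_n
  (g_sigma_preimage coord) rV_set0 rV_setC rV_bigcup.

End measurable_rV.

Section measurable_rV_lemmas.
Context {R : realType}.

Lemma measurable_rV_coord n (i : 'I_n) :
  measurable_fun [set: 'rV[R]_n] (fun x => x 0 i).
Proof.
move=> _ Y mY; rewrite setTI; apply: sub_sigma_algebra => /=.
rewrite -bigcup_seq/=; exists i => /=; first by rewrite mem_index_enum.
by exists Y => //; rewrite setTI.
Qed.

Lemma measurable_fun_rVP d (T : measurableType d) n (f : T -> 'rV[R]_n) :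
  (forall i, measurable_fun [set: T] (fun x => f x 0 i)) ->
  measurable_fun [set: T] f.
Proof.
move=> mf.
suff H : @measurable _ 'rV[R]_n `<=` [set A | measurable (f @^-1` A)].
  by move=> _ A mA; rewrite setTI; exact: H.
apply: smallest_sub.
  split => /=.
  - by rewrite preimage_set0; exact: measurable0.
  - by move=> A mA; rewrite setTD preimage_setC; exact: measurableC.
  - by move=> F mF; rewrite preimage_bigcup; exact: bigcup_measurable.
case: n f mf => [|n] f mf; first by rewrite big_ord0.
rewrite -bigcup_mkord_ord; apply: bigcup_sub => i Ii A [B mB <-] /=.
by rewrite setTI -[X in measurable X]setTI; exact: mf.
Qed.

End measurable_rV_lemmas.

(* Lebesgue measure on R^n, as the n-fold product of Lebesgue measure on R *)
Section lebesgue_rV.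
Context {R : realType}.

Definition rV_cons n (p : R * 'rV[R]_n) : 'rV[R]_n.+1 :=
  \row_i oapp (fun j => p.2 0 j) p.1 (unlift ord0 i).

Definition rV_uncons n (x : 'rV[R]_n.+1) : R * 'rV[R]_n :=
  (x 0 ord0, \row_j x 0 (lift ord0 j)).

Lemma rV_consK n : cancel (@rV_cons n) (@rV_uncons n).
Proof.
move=> [a x]; congr pair; first by rewrite mxE unlift_none.
by apply/rowP => j; rewrite !mxE liftK.
Qed.

Lemma measurable_rV_cons n : measurable_fun setT (@rV_cons n).
Proof.
apply: measurable_fun_rVP => i; case: (unliftP ord0 i) => [j|] ->.
  apply: (eq_measurable_fun (fun p : R * 'rV[R]_n => p.2 0 j)).
    by move=> p _; rewrite mxE liftK.
  apply: (@measurableT_comp _ _ _ _ _ _ (fun x : 'rV[R]_n => x 0 j)) => //.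
  exact: measurable_rV_coord.
apply: (eq_measurable_fun (fun p : R * 'rV[R]_n => p.1)); last first.
  exact: measurable_fst.
by move=> p _; rewrite mxE unlift_none.
Qed.

Lemma measurable_rV_uncons n : measurable_fun setT (@rV_uncons n).
Proof.
apply/measurable_fun_pairP; split; first exact: measurable_rV_coord.
apply: measurable_fun_rVP => i.
apply: (eq_measurable_fun (fun x : 'rV[R]_n.+1 => x 0 (lift ord0 i))).
  by move=> x _; rewrite /= mxE.
exact: measurable_rV_coord.
Qed.

Section step.
Context n (m : {sigma_finite_measure set 'rV[R]_n -> \bar R}).

Definition lebesgue_rV_succ : set 'rV[R]_n.+1 -> \bar R :=
  pushforward (@lebesgue_measure R \x m)%E (@rV_cons n).

Let pf : {measure set 'rV[R]_n.+1 -> \bar R} :=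
  measure_function_pushforward__canonical__measure_function_Measure
    (@lebesgue_measure R \x m)%E (@measurable_rV_cons n).

HB.instance Definition _ := isMeasure.Build _ _ _ lebesgue_rV_succ
  (measure0 pf) (measure_ge0 pf) (@measure_semi_sigma_additive _ _ _ pf).

Let sigma_finite_succ : sigma_finite setT lebesgue_rV_succ.
Proof.
have /sigma_finiteP[F [TF ndF Foo]] := sigma_finiteT (@lebesgue_measure R).
have /sigma_finiteP[G [TG ndG Goo]] := sigma_finiteT m.
exists (fun k => @rV_uncons n @^-1` (F k `*` G k)).
  rewrite -preimage_bigcup -[LHS](preimage_setT (@rV_uncons n)).
  congr (_ @^-1` _); rewrite -setXTT TF TG predeqE => -[x y]; split.
    move=> [/= [i _ Fix] [j _ Gjy]]; exists (maxn i j) => //; split.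
    - by move: x Fix; exact/subsetPset/ndF/leq_maxl.
    - by move: y Gjy; exact/subsetPset/ndG/leq_maxr.
  by move=> [i _ []/= ? ?]; split; exists i.
move=> k; have [mF Fk] := Foo k; have [mG Gk] := Goo k; split.
  rewrite -[X in measurable X]setTI; apply: measurable_rV_uncons => //.
  exact: measurableX.
rewrite /lebesgue_rV_succ /pushforward -comp_preimage.
rewrite (_ : _ \o _ = id); last by apply/funext => p /=; rewrite rV_consK.
by rewrite preimage_id product_measure1E// lte_mul_pinfty// ge0_fin_numE.
Qed.

HB.instance Definition _ := Measure_isSigmaFinite.Build _ _ _ lebesgue_rV_succ
  sigma_finite_succ.

End step.

Fixpoint lebesgue_rV n : {sigma_finite_measure set 'rV[R]_n -> \bar R} :=
  if n is n'.+1 then lebesgue_rV_succ (lebesgue_rV n') else \d_(0 : 'rV[R]_0).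

End lebesgue_rV.

Section sphere.
Context {R : realType} (d : nat).
Local Notation E := 'rV[R]_d.
Implicit Types (x u v : E).

Definition dotp u v : R := \sum_i u 0 i * v 0 i.

(* the Euclidean norm; the library's norm on row vectors is the sup norm *)
Definition enorm u : R := Num.sqrt (dotp u u).

Definition sphere : set E := [set x | enorm x = 1].

Definition unitv x : E := (enorm x)^-1 *: x.

Lemma measurable_enorm : measurable_fun setT enorm.
Proof.
apply: (eq_measurable_fun (fun x => dotp x x `^ 2^-1)).
  by move=> x _; rewrite /enorm powR12_sqrt// sumr_ge0// => i _; exact: sqr_ge0.
apply: (measurableT_comp (measurable_powR _)).
by apply: measurable_sum => i; apply: measurable_funM; exact: measurable_rV_coord.
Qed.

Lemma measurable_unitv : measurable_fun setT unitv.
Proof.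
apply: measurable_fun_rVP => i.
apply: (eq_measurable_fun (fun x => enorm x `^ (-1) * x 0 i)).
  by move=> x _; rewrite mxE powR_inv1// sqrtr_ge0.
apply: measurable_funM; last exact: measurable_rV_coord.
exact: (measurableT_comp (measurable_powR _) measurable_enorm).
Qed.

Definition pball : set E := [set x | 0 < enorm x <= 1].

Lemma measurable_pball : measurable pball.
Proof.
rewrite (_ : pball = setT `&` enorm @^-1` `]0, 1]).
  by apply: measurable_enorm => //; exact: measurable_itv.
by rewrite setTI; apply/seteqP; split => x /=; rewrite in_itv.
Qed.

(* Surface measure of the sphere, as a Borel measure on R^d carried by the
   sphere, by polar coordinates:
   omega A = d * Lebesgue {x | 0 < |x| <= 1 & x / |x| \in A} *)
Definition omega : set E -> \bar R :=
  pushforward (mscale d%:R%:nng (mrestr (lebesgue_rV d) measurable_pball)) unitv.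

Let pf : {measure set E -> \bar R} :=
  measure_function_pushforward__canonical__measure_function_Measure
    (mscale d%:R%:nng (mrestr (lebesgue_rV d) measurable_pball))
    measurable_unitv.

HB.instance Definition _ := isMeasure.Build _ _ _ omega
  (measure0 pf) (measure_ge0 pf) (@measure_semi_sigma_additive _ _ _ pf).

End sphere.

Arguments omega {R} d.
Arguments sphere {R} d.

Section layer_potentials.
Context {R : realType} (d : nat).
Local Notation E := 'rV[R]_d.
Implicit Types (x y : E) (f g phi : E -> R) (F V : E -> E) (Sigma : set E).
Local Notation omega := (@omega R d).
Local Notation sphere := (@sphere R d).

Definition omega_d : R := fine (omega sphere).

(* Elements of L^2(S) are represented by Borel functions on R^d; as omega is
   carried by the sphere, values off the sphere are irrelevant, and equality
   in L^2(S) is equality omega-almost everywhere. *)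
Definition L2 : set (E -> R) := [set f | f \in Lfun omega 2%:E].

Definition L2vec : set (E -> E) := [set F | forall i, L2 (fun x => F x 0 i)].

Definition mean f : R := omega_d^-1 * \int[omega]_(x in sphere) f x.

(* L^2(S)/<1> *)
Definition L2_0 : set (E -> R) :=
  L2 `&` [set f | \int[omega]_(x in sphere) f x = 0].

Definition sphere_open Sigma := exists2 O, open O & Sigma = O `&` sphere.

(* Sigma \Subset S *)
Definition compactly_proper Sigma :=
  Sigma `<` sphere /\ closure Sigma `<` sphere.

(* orthogonal projection of L^2(S) onto L^2(Sigma): multiplication by the
   indicator function of Sigma *)
Definition projL2 Sigma f : E -> R := f \_ Sigma.

Definition partial (i : 'I_d) f x : R := 'D_(delta_mx 0 i) f x.

(* f is C^infinity on the open set U *)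
Definition smooth_on (U : set E) f :=
  forall (s : seq 'I_d) x, U x -> differentiable (foldr partial f s) x.

(* the extension of f|_S that is constant along rays from the origin *)
Definition radial_ext f x : R := f (unitv x).

Definition smooth f := smooth_on [set x | x != 0] (radial_ext f).

(* surface gradient: the gradient of the radially constant extension, which on
   S is the tangential part of the gradient of any smooth extension *)
Definition sgrad f x : E := \row_i partial i (radial_ext f) x.

Definition Cc_infty Sigma : set (E -> R) := [set phi |
  let K := closure (sphere `&` [set x | phi x != 0]) in
  [/\ smooth phi, compact K & K `<=` Sigma]].

Definition smooth_tangent_field V :=
  (forall i, smooth (fun x => V x 0 i)) /\
  (forall x, sphere x -> dotp x (V x) = 0).

(* surface divergence of a smooth tangent field *)
Definition sdiv V x : R := \sum_i sgrad (fun y => V y 0 i) x 0 i.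

(* F is the weak surface gradient of u; thus u is in W^{1,2}(S) iff
   u is in L^2(S) and such an F exists *)
Definition is_weak_sgrad (u : E -> R) F :=
  [/\ L2vec F,
      \forall x \ae omega, sphere x -> dotp x (F x) = 0 &
      forall V, smooth_tangent_field V ->
        \int[omega]_(x in sphere) dotp (F x) (V x) =
        - \int[omega]_(x in sphere) (u x * sdiv V x)].

(* surface gradient on W^{1,2}(S), a null field elsewhere; determined up to
   equality almost everywhere *)
Definition weak_sgrad (u : E -> R) : E -> E :=
  xget (cst 0) [set F | is_weak_sgrad u F].

Definition tangent_on Sigma F :=
  \forall x \ae omega, Sigma x -> dotp x (F x) = 0.

Definition divfree_on Sigma F := forall phi, Cc_infty Sigma phi ->
  \int[omega]_(x in Sigma) dotp (F x) (sgrad phi x) = 0.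

(* In the definitions below the outward unit normal at y in S is y itself. *)

Definition single_layer f x : R :=
  - 1 / (omega_d * (d - 2)%:R) *
  \int[omega]_(y in sphere) (f y / enorm (x - y) ^+ (d - 2)).

(* The principal value is the limit as eps -> 0+ of the integral over
   {y in S | eps < |x - y|}. *)
Definition double_layer f x : R :=
  lim (- 1 / omega_d *
    \int[omega]_(y in sphere `&` [set y | eps < enorm (x - y)])
      (dotp y (x - y) / enorm (x - y) ^+ d * f y) @[eps --> 0^'+]).

(* K + I/2 and K - I/2 *)
Definition Kplus f x : R := double_layer f x + 2^-1 * f x.
Definition Kminus f x : R := double_layer f x - 2^-1 * f x.

Definition Bplus f x : E := Kminus f x *: x + weak_sgrad (single_layer f) x.
Definition Bminus f x : E := Kplus f x *: x + weak_sgrad (single_layer f) x.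

Definition Dspace Sigma : set (E -> R) :=
  L2 `&` [set f | divfree_on Sigma (weak_sgrad (single_layer f))].

Definition Dspace0 Sigma : set (E -> R) := Dspace Sigma `&` L2_0.

(* g is a preimage of h under the restriction of P T to D, in L^2(S) *)
Definition is_preimage Sigma (D : set (E -> R)) (T : (E -> R) -> E -> R) h g :=
  D g /\ projL2 Sigma (T g) = h %[ae omega].

(* [P T]^{-1} h for h in the range of the injective operator P T on D *)
Definition inverse_on Sigma (D : set (E -> R)) (T : (E -> R) -> E -> R) h :=
  xget (cst 0) [set g | is_preimage Sigma D T h g].

Definition Uplus Sigma : set (E -> R) := L2_0 `&`
  [set f | exists g, is_preimage Sigma (Dspace Sigma) Kplus (projL2 Sigma f) g].

Definition Uminus Sigma : set (E -> R) := L2 `&`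
  [set f | exists g, is_preimage Sigma (Dspace0 Sigma) Kminus (projL2 Sigma f) g].

Definition tau_pm Sigma f x : R :=
  inverse_on Sigma (Dspace Sigma) Kplus (projL2 Sigma f) x - f x.

Definition tau_mp Sigma f x : R :=
  - inverse_on Sigma (Dspace0 Sigma) Kminus (projL2 Sigma f) x - f x + mean f.

Definition tangent_divfree_on Sigma F :=
  [/\ L2vec F, tangent_on Sigma F & divfree_on Sigma F].

(* t is the unique element, up to equality a.e., of D satisfying Q *)
Definition unique_ae_in (D : set (E -> R)) (Q : (E -> R) -> Prop) (t : E -> R) :=
  [/\ D t, Q t & forall t', D t' -> Q t' -> t' = t %[ae omega]].

End layer_potentials.

Arguments L2 {R} d.
Arguments L2_0 {R} d.

(* Main.v *)
(* Let W be the area of the sphere, beta = (d - 2) / 2, and let T_r and P_r be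
   the integral operators on the sphere with the kernels k_r = |r x - y|^(2 - d)
   and p_r = (1 - r^2) |r x - y|^(-d), and T = T_1. Then S = - T / ((d - 2) W)
   and K = T / (2 W), and K maps the constant m to m / 2. By linearity this
   shows that tau_pm and tau_mp yield solutions, and uniqueness amounts to the
   following: if g is in L^2, v = T g + e W g with e = 1 or e = -1 vanishes on
   Sigma, and T g is weakly harmonic on Sigma, then g = 0, provided that g has
   mean zero if e = -1.

   Integrating by parts, the pairing of v with (r d/dr + (1 - e) beta) P_r phi
   is a multiple of the pairing of g with T_r (lap phi). If phi is supported in
   a cap inside Sigma, the latter tends to 0 as r -> 1, so that the integral of
   v(x) phi(y) |x - y|^(-d) vanishes. Replacing phi by lap phi repeatedly gives
   the same for |x - y|^(-d-2j); as t = x . y is bounded away from 1 on the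
   support, powers of 1 / |x - y|^2 approximate t^m, and letting phi concentrate
   at y shows that the moments of v, the integrals of v(x) (x . y)^m, vanish for
   y in Sigma. They are polynomials in y, so they vanish everywhere, the Poisson
   integrals of v are 0, and so is v. Finally P_r v = W (T_r g + e P_r g), and
   r d/dr T_r g = beta (P_r g - T_r g) turns P_r v = 0 into P_r g = 0.

   The weak gradient of S f is the limit in L^2 of the gradients of T_r f; these
   are Cauchy since <grad T_r f, grad T_s f> is beta^2 times
   <P_r f, P_s f> - <T_r f, T_s f>, and <P_r f, P_s f> = W <P_(r s) f, f> is
   monotone in r s and bounded. *)

From HB Require Import structures.
Require Import Defs.
From mathcomp Require Import all_boot all_order all_algebra.
From mathcomp Require Import all_classical all_reals all_analysis.
From mathcomp Require Import measurable_realfun ring lra.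

Set Implicit Arguments.
Unset Strict Implicit.
Unset Printing Implicit Defensive.

Import Order.TTheory GRing.Theory Num.Theory.
Import numFieldNormedType.Exports.

Local Open Scope classical_set_scope.
Local Open Scope ring_scope.

(** * Integrable functions on a subset *)

(** Uniqueness is unique continuation in disguise. Let u(r x) = T_r g(x), which is harmonic in the
    ball. Up to a constant factor, P_r v is w = r d/dr u for e = -1 and w = r d/dr u + (d - 2) u for
    e = 1. So v = 0 on Sigma is a zero Dirichlet datum of w; by the Laplace equation in polar
    coordinates, r d/dr w is then minus the surface Laplacian of u on Sigma, so that weak
    harmonicity of T g is a zero Neumann datum. The integral of v(x) |x - y|^(-d) is this Neumann
    datum at y, up to a factor. As g is only in L^2, neither datum exists pointwise: kernels of
    radius r < 1 are paired with test functions, and r tends to 1 at the end.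

    For e = -1 the constants m satisfy T m = W m, whence the condition of zero mean.

    No spherical harmonics occur: the composition laws of the kernels follow from Green's formula
    and differential equations in the radius. The surface measure is defined by polar coordinates,
    so Green's formula itself is derived from integration along coordinate lines of R^d. *)

Section integral_on_subset.
Context d (T : measurableType d) (R : realType).
Variables (mu : {finite_measure set T -> \bar R}) (D : set T).
Hypothesis mD : measurable D.
Implicit Types (f g h : T -> R) (F : T * T -> R) (K L : T -> T -> R).

(** Measurability is asked on the whole space rather than on [D], so that products, compositions and
    sections of kernels stay measurable with no restriction to carry along. *)
Definition L1on f := measurable_fun setT f /\ mu.-integrable D (EFin \o f).

Definition I f := \int[mu]_(x in D) f x.

Lemma L1on_meas f : L1on f -> measurable_fun setT f.
Proof. by case. Qed.

Lemma muD_fin : (mu D < +oo)%E.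
Proof. by rewrite ltey_eq fin_num_measure. Qed.

Lemma L1on_bounded M f : measurable_fun setT f ->
  (forall x, D x -> `|f x| <= M) -> L1on f.
Proof.
move=> mf fM; split=> //; apply: measurable_bounded_integrable => //.
- exact: muD_fin.
- exact: measurable_funS mf.
- exists M; split; first exact: num_real.
  by move=> y My x Dx; exact: le_trans (fM x Dx) (ltW My).
Qed.

Lemma L1on_le f g : measurable_fun setT f -> L1on g ->
  (forall x, D x -> `|f x| <= `|g x|) -> L1on f.
Proof.
move=> mf [mg ig] fg; split=> //; apply: (le_integrable mD _ _ ig).
  by apply/measurable_EFinP; exact: measurable_funS mf.
by move=> x Dx; rewrite lee_fin fg.
Qed.

Lemma L1onD f g : L1on f -> L1on g -> L1on (fun x => f x + g x).
Proof.
move=> [mf if_] [mg ig]; split; first exact: measurable_funD.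
exact: (integrableD mD if_ ig).
Qed.

Lemma L1onZ r f : L1on f -> L1on (fun x => r * f x).
Proof.
move=> [mf if_]; split; first exact: measurable_funM.
exact: (integrableZl mD r if_).
Qed.

Lemma L1onB f g : L1on f -> L1on g -> L1on (fun x => f x - g x).
Proof.
move=> [mf if_] [mg ig]; split; first exact: measurable_funB.
exact: (integrableB mD if_ ig).
Qed.

Lemma L1on_sum n (f : 'I_n -> T -> R) : (forall i, L1on (f i)) ->
  L1on (fun x => \sum_i f i x).
Proof.
elim: n f => [|n IH] f Lf.
  apply: (@L1on_bounded 0) => [|x _]; last by rewrite big_ord0 normr0.
  rewrite (_ : (fun _ => _) = cst 0) //.
  by apply/funext => x; rewrite big_ord0.
rewrite (_ : (fun _ => _) = fun x => f ord0 x + \sum_i f (lift ord0 i) x).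
  by apply: L1onD => //; apply: IH.
by apply/funext => x; rewrite big_ord_recl.
Qed.

Lemma L1on_mul_bounded M f g : measurable_fun setT f ->
  (forall x, D x -> `|f x| <= M) -> L1on g -> L1on (fun x => f x * g x).
Proof.
move=> mf fM Lg; apply: (@L1on_le _ (fun x => `|M| * g x)).
- by apply: measurable_funM => //; exact: L1on_meas.
- exact: L1onZ.
- move=> x Dx; rewrite !normrM normr_id ler_wpM2r//.
  by rewrite (le_trans (fM x Dx))// ler_norm.
Qed.

Lemma L1on_norm f : L1on f -> L1on (fun x => `|f x|).
Proof.
move=> [mf if_]; split; first exact: measurableT_comp.
exact: integrable_norm.
Qed.

Lemma L1on_cst r : L1on (fun=> r).
Proof. by apply: (@L1on_bounded `|r|). Qed.

Lemma I_add f g : L1on f -> L1on g -> I (fun x => f x + g x) = I f + I g.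
Proof. by move=> [_ ?] [_ ?]; rewrite /I RintegralD. Qed.

Lemma I_sub f g : L1on f -> L1on g -> I (fun x => f x - g x) = I f - I g.
Proof. by move=> [_ ?] [_ ?]; rewrite /I RintegralB. Qed.

Lemma I_scale r f : L1on f -> I (fun x => r * f x) = r * I f.
Proof. by move=> [_ ?]; rewrite /I RintegralZl. Qed.

Lemma I_opp f : L1on f -> I (fun x => - f x) = - I f.
Proof.
move=> Lf; rewrite -[RHS]mulN1r -I_scale//.
by congr I; apply/funext => x; rewrite mulN1r.
Qed.

Lemma eq_I f g : (forall x, D x -> f x = g x) -> I f = I g.
Proof. by move=> fg; apply: eq_Rintegral => x /[!inE] /fg. Qed.

Lemma I_0 : I (fun=> 0) = 0.
Proof. by rewrite /I Rintegral_cst// mul0r. Qed.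

Lemma I_eq0 f : (forall x, D x -> f x = 0) -> I f = 0.
Proof. by move=> f0; rewrite (eq_I f0) I_0. Qed.

Lemma I_sum n (f : 'I_n -> T -> R) : (forall i, L1on (f i)) ->
  I (fun x => \sum_i f i x) = \sum_i I (f i).
Proof.
elim: n f => [|n IH] f Lf.
  by rewrite big_ord0; apply: I_eq0 => x _; rewrite big_ord0.
rewrite big_ord_recl -IH// -I_add//; last exact: L1on_sum.
by congr I; apply/funext => x; rewrite big_ord_recl.
Qed.

Lemma I_le f g : L1on f -> L1on g -> (forall x, D x -> f x <= g x) -> I f <= I g.
Proof. by move=> [_ ?] [_ ?] fg; apply: le_Rintegral. Qed.

Lemma I_ge0 f : (forall x, D x -> 0 <= f x) -> 0 <= I f.
Proof. by move=> f0; apply: Rintegral_ge0. Qed.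

Lemma I_norm f : L1on f -> `|I f| <= I (fun x => `|f x|).
Proof. by move=> [_ ?]; apply: le_normr_Rintegral. Qed.

Lemma I_norm_le f g : L1on f -> L1on g -> (forall x, D x -> `|f x| <= g x) ->
  `|I f| <= I g.
Proof.
move=> Lf Lg fg; rewrite (le_trans (I_norm Lf))// I_le//; exact: L1on_norm.
Qed.

Lemma I_EFin f : L1on f -> (\int[mu]_(x in D) (f x)%:E = (I f)%:E)%E.
Proof. by move=> [_ ?]; rewrite /I /Rintegral fineK//; apply: integrable_fin_num. Qed.

Lemma L1on_nneg_lty f : measurable_fun setT f -> (forall x, D x -> 0 <= f x) ->
  (\int[mu]_(x in D) (f x)%:E < +oo)%E -> L1on f.
Proof.
move=> mf f0 foo; split=> //; apply/integrableP; split.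
  by apply/measurable_EFinP; exact: measurable_funS mf.
rewrite (eq_integral (fun x => (f x)%:E))// => x /[!inE] Dx.
by rewrite gee0_abs// lee_fin f0.
Qed.

Lemma I_ae_eq f g : L1on f -> L1on g ->
  {ae mu, forall x, D x -> f x = g x} -> I f = I g.
Proof.
move=> [mf _] [mg _] fg; congr fine; apply: ae_eq_integral => //.
- by apply/measurable_EFinP; exact: measurable_funS mf.
- by apply/measurable_EFinP; exact: measurable_funS mg.
- by apply: filterS fg => x h /h /= ->.
Qed.

Lemma I_nneg_eq0 f : L1on f -> (forall x, D x -> 0 <= f x) -> I f = 0 ->
  {ae mu, forall x, D x -> f x = 0}.
Proof.
move=> [mf if_] f0 If.
have : (\int[mu]_(x in D) `|(f x)%:E| = 0)%E.
  rewrite (eq_integral (fun x => (f x)%:E)); first by rewrite I_EFin// If.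
  by move=> x /[!inE] Dx; rewrite gee0_abs// lee_fin f0.
have mfD : measurable_fun D (EFin \o f).
  by apply/measurable_EFinP; exact: measurable_funS mf.
move/(ae_eq_integral_abs mu mD mfD); apply: filterS => x h Dx.
by have [] := h Dx.
Qed.

Lemma I_dominated_ae (f_ : nat -> T -> R) f g :
  (forall n, measurable_fun setT (f_ n)) -> measurable_fun setT f -> L1on g ->
  {ae mu, forall x, D x -> (f_ n x @[n --> \oo] --> f x)} ->
  (forall n x, D x -> `|f_ n x| <= g x) ->
  I (f_ n) @[n --> \oo] --> I f.
Proof.
move=> mf_ mf [mg ig] ff fg.
have [||||intf _ cv] := @dominated_convergence _ _ _ mu D mD
  (fun n x => (f_ n x)%:E) (EFin \o f) (EFin \o g) _ _ _ ig.
- by move=> n; apply/measurable_EFinP; exact: measurable_funS (mf_ n).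
- by apply/measurable_EFinP; exact: measurable_funS mf.
- by apply: filterS ff => x h Dx; apply: cvg_EFin; [exact: nearW|exact: h].
- by apply: aeW => x n Dx; rewrite lee_fin fg.
apply: fine_cvg; rewrite /I /Rintegral fineK//.
exact: integrable_fin_num.
Qed.

Lemma I_dominated (f_ : nat -> T -> R) f g :
  (forall n, measurable_fun setT (f_ n)) -> measurable_fun setT f -> L1on g ->
  (forall x, D x -> (f_ n x @[n --> \oo] --> f x)) ->
  (forall n x, D x -> `|f_ n x| <= g x) ->
  I (f_ n) @[n --> \oo] --> I f.
Proof. by move=> ? ? Lg ff fg; apply: (@I_dominated_ae f_ f g) => //; apply: aeW. Qed.

(** * Square-integrable functions *)

Definition L2on f := measurable_fun setT f /\ L1on (fun x => f x ^+ 2).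

Lemma L2on_meas f : L2on f -> measurable_fun setT f.
Proof. by case. Qed.

Lemma L2on_sqr f : L2on f -> L1on (fun x => f x ^+ 2).
Proof. by case. Qed.

Lemma L2on_bounded M f : measurable_fun setT f ->
  (forall x, D x -> `|f x| <= M) -> L2on f.
Proof.
move=> mf fM; split=> //; apply: (@L1on_bounded (M ^+ 2)).
  exact: measurable_funX.
by move=> x Dx; rewrite normrX lerXn2r ?nnegrE ?fM// (le_trans (normr_ge0 (f x)))// fM.
Qed.

Lemma L2on_mul f g : L2on f -> L2on g -> L1on (fun x => f x * g x).
Proof.
move=> [mf Lf] [mg Lg].
apply: (@L1on_le _ (fun x => f x ^+ 2 + g x ^+ 2)).
- exact: measurable_funM.
- exact: L1onD.
- move=> x _; rewrite [leRHS]ger0_norm ?addr_ge0 ?sqr_ge0//.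
  by rewrite normrM -(real_normK (num_real (f x))) -(real_normK (num_real (g x))); nra.
Qed.

Lemma L2on_cst r : L2on (fun=> r).
Proof. by apply: (@L2on_bounded `|r|). Qed.

Lemma L2on_L1on f : L2on f -> L1on f.
Proof.
move=> Lf; have := L2on_mul Lf (L2on_cst 1).
by congr L1on; apply/funext => x; rewrite mulr1.
Qed.

Lemma L2onD f g : L2on f -> L2on g -> L2on (fun x => f x + g x).
Proof.
move=> Lf Lg; split; first by apply: measurable_funD; exact: L2on_meas.
rewrite (_ : (fun _ => _) = fun x => f x ^+ 2 + 2 * (f x * g x) + g x ^+ 2).
  by apply: L1onD; [apply: L1onD|]; [exact: L2on_sqr|apply/L1onZ/L2on_mul|exact: L2on_sqr].
by apply/funext => x; ring.
Qed.

Lemma L2onZ r f : L2on f -> L2on (fun x => r * f x).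
Proof.
move=> Lf; split; first by apply: measurable_funM => //; exact: L2on_meas.
rewrite (_ : (fun _ => _) = fun x => r ^+ 2 * f x ^+ 2).
  by apply/L1onZ/L2on_sqr.
by apply/funext => x; rewrite exprMn.
Qed.

Lemma L2onB f g : L2on f -> L2on g -> L2on (fun x => f x - g x).
Proof.
move=> Lf Lg; rewrite (_ : (fun _ => _) = fun x => f x + (-1) * g x).
  by apply: L2onD => //; apply: L2onZ.
by apply/funext => x; rewrite mulN1r.
Qed.

Lemma L2on_mul_bounded M f g : measurable_fun setT f ->
  (forall x, D x -> `|f x| <= M) -> L2on g -> L2on (fun x => f x * g x).
Proof.
move=> mf fM [mg Lg]; split; first exact: measurable_funM.
rewrite (_ : (fun _ => _) = fun x => f x ^+ 2 * g x ^+ 2).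
  apply: (@L1on_mul_bounded (M ^+ 2)) => //; first exact: measurable_funX.
  by move=> x Dx; rewrite normrX lerXn2r ?nnegrE ?fM// (le_trans (normr_ge0 (f x)))// fM.
by apply/funext => x; rewrite exprMn.
Qed.

Lemma I_sqr_scale_add s f g : L2on f -> L2on g ->
  I (fun x => (s * f x + g x) ^+ 2) =
  s ^+ 2 * I (fun x => f x ^+ 2) + 2 * s * I (fun x => f x * g x)
  + I (fun x => g x ^+ 2).
Proof.
move=> Lf Lg; have Lfg := L2on_mul Lf Lg.
have [L2f L2g] := (L2on_sqr Lf, L2on_sqr Lg).
rewrite -!I_scale// -!I_add//; try by [exact: L1onZ|apply: L1onD; exact: L1onZ].
by congr I; apply/funext => x; ring.
Qed.

(** The quadratic polynomial [I ((s f + g) ^+ 2)] in [s] is nonnegative, in particular at its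
    minimum. *)
Lemma I_Cauchy_Schwarz f g : L2on f -> L2on g ->
  I (fun x => f x * g x) ^+ 2 <= I (fun x => f x ^+ 2) * I (fun x => g x ^+ 2).
Proof.
move=> Lf Lg.
have H s : 0 <= s ^+ 2 * I (fun x => f x ^+ 2) + 2 * s * I (fun x => f x * g x)
  + I (fun x => g x ^+ 2).
  by rewrite -I_sqr_scale_add//; apply: I_ge0 => x _; rewrite sqr_ge0.
have : 0 <= I (fun x => f x ^+ 2) by apply: I_ge0 => x _; rewrite sqr_ge0.
move: (I (fun x => f x ^+ 2)) (I (fun x => f x * g x)) (I (fun x => g x ^+ 2)) H.
move=> a b c H; rewrite le_eqVlt => /predU1P[a0|a0].
  have [->|b0] := eqVneq b 0; first by rewrite -a0 expr0n mul0r.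
  (* For a = 0 the polynomial is affine in [s], and at this point its value would be -1. *)
  have := H (- (c + 1) / (2 * b)); rewrite -a0 mulr0 add0r.
  rewrite (_ : 2 * _ * b = - (c + 1)); last by field.
  by lra.
(* The minimum of the quadratic polynomial. *)
have := H (- b / a).
rewrite (_ : _ + _ = (a * c - b ^+ 2) / a); last by field; rewrite gt_eqF.
by rewrite pmulr_lge0 ?invr_gt0// subr_ge0.
Qed.

End integral_on_subset.

(** * Fubini's theorem and double integrals over a subset *)

Section fubini_on_subset.
Context d (T : measurableType d) (R : realType).
Variables (mu : {finite_measure set T -> \bar R}) (D : set T).
Hypothesis mD : measurable D.
Implicit Types (f g h : T -> R) (F : T * T -> R) (K L : T -> T -> R).
Local Notation L1 := (L1on mu D).
Local Notation L2 := (L2on mu D).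
Local Notation I := (I mu D).

(** Double integrals over [D] are treated as integrals over the whole product of the extension by 0,
    to which Fubini's theorem applies directly. *)
Let restr F : T * T -> \bar R := (EFin \o F) \_ (D `*` D).

Let mrestr F : measurable_fun setT F -> measurable_fun setT (restr F).
Proof.
move=> mF; apply: (measurable_restrictT (EFin \o F) (measurableX mD mD)).1.
by apply/measurable_EFinP; exact: measurable_funS mF.
Qed.

Let restrE F x y : D x -> D y -> restr F (x, y) = (F (x, y))%:E.
Proof. by move=> Dx Dy; rewrite /restr /patch mem_set. Qed.

Let restr0 F x y : ~ (D x /\ D y) -> restr F (x, y) = 0%E.
Proof. by move=> h; rewrite /restr /patch memNset. Qed.

Let int_restr F x : (\int[mu]_y restr F (x, y) =
  ((fun x => \int[mu]_(y in D) (F (x, y))%:E) \_ D) x)%E.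
Proof.
rewrite [RHS]/patch; case: ifPn => [/[!inE] Dx|]; last first.
  by rewrite notin_setE => Dx; rewrite integral0_eq// => y _; rewrite restr0// => -[].
rewrite [RHS]integral_mkcond; apply: eq_integral => y _; rewrite [RHS]/patch.
case: ifPn => [/[!inE] Dy|]; first by rewrite restrE.
by rewrite notin_setE => Dy; rewrite restr0// => -[].
Qed.

Let int_restr2 F y : (\int[mu]_x restr F (x, y) =
  ((fun y => \int[mu]_(x in D) (F (x, y))%:E) \_ D) y)%E.
Proof.
rewrite [RHS]/patch; case: ifPn => [/[!inE] Dy|]; last first.
  by rewrite notin_setE => Dy; rewrite integral0_eq// => x _; rewrite restr0// => -[].
rewrite [RHS]integral_mkcond; apply: eq_integral => x _; rewrite [RHS]/patch.
case: ifPn => [/[!inE] Dx|]; first by rewrite restrE.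
by rewrite notin_setE => Dx; rewrite restr0// => -[].
Qed.

Let int_abs_restr F x : (\int[mu]_y `|restr F (x, y)| =
  ((fun x => \int[mu]_(y in D) `|F (x, y)|%:E) \_ D) x)%E.
Proof.
rewrite -(int_restr (fun z => `|F z|)); apply: eq_integral => y _.
by rewrite /restr /patch; case: ifPn => //; rewrite abse0.
Qed.

(** The extended integral of a section is the difference of those of the positive and negative
    parts, each measurable in [x] by Tonelli's theorem. As [fine] is measurable, sections that are
    not integrable do no harm. *)
Lemma measurable_I2 F : measurable_fun setT F ->
  measurable_fun setT (fun x => I (fun y => F (x, y))).
Proof.
move=> mF; apply: (measurableT_comp (fine_measurable _)) => //.
pose G : T * T -> \bar R := (EFin \o F) \_ (setT `*` D).
have mG : measurable_fun setT G.
  apply: (measurable_restrictT (EFin \o F) (measurableX measurableT mD)).1.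
  by apply/measurable_EFinP; exact: measurable_funS mF.
rewrite (_ : (fun _ => _) = fun x => (\int[mu]_y G^\+ (x, y) - \int[mu]_y G^\- (x, y))%E).
  apply: emeasurable_funB.
    have := @measurable_fun_fubini_tonelli_F _ _ T T R mu G^\+%E.
    by apply; [exact: measurable_funepos|move=> z; exact: funepos_ge0].
  have := @measurable_fun_fubini_tonelli_F _ _ T T R mu G^\-%E.
  by apply; [exact: measurable_funeneg|move=> z; exact: funeneg_ge0].
apply/funext => x; rewrite integral_mkcond integralE.
have GE y : ((fun y => (F (x, y))%:E) \_ D) y = G (x, y).
  by rewrite /G /patch in_setX in_setT.
by congr (_ - _)%E; apply: eq_integral => y _; rewrite unlock/= GE.
Qed.

Definition PL1 F := measurable_fun setT F /\
  (mu \x mu)%E.-integrable setT ((EFin \o F) \_ (D `*` D)).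

Let PL1_integrable F : PL1 F -> (mu \x mu)%E.-integrable setT (restr F).
Proof. by case. Qed.

Lemma PL1_lty F : measurable_fun setT F ->
  (\int[mu]_(x in D) \int[mu]_(y in D) `|F (x, y)|%:E < +oo)%E -> PL1 F.
Proof.
move=> mF Foo; split=> //; apply/integrable12ltyP; first exact: mrestr.
have -> : (\int[mu]_x \int[mu]_y `|restr F (x, y)| =
   \int[mu]_(x in D) \int[mu]_(y in D) `|F (x, y)|%:E)%E.
  by rewrite [RHS]integral_mkcond; apply: eq_integral => x _; rewrite int_abs_restr.
exact: Foo.
Qed.

Lemma PL1_swap F : PL1 F -> PL1 (fun z => F (z.2, z.1)).
Proof.
move=> PF; have iF := PL1_integrable PF.
have mF := measurable_int _ iF.
apply: PL1_lty.
  apply: (measurableT_comp PF.1); apply/measurable_fun_pairP; split.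
    exact: measurable_snd.
  exact: measurable_fst.
have -> : (\int[mu]_(x in D) \int[mu]_(y in D) `|F (y, x)|%:E =
   \int[mu]_y \int[mu]_x `|restr F (x, y)|)%E.
  rewrite [LHS]integral_mkcond; apply: eq_integral => x _.
  rewrite -(int_restr2 (fun z => `|F z|)); apply: eq_integral => y _.
  by rewrite /restr /patch; case: ifPn => //; rewrite abse0.
by have /integrable21ltyP := iF; apply.
Qed.

(** Only almost every section is integrable. On the remaining null set the inner [fine] may alter
    the value, which the outer integral does not see. *)
Let I_restr F : PL1 F ->
  I (fun x => I (fun y => F (x, y))) = fine (\int[mu]_x \int[mu]_y restr F (x, y))%E.
Proof.
move=> PF; have iF := PL1_integrable PF; have iF1 := integrable_fubini_F iF.
congr fine; rewrite integral_mkcond; apply: ae_eq_integral => //.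
- apply: (measurable_restrictT (fun x => (I (fun y => F (x, y)))%:E) mD).1.
  by apply/measurable_EFinP; apply: measurable_funS (measurable_I2 PF.1).
- exact: measurable_int iF1.
- apply: filterS (integrable_ae measurableT iF1) => x /(_ Logic.I).
  rewrite /fubini_F => + _; rewrite int_restr /patch; case: ifP => // xD.
  by move=> /fineK <-.
Qed.

Lemma PL1_fubini F : PL1 F ->
  I (fun x => I (fun y => F (x, y))) = I (fun y => I (fun x => F (x, y))).
Proof.
move=> PF; have iF := PL1_integrable PF.
rewrite (I_restr PF) (I_restr (PL1_swap PF)) (Fubini iF).
congr fine; apply: eq_integral => y _; apply: eq_integral => x _.
have [[Dx Dy]|h] := pselect (D x /\ D y); first by rewrite !restrE.
by rewrite !restr0// => -[? ?]; apply: h.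
Qed.

Lemma PL1_I2 F : PL1 F -> L1 (fun x => I (fun y => F (x, y))).
Proof.
move=> PF; split; first exact: measurable_I2 PF.1.
have iF := PL1_integrable PF; have iF1 := integrable_fubini_F iF.
have iF2 : mu.-integrable D (fubini_F mu (restr F)).
  exact: integrableS iF1.
have [mfi foo] := integrableP _ _ _ iF2.
apply/integrableP; split.
  by apply/measurable_EFinP; exact: measurable_funS (measurable_I2 PF.1).
apply: le_lt_trans foo; apply: ge0_le_integral => //.
- apply: measurableT_comp => //; apply/measurable_EFinP.
  exact: measurable_funS (measurable_I2 PF.1).
- exact: measurableT_comp.
- move=> x Dx; rewrite /fubini_F int_restr /patch mem_set//=.
  (* An infinite inner integral becomes 0 under [fine], so the bound persists. *)
  rewrite /I /Rintegral; case: (integral _ _ _) => [r| |]//=; rewrite ?normr0 ?leey//.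
Qed.

Lemma PL1_ae F : PL1 F -> {ae mu, forall x, D x -> L1 (fun y => F (x, y))}.
Proof.
move=> PF; have iF := PL1_integrable PF; have mF := measurable_int _ iF.
apply: filterS (ae_integrable1 iF) => x /= ix Dx; split.
  exact: measurable_fun_pair2 PF.1.
have := integrableS measurableT mD (@subsetT _ D) ix.
apply: eq_integrable => // y /[!inE] Dy; rewrite /restr /patch.
by rewrite mem_set.
Qed.

Lemma PL1_le F G : measurable_fun setT F -> PL1 G ->
  (forall x y, D x -> D y -> `|F (x, y)| <= `|G (x, y)|) -> PL1 F.
Proof.
move=> mF [mG Goo] FG; split=> //.
apply: (le_integrable measurableT (mrestr mF) _ Goo) => -[x y] _.
rewrite -/(restr F) -/(restr G).
have [[Dx Dy]|h] := pselect (D x /\ D y); first by rewrite !restrE// lee_fin FG.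
by rewrite !restr0// abse0.
Qed.

Lemma measurable_fst_comp f : measurable_fun setT f ->
  measurable_fun setT (fun z : T * T => f z.1).
Proof. by move=> mf; apply: (measurableT_comp mf); exact: measurable_fst. Qed.

Lemma measurable_snd_comp f : measurable_fun setT f ->
  measurable_fun setT (fun z : T * T => f z.2).
Proof. by move=> mf; apply: (measurableT_comp mf); exact: measurable_snd. Qed.

Lemma PL1_tensor f g : L1 f -> L1 g -> PL1 (fun z => f z.1 * g z.2).
Proof.
move=> Lf Lg; apply: PL1_lty.
  apply: measurable_funM; first exact: measurable_fst_comp (L1on_meas Lf).
  exact: measurable_snd_comp (L1on_meas Lg).
rewrite (eq_integral (fun x => (`|f x| * I (fun y => `|g y|))%:E)).
  rewrite I_EFin//; first exact: ltry.
  have := L1onZ mD (I (fun y => `|g y|)) (L1on_norm Lf).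
  by congr L1on; apply/funext => x; rewrite mulrC.
move=> x _ /=.
rewrite -(I_scale mD); last exact: L1on_norm.
rewrite -I_EFin//; last by apply: L1onZ => //; exact: L1on_norm.
by apply: eq_integral => y _; rewrite normrM.
Qed.

Lemma PL1_bounded_kernel M K f g : measurable_fun setT (fun z => K z.1 z.2) ->
  (forall x y, D x -> D y -> `|K x y| <= M) -> L1 f -> L1 g ->
  PL1 (fun z => f z.1 * K z.1 z.2 * g z.2).
Proof.
move=> mK KM Lf Lg.
apply: (@PL1_le _ (fun z => (M * f z.1) * g z.2)).
- apply: measurable_funM; last by apply: measurable_snd_comp; apply: L1on_meas; eassumption.
  by apply: measurable_funM => //; by apply: measurable_fst_comp; apply: L1on_meas; eassumption.
- by apply: (@PL1_tensor (fun x => M * f x)) => //; apply: L1onZ.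
- move=> x y Dx Dy; rewrite !normrM ler_wpM2r// mulrC ler_wpM2r//.
  by rewrite (le_trans (KM x y Dx Dy))// ler_norm.
Qed.

(** * Integral operators with Schur kernels *)

(** Symmetry makes the bound on the rows of [K] a bound on its columns as well, which is what
    Schur's test for boundedness on L^2 asks. *)
Definition schur K := [/\ measurable_fun setT (fun z => K z.1 z.2),
  (forall x y, D x -> D y -> K x y = K y x) &
  exists C, forall x, D x -> L1 (K x) /\ I (fun y => `|K x y|) <= C].

Lemma schur_bounded M K : measurable_fun setT (fun z => K z.1 z.2) ->
  (forall x y, D x -> D y -> K x y = K y x) ->
  (forall x y, D x -> D y -> `|K x y| <= M) -> schur K.
Proof.
move=> mK sK KM; split=> //; exists (I (fun=> M)) => x Dx.
have LK : L1 (K x).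
  apply: (@L1on_bounded _ _ _ _ _ _ M) => //; last by move=> y Dy; exact: KM.
  exact: (measurable_fun_pair2 x mK).
split=> //; apply: I_le => //; [exact: L1on_norm|exact: L1on_cst|].
by move=> y Dy; exact: KM.
Qed.

Lemma PL1_schur_sqr K f : schur K -> L1 f ->
  PL1 (fun z => K z.1 z.2 * f z.1).
Proof.
move=> [mK _ [C HC]] Lf; apply: PL1_lty.
  by apply: measurable_funM => //; by apply: measurable_fst_comp; apply: L1on_meas; eassumption.
pose k x := I (fun y => `|K x y|).
have mk : measurable_fun setT k.
  by apply: (@measurable_I2 (fun z => `|K z.1 z.2|)); exact: measurableT_comp.
have k0 x : 0 <= k x by apply: I_ge0.
have Lkf : L1 (fun x => k x * `|f x|).
  apply: (@L1on_mul_bounded _ _ _ _ _ mD C) => //; last exact: L1on_norm.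
  by move=> x Dx; rewrite ger0_norm// (HC x Dx).2.
rewrite (eq_integral (fun x => (k x * `|f x|)%:E)); first by rewrite I_EFin// ltry.
move=> x /[!inE] Dx /=; have [LK _] := HC x Dx.
rewrite mulrC /k -(I_scale mD); last exact: L1on_norm.
rewrite -I_EFin//; last by apply: L1onZ => //; exact: L1on_norm.
by apply: eq_integral => y _; rewrite normrM mulrC.
Qed.

Lemma PL1_sqr_schur K f : schur K -> L1 f ->
  PL1 (fun z => K z.1 z.2 * f z.2).
Proof.
move=> sK Lf; have := PL1_swap (PL1_schur_sqr sK Lf).
case: (sK) => mK sym _ P.
apply: (PL1_le _ P).
  by apply: measurable_funM => //; by apply: measurable_snd_comp; apply: L1on_meas; eassumption.
by move=> x y Dx Dy /=; rewrite sym.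
Qed.

Lemma PL1D F G : PL1 F -> PL1 G -> PL1 (fun z => F z + G z).
Proof.
move=> [mF iF] [mG iG]; split; first exact: measurable_funD.
apply: eq_integrable (integrableD measurableT iF iG) => // -[x y] _ /=.
rewrite -!/(restr _).
have [[Dx Dy]|h] := pselect (D x /\ D y); first by rewrite !restrE// EFinD.
by rewrite !restr0// adde0.
Qed.

Lemma schur_norm K : schur K -> schur (fun x y => `|K x y|).
Proof.
move=> [mK sK [C HC]]; split; first exact: measurableT_comp.
  by move=> x y Dx Dy; rewrite sK.
exists C => x Dx; have [LK KC] := HC x Dx; split; first exact: L1on_norm.
by rewrite (@eq_I _ _ _ _ _ _ (fun y => `|K x y|))// => y _; rewrite normr_id.
Qed.

(** The product |f(x) K(x, y) g(y)| is at most |K| f(x)^2 + |K| g(y)^2. The first summand is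
    integrable by the row bound, the second by symmetry. *)
Lemma PL1_schur K f g : schur K -> L2 f -> L2 g ->
  PL1 (fun z => f z.1 * K z.1 z.2 * g z.2).
Proof.
move=> sK Lf Lg; have sK' := schur_norm sK.
have P1 := PL1_schur_sqr sK' (L2on_sqr Lf).
have P2 := PL1_sqr_schur sK' (L2on_sqr Lg).
have P := PL1D P1 P2.
apply: (PL1_le _ P).
  apply: measurable_funM; last by apply: measurable_snd_comp; apply: L2on_meas; eassumption.
  apply: measurable_funM; first by apply: measurable_fst_comp; apply: L2on_meas; eassumption.
  by case: sK.
move=> x y Dx Dy /=; rewrite -mulrDr [leRHS]ger0_norm;
  last by rewrite mulr_ge0// addr_ge0// sqr_ge0.
rewrite !normrM mulrAC mulrC ler_wpM2l//.
by rewrite -(real_normK (num_real (f x))) -(real_normK (num_real (g y))); nra.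
Qed.

Definition Op K f x := I (fun y => K x y * f y).

Lemma Op_meas K f : measurable_fun setT (fun z => K z.1 z.2) ->
  measurable_fun setT f -> measurable_fun setT (Op K f).
Proof.
move=> mK mf; apply: (@measurable_I2 (fun z => K z.1 z.2 * f z.2)).
by apply: measurable_funM => //; exact: measurable_snd_comp.
Qed.

Lemma L1on_le_ae f g : measurable_fun setT f -> L1 g ->
  {ae mu, forall x, D x -> `|f x| <= g x} -> L1 f.
Proof.
move=> mf [mg ig] fg; split=> //; apply/integrableP; split.
  by apply/measurable_EFinP; exact: measurable_funS mf.
have [mgD goo] := integrableP _ _ _ ig.
apply: le_lt_trans goo; apply: ae_ge0_le_integral => //.
- by apply: measurableT_comp => //; apply/measurable_EFinP; exact: measurable_funS mf.
- exact: measurableT_comp.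
- apply: filterS fg => x fg Dx; rewrite lee_fin (le_trans (fg Dx))//.
  exact: ler_norm.
Qed.

Lemma I_le_ae f g : L1 f -> L1 g -> {ae mu, forall x, D x -> f x <= g x} ->
  I f <= I g.
Proof.
move=> Lf Lg fg; rewrite -subr_ge0 -(I_sub mD Lg Lf).
rewrite (@I_ae_eq _ _ _ mu D mD _ (fun x => `|g x - f x|)); first exact: I_ge0.
- exact: L1onB.
- by apply: L1on_norm => //; apply: L1onB.
- by apply: filterS fg => x fg Dx; rewrite ger0_norm// subr_ge0 fg.
Qed.

(** The pointwise half of Schur's test: Cauchy-Schwarz for the factors |K|^(1/2) and |K|^(1/2)
    |f|. *)
Lemma Op_sqr_bound K f C x : D x -> measurable_fun setT (fun z => K z.1 z.2) ->
  L1 (K x) -> I (fun y => `|K x y|) <= C ->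
  measurable_fun setT f -> L1 (fun y => K x y * f y ^+ 2) ->
  Op K f x ^+ 2 <= C * I (fun y => `|K x y| * f y ^+ 2).
Proof.
move=> Dx mK LK KC mf LKf.
have mKx : measurable_fun setT (K x) by exact: L1on_meas LK.
pose s y := Num.sqrt `|K x y|.
have ms : measurable_fun setT s.
  apply: (@measurableT_comp _ _ _ _ _ _ (@Num.sqrt R)); last exact: measurableT_comp.
  by apply: continuous_measurable_fun => r; exact: sqrt_continuous.
have s2 y : s y ^+ 2 = `|K x y| by rewrite sqr_sqrtr.
have Ls : L2 s by split=> //; under eq_fun do rewrite s2; exact: L1on_norm.
have LKf' : L1 (fun y => `|K x y| * f y ^+ 2).
  have := L1on_norm LKf; congr L1on; apply/funext => y.
  by rewrite normrM [X in _ * X]ger0_norm ?sqr_ge0.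
have Lsf : L2 (fun y => s y * `|f y|).
  split; first by apply: measurable_funM => //; exact: measurableT_comp.
  move: LKf'; congr L1on; apply/funext => y.
  by rewrite exprMn s2 real_normK ?num_real.
have LKf1 : L1 (fun y => K x y * f y).
  apply: (L1on_le mD _ (L2on_mul mD Ls Lsf)); first exact: measurable_funM.
  move=> y _; rewrite mulrA -expr2 s2 !normrM !normr_id//.
have := I_Cauchy_Schwarz mD Ls Lsf.
rewrite (_ : (fun y => s y ^+ 2) = fun y => `|K x y|); last by apply/funext.
rewrite (_ : (fun y => (s y * `|f y|) ^+ 2) = fun y => `|K x y| * f y ^+ 2); last first.
  by apply/funext => y; rewrite exprMn s2 real_normK ?num_real.
move=> CS; apply: (@le_trans _ _ (I (fun y => `|K x y|) * I (fun y => `|K x y| * f y ^+ 2))).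
  apply: le_trans CS; rewrite -[leLHS](real_normK (num_real _)) lerXn2r ?nnegrE//.
    by apply: I_ge0 => y _; rewrite !mulr_ge0 ?sqrtr_ge0.
  apply: I_norm_le => //; first exact: L2on_mul.
  by move=> y _; rewrite mulrA -expr2 s2 normrM.
by apply: ler_wpM2r => //; apply: I_ge0 => y _; rewrite mulr_ge0 ?sqr_ge0.
Qed.

Lemma Op_L2 K f : schur K -> L2 f -> L2 (Op K f).
Proof.
move=> sK Lf; have sK' := schur_norm sK; have [mK sym [C HC]] := sK.
have P := PL1_sqr_schur sK (L2on_sqr Lf).
have P' := PL1_sqr_schur sK' (L2on_sqr Lf).
have mO : measurable_fun setT (Op K f) by apply: Op_meas => //; exact: L2on_meas Lf.
split=> //; apply: (L1on_le_ae _ (L1onZ mD C (PL1_I2 P'))).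
  exact: measurable_funX.
apply: filterS (PL1_ae P) => x /= Lx Dx; have [LK KC] := HC x Dx.
rewrite ger0_norm ?sqr_ge0//; apply: Op_sqr_bound => //; last exact: Lx.
exact: L2on_meas Lf.
Qed.

(** Schur's test: the pointwise bound is integrated in [x], and after exchanging the integrals the
    column bound supplies the second factor [C]. *)
Lemma Op_L2_le K f C : schur K -> (forall x, D x -> I (fun y => `|K x y|) <= C) ->
  L2 f -> I (fun x => Op K f x ^+ 2) <= C ^+ 2 * I (fun x => f x ^+ 2).
Proof.
move=> sK KC Lf; have sK' := schur_norm sK; have [mK sym [C' HC]] := sK.
have P := PL1_sqr_schur sK (L2on_sqr Lf).
have P' := PL1_sqr_schur sK' (L2on_sqr Lf).
apply: (@le_trans _ _ (I (fun x => C * I (fun y => `|K x y| * f y ^+ 2)))).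
  apply: I_le_ae.
  - by case: (Op_L2 sK Lf).
  - exact: (L1onZ mD C (PL1_I2 P')).
  - apply: filterS (PL1_ae P) => x /= Lx Dx; have [LK _] := HC x Dx.
    by apply: Op_sqr_bound => //; [exact: KC|exact: L2on_meas Lf|exact: Lx].
rewrite I_scale//; last exact: PL1_I2 P'.
rewrite (PL1_fubini P').
(* The row bound at a point of [D] shows that [C] is nonnegative; for empty [D] both sides are 0. *)
have [[x Dx]|D0] := pselect (exists x, D x); last first.
  rewrite !I_eq0 ?mulr0// => x Dx; exfalso; apply: D0; by exists x.
have C0 : 0 <= C by apply: le_trans (KC x Dx); apply: I_ge0.
rewrite expr2 -mulrA ler_wpM2l// -I_scale//; last exact: L2on_sqr.
apply: I_le => //; first exact: (PL1_I2 (PL1_swap P')).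
  by apply: L1onZ => //; exact: L2on_sqr.
move=> y Dy /=; rewrite (@eq_I _ _ _ _ _ _ (fun x => f y ^+ 2 * `|K y x|)); last first.
  by move=> z Dz; rewrite sym// mulrC.
rewrite I_scale//; last by apply: L1on_norm => //; case: (HC y Dy).
by rewrite mulrC ler_wpM2r ?sqr_ge0// KC.
Qed.

Lemma Op_sym K f g : schur K -> L2 f -> L2 g ->
  I (fun x => f x * Op K g x) = I (fun x => Op K f x * g x).
Proof.
move=> sK Lf Lg; have P := PL1_schur sK Lf Lg; have Ps := PL1_swap P.
have sm := sK; case: sm => mK sym [C HC].
transitivity (I (fun x => I (fun y => f x * K x y * g y))).
  apply: I_ae_eq => //; first by apply: L2on_mul => //; exact: Op_L2.
    exact: (PL1_I2 P).
  apply: filterS (PL1_ae (PL1_sqr_schur sK (L2on_L1on mD Lg))) => x /= Lx Dx.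
  rewrite /Op -I_scale//; last exact: Lx.
  by apply: eq_I => y _; rewrite mulrA.
rewrite (PL1_fubini P).
apply: I_ae_eq => //; first exact: (PL1_I2 Ps).
  by apply: L2on_mul => //; exact: Op_L2.
apply: filterS (PL1_ae (PL1_sqr_schur sK (L2on_L1on mD Lf))) => x /= Lx Dx.
rewrite /Op mulrC -I_scale//; last exact: Lx.
by apply: eq_I => y Dy; rewrite sym// mulrC [f y * _]mulrC.
Qed.

(** This lemma and the next compose kernels by Fubini's theorem. They serve the two orders in which
    the singular kernel meets a bounded one: here the left kernel may be singular, there the right
    one. *)
Lemma Op_comp_bounded K L M x f : D x -> L1 (K x) ->
  measurable_fun setT (fun z => L z.1 z.2) ->
  (forall y z, D y -> D z -> `|L y z| <= M) -> L1 f ->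
  I (fun y => K x y * Op L f y) = I (fun z => I (fun y => K x y * L y z) * f z).
Proof.
move=> Dx LK mL LM Lf; have P := PL1_bounded_kernel mL LM LK Lf.
transitivity (I (fun y => I (fun z => K x y * L y z * f z))).
  apply: eq_I => y Dy; rewrite /Op -I_scale//.
    by apply: eq_I => z _; rewrite mulrA.
  apply: (@L1on_mul_bounded _ _ _ _ _ mD M) => //; last by move=> z Dz; exact: LM.
  exact: (measurable_fun_pair2 y mL).
rewrite (PL1_fubini P) /=; apply: eq_I => z Dz.
rewrite [RHS]mulrC -I_scale//; last first.
  rewrite (_ : (fun _ => _) = fun y => L y z * K x y); last by apply/funext => y; rewrite mulrC.
  apply: (@L1on_mul_bounded _ _ _ _ _ mD M) => //; last by move=> y Dy; exact: LM.
  exact: (measurable_fun_pair1 z mL).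
by apply: eq_I => y _; rewrite mulrC.
Qed.

Lemma Op_bounded_comp K L M x f : D x ->
  measurable_fun setT (fun z => K z.1 z.2) ->
  (forall y z, D y -> D z -> `|K y z| <= M) -> schur L -> L2 f ->
  I (fun y => K x y * Op L f y) = I (fun z => I (fun y => K x y * L y z) * f z).
Proof.
move=> Dx mK KM sL Lf; have [mL sym [C HC]] := sL.
have mKx : measurable_fun setT (K x) by exact: (measurable_fun_pair2 x mK).
have LKx : L2 (K x) by apply: (@L2on_bounded _ _ _ _ _ mD M) => // z Dz; exact: KM.
rewrite (Op_sym sL LKx Lf); apply: eq_I => z Dz; congr (_ * _).
by apply: eq_I => y Dy; rewrite sym// mulrC.
Qed.

Lemma Op_add_ae K f g : schur K -> L2 f -> L2 g ->
  {ae mu, forall x, D x -> Op K (fun y => f y + g y) x = Op K f x + Op K g x}.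
Proof.
move=> sK Lf Lg.
have af := PL1_ae (PL1_sqr_schur sK (L2on_L1on mD Lf)).
have ag := PL1_ae (PL1_sqr_schur sK (L2on_L1on mD Lg)).
apply: filterS2 af ag => x Lfx Lgx Dx; rewrite /Op -I_add//; last 2 first.
- exact: Lfx.
- exact: Lgx.
by apply: eq_I => y _; rewrite mulrDr.
Qed.

Lemma Op_scale_ae K r f : schur K -> L2 f ->
  {ae mu, forall x, D x -> Op K (fun y => r * f y) x = r * Op K f x}.
Proof.
move=> sK Lf.
have af := PL1_ae (PL1_sqr_schur sK (L2on_L1on mD Lf)).
apply: filterS af => x Lfx Dx; rewrite /Op -I_scale//; last exact: Lfx.
by apply: eq_I => y _; rewrite mulrCA.
Qed.

End fubini_on_subset.

(** * Completeness of L^2 and differentiation under the integral *)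

Section completeness_and_derivation.
Context d (T : measurableType d) (R : realType).
Variables (mu : {finite_measure set T -> \bar R}) (D : set T).
Hypothesis mD : measurable D.
Implicit Types (f g h : T -> R).
Local Notation L1 := (L1on mu D).
Local Notation L2 := (L2on mu D).
Local Notation I := (I mu D).

(** Fatou's lemma in a form that also yields integrability of the limit; it supplies both the
    integrability of the singular kernel and the limits in L^2. *)
Lemma I_fatou_ae (h_ : nat -> T -> R) h M : (forall n, L1 (h_ n)) ->
  (forall n x, D x -> 0 <= h_ n x) -> measurable_fun setT h ->
  (forall x, D x -> 0 <= h x) ->
  {ae mu, forall x, D x -> (h_ n x @[n --> \oo] --> h x)} ->
  (forall n, I (h_ n) <= M) -> L1 h /\ I h <= M.
Proof.
move=> Lh_ h_0 mh h0 hh IM.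
have mE f : measurable_fun setT f -> measurable_fun D (EFin \o f).
  by move=> mf; apply/measurable_EFinP; exact: measurable_funS mf.
have key : (\int[mu]_(x in D) (h x)%:E <= M%:E)%E.
  apply: (@le_trans _ _ (\int[mu]_(x in D) limn_einf (fun n => (h_ n x)%:E))%E).
    apply: ae_ge0_le_integral => //.
    - exact: mE.
    - move=> x Dx; apply: (@le_trans _ _ (limn_einf (fun=> 0%E))).
        by rewrite (cvg_limn_einf_sup (cvg_cst _)).1.
      rewrite !limn_einf_lim; apply: lee_lim; try exact: is_cvg_einfs.
      apply: nearW => n; rewrite /einfs; apply: le_ereal_inf_tmp => _ [k nk <-].
      apply: (@le_trans _ _ 0%E); last by rewrite lee_fin h_0.
      by apply: ereal_inf_lbound; exists k.
    - rewrite (_ : (fun _ => _) = fun x => - limn_esup (fun n => (- h_ n x)%:E))%E.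
        apply: measurableT_comp => //; apply: measurable_fun_limn_esup => n.
        exact/mE/measurableT_comp/(L1on_meas (Lh_ n)).
      by apply/funext => x; rewrite /limn_einf.
    - apply: filterS hh => x hx Dx.
      have cv : ((h_ n x)%:E @[n --> \oo] --> (h x)%:E)%E.
        by apply: cvg_EFin; [exact: nearW|exact: hx].
      by rewrite (cvg_limn_einf_sup cv).1.
  apply: (@le_trans _ _ (limn_einf (fun n => \int[mu]_(x in D) (h_ n x)%:E))%E).
    apply: (fatou mu mD) => [n|n x Dx]; first exact/mE/(L1on_meas (Lh_ n)).
    by rewrite lee_fin h_0.
  rewrite -(cvg_limn_einf_sup (@cvg_cst _ M%:E _ \oo _)).1 !limn_einf_lim.
  apply: lee_lim; try exact: is_cvg_einfs.
  apply: nearW => n; rewrite /einfs; apply: le_ereal_inf_tmp => _ [k nk <-].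
  apply: (@le_trans _ _ (\int[mu]_(x in D) (h_ k x)%:E)%E).
    by apply: ereal_inf_lbound; exists k.
  by rewrite (I_EFin mD (Lh_ k)) lee_fin.
have Lh : L1 h by apply: L1on_nneg_lty => //; exact: le_lt_trans key (ltry _).
by split=> //; rewrite -lee_fin -I_EFin.
Qed.

(** The sum of the absolute increments has a finite integral, hence is finite almost everywhere, and
    there the telescoping series converges absolutely. *)
Lemma L1_fast_Cauchy_cvg_ae (f_ : nat -> T -> R) c : (forall n, L2 (f_ n)) ->
  (forall n, I (fun x => `|f_ n.+1 x - f_ n x|) <= c * 2^-1 ^+ n) ->
  {ae mu, forall x, D x -> cvgn (f_ ^~ x)}.
Proof.
move=> Lf fc.
have Lu n : L1 (fun x => `|f_ n.+1 x - f_ n x|).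
  by apply: L1on_norm; apply: L2on_L1on => //; apply: L2onB.
pose u n x := (`|f_ n.+1 x - f_ n x|)%:E : \bar R.
have mu_ n : measurable_fun D (u n).
  by apply/measurable_EFinP; apply: measurable_funS (L1on_meas (Lu n)).
have u0 n x : (0 <= u n x)%E by rewrite lee_fin.
have Su : (\int[mu]_(x in D) (\sum_(n <oo) u n x) < +oo)%E.
  rewrite integral_nneseries//.
  apply: (@le_lt_trans _ _ (\sum_(n <oo) (c * 2^-1 ^+ n)%:E)%E).
    apply: lee_nneseries => [n _|n _]; rewrite (I_EFin mD (Lu n)) lee_fin//.
    by move=> _; exact: I_ge0.
  have c0 : 0 <= c.
    by have := fc 0%N; rewrite expr0 mulr1; apply: le_trans; apply: I_ge0.
  have cv : (\sum_(0 <= n < k) (c * 2^-1 ^+ n)%:E)%E @[k --> \oo] --> (c * (1 - 2^-1)^-1)%:E.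
    under eq_cvg do rewrite sumEFin.
    apply: cvg_EFin; first exact: nearW.
    have := @cvg_geometric_series R c 2^-1; rewrite /series /geometric /=.
    by apply; rewrite ger0_norm ?invf_lt1//; lra.
  by rewrite (cvg_lim _ cv)// ltry.
have mS : measurable_fun D (fun x => (\sum_(n <oo) u n x)%E).
  exact: ge0_emeasurable_sum.
have S0 x : (0 <= \sum_(n <oo) u n x)%E by exact: nneseries_ge0.
have iS : mu.-integrable D (fun x => (\sum_(n <oo) u n x)%E).
  apply/integrableP; split => //.
  by under eq_integral do rewrite gee0_abs//.
apply: filterS (integrable_ae mD iS) => x /= fS Dx; have {}fS := fS Dx.
have cs : cvgn (series (fun n => f_ n.+1 x - f_ n x)).
  apply: normed_cvg; apply: nondecreasing_is_cvgn.
    by move=> n m nm /=; exact: (@nondecreasing_series R (fun k =>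
      `|f_ k.+1 x - f_ k x|) xpredT 0 (fun k _ _ => normr_ge0 _) n m nm).
  exists (fine (\sum_(n <oo) u n x)%E) => _ [n _ <-].
  rewrite -lee_fin fineK// /series /= -sumEFin.
  by have := nneseries_lim_ge n (fun k _ _ => u0 k x) (P := xpredT).
rewrite (_ : f_ ^~ x = (fun n => series (fun n => f_ n.+1 x - f_ n x) n + f_ 0%N x)).
  by apply: is_cvgD; [exact: cs|exact: is_cvg_cst].
apply/funext => n; have := telescopeK (f_ ^~ x); rewrite /telescope.
by move=> /(congr1 (fun s => s n)) /= ->; rewrite subrK.
Qed.

(** The Riesz-Fischer argument: Cauchy-Schwarz gives fast convergence in L^1 and so convergence
    almost everywhere, and Fatou's lemma brings the L^2 bound to the limit. *)
Lemma L2_fast_Cauchy_cvg (f_ : nat -> T -> R) : (forall n, L2 (f_ n)) ->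
  (forall n m, (n <= m)%N -> I (fun x => (f_ m x - f_ n x) ^+ 2) <= 4^-1 ^+ n) ->
  exists f, L2 f /\ forall n, I (fun x => (f_ n x - f x) ^+ 2) <= 4^-1 ^+ n.
Proof.
(* With a the measure of [D], Cauchy-Schwarz bounds the squared L^1 norm of the n-th increment by a
   4^(-n), and a <= (1 + a)^2. *)
move=> Lf fC; pose c := 1 + I (fun=> 1).
have c1 : 0 <= I (fun=> 1) by exact: I_ge0.
have fc n : I (fun x => `|f_ n.+1 x - f_ n x|) <= c * 2^-1 ^+ n.
  have Ld : L2 (fun x => `|f_ n.+1 x - f_ n x|).
    have [m l] := L2onB mD (Lf n.+1) (Lf n).
    split; first exact: measurableT_comp.
    by move: l; congr L1on; apply/funext => x; rewrite real_normK ?num_real.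
  have := I_Cauchy_Schwarz mD (L2on_cst mu mD 1) Ld.
  rewrite (_ : (fun _ => 1 * _) = fun x => `|f_ n.+1 x - f_ n x|); last first.
    by apply/funext => x; rewrite mul1r.
  rewrite expr1n.
  rewrite (_ : (fun x => `|f_ n.+1 x - f_ n x| ^+ 2) = fun x => (f_ n.+1 x - f_ n x) ^+ 2);
    last first.
    by apply/funext => x; rewrite real_normK ?num_real.
  move=> CS; have := fC n n.+1 (leqnSn n).
  have x0 : 0 <= I (fun x => `|f_ n.+1 x - f_ n x|) by exact: I_ge0.
  have -> : 4^-1 ^+ n = (2^-1 ^+ n) ^+ 2 :> R.
    by rewrite exprAC; congr (_ ^+ _); rewrite expr2; field.
  have t0 : 0 <= 2^-1 ^+ n :> R by rewrite exprn_ge0.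
  move: CS; rewrite /c.
  move: (I (fun=> 1)) (I (fun x => `|_|)) (I (fun x => (_ - _) ^+ 2)) (2^-1 ^+ n) c1 x0 t0 =>
    a x b t a0 x0 t0 h1 h2.
  have h3 : x ^+ 2 <= a * t ^+ 2 by apply: le_trans h1 _; rewrite ler_wpM2l.
  rewrite -ler_sqr ?nnegrE ?mulr_ge0 ?addr_ge0//; apply: le_trans h3 _.
  by rewrite exprMn ler_wpM2r ?sqr_ge0//; nra.
have cv := L1_fast_Cauchy_cvg_ae Lf fc.
(* The upper limit is measurable and defined everywhere; it is the limit wherever the sequence
   converges. *)
pose f x := fine (limn_esup (fun n => (f_ n x)%:E)).
have mf : measurable_fun setT f.
  apply: (measurableT_comp (fine_measurable _)) => //.
  apply: measurable_fun_limn_esup => n; apply/measurable_EFinP.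
  exact: L2on_meas (Lf n).
have cvf : {ae mu, forall x, D x -> f_ n x @[n --> \oo] --> f x}.
  apply: filterS cv => x h /h cx; rewrite /f.
  have cE : ((f_ n x)%:E @[n --> \oo] --> (limn (f_ ^~ x))%:E)%E.
    by apply: cvg_EFin; [exact: nearW|exact: cx].
  by rewrite (cvg_limn_einf_sup cE).2 /=; exact: cx.
have key n : L1 (fun x => (f_ n x - f x) ^+ 2) /\
    I (fun x => (f_ n x - f x) ^+ 2) <= 4^-1 ^+ n.
  apply: (@I_fatou_ae (fun k x => (f_ n x - f_ (k + n)%N x) ^+ 2)).
  - by move=> k; apply: L2on_sqr; apply: L2onB.
  - by move=> k x _; rewrite sqr_ge0.
  - apply: measurable_funX; apply: measurable_funB => //; exact: L2on_meas (Lf n).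
  - by move=> x _; rewrite sqr_ge0.
  - apply: filterS cvf => x h /h cx.
    apply: (@cvg_comp _ _ _ (fun k => f_ n x - f_ (k + n)%N x) (fun z => z ^+ 2)); last first.
      exact: (@exprn_continuous R 2 (f_ n x - f x)).
    by apply: cvgB; [exact: cvg_cst|rewrite (cvg_shiftn n (f_ ^~ x))].
  - move=> k; rewrite (@eq_I _ _ _ _ _ _ (fun x => (f_ (k + n)%N x - f_ n x) ^+ 2)).
      by apply: fC; exact: leq_addl.
    by move=> x _; rewrite -sqrrN opprB.
exists f; split; last by move=> n; case: (key n).
have Lz : L2 (fun x => f_ 0%N x - f x).
  split; first by apply: measurable_funB => //; exact: L2on_meas (Lf 0%N).
  by case: (key 0%N).
have := L2onB mD (Lf 0%N) Lz; congr L2on; apply/funext => x.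
by rewrite opprB addrC subrK.
Qed.

Lemma is_derive_I (f df : R -> T -> R) (G : T -> R) (u v a : R) :
  u < a < v -> (forall s, u < s < v -> L1 (f s)) ->
  (forall s x, u < s < v -> D x -> is_derive s 1 (f ^~ x) (df s x)) ->
  L1 G -> (forall s x, u < s < v -> D x -> `|df s x| <= G x) ->
  is_derive a 1 (fun s => I (f s)) (I (df a)).
Proof.
move=> uav Lf fdf LG dfG.
have d1 s x : u < s < v -> D x -> partial1of2 f s x = df s x.
  by move=> us Dx; rewrite partial1of2E; have -> := @derive_val _ _ _ _ _ _ _ (fdf s x us Dx).
have intf s : `]u, v[%classic s -> mu.-integrable D (EFin \o f s).
  by rewrite /= in_itv/= => /Lf[].
have derf s x : `]u, v[%classic s -> D x -> derivable (f ^~ x) s 1.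
  by rewrite /= in_itv/= => us Dx; case: (fdf s x us Dx).
have aI : `]u, v[%classic a by rewrite /= in_itv.
have G0 x : 0 <= `|G x| by [].
have iG : mu.-integrable D (EFin \o (fun x => `|G x|)).
  by case: (L1on_norm LG).
have Gub s x : `]u, v[%classic s -> D x -> `|partial1of2 f s x| <= `|G x|.
  by rewrite /= in_itv/= => us Dx; rewrite d1// (le_trans (dfG s x us Dx))// ler_norm.
have dI := @derivable_under_integral R _ T mu f D mD a u v aI intf derf _ G0 iG Gub.
have eI := @differentiation_under_integral R _ T mu f D mD a u v aI intf derf _ G0 iG Gub.
apply: DeriveDef; first exact: dI.
rewrite -derive1E /I eI; apply: eq_Rintegral => x /[!inE] Dx.
by rewrite d1.
Qed.

End completeness_and_derivation.

Lemma is_derive0_cst (R : realType) (N : R -> R) (a b : R) : a <= b ->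
  (forall s, a < s < b -> is_derive s 1 N 0) ->
  {within `[a, b], continuous N} -> N a = N b.
Proof.
rewrite le_eqVlt => /predU1P[->//|ab] dN cN.
have dN' s : s \in `]a, b[ -> is_derive s 1 N ((fun=> 0) s).
  by rewrite in_itv/=; exact: dN.
have [c _] := MVT ab dN' cN.
by rewrite mul0r => /eqP; rewrite subr_eq0 => /eqP ->.
Qed.

(** * Geometry of the Euclidean sphere *)

Section borel_rV.
Context {R : realType} (n : nat).
Local Notation E := 'rV[R]_n.

Let box (p : 'rV[rat]_n * nat) : set E :=
  [set y | forall i, `|y 0 i - ratr (p.1 0 i)| < p.2.+1%:R^-1].

Let measurable_box p : measurable (box p).
Proof.
rewrite (_ : box p = \bigcap_(i in [set: 'I_n])
    [set y : E | `|y 0 i - ratr (p.1 0 i)| < p.2.+1%:R^-1]); last first.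
  by apply/seteqP; split=> y /= h i; [move=> _; exact: h|exact: (h i Logic.I)].
apply: fin_bigcap_measurable => [|i _]; first exact: finite_finset.
have : measurable_fun setT (fun y : E => `|y 0 i - ratr (p.1 0 i)|).
  apply: measurableT_comp => //; apply: measurable_funB => //.
  exact: measurable_rV_coord.
move=> /(_ measurableT _ (measurable_itv `]-oo, p.2.+1%:R^-1[)).
rewrite setTI; congr measurable; apply/seteqP; split=> y /=; by rewrite in_itv.
Qed.

(** The sigma-algebra is generated by the coordinates. An open set is the union of the boxes with
    rational centre and radius 1/(k+1) that it contains, and there are countably many of them. *)
Lemma open_measurable_rV (O : set E) : open O -> measurable O.
Proof.
move=> oO.
pose F p := if `[< box p `<=` O >] then box p else set0.
have -> : O = \bigcup_p F p.
  apply/seteqP; split=> [x Ox|x [p _]]; last first.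
    by rewrite /F; case: ifP => [/asboolP|//]; apply.
  have /nbhs_ballP[e /= e0 eO] := open_nbhs_nbhs (conj oO Ox).
  (* Two points of a box differ in each coordinate by less than twice its radius. *)
  have [k ke] : exists k : nat, 2 * k.+1%:R^-1 < e.
    have e2 : 0 < e / 2 by rewrite divr_gt0.
    have [k _ /(_ k (leqnn k)) hk] := near_infty_natSinv_lt (PosNum e2).
    by exists k; rewrite mulrC -ltr_pdivlMr.
  have cex i : exists q : rat, `|x 0 i - ratr q| < k.+1%:R^-1.
    have : exists q : rat, ratr q \in `](x 0 i - k.+1%:R^-1), (x 0 i + k.+1%:R^-1)[.
      apply: rat_in_itvoo; rewrite ltrD2l.
      by rewrite (lt_trans (_ : _ < 0)) ?oppr_lt0 ?invr_gt0.
    by move=> [q]; rewrite in_itv/= => /andP[q1 q2]; exists q; rewrite distrC ltr_distl q1.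
  have [c hc] := choice cex.
  exists (\row_i c i, k) => //; rewrite /F.
  case: ifPn => [_ i|/asboolPn []]; first by rewrite /= mxE hc.
  move=> y hy; apply: eO; split=> // i j; rewrite (ord1 i) /ball /=.
  have := hy j; rewrite /= mxE => h.
  have -> : x 0 j - y 0 j = (x 0 j - ratr (c j)) - (y 0 j - ratr (c j)) by ring.
  rewrite (le_lt_trans (ler_normB _ _))// (lt_trans _ ke)// mulr_natl mulr2n.
  by rewrite ltrD// hc.
apply: countable_bigcupT_measurable; first exact: countableP.
by move=> p; rewrite /F; case: ifP.
Qed.

Lemma measurable_rV_set1 (x : E) : measurable [set x].
Proof.
have : closed [set x] by exact: accessible_closed_set1 (hausdorff_accessible (@norm_hausdorff _
  _)) x.
by move=> /closed_openC/open_measurable_rV/measurableC; rewrite setCK.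
Qed.

(** Functions of the direction x / |x| have no natural value at the origin; a point is a measurable
    set, so that value is harmless. *)
Lemma measurable_continuous_off0 (f : E -> R) :
  (forall x, x != 0 -> {for x, continuous f}) -> measurable_fun setT f.
Proof.
move=> cf.
have oU : open [set x : E | x != 0].
  rewrite (_ : [set x | _] = ~` [set 0]); last first.
    by apply/seteqP; split=> x /= /eqP.
  apply: closed_openC.
  exact: accessible_closed_set1 (hausdorff_accessible (@norm_hausdorff _ _)) _.
have -> : [set: E] = [set x | x != 0] `|` [set 0].
  apply/seteqP; split=> x //= _; have [->|x0] := eqVneq x 0; [by right|by left].
apply/measurable_funU.
- exact: open_measurable_rV.
- exact: measurable_rV_set1.
split; last exact: measurable_fun_set1.
apply: (@measurability _ _ _ _ _ _ (@RGenOpens.G R) (RGenOpens.measurableE R)).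
move=> _ [_ [a [b ->] <-]]; apply: open_measurable_rV; rewrite openE => x [/= x0 fx].
apply: filterI; first exact: open_nbhs_nbhs.
by apply: (cf x x0); apply: open_nbhs_nbhs; split=> //; exact: interval_open.
Qed.

End borel_rV.

Section euclidean.
Context {R : realType} {d : nat}.
Local Notation E := 'rV[R]_d.
Implicit Types (x y z : E) (a : R).

Lemma dotpC x y : dotp x y = dotp y x.
Proof. by apply: eq_bigr => i _; rewrite mulrC. Qed.

Lemma dotpDl x y z : dotp (x + y) z = dotp x z + dotp y z.
Proof. by rewrite -big_split; apply: eq_bigr => i _; rewrite mxE mulrDl. Qed.

Lemma dotpZl a x y : dotp (a *: x) y = a * dotp x y.
Proof. by rewrite mulr_sumr; apply: eq_bigr => i _; rewrite mxE mulrA. Qed.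

Lemma dotpZr a x y : dotp x (a *: y) = a * dotp x y.
Proof. by rewrite dotpC dotpZl dotpC. Qed.

Lemma dotpNl x y : dotp (- x) y = - dotp x y.
Proof. by rewrite -scaleN1r dotpZl mulN1r. Qed.

Lemma dotpBl x y z : dotp (x - y) z = dotp x z - dotp y z.
Proof. by rewrite dotpDl dotpNl. Qed.

Lemma dotpBr x y z : dotp x (y - z) = dotp x y - dotp x z.
Proof. by rewrite dotpC dotpBl !(dotpC x). Qed.

Lemma dotpDr x y z : dotp x (y + z) = dotp x y + dotp x z.
Proof. by rewrite dotpC dotpDl !(dotpC x). Qed.

Lemma dotp_ge0 x : 0 <= dotp x x.
Proof. by apply: sumr_ge0 => i _; exact: sqr_ge0. Qed.

Lemma dotp_eq0 x : dotp x x = 0 -> x = 0.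
Proof.
move=> /eqP; rewrite psumr_eq0; last by move=> i _; exact: sqr_ge0.
move=> /allP h; apply/rowP => i; rewrite mxE; apply/eqP.
by rewrite -sqrf_eq0 expr2; apply: h; rewrite mem_index_enum.
Qed.

Lemma enorm_ge0 x : 0 <= enorm x.
Proof. exact: sqrtr_ge0. Qed.

Lemma enorm_sqr x : enorm x ^+ 2 = dotp x x.
Proof. by rewrite sqr_sqrtr// dotp_ge0. Qed.

Lemma enorm_eq0 x : enorm x = 0 -> x = 0.
Proof. by move=> x0; apply: dotp_eq0; rewrite -enorm_sqr x0 expr0n. Qed.

Lemma enorm_gt0 x : x != 0 -> 0 < enorm x.
Proof.
by move=> x0; rewrite lt_neqAle enorm_ge0 andbT eq_sym; apply: contra_neq x0 => /enorm_eq0.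
Qed.

Lemma enorm0 : enorm (0 : E) = 0.
Proof.
by rewrite /enorm /dotp big1 ?sqrtr0// => i _; rewrite !mxE mulr0.
Qed.

Lemma enormZ a x : enorm (a *: x) = `|a| * enorm x.
Proof.
by rewrite /enorm dotpZl dotpZr mulrA -expr2 sqrtrM ?sqr_ge0// sqrtr_sqr.
Qed.

Lemma enormB x y : enorm (x - y) = enorm (y - x).
Proof. by rewrite -opprB -scaleN1r enormZ normrN1 mul1r. Qed.

Lemma unitv0 : unitv (0 : E) = 0.
Proof. by rewrite /unitv scaler0. Qed.

Lemma enorm_unitv x : x != 0 -> enorm (unitv x) = 1.
Proof.
move=> /enorm_gt0 x0; rewrite enormZ gtr0_norm ?invr_gt0// mulVf// gt_eqF//.
Qed.

Lemma sphere_unitv x : x != 0 -> sphere d (unitv x).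
Proof. exact: enorm_unitv. Qed.

Lemma sphere_neq0 x : sphere d x -> x != 0.
Proof.
move=> Sx; apply/eqP => x0; move: Sx; rewrite /sphere /= x0 enorm0 => /eqP.
by rewrite eq_sym oner_eq0.
Qed.

Lemma unitv_id x : sphere d x -> unitv x = x.
Proof. by move=> Sx; rewrite /unitv Sx invr1 scale1r. Qed.

Lemma unitvK x : unitv (unitv x) = unitv x.
Proof.
have [->|x0] := eqVneq x 0; first by rewrite !unitv0.
by rewrite unitv_id//; exact: sphere_unitv.
Qed.

Lemma unitvZ a x : 0 < a -> unitv (a *: x) = unitv x.
Proof.
move=> a0; have [->|x0] := eqVneq x 0; first by rewrite scaler0.
rewrite /unitv enormZ gtr0_norm// scalerA invfM mulrAC mulVf ?mul1r// gt_eqF//.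
Qed.

Lemma enorm_unitvK x : enorm x *: unitv x = x.
Proof.
have [->|/enorm_gt0 x0] := eqVneq x 0; first by rewrite enorm0 scale0r.
by rewrite /unitv scalerA mulfV ?scale1r// gt_eqF.
Qed.

Lemma dotp_sphere x : sphere d x -> dotp x x = 1.
Proof. by move=> Sx; rewrite -enorm_sqr Sx expr1n. Qed.

Lemma enorm_sub_sqr x y : sphere d x -> sphere d y ->
  enorm (x - y) ^+ 2 = 2 - 2 * dotp x y.
Proof.
move=> Sx Sy; rewrite enorm_sqr dotpBl !dotpBr (dotp_sphere Sx) (dotp_sphere Sy).
by rewrite (dotpC y x); ring.
Qed.

Lemma dotp_le1 x y : sphere d x -> sphere d y -> dotp x y <= 1.
Proof.
by move=> Sx Sy; have := enorm_sub_sqr Sx Sy; have := sqr_ge0 (enorm (x - y)); lra.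
Qed.

Lemma dotp_geN1 x y : sphere d x -> sphere d y -> -1 <= dotp x y.
Proof.
move=> Sx Sy; have := dotp_ge0 (x + y).
by rewrite dotpDl !dotpDr (dotp_sphere Sx) (dotp_sphere Sy) (dotpC y x); lra.
Qed.

Lemma dotp_norm_le1 x y : sphere d x -> sphere d y -> `|dotp x y| <= 1.
Proof. by move=> Sx Sy; rewrite ler_norml dotp_geN1// dotp_le1. Qed.

Lemma dotp_eq1 x y : sphere d x -> sphere d y -> dotp x y = 1 -> x = y.
Proof.
move=> Sx Sy xy; apply/eqP; rewrite -subr_eq0; apply/eqP/enorm_eq0/eqP.
by rewrite -sqrf_eq0 enorm_sub_sqr// xy; apply/eqP; ring.
Qed.

Lemma coord_le_enorm x i : `|x 0 i| <= enorm x.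
Proof.
rewrite -ler_sqr ?nnegrE ?enorm_ge0// real_normK ?num_real// enorm_sqr.
rewrite /dotp (bigD1 i)//= expr2 lerDl sumr_ge0// => j _; exact: sqr_ge0.
Qed.

Lemma coord_sphere_le1 x i : sphere d x -> `|x 0 i| <= 1.
Proof. by move=> Sx; rewrite -[leRHS]Sx; exact: coord_le_enorm. Qed.

Lemma rV_sum_delta x : x = \sum_i x 0 i *: delta_mx 0 i.
Proof. exact: row_sum_delta. Qed.

End euclidean.

Section near_differentiable.
Context {R : realType} (V W : normedModType R).

Lemma near0_differentiable (f : V -> W) x :
  (\forall y \near x, f y = 0) -> differentiable f x.
Proof.
move=> f0.
have fx0 : f x = 0 by exact: nbhs_singleton f0.
have h : f \o shift x = cst (f x) + (\0 : {linear V -> W}) +o_ (0 : V) id.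
  apply/eqaddoP => e e0; have := f0; rewrite (near_shift 0) => f0'.
  apply: filterS f0' => y; rewrite subr0 /= => fy.
  by rewrite !fctE /= fy fx0 addr0 subr0 normr0 mulr_ge0// ltW.
have c0 : continuous (\0 : {linear V -> W}) by move=> y; exact: cst_continuous.
have dE := diff_unique c0 h.
by apply/diff_locallyP; rewrite dE.
Qed.

Lemma near_eq_differentiable (f g : V -> W) x :
  (\forall y \near x, f y = g y) -> differentiable f x -> differentiable g x.
Proof.
move=> fg df; have -> : g = f - (f - g) by rewrite opprB addrC subrK.
have h := @near0_differentiable (f - g) x.
apply: differentiableB => //; apply: h.
by apply: filterS fg => y fgy; rewrite fctE fgy subrr.
Qed.

End near_differentiable.

(** * Smooth functions off the origin *)

Section smooth_functions.
Context {R : realType} {d : nat}.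
Local Notation E := 'rV[R]_d.
Implicit Types (f g : E -> R) (x y z : E).

Definition off0 : set E := [set x | x != 0].

Lemma open_off0 : open off0.
Proof.
rewrite (_ : off0 = ~` [set 0]); last by apply/seteqP; split=> x /= /eqP.
apply: closed_openC.
exact: accessible_closed_set1 (hausdorff_accessible (@norm_hausdorff _ _)) _.
Qed.

Lemma near_off0 x : x != 0 -> \forall y \near x, y != 0.
Proof. by move=> x0; apply: open_nbhs_nbhs; split=> //; exact: open_off0. Qed.

(* Generators of a class of functions on [off0] that is closed under partial
   derivatives; [Sm_comp] takes a family of functions of one variable that is
   closed under differentiation. *)
Inductive Sm : (E -> R) -> Prop :=
| Sm_ext f g : (forall x, x != 0 -> f x = g x) -> Sm g -> Sm f
| Sm_base f : smooth_on off0 f -> Sm f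
| Sm_cst c : Sm (fun=> c)
| Sm_coord i : Sm (fun x => x 0 i)
| Sm_add f g : Sm f -> Sm g -> Sm (fun x => f x + g x)
| Sm_mul f g : Sm f -> Sm g -> Sm (fun x => f x * g x)
| Sm_comp (A : Type) (D : A -> A) (k : A -> R -> R) (J : set R) (a : A) f :
    (forall b s, J s -> is_derive s 1 (k b) (k (D b) s)) ->
    (forall x, x != 0 -> J (f x)) -> Sm f -> Sm (fun x => k a (f x)).

Lemma Sm_diff f : Sm f -> forall x, x != 0 -> differentiable f x.
Proof.
elim=> {f} [f g fg _ IH|f sf|c|i|f g _ IHf _ IHg|f g _ IHf _ IHg|A D k J a f kD fJ _ IH] x x0.
- apply: (@near_eq_differentiable _ _ _ g); last exact: IH.
  by apply: filterS (near_off0 x0) => y /fg.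
- exact: (sf [::]).
- exact: differentiable_cst.
- exact: differentiable_coord.
- exact: differentiableD (IHf x x0) (IHg x x0).
- exact: differentiableM (IHf x x0) (IHg x x0).
- apply: (@differentiable_comp _ _ _ _ f (k a)); first exact: IH.
  by apply/derivable1_diffP; case: (kD a (f x) (fJ x x0)).
Qed.

Lemma Sm_derivable f i x : Sm f -> x != 0 -> derivable f x (delta_mx 0 i).
Proof. by move=> sf x0; apply: diff_derivable; exact: Sm_diff. Qed.

Lemma near_eq_partial f g i x : (forall y, y != 0 -> f y = g y) -> x != 0 ->
  partial i f x = partial i g x.
Proof.
move=> fg x0; apply: near_eq_derive.
by apply: filterS (near_off0 x0) => y /fg.
Qed.

Lemma partial_comp (k : R -> R) (k' : R) f i x : differentiable f x ->
  is_derive (f x) 1 k k' -> partial i (fun x => k (f x)) x = k' * partial i f x.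
Proof.
move=> df dk; have kd : differentiable k (f x) by apply/derivable1_diffP; case: dk.
rewrite /partial deriveE; last exact: differentiable_comp.
rewrite (_ : (fun x => k (f x)) = k \o f)// diff_comp//=.
rewrite deriveE// diff1E// derive1E (@derive_val _ _ _ _ _ _ _ dk).
by rewrite mulrC.
Qed.

Lemma partialD f g i x : Sm f -> Sm g -> x != 0 ->
  partial i (fun x => f x + g x) x = partial i f x + partial i g x.
Proof.
move=> sf sg x0; rewrite /partial -deriveD//; exact: Sm_derivable.
Qed.

Lemma partialM f g i x : Sm f -> Sm g -> x != 0 ->
  partial i (fun x => f x * g x) x = partial i f x * g x + f x * partial i g x.
Proof.
move=> sf sg x0; rewrite /partial.
have -> := deriveM (Sm_derivable sf x0) (Sm_derivable sg x0).
by rewrite addrC mulrC.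
Qed.

Lemma partial_coord i j x : partial i (fun x => x 0 j) x = (i == j)%:R :> R.
Proof.
rewrite /partial /derive; apply: lim_near_cst => //.
near=> h; rewrite /= !mxE eqxx /= eq_sym addrK /GRing.scale /= mulrA mulVf ?mul1r//.
by near: h; exact: nbhs_dnbhs_neq.
Unshelve. all: by end_near. Qed.

Lemma Sm_partial i f : Sm f -> Sm (partial i f).
Proof.
elim=> {f} [f g fg sg IH|f sf|c|j|f g sf IHf sg IHg|f g sf IHf sg IHg|A D k J a f kD fJ sf IH].
- by apply: Sm_ext IH => x x0; exact: near_eq_partial.
- apply: Sm_base => s x x0; have := sf (rcons s i) x x0.
  by rewrite -cats1 foldr_cat.
- apply: Sm_ext (Sm_cst 0) => x _; exact: derive_cst.
- by apply: Sm_ext (Sm_cst (i == j)%:R) => x _; exact: partial_coord.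
- by apply: Sm_ext (Sm_add IHf IHg) => x x0; rewrite partialD.
- apply: Sm_ext (Sm_add (Sm_mul IHf sg) (Sm_mul sf IHg)) => x x0.
  by rewrite partialM.
- apply: Sm_ext (Sm_mul (Sm_comp (D a) kD fJ sf) IH) => x x0.
  by rewrite (partial_comp _ (Sm_diff sf x0) (kD a (f x) (fJ x x0))).
Qed.

Lemma Sm_smooth_on f : Sm f -> smooth_on off0 f.
Proof.
move=> sf s x x0.
suff [g sg fg] : exists2 g, Sm g & forall y, y != 0 -> foldr (@partial R d) f s y = g y.
  apply: (@near_eq_differentiable _ _ _ g); last exact: Sm_diff.
  by apply: filterS (near_off0 x0) => y /fg.
elim: s => [|i s [g sg fg]]; first by exists f.
exists (partial i g); first exact: Sm_partial.
by move=> y y0 /=; exact: near_eq_partial.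
Qed.

Lemma Sm_continuous f x : Sm f -> x != 0 -> {for x, continuous f}.
Proof. by move=> sf x0; apply: differentiable_continuous; exact: Sm_diff. Qed.

Lemma Sm_measurable f : Sm f -> measurable_fun setT f.
Proof. by move=> sf; apply: measurable_continuous_off0 => x; exact: Sm_continuous. Qed.

Lemma Sm_opp f : Sm f -> Sm (fun x => - f x).
Proof.
move=> sf; apply: Sm_ext (Sm_mul (Sm_cst (-1)) sf) => x _.
by rewrite mulN1r.
Qed.

Lemma Sm_sub f g : Sm f -> Sm g -> Sm (fun x => f x - g x).
Proof. by move=> sf sg; apply: Sm_add => //; exact: Sm_opp. Qed.

Lemma Sm_sum n (f : 'I_n -> E -> R) : (forall i, Sm (f i)) ->
  Sm (fun x => \sum_i f i x).
Proof.
elim: n f => [|n IH] f sf.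
  by apply: Sm_ext (Sm_cst 0) => x _; rewrite big_ord0.
apply: Sm_ext (Sm_add (sf ord0) (IH (fun i => f (lift ord0 i)) (fun i => sf _))) => x _.
by rewrite big_ord_recl.
Qed.

Lemma partial_sum n (f : 'I_n -> E -> R) i x : (forall i, Sm (f i)) -> x != 0 ->
  partial i (fun x => \sum_j f j x) x = \sum_j partial i (f j) x.
Proof.
elim: n f => [|n IH] f sf x0.
  rewrite big_ord0 (near_eq_partial (g := fun=> 0)) => [|y _|//]; last by rewrite big_ord0.
  exact: derive_cst.
rewrite big_ord_recl -(IH (fun j => f (lift ord0 j)))// -partialD//; last exact: Sm_sum.
by apply: near_eq_partial => // y _; rewrite big_ord_recl.
Qed.

(** The functions a s^(-n/2), indexed by (a, n). Differentiation takes (a, n) to (- a n / 2, n + 2),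
    so they form a family as [Sm_comp] requires. *)
Definition invsqrt_fam (a : R * nat) (s : R) : R := a.1 * (Num.sqrt s)^-1 ^+ a.2.

Lemma is_derive_sqrtV (s : R) n : 0 < s ->
  is_derive s 1 (fun s => (Num.sqrt s)^-1 ^+ n) (- (n%:R / 2) * (Num.sqrt s)^-1 ^+ n.+2).
Proof.
move=> s0; have q0 : 0 < Num.sqrt s by rewrite sqrtr_gt0.
have ds := is_derive1_sqrt s0.
have dv : is_derive s 1 (fun s => (Num.sqrt s)^-1) (- (Num.sqrt s) ^- 2 *: (2 * Num.sqrt s)^-1).
  apply: DeriveDef; first by apply: derivableV; [rewrite gt_eqF|case: ds].
  rewrite (deriveV (lt0r_neq0 q0)); last by case: ds.
  by rewrite (@derive_val _ _ _ _ _ _ _ ds).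
rewrite (_ : (fun s => _ ^+ n) = (fun s => (Num.sqrt s)^-1) ^+ n); last first.
  by apply/funext => t; rewrite exprfctE.
apply: (is_derive_eq (is_deriveX n dv)).
rewrite /GRing.scale /=; case: n => [|n]; first by rewrite !mul0r oppr0 mul0r.
rewrite !exprS /=; move: (Num.sqrt s) q0 => q q0.
by field; rewrite gt_eqF.
Qed.

Lemma invsqrt_fam_derive (a : R * nat) (s : R) : 0 < s -> is_derive s 1 (invsqrt_fam a)
  (invsqrt_fam (- (a.1 * a.2%:R / 2), a.2.+2) s).
Proof.
move=> s0; apply: (is_derive_eq (is_deriveZ a.1 (is_derive_sqrtV a.2 s0))).
by rewrite /invsqrt_fam /= /GRing.scale /=; ring.
Qed.

Lemma Sm_sqrtV n f : (forall x, x != 0 -> 0 < f x) -> Sm f ->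
  Sm (fun x => (Num.sqrt (f x))^-1 ^+ n).
Proof.
move=> f0 sf.
have := @Sm_comp (R * nat) (fun a => (- (a.1 * a.2%:R / 2), a.2.+2))
  invsqrt_fam [set s | 0 < s] (1, n) f.
move=> /(_ (fun b s h => invsqrt_fam_derive b h) f0 sf).
by apply: Sm_ext => x _; rewrite /invsqrt_fam /= mul1r.
Qed.

Lemma Sm_dotp : Sm (fun x => dotp x x).
Proof. by apply: Sm_sum => i; apply: Sm_mul; exact: Sm_coord. Qed.

Lemma dotp_gt0 x : x != 0 -> 0 < dotp x x.
Proof. by move=> /enorm_gt0 x0; rewrite -enorm_sqr exprn_gt0. Qed.

Lemma Sm_enormV : Sm (fun x => (enorm x)^-1).
Proof.
by apply: Sm_ext (Sm_sqrtV 1 dotp_gt0 Sm_dotp) => x _; rewrite expr1.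
Qed.

Lemma Sm_enorm : Sm (@enorm R d).
Proof.
apply: Sm_ext (Sm_mul Sm_dotp Sm_enormV) => x /enorm_gt0 x0.
by rewrite -enorm_sqr expr2 mulfK// gt_eqF.
Qed.

Lemma partial_dotp i x : x != 0 -> partial i (fun x => dotp x x) x = 2 * x 0 i.
Proof.
move=> x0; rewrite (@partial_sum _ (fun j x => x 0 j * x 0 j))//; last first.
  by move=> j; apply: Sm_mul; exact: Sm_coord.
rewrite (bigD1 i)//= big1 => [|j ji]; rewrite partialM//; try exact: Sm_coord.
  by rewrite !(partial_coord i i) eqxx /=; ring.
by rewrite !partial_coord eq_sym (negbTE ji) mul0r mulr0 addr0.
Qed.

Lemma partial_enormV i x : x != 0 ->
  partial i (fun x => (enorm x)^-1) x = - (enorm x)^-1 ^+ 3 * x 0 i.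
Proof.
move=> x0; have x1 := dotp_gt0 x0.
rewrite (@near_eq_partial _ (fun x => (Num.sqrt (dotp x x))^-1 ^+ 1))//.
rewrite (partial_comp _ (Sm_diff Sm_dotp x0) (is_derive_sqrtV 1 x1)) partial_dotp//.
by rewrite -/(enorm x); move: (enorm x)^-1 => q; field.
Qed.

(** * Functions that are constant along rays *)

Definition radial f := forall x, f (unitv x) = f x.

(** Smooth functions on the sphere, represented by their extensions that are constant along rays, so
    that ambient partial derivatives apply to them. *)
Definition RS f := Sm f /\ radial f.

(** A partial derivative of a function that is constant along rays is homogeneous of degree -1; the
    factor [enorm x] makes it constant along rays again. On the sphere this is a component of the
    surface gradient. *)
Definition Dr i f x : R := enorm x * partial i f x.

Definition xh j x : R := unitv x 0 j.

Lemma xhE j x : xh j x = (enorm x)^-1 * x 0 j.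
Proof. by rewrite /xh /unitv mxE. Qed.

Lemma RS_xh j : RS (xh j).
Proof.
split; last by move=> x; rewrite /xh unitvK.
by apply: Sm_ext (Sm_mul Sm_enormV (Sm_coord j)) => x _; rewrite xhE.
Qed.

Lemma sum_xh_sqr x : x != 0 -> \sum_i xh i x ^+ 2 = 1.
Proof.
by move=> x0; rewrite -[RHS](dotp_sphere (sphere_unitv x0)); apply: eq_bigr.
Qed.

Lemma RS_cst c : RS (fun=> c).
Proof. by split=> //; exact: Sm_cst. Qed.

Lemma RS_add f g : RS f -> RS g -> RS (fun x => f x + g x).
Proof. by move=> [sf rf] [sg rg]; split=> [|x]; [exact: Sm_add|rewrite rf rg]. Qed.

Lemma RS_mul f g : RS f -> RS g -> RS (fun x => f x * g x).
Proof. by move=> [sf rf] [sg rg]; split=> [|x]; [exact: Sm_mul|rewrite rf rg]. Qed.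

Lemma RS_opp f : RS f -> RS (fun x => - f x).
Proof. by move=> [sf rf]; split=> [|x]; [exact: Sm_opp|rewrite rf]. Qed.

Lemma RS_sub f g : RS f -> RS g -> RS (fun x => f x - g x).
Proof. by move=> sf sg; apply: RS_add => //; exact: RS_opp. Qed.

Lemma RS_sum n (f : 'I_n -> E -> R) : (forall i, RS (f i)) ->
  RS (fun x => \sum_i f i x).
Proof.
move=> sf; split; first by apply: Sm_sum => i; case: (sf i).
by move=> x; apply: eq_bigr => i _; case: (sf i).
Qed.

Lemma partial_radial i f x c : Sm f -> radial f -> x != 0 -> 0 < c ->
  partial i f (c *: x) = c^-1 * partial i f x.
Proof.
move=> sf rf x0 c0.
have cx0 : c *: x != 0 by rewrite scaler_eq0 negb_or gt_eqF.
have fE : f = f \o ( *:%R c^-1).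
  by apply/funext => y /=; rewrite -[LHS]rf -[RHS]rf unitvZ// invr_gt0.
rewrite /partial {1}fE.
have cK : c^-1 *: (c *: x) = x by rewrite scalerA mulVf ?scale1r// gt_eqF.
have ds := @is_diff_scaler R E c^-1 (c *: x).
have d1 : differentiable ( *:%R c^-1) (c *: x) by case: ds.
have d2 : differentiable f (c^-1 *: (c *: x)) by rewrite cK; exact: Sm_diff.
rewrite deriveE; last exact: differentiable_comp.
rewrite diff_comp//= (@diff_val _ _ _ _ _ _ _ ds) cK.
by rewrite linearZ/= deriveE//; exact: Sm_diff.
Qed.

Lemma RS_Dr i f : RS f -> RS (Dr i f).
Proof.
move=> [sf rf]; split; first by apply: Sm_mul; [exact: Sm_enorm|exact: Sm_partial].
move=> x; have [->|x0] := eqVneq x 0; first by rewrite unitv0.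
have e0 := enorm_gt0 x0; rewrite /Dr enorm_unitv// mul1r /unitv.
by rewrite partial_radial ?invr_gt0// invrK.
Qed.

Lemma Dr_ext i f g x : (forall y, y != 0 -> f y = g y) -> x != 0 ->
  Dr i f x = Dr i g x.
Proof. by move=> fg x0; rewrite /Dr (near_eq_partial i fg). Qed.

Lemma DrD i f g x : Sm f -> Sm g -> x != 0 ->
  Dr i (fun x => f x + g x) x = Dr i f x + Dr i g x.
Proof. by move=> sf sg x0; rewrite /Dr partialD// mulrDr. Qed.

Lemma DrM i f g x : Sm f -> Sm g -> x != 0 ->
  Dr i (fun x => f x * g x) x = Dr i f x * g x + f x * Dr i g x.
Proof. by move=> sf sg x0; rewrite /Dr partialM//; ring. Qed.

Lemma Dr_cst i c x : Dr i (fun=> c) x = 0.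
Proof. by rewrite /Dr /partial derive_cst mulr0. Qed.

Lemma Dr_sum n (f : 'I_n -> E -> R) i x : (forall i, Sm (f i)) -> x != 0 ->
  Dr i (fun x => \sum_j f j x) x = \sum_j Dr i (f j) x.
Proof. by move=> sf x0; rewrite /Dr partial_sum// mulr_sumr. Qed.

Lemma Dr_comp (k : R -> R) (k' : R) f i x : Sm f -> x != 0 ->
  is_derive (f x) 1 k k' -> Dr i (fun x => k (f x)) x = k' * Dr i f x.
Proof.
by move=> sf x0 dk; rewrite /Dr (partial_comp _ (Sm_diff sf x0) dk) mulrCA.
Qed.

Lemma Dr_xh i j x : x != 0 -> Dr i (xh j) x = (i == j)%:R - xh i x * xh j x.
Proof.
move=> x0; rewrite (@Dr_ext _ _ (fun x => (enorm x)^-1 * x 0 j)); last by [].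
  rewrite /Dr partialM//; [|exact: Sm_enormV|exact: Sm_coord].
  rewrite partial_enormV// partial_coord !xhE.
  by have := enorm_gt0 x0; move: (enorm x) => e e0; field; rewrite gt_eqF.
by move=> y _; rewrite xhE.
Qed.

(** The sum is the derivative of [f] in the direction of the ray through [x]. *)
Lemma Euler_radial f x : RS f -> x != 0 -> \sum_i xh i x * Dr i f x = 0.
Proof.
move=> [sf rf] x0.
have -> : \sum_i xh i x * Dr i f x = 'D_x f x.
  rewrite deriveE; last exact: Sm_diff.
  rewrite {5}(rV_sum_delta x) linear_sum; apply: eq_bigr => i _.
  rewrite linearZ /= xhE /Dr /partial deriveE; last exact: Sm_diff.
  rewrite /GRing.scale /=; have := enorm_gt0 x0; move: (enorm x) => e e0.
  by field; rewrite gt_eqF.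
rewrite /derive; apply: lim_near_cst => //.
have : \forall h \near (0 : R)^', `|h| < 1.
  by apply: dnbhs0_lt.
apply: filterS => h h1.
rewrite /= (_ : h *: x + x = (h + 1) *: x); last by rewrite scalerDl scale1r.
rewrite -[f (_ *: x)]rf unitvZ; last by move: h1; rewrite ltr_norml; lra.
by rewrite rf subrr scaler0.
Qed.

End smooth_functions.

(** * Smooth bump functions *)

Section bump_functions.
Context {R : realType}.
Implicit Types (P : {poly R}) (s t : R).

Lemma is_derive_sqr_bound (f : R -> R) C : (forall h, `|f h| <= C * h ^+ 2) ->
  is_derive (0 : R) 1 f 0.
Proof.
move=> fC; have f0 : f 0 = 0.
  by apply/eqP; rewrite -normr_le0; have := fC 0; rewrite expr0n mulr0.
have C0 : 0 <= C by have := fC 1; rewrite expr1n mulr1; apply: le_trans.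
have cv : h^-1 *: ((f \o shift 0) (h *: 1) - f 0) @[h --> 0^'] --> (0 : R).
  apply/cvgr0Pnorm_le => e e0.
  have eC : 0 < e / (C + 1) by rewrite divr_gt0// ltr_wpDl.
  near=> h; have h0 : h != 0 by near: h; exact: nbhs_dnbhs_neq.
  rewrite /= f0 subr0 addr0 /GRing.scale /= mulr1 normrM normfV.
  rewrite ler_pdivrMl ?normr_gt0//; apply: le_trans (fC h) _.
  rewrite -(real_normK (num_real h)) expr2 mulrCA ler_wpM2l//.
  have : `|h| <= e / (C + 1) by near: h; apply: dnbhs0_le.
  rewrite ler_pdivlMr ?ltr_wpDl// => hC; apply: le_trans hC.
  by rewrite mulrC ler_wpM2l// lerDl.
apply: DeriveDef; first by apply/cvg_ex; exists 0; exact: cv.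
exact: cvg_lim cv.
Unshelve. all: by end_near. Qed.

(** The base is s^k <= k! e^s, a single term of the exponential series. The induction on [P] raises
    the exponent, so [k] has to be general. *)
Lemma poly_expRN_bound P k : exists C, forall s, 0 < s ->
  `|P.[s]| * s ^+ k * expR (- s) <= C.
Proof.
have base k' : forall s, 0 < s -> s ^+ k' * expR (- s) <= k'`!%:R.
  move=> s s0; rewrite expRN -ler_pdivlMr ?invr_gt0 ?expR_gt0// invrK mulrC.
  rewrite -ler_pdivrMr ?ltr0n ?fact_gt0//.
  case: k' => [|k']; last by apply: le_trans (expR_ge1Dxn k' (ltW s0)); rewrite lerDr.
  by rewrite expr0 divr1; apply: le_trans (expR_ge1Dx s); rewrite lerDl ltW.
elim/poly_ind: P k => [|P c IH] k.
  by exists 0 => s s0; rewrite horner0 normr0 !mul0r.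
have [C hC] := IH k.+1.
exists (C + `|c| * k`!%:R) => s s0; rewrite !hornerE.
apply: (@le_trans _ _ ((`|P.[s]| * s + `|c|) * s ^+ k * expR (- s))).
  rewrite !ler_wpM2r ?expR_ge0 ?exprn_ge0 ?(ltW s0)//.
  by apply: le_trans (ler_normD _ _) _; rewrite normrM (gtr0_norm s0).
rewrite !mulrDl lerD//.
  by have := hC s s0; rewrite exprS mulrA.
by rewrite -mulrA ler_wpM2l// base.
Qed.

Definition bump P t : R := if 0 < t then P.[t^-1] * expR (- t^-1) else 0.

Definition bumpD P : {poly R} := 'X ^+ 2 * (P - P^`()).

Lemma bump_le0 P t : t <= 0 -> bump P t = 0.
Proof. by move=> t0; rewrite /bump ltNge t0. Qed.

Lemma bump1_gt0 t : 0 < t -> 0 < bump 1 t.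
Proof. by move=> t0; rewrite /bump t0 hornerC mul1r expR_gt0. Qed.

Lemma bump1_ge0 t : 0 <= bump 1 t.
Proof. by have [/bump1_gt0/ltW//|/bump_le0->] := ltP 0 t. Qed.

Lemma bump1_le1 t : bump 1 t <= 1.
Proof.
rewrite /bump; case: ifPn => // t0.
by rewrite hornerC mul1r -expR0 ler_expR oppr_le0 invr_ge0 ltW.
Qed.

Lemma is_derive_bump P t : is_derive t 1 (bump P) (bump (bumpD P) t).
Proof.
have [t0|t0|->] := ltgtP t 0.
- rewrite (bump_le0 _ (ltW t0)).
  have dc : is_derive t 1 (cst 0 : R -> R) 0 by exact: is_derive_cst.
  apply: near_eq_is_derive dc; near=> s; rewrite /= bump_le0//.
  by apply/ltW; near: s; exact: lt_nbhsl.
- have ti : is_derive t 1 (fun t => t^-1) (- t ^- 2).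
    by apply: (is_derive_eq (is_deriveV (lt0r_neq0 t0) (is_derive_id t 1)));
      rewrite /GRing.scale /= mulr1.
  have tm : is_derive t 1 (fun t => - t^-1) (t ^- 2).
    by apply: (is_derive_eq (is_deriveN ti)); rewrite opprK.
  have te := @is_derive1_comp R expR (fun t => - t^-1) t _ _ (is_derive_expR (- t^-1)) tm.
  have tP := @is_derive1_comp R (horner P) (fun t => t^-1) t _ _ (is_derive_poly P (t^-1)) ti.
  have tPe := is_deriveM tP te.
  suff dE : is_derive t 1 ((fun t => P.[t^-1]) * (fun t => expR (- t^-1)))
      (bump (bumpD P) t).
    apply: near_eq_is_derive dE; near=> s; rewrite /bump ifT//.
    by near: s; exact: lt_nbhsr.
  apply: (is_derive_eq tPe).
  rewrite /GRing.scale /= /bump t0 /bumpD !hornerE /=.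
  by move: (expR _) => e; rewrite exprVn; ring.
- rewrite (bump_le0 _ (lexx 0)).
  (* With exponent 2 the function is bounded by a multiple of h^2 near the origin, so its derivative
     there is 0. *)
  have [C hC] := poly_expRN_bound P 2.
  apply: (@is_derive_sqr_bound _ `|C|) => h; rewrite /bump; case: ifPn => h0; last first.
    by rewrite normr0 mulr_ge0// sqr_ge0.
  have := hC h^-1; rewrite invr_gt0 => /(_ h0).
  rewrite normrM (gtr0_norm (expR_gt0 _)) mulrAC exprVn ler_pdivrMr ?exprn_gt0// => h1.
  by apply: le_trans h1 _; rewrite ler_wpM2r ?sqr_ge0// ler_norm.
Unshelve. all: by end_near. Qed.

Lemma Sm_bump d P (f : 'rV[R]_d -> R) : Sm f -> Sm (fun x => bump P (f x)).
Proof.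
apply: (@Sm_comp R d {poly R} bumpD bump setT P f) => // Q s _.
exact: is_derive_bump.
Qed.

Lemma Sm_expR d c (f : 'rV[R]_d -> R) : Sm f -> Sm (fun x => c * expR (f x)).
Proof.
apply: (@Sm_comp R d R id (fun c s => c * expR s) setT c f) => // b s _.

Qed.

(* Smooth cutoffs that converge to the indicator function of [t <= 1]. *)
Definition cutoff (n : nat) (t : R) : R :=
  expR (- n%:R * bump 1 (t - 1)) * bump 1 (n%:R * (2 - t)).

Definition cutoff' (n : nat) (t : R) : R :=
  - n%:R * (bump (bumpD 1) (t - 1) * cutoff n t
    + expR (- n%:R * bump 1 (t - 1)) * bump (bumpD 1) (n%:R * (2 - t))).

Lemma is_derive_cutoff n t : is_derive t 1 (cutoff n) (cutoff' n t).
Proof.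
have d1 : is_derive t 1 (fun t => t - 1) (1 : R).
  exact: is_derive_shift.
have d2 := @is_derive1_comp R (bump 1) (fun t => t - 1) t _ _ (is_derive_bump 1 (t - 1)) d1.
have d3 := @is_derive1_comp R expR (fun t => - n%:R * bump 1 (t - 1)) t _ _ (is_derive_expR _)
  (is_deriveZ (- n%:R) d2).
have d4 : is_derive t 1 (fun t => n%:R * (2 - t)) (- n%:R : R).
  have dB : is_derive t 1 (fun t : R => 2 - t) (-1 : R).
    have dB : is_derive t (1 : R) (cst (2 : R) - id) (0 - 1) by exact: is_deriveB.
    by apply: (is_derive_eq dB); rewrite sub0r.
  by apply: (is_derive_eq (is_deriveZ n%:R dB)); rewrite /GRing.scale /= mulrN1.
have d5 := @is_derive1_comp R (bump 1) (fun t => n%:R * (2 - t)) t _ _ (is_derive_bump 1 _) d4.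
apply: (is_derive_eq (is_deriveM d3 d5)).
by rewrite /cutoff' /cutoff /GRing.scale /=; ring.
Qed.

Lemma cutoff_ge0 n t : 0 <= cutoff n t.
Proof. by rewrite mulr_ge0 ?expR_ge0 ?bump1_ge0. Qed.

Lemma cutoff_le1 n t : cutoff n t <= 1.
Proof.
rewrite -[leRHS]mulr1 ler_pM ?expR_ge0 ?bump1_ge0 ?bump1_le1//.
by rewrite -expR0 ler_expR mulNr oppr_le0 mulr_ge0 ?bump1_ge0.
Qed.

Lemma cutoff_ge2 n t : 2 <= t -> cutoff n t = 0.
Proof.
by move=> t2; rewrite /cutoff [X in _ * X]bump_le0 ?mulr0// mulr_ge0_le0// subr_le0.
Qed.

(** The first factor is 1 for t <= 1 and decays geometrically in [n] beyond. The second is 0 for t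
    >= 2 and tends to 1 for t < 2. *)
Lemma cutoff_cvg (t : R) : cutoff n t @[n --> \oo] --> ((t <= 1)%R%:R : R).
Proof.
have [t2|t2] := leP 2 t.
  rewrite (_ : (t <= 1) = false); last by apply/negbTE; rewrite -ltNge; lra.
  by under eq_fun do rewrite cutoff_ge2//; exact: cvg_cst.
have c2 : bump 1 (n%:R * (2 - t)) @[n --> \oo] --> (1 : R).
  have E : (fun n => bump 1 (n.+1%:R * (2 - t))) = fun n : nat =>
    expR (- (n.+1%:R^-1 * (2 - t)^-1)).
    apply/funext => n; rewrite /bump ifT ?hornerC ?mul1r ?invfM//.
    by rewrite mulr_gt0// subr_gt0.
  have c : (fun n : nat => expR (- (n.+1%:R^-1 * (2 - t)^-1))) @ \oo --> expR (- 0 : R).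
    apply: (@cvg_comp _ _ _ (fun n : nat => - (n.+1%:R^-1 * (2 - t)^-1)) expR _ (nbhs (- 0))).
      apply: cvgN; rewrite -[X in _ --> X](mul0r (2 - t)^-1); apply: cvgMl.
      exact: cvg_harmonic.
    exact: continuous_expR.
  by move: c; rewrite -E oppr0 expR0 => c; rewrite -cvg_shiftS.
have [t1|t1] := leP t 1.
  have E : cutoff ^~ t = fun n : nat => bump 1 (n%:R * (2 - t)).
    apply/funext => n; rewrite /cutoff (bump_le0 _ (_ : t - 1 <= 0)) ?subr_le0//.
    by rewrite mulr0 expR0 mul1r.
  by rewrite E.
rewrite (_ : (false)%:R = 0 * 1 :> R) ?mul0r//; last first.
rewrite -[X in _ --> X](mul0r (1 : R)); apply: cvgM => //.
have b0 : 0 < bump 1 (t - 1) by rewrite bump1_gt0// subr_gt0.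
have E : (fun n : nat => expR (- n%:R * bump 1 (t - 1))) = geometric 1 (expR (- bump 1 (t - 1))).
  by apply/funext => n; rewrite /geometric /= mul1r -expRM_natl mulNr mulrN.
rewrite E; apply: cvg_geometric; rewrite ger0_norm ?expR_ge0//.
by rewrite -[ltRHS]expR0 ltr_expR oppr_lt0.
Qed.

End bump_functions.

(** * The surface measure *)

Lemma integral_abse_pushforward {R : realType} d1 d2 (X : measurableType d1)
    (Y : measurableType d2) (m : {measure set X -> \bar R}) (f : X -> Y)
    (mf : measurable_fun setT f) (g : Y -> \bar R) : measurable_fun setT g ->
  (\int[measure_function_pushforward__canonical__measure_function_Measure m mf]_y `|g y| =
   \int[m]_x `|(g \o f) x|)%E.
Proof.
move=> mg.
rewrite (@ge0_integral_pushforward _ _ _ _ _ _ mf m setT (fun y => `|g y|)%E)//.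
by exact: measurableT_comp.
Qed.

Lemma integral_pushforwardT {R : realType} d1 d2 (X : measurableType d1)
    (Y : measurableType d2) (m : {measure set X -> \bar R}) (f : X -> Y)
    (mf : measurable_fun setT f) (g : Y -> \bar R) : measurable_fun setT g ->
  m.-integrable setT (g \o f) ->
  (\int[measure_function_pushforward__canonical__measure_function_Measure m mf]_y g y =
   \int[m]_x (g \o f) x)%E.
Proof.
move=> mg ig.
by rewrite (@integral_pushforward _ _ _ _ _ _ mf m setT g).
Qed.

Section lebesgue_boxes_and_lines.
Context {R : realType}.
Local Notation leb := (@lebesgue_measure R).

Definition cube n (A : 'I_n -> set R) : set 'rV[R]_n := [set x | forall i, A i (x 0 i)].

Lemma measurable_cube n (A : 'I_n -> set R) : (forall i, measurable (A i)) ->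
  measurable (cube A).
Proof.
move=> mA; rewrite (_ : cube A = \bigcap_(i in [set: 'I_n])
    [set y : 'rV[R]_n | A i (y 0 i)]); last first.
  by apply/seteqP; split=> y /= h i; [move=> _; exact: h|exact: (h i Logic.I)].
apply: fin_bigcap_measurable => [|i _]; first exact: finite_finset.
by have := @measurable_rV_coord R n i measurableT _ (mA i); rewrite setTI.
Qed.

Lemma lebesgue_rV_cube n (A : 'I_n -> set R) (l : R) : (forall i, measurable (A i)) ->
  (forall i, leb (A i) = l%:E) -> lebesgue_rV n (cube A) = (l ^+ n)%:E.
Proof.
elim: n A => [|n IH] A mA lA.
  rewrite /= /dirac indicE mem_set//.
  by move=> -[].
rewrite /= /lebesgue_rV_succ /pushforward.
rewrite (_ : _ @^-1` _ = A ord0 `*` cube (fun i => A (lift ord0 i))); last first.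
  apply/seteqP; split=> -[t y] /= h.
    split; first by have := h ord0; rewrite mxE unlift_none.
    by move=> i; have := h (lift ord0 i); rewrite mxE liftK.
  move=> i; rewrite mxE; case: (unliftP ord0 i) => [j|] -> /=; last by case: h.
  by case: h => _ /(_ j).
rewrite product_measure1E; [|exact: mA|exact: measurable_cube].
by rewrite IH//= lA -EFinM exprS.
Qed.

Definition upd n (x : 'rV[R]_n) (j : 'I_n) (t : R) : 'rV[R]_n :=
  \row_k if k == j then t else x 0 k.

(** Fubini's theorem by induction on [n]: the measure splits off the first coordinate, and [j] is
    either that coordinate or one of the remaining ones. *)
Lemma lebesgue_rV_lines n (j : 'I_n) (F : 'rV[R]_n -> R) :
  (lebesgue_rV n).-integrable setT (EFin \o F) ->
  (forall x, \int[leb]_t (F (upd x j t))%:E = 0)%E ->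
  (\int[lebesgue_rV n]_x (F x)%:E = 0)%E.
Proof.
elim: n j F => [[]//|n IH] j F iF F0.
pose m := (leb \x lebesgue_rV n)%E.
have mF := measurable_int _ iF.
have mG : measurable_fun setT ((EFin \o F) \o @rV_cons R n).
  by apply: measurableT_comp => //; exact: measurable_rV_cons.
pose pm : {measure set 'rV[R]_n.+1 -> \bar R} :=
  measure_function_pushforward__canonical__measure_function_Measure m
    (@measurable_rV_cons R n).
have iG : m.-integrable setT ((EFin \o F) \o @rV_cons R n).
  apply/integrableP; split=> //.
  have [_] := integrableP _ _ _ iF.
  have -> : (\int[lebesgue_rV n.+1]_x `|(EFin \o F) x| =
     \int[m]_x `|((EFin \o F) \o @rV_cons R n) x|)%E; last by [].
  rewrite (eq_measure_integral pm)//.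
  by rewrite /pm integral_abse_pushforward.
have -> : (\int[lebesgue_rV n.+1]_x (F x)%:E =
    \int[m]_z ((EFin \o F) \o @rV_cons R n) z)%E.
  rewrite (eq_measure_integral pm)//.
  by rewrite /pm (integral_pushforwardT _ mF).
case: (unliftP ord0 j) => [k|] jE.
  rewrite -(integral12_prod_meas1 iG).
  have cz : {ae leb, forall t, setT t -> fubini_F (lebesgue_rV n) ((EFin \o F) \o @rV_cons R n)
    t = 0%E}.
    apply: filterS (ae_integrable1 iG) => t it _.
    apply: (IH k (fun y => F (rV_cons (t, y)))) => // x.
    rewrite -[RHS](F0 (rV_cons (t, x))); apply: eq_integral => s _ /=.
    congr (F _)%:E; apply/rowP => i; rewrite jE !mxE.
    case: (unliftP ord0 i) => [i'|] -> /=.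
      by rewrite (inj_eq lift_inj) mxE.
    by [].
  rewrite (ae_eq_integral (cst 0%E))//; first by rewrite integral0.
  exact: (measurable_fubini_F iG).
rewrite -(integral21_prod_meas1 iG) integral0_eq// => y _.
rewrite /fubini_G -[RHS](F0 (rV_cons (0, y))); apply: eq_integral => s _ /=.
congr (F _)%:E; apply/rowP => i; rewrite jE !mxE.
by case: (unliftP ord0 i) => [i'|] -> /=; rewrite ?eqxx.
Qed.

End lebesgue_boxes_and_lines.

Section sphere_measure.
Context {R : realType} {d : nat}.
Local Notation E := 'rV[R]_d.
Local Notation S := (@sphere R d).

Definition cubeC (r : R) : set E := cube (fun=> `[- r, r]%classic).

Lemma measurable_cubeC r : measurable (cubeC r).
Proof. by apply: measurable_cube => i; exact: measurable_itv. Qed.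

Lemma lebesgue_cubeC r : 0 <= r -> lebesgue_rV d (cubeC r) = ((r *+ 2) ^+ d)%:E.
Proof.
move=> r0; apply: lebesgue_rV_cube => i; first exact: measurable_itv.
rewrite lebesgue_measure_itv/= lte_fin; case: ltP => h.
  by rewrite -EFinD opprK mulr2n.
have -> : r = 0 by apply/eqP; rewrite eq_le r0 andbT; lra.
by rewrite mul0rn.
Qed.

Lemma enorm_cubeC r (x : E) : enorm x <= r -> cubeC r x.
Proof.
move=> xr i /=; rewrite in_itv/= -ler_norml; apply: le_trans xr.
exact: coord_le_enorm.
Qed.

Lemma lebesgue_pball_lty : (lebesgue_rV d (@pball R d) < +oo)%E.
Proof.
apply: (@le_lt_trans _ _ (lebesgue_rV d (cubeC 1))).
  rewrite le_measure ?inE//; [exact: measurable_pball|exact: measurable_cubeC|].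
  by move=> x /andP[_]; exact: enorm_cubeC.
by rewrite lebesgue_cubeC// ltry.
Qed.

Lemma measurable_sphere : measurable S.
Proof.
have := @measurable_enorm R d measurableT _ (measurable_set1 1); rewrite setTI.
by congr measurable; apply/seteqP; split.
Qed.

Lemma omega_fin_num : fin_num_fun (@omega R d).
Proof.
move=> A mA; rewrite ge0_fin_numE//.
rewrite /omega /pushforward /mscale /= /mrestr.
rewrite lte_mul_pinfty//.
apply: le_lt_trans lebesgue_pball_lty.
have mP := @measurable_pball R d.
have mUA : measurable (@unitv R d @^-1` A).
  by have := @measurable_unitv R d measurableT _ mA; rewrite setTI.
by apply: le_measure; rewrite ?inE//; exact: measurableI.
Qed.

HB.instance Definition _ := Measure_isFinite.Build _ _ _ (@omega R d) omega_fin_num.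

Lemma pball_neq0 (x : E) : pball x -> x != 0.
Proof.
move=> /andP[x0 _]; apply/eqP => xE; move: x0.
by rewrite xE enorm0 ltxx.
Qed.

Lemma omega_setC_sphere : omega d (~` S) = 0.
Proof.
rewrite /omega /pushforward /mscale /= /mrestr.
rewrite (_ : _ `&` _ = set0) ?measure0 ?mule0//.
apply/seteqP; split=> x //= [h /pball_neq0 x0]; apply: h.
exact: sphere_unitv.
Qed.

Lemma ae_sphere : {ae @omega R d, forall x, S x}.
Proof.
exists (~` S); split=> //; first by apply: measurableC; exact: measurable_sphere.
exact: omega_setC_sphere.
Qed.

Lemma ge0_integral_omega (h : E -> R) : measurable_fun setT h ->
  (forall x, 0 <= h x) ->
  (\int[@omega R d]_(x in S) (h x)%:E =
   d%:R%:E * \int[lebesgue_rV d]_(x in @pball R d) (h (unitv x))%:E)%E.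
Proof.
move=> mh h0; pose nu := mrestr (lebesgue_rV d) (@measurable_pball R d).
pose mu := mscale (NngNum (ler0n R d)) nu.
pose pm : {measure set E -> \bar R} :=
  measure_function_pushforward__canonical__measure_function_Measure mu
    (@measurable_unitv R d).
rewrite (eq_measure_integral pm)//.
have mU := @measurable_unitv R d.
have mhu : measurable_fun setT (fun x : E => (h (unitv x))%:E).
  by apply/measurable_EFinP; exact: measurableT_comp.
have mP := @measurable_pball R d.
have mhS : measurable_fun S (EFin \o h).
  by apply/measurable_EFinP; exact: measurable_funS mh.
rewrite (@ge0_integral_pushforward _ _ _ _ _ _ mU mu S (EFin \o h) measurable_sphere mhS);
  last first.
  by move=> x _; rewrite lee_fin.
have mPre : measurable (@unitv R d @^-1` S).
  by have := mU measurableT _ measurable_sphere; rewrite setTI.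
rewrite ge0_integral_mscale//; last 2 first.
- exact: measurable_funS mhu.
- by move=> x _; rewrite lee_fin.
congr (_ * _)%E.
rewrite (@ge0_negligible_integral _ _ _ nu _ (~` @pball R d))//; last 4 first.
- exact: measurableC.
- exact: measurable_funS mhu.
- by move=> x _; rewrite lee_fin.
- by rewrite /nu /= /mrestr setICl measure0.
rewrite setDE setCK (_ : _ `&` _ = @pball R d); last first.
  apply/seteqP; split=> x /=; first by case.
  by move=> px; split=> //; exact/sphere_unitv/pball_neq0.
apply: eq_measure_integral => A mA AP.
transitivity (lebesgue_rV d (A `&` @pball R d)); first by [].
by rewrite setIidl.
Qed.

(** The formula in polar coordinates is stated for nonnegative functions, so the bound [M] is added
    to [h] and subtracted again after integration. *)
Lemma integral_omega_eq0 (h : E -> R) (M : R) : measurable_fun setT h -> radial h ->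
  (forall x, `|h x| <= M) ->
  (\int[lebesgue_rV d]_(x in @pball R d) (h x)%:E = 0)%E ->
  I (@omega R d) S h = 0.
Proof.
move=> mh rh hM h0.
have M0 : 0 <= M by apply: le_trans (hM 0).
have mS := measurable_sphere; have mP := @measurable_pball R d.
have Lh : L1on (@omega R d) S h by apply: (@L1on_bounded _ _ _ _ _ mS M).
have hM' x : 0 <= h x + M by have := hM x; rewrite ler_norml; lra.
have e1 := ge0_integral_omega (measurable_funD mh (measurable_cst M)) hM'.
have e2 := ge0_integral_omega (measurable_cst M) (fun _ : E => M0).
have ih : (lebesgue_rV d).-integrable (@pball R d) (EFin \o h).
  apply: measurable_bounded_integrable => //; first exact: lebesgue_pball_lty.
    exact: measurable_funS mh.
  exists M; split; first exact: num_real.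
  by move=> y My x _; exact: le_trans (hM x) (ltW My).
have iM : (lebesgue_rV d).-integrable (@pball R d) (EFin \o cst M).
  apply: measurable_bounded_integrable => //; first exact: lebesgue_pball_lty.
  exists M; split; first exact: num_real.
  by move=> y My x _ /=; rewrite ger0_norm// ltW.
have e3 : (\int[@omega R d]_(x in S) (h x + M)%:E = \int[@omega R d]_(x in S) M%:E)%E.
  rewrite e1 e2; congr (_ * _)%E.
  rewrite (eq_integral (fun x => (h x)%:E + (cst M x)%:E)%E); last first.
    by move=> x _ /=; rewrite rh EFinD.
  by rewrite integralD_EFin// h0 add0e.
have LM : L1on (@omega R d) S (fun=> M) by exact: L1on_cst.
have := I_add mS Lh LM; rewrite {1}/I /Rintegral e3 -/(Rintegral _ _ _) -/(I _ _ _).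
by move=> e; apply: (addIr (I (@omega R d) S (fun=> M))); rewrite add0r -e.
Qed.

End sphere_measure.

(** * The divergence theorem on the sphere *)

Section derivative_along_coordinate_lines.
Context {R : realType} {d : nat}.
Local Notation E := 'rV[R]_d.

Lemma upd_shift (x : E) j (t h : R) :
  upd x j (h + t) = h *: delta_mx 0 j + upd x j t.
Proof.
apply/rowP => k; rewrite !mxE eqxx /= eq_sym.
by case: eqP => _; rewrite ?mulr1 ?mulr0 ?add0r.
Qed.

Lemma is_derive_upd (g : E -> R) (x : E) j t :
  derivable g (upd x j t) (delta_mx 0 j) ->
  is_derive t 1 (fun t => g (upd x j t)) (partial j g (upd x j t)).
Proof.
move=> dg.
have EQ : (fun h : R => h^-1 *: (((fun t => g (upd x j t)) \o shift t) (h *: 1) - g (upd x j t))) =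
          (fun h : R => h^-1 *: ((g \o shift (upd x j t)) (h *: delta_mx 0 j) - g (upd x j t))).
  by apply/funext => h /=; rewrite -upd_shift scaler1.
split; first by rewrite /derivable EQ.
by rewrite /derive EQ.
Qed.

Lemma continuous_upd (x : E) j : continuous (fun t : R => upd x j t).
Proof.
have -> : (fun t => upd x j t) = (fun t : R => t *: delta_mx 0 j + upd x j 0).
  by apply/funext => t; rewrite -upd_shift addr0.
move=> t; apply: cvgD; last exact: cvg_cst.
by apply: cvgZl; exact: cvg_id.
Qed.

Lemma upd_neq0 (x : E) i j t : i != j -> x 0 i != 0 -> upd x j t != 0.
Proof.
move=> ij xi; apply/eqP => /rowP/(_ i); rewrite !mxE (negbTE ij).
exact/eqP.
Qed.

(** As i differs from j, the coordinate x_i is constant along the line, and the integrand is the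
    derivative of a function of compact support. If x_i is 0 the integrand vanishes; otherwise the
    line misses the origin, so that [g] is smooth along it. *)
Lemma line_integral_eq0 (g : E -> R) (i j : 'I_d) (x : E) : i != j -> Sm g ->
  (forall y, 2 <= dotp y y -> g y = 0) ->
  (\int[@lebesgue_measure R]_t (upd x j t 0 i * partial j g (upd x j t))%:E = 0)%E.
Proof.
move=> ij sg g2.
have E1 (t : R) : upd x j t 0 i = x 0 i by rewrite mxE (negbTE ij).
have [xi|xi] := eqVneq (x 0 i) 0.
  by apply: integral0_eq => t _; rewrite E1 xi mul0r.
have u0 (t : R) : upd x j t != 0 by exact: upd_neq0 ij xi.
have d2 (t : R) : t ^+ 2 <= dotp (upd x j t) (upd x j t).
  rewrite /dotp (bigD1 j)//= !mxE eqxx -expr2 lerDl.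
  by apply: sumr_ge0 => k _; exact: sqr_ge0.
have gt (t : R) : 2 <= `|t| -> g (upd x j t) = 0.
  move=> t2; apply: g2; apply: le_trans (d2 t); rewrite -real_normK ?num_real//.
  by nra.
have dgt (t : R) : is_derive t 1 (fun t => g (upd x j t)) (partial j g (upd x j t)).
  by apply: is_derive_upd; exact: Sm_derivable.
have dgt0 (t : R) : 2 < `|t| -> partial j g (upd x j t) = 0.
  move=> t2; rewrite -(@derive_val _ _ _ _ _ _ _ (dgt t)).
  rewrite -(@derive_cst R R R 0 t 1); apply: near_eq_derive.
  near=> s; apply: gt; apply/ltW; near: s.
  by apply: (cvgr_norm_gt t) => //; exact: cvg_id.
have E2 : (\int[@lebesgue_measure R]_t (upd x j t 0 i * partial j g (upd x j t))%:E =
   \int[@lebesgue_measure R]_(t in `[(-2)%R, 2%R]) (x 0 i * partial j g (upd x j t))%:E)%E.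
  rewrite [RHS]integral_mkcond; apply: eq_integral => t _.
  rewrite E1 patchE; case: ifPn => //.
  rewrite notin_setE /= in_itv/= -ler_norml => /negP; rewrite -ltNge => t2.
  by rewrite dgt0// mulr0.
rewrite E2.
have cpu : continuous (fun t : R => partial j g (upd x j t)).
  move=> t; apply: (@continuous_comp _ _ _ (fun t => upd x j t) (partial j g)).
    exact: continuous_upd.
  by apply: Sm_continuous => //; exact: Sm_partial.
have cgu : continuous (fun t : R => g (upd x j t)).
  move=> t; apply: (@continuous_comp _ _ _ (fun t => upd x j t) g).
    exact: continuous_upd.
  exact: Sm_continuous.
rewrite (@continuous_FTC2 _ _ (fun t => x 0 i * g (upd x j t))).
- by rewrite !gt ?mulr0 ?subee// ?normrN ger0_norm.
- by lra.
- apply: continuous_subspaceT => t; apply: cvgM; first exact: cvg_cst.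
  exact: cpu.
- have cg t : x 0 i * g (upd x j s) @[s --> t] --> x 0 i * g (upd x j t).
    by apply: cvgM; [exact: cvg_cst|exact: cgu].
  split=> [t _||]; last 2 first.
  - exact/cvg_at_right_filter/cg.
  - exact/cvg_at_left_filter/cg.
  by case: (is_deriveZ (x 0 i) (dgt t)).
- move=> t _; rewrite derive1E.
  by have [_ ->] := is_deriveZ (x 0 i) (dgt t).
Unshelve. all: by end_near. Qed.

End derivative_along_coordinate_lines.

Section rotation_fields.
Context {R : realType} {d : nat}.
Local Notation E := 'rV[R]_d.
Local Notation S := (@sphere R d).
Local Notation I := (I (@omega R d) S).

Lemma continuous_dotp : continuous (fun x : E => dotp x x).
Proof.
have H n (f : 'I_n -> E -> R) : (forall i, continuous (f i)) ->
    continuous (fun x => \sum_i f i x).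
  elim: n f => [|n IH] f cf x.
    rewrite (_ : (fun x => _) = cst 0); first exact: cst_continuous.
    by apply/funext => y; rewrite big_ord0.
  rewrite (_ : (fun x => _) = fun x => f ord0 x + \sum_i f (lift ord0 i) x); last first.
    by apply/funext => y; rewrite big_ord_recl.
  exact: (continuousD (cf ord0 x) (IH (fun i => f (lift ord0 i)) (fun i => cf _) x)).
apply: H => i x.
have c : continuous (fun x : E => x 0 i) by move=> y; exact: coord_continuous.
exact: (continuousM (c x) (c x)).
Qed.

Lemma sphere_dotp : S = [set x | dotp x x = 1].
Proof.
apply/seteqP; split=> x /=; first exact: dotp_sphere.
by move=> x1; rewrite /sphere /= /enorm x1 sqrtr1.
Qed.

Lemma compact_sphere : compact S.
Proof.
apply: bounded_closed_compact.
  exists 1; split; first exact: num_real.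
  move=> M M1 x Sx /=; rewrite /Num.norm /= mx_normrE; apply: bigmax_le => [|[k i] _ /=]; first lra.
  by rewrite ord1; apply: le_trans (ltW M1); exact: coord_sphere_le1.
rewrite sphere_dotp; apply: (@closed_comp _ _ (fun x : E => dotp x x) [set 1]).
  by move=> x _; exact: continuous_dotp.
exact: closed_eq.
Qed.

Lemma RS_bounded (f : E -> R) : RS f -> exists M, forall x, `|f x| <= M.
Proof.
move=> [sf rf].
have : bounded_set (f @` S).
  apply: compact_bounded; apply: continuous_compact; last exact: compact_sphere.
  apply: continuous_in_subspaceT => x /set_mem Sx.
  by apply: Sm_continuous sf _; exact: sphere_neq0.
move=> [M [_ HM]]; exists (`|M| + 1 + `|f 0|) => x.
have [->|x0] := eqVneq x 0; first by rewrite lerDr.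
rewrite -rf; apply: (@le_trans _ _ (`|M| + 1)); last by rewrite lerDl.
apply: (HM (`|M| + 1)); first by rewrite ltr_pwDr// ler_norm.
by exists (unitv x) => //; exact: sphere_unitv.
Qed.

Lemma RS_measurable (f : E -> R) : RS f -> measurable_fun setT f.
Proof. by case=> /Sm_measurable. Qed.

Lemma RS_L1 (f : E -> R) : RS f -> L1on (@omega R d) S f.
Proof.
move=> sf; have [M fM] := RS_bounded sf.
by apply: (@L1on_bounded _ _ _ _ _ measurable_sphere M) => //; exact: RS_measurable.
Qed.

Lemma bump_bounded (P : {poly R}) : exists2 C, 0 <= C & forall t, `|bump P t| <= C.
Proof.
have [C HC] := poly_expRN_bound P 0; exists `|C| => // t; rewrite /bump.
case: ifPn => [t0|_]; last by rewrite normr0.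
have := HC t^-1; rewrite invr_gt0 => /(_ t0); rewrite expr0 mulr1 => h.
rewrite normrM (ger0_norm (expR_ge0 _)); apply: le_trans h _; exact: ler_norm.
Qed.

Lemma cutoff'_bounded n : exists M, forall t : R, `|cutoff' n t| <= M.
Proof.
have [C C0 HC] := bump_bounded (bumpD (1 : {poly R})).
exists (n%:R * (C * 1 + 1 * C)) => t.
rewrite /cutoff' normrM normrN normr_nat; apply: ler_wpM2l => //.
apply: le_trans (ler_normD _ _) _; rewrite [X in X + _]normrM [X in _ + X]normrM.
apply: lerD; apply: ler_pM => //.
  by rewrite ger0_norm ?cutoff_ge0 ?cutoff_le1.
rewrite ger0_norm ?expR_ge0// -[leRHS]expR0 ler_expR mulNr oppr_le0.
by rewrite mulr_ge0 ?bump1_ge0.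
Qed.

Lemma cutoff'_ge2 n (t : R) : 2 <= t -> cutoff' n t = 0.
Proof.
move=> t2; rewrite /cutoff' cutoff_ge2// (bump_le0 (bumpD 1) (t := n%:R * _)).
  by rewrite !mulr0 addr0 mulr0.
by rewrite mulr_ge0_le0// subr_le0.
Qed.

Lemma Sm_cutoff n (f : E -> R) : Sm f -> Sm (fun x => cutoff n (f x)).
Proof.
move=> sf.
have s1 : Sm (fun x => 1 * expR (- n%:R * bump 1 (f x - 1))).
  apply: Sm_expR; apply: Sm_mul; first exact: Sm_cst.
  by apply: Sm_bump; apply: Sm_sub => //; exact: Sm_cst.
have s2 : Sm (fun x => bump 1 (n%:R * (2 - f x))).
  apply: Sm_bump; apply: Sm_mul; first exact: Sm_cst.
  by apply: Sm_sub => //; exact: Sm_cst.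
by apply: Sm_ext (Sm_mul s1 s2) => x _; rewrite mul1r.
Qed.

Lemma cubeC2 (x : E) : ~ cubeC 2 x -> 2 <= dotp x x.
Proof.
move=> Cx; rewrite leNgt; apply/negP => x2; apply: Cx; apply: enorm_cubeC.
rewrite -(@ler_pXn2r _ 2)// ?nnegrE ?enorm_ge0// enorm_sqr.
by apply: (le_trans (ltW x2)); lra.
Qed.

Lemma lebesgue_integrable_supp (a : E -> R) M : measurable_fun setT a ->
  (forall x, `|a x| <= M) -> (forall x, 2 <= dotp x x -> a x = 0) ->
  (lebesgue_rV d).-integrable setT (EFin \o a).
Proof.
move=> ma aM a0.
have mC : measurable (@cubeC R d 2) by exact: measurable_cubeC.
have lC : (lebesgue_rV d (@cubeC R d 2) < +oo)%E by rewrite lebesgue_cubeC// ltry.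
have -> : EFin \o a = (EFin \o a) \_ (cubeC 2).
  apply/funext => x; rewrite patchE; case: ifPn => //; rewrite notin_setE => Cx.
  by rewrite /= a0//; exact: cubeC2.
apply/integrable_restrict => //; rewrite setTI.
apply: measurable_bounded_integrable; [exact: mC|exact: lC|exact: measurable_funS ma|].
exists M; split; first exact: num_real.
by move=> y My x Dx; exact: le_trans (aM x) (ltW My).
Qed.

Section cutoff_rotation.
Variables (G : E -> R) (n : nat).
Hypothesis sG : RS G.

Let g x := cutoff n (dotp x x) * G x.

Let sg : Sm g.
Proof. by apply: Sm_mul; [apply: Sm_cutoff; exact: Sm_dotp|case: sG]. Qed.

Let partial_g j x : x != 0 -> partial j g x =
  cutoff' n (dotp x x) * (2 * x 0 j) * G x + cutoff n (dotp x x) * partial j G x.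
Proof.
move=> x0; rewrite partialM//; last 2 first.
- by apply: Sm_cutoff; exact: Sm_dotp.
- by case: sG.
rewrite (partial_comp _ (Sm_diff Sm_dotp x0) (is_derive_cutoff n _)).
by rewrite partial_dotp.
Qed.

Lemma integrable_coord_partial_cutoff i j :
  (lebesgue_rV d).-integrable setT (EFin \o (fun x : E => x 0 i * partial j g x)).
Proof.
have [M1 HM1] := cutoff'_bounded n.
have [M2 HM2] := RS_bounded sG.
have [M3 HM3] := RS_bounded (RS_Dr j sG).
have a0 x : 2 <= dotp x x -> x 0 i * partial j g x = 0.
  move=> x2; have x0 : x != 0.
    apply: contraTneq x2 => ->; rewrite -ltNge -enorm_sqr enorm0 expr0n /=; lra.
  by rewrite partial_g// cutoff'_ge2// cutoff_ge2// !mul0r addr0 mulr0.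
apply: (@lebesgue_integrable_supp _ (2 * (M1 * (2 * 2) * M2) + M3)) => //.
  apply: measurable_funM; first exact: measurable_rV_coord.
  exact: Sm_measurable (Sm_partial j sg).
have C0 (c M : R) : `|c| <= M -> 0 <= M by apply: le_trans.
have M30 := C0 _ _ (HM3 0); have M20 := C0 _ _ (HM2 0); have M10 := C0 _ _ (HM1 0).
move=> x; have [x2|x2] := leP 2 (dotp x x).
  by rewrite a0// normr0 addr_ge0// !mulr_ge0.
have ex2 : enorm x <= 2.
  rewrite -(@ler_pXn2r _ 2)// ?nnegrE ?enorm_ge0// enorm_sqr.
  by apply: (le_trans (ltW x2)); lra.
have [->|x0] := eqVneq x 0.
  by rewrite mxE mul0r normr0 addr_ge0// !mulr_ge0.
have cx k : `|x 0 k| <= 2 by apply: le_trans ex2; exact: coord_le_enorm.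
rewrite partial_g// mulrDr; apply: le_trans (ler_normD _ _) _; apply: lerD.
  rewrite normrM [X in _ * X]normrM [X in _ * (X * _)]normrM.
  apply: ler_pM => //; apply: ler_pM => //; try exact: mulr_ge0.
  by apply: ler_pM => //; rewrite normrM ger0_norm// ler_wpM2l.
(* The partial derivative of [G] is homogeneous of degree -1 and so may be unbounded at the origin;
   the factor x_i makes up for it. *)
have -> : x 0 i * (cutoff n (dotp x x) * partial j G x) =
   cutoff n (dotp x x) * (xh i x * Dr j G x).
  rewrite xhE /Dr; have := enorm_gt0 x0; move: (enorm x) => e e0; field.
  by rewrite gt_eqF.
rewrite normrM -[leRHS]mul1r; apply: ler_pM => //.
  by rewrite ger0_norm ?cutoff_ge0 ?cutoff_le1.
rewrite normrM -[leRHS]mul1r; apply: ler_pM => //.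
by apply: coord_sphere_le1; exact: sphere_unitv.
Qed.

(** The field x_i d/dx_j - x_j d/dx_i annihilates functions of |x|^2, so it acts on [G] alone, and
    each of its two terms integrates to 0 along coordinate lines. *)
Lemma cutoff_rotation_eq0 i j : i != j -> (\int[lebesgue_rV d]_x
  (cutoff n (dotp x x) * (xh i x * Dr j G x - xh j x * Dr i G x))%:E = 0)%E.
Proof.
move=> ij.
have E0 i' j' : i' != j' ->
    (\int[lebesgue_rV d]_x (x 0 i' * partial j' g x)%:E = 0)%E.
  move=> ij'; apply: (@lebesgue_rV_lines _ _ j' (fun x : E => x 0 i' * partial j' g x));
    first exact: integrable_coord_partial_cutoff.
  move=> x.
  apply: (line_integral_eq0 x ij' sg) => y y2.
  by rewrite /g cutoff_ge2// mul0r.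
rewrite (eq_integral (fun x : E => (x 0 i * partial j g x)%:E - (x 0 j * partial i g x)%:E)%E).
  have := integralB_EFin measurableT (integrable_coord_partial_cutoff i j)
    (integrable_coord_partial_cutoff j i).
  by move=> /= ->; rewrite !E0 ?sube0// eq_sym.
move=> x _; rewrite -EFinB; congr EFin.
have [->|x0] := eqVneq x 0; first by rewrite !xhE !mxE !mulr0 !mul0r !subr0 mulr0.
rewrite !partial_g// !xhE /Dr.
have := enorm_gt0 x0; move: (enorm x) => e e0; field.
by rewrite gt_eqF.
Qed.

End cutoff_rotation.

(** Infinitesimally, the surface measure is invariant under rotations. The cutoffs lead from
    integrals over R^d to the integral over the unit ball, and polar coordinates lead from there to
    the sphere. *)
Lemma I_rotation i j (G : E -> R) : i != j -> RS G ->
  I (fun x => xh i x * Dr j G x - xh j x * Dr i G x) = 0.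
Proof.
move=> ij sG; set h := fun x => _.
have sh : RS h.
  by apply: RS_sub; apply: RS_mul; (exact: RS_xh || exact: RS_Dr).
have [M hM] := RS_bounded sh.
have M0 : 0 <= M by apply: le_trans (hM 0).
have mh := RS_measurable sh.
apply: (@integral_omega_eq0 _ _ _ M) => //; first by case: sh.
have mC : measurable (@cubeC R d 2) by exact: measurable_cubeC.
have lC : (lebesgue_rV d (@cubeC R d 2) < +oo)%E by rewrite lebesgue_cubeC// ltry.
have mP := @measurable_pball R d.
pose b := (EFin \o cst M) \_ (@cubeC R d 2).
have ib : (lebesgue_rV d).-integrable setT b.
  apply/integrable_restrict => //; rewrite setTI.
  apply: measurable_bounded_integrable => //.
  exists M; split; first exact: num_real.
  by move=> y My x Dx /=; rewrite ger0_norm// ltW.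
(* The punctured ball omits the origin, where the cutoffs tend to 1; the limit is right there
   because [h] vanishes. *)
have h00 : h 0 = 0 by rewrite /h !xhE !mxE !mulr0 !mul0r subr0.
have mc n : measurable_fun setT (fun x : E => (cutoff n (dotp x x) * h x)%:E).
  apply/measurable_EFinP; apply: measurable_funM => //.
  by apply: Sm_measurable; apply: Sm_cutoff; exact: Sm_dotp.
have := @dominated_cvg _ _ _ (lebesgue_rV d) setT measurableT
  (fun n x => (cutoff n (dotp x x) * h x)%:E)
  ((EFin \o h) \_ (@pball R d)) b mc.
have -> : (fun n => \int[lebesgue_rV d]_x (cutoff n (dotp x x) * h x)%:E)%E = cst 0%E.
  by apply/funext => n; rewrite cutoff_rotation_eq0.
rewrite [in X in _ -> X]integral_mkcond => H.
suff Z : (cst 0%E : nat -> \bar R) @ \oo -->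
    (\int[lebesgue_rV d]_x ((EFin \o h) \_ (@pball R d)) x)%E.
  by rewrite -(cvg_lim (@ereal_hausdorff R) Z) lim_cst//; exact: ereal_hausdorff.
apply: H => //.
- move=> x _; rewrite patchE; case: ifPn => [|]; rewrite ?inE ?notin_setE => xP.
    rewrite /= -[in X in _ --> X](mul1r (h x)); apply: cvg_EFin.
      by near=> n.
    apply: cvgM; last exact: cvg_cst.
    have -> : (1 : R) = (dotp x x <= 1)%R%:R.
      move: xP => /andP[_ x1]; rewrite -enorm_sqr.
      by rewrite (_ : _ <= 1)// expr_le1// enorm_ge0.
    exact: cutoff_cvg.
  have [->|x0] := eqVneq x 0.
    by under eq_fun do rewrite h00 mulr0; exact: cvg_cst.
  rewrite (_ : point = (0 * h x)%:E); last by rewrite mul0r.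
  apply: cvg_EFin; first by near=> n.
  apply: cvgM; last exact: cvg_cst.
  have -> : (0 : R) = (dotp x x <= 1)%R%:R.
    rewrite (_ : _ <= 1 = false)//; apply/negbTE; apply: contra_notN xP => x1.
    rewrite /pball /= enorm_gt0//= -(@ler_pXn2r _ 2)// ?nnegrE ?enorm_ge0//.
    by rewrite enorm_sqr expr1n.
  exact: cutoff_cvg.
- by move=> x _; rewrite /b patchE; case: ifP.
- move=> n x _; rewrite /b patchE; case: ifPn => xC.
    rewrite lee_fin normrM -[leRHS]mul1r; apply: ler_pM => //.
    by rewrite ger0_norm ?cutoff_ge0 ?cutoff_le1.
  have x2 : 2 <= dotp x x by apply: cubeC2; move: xC; rewrite notin_setE.
  rewrite (_ : point = 0%:E :> \bar R)// cutoff_ge2// mul0r.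
  by rewrite lee_fin normr0.
Unshelve. all: by end_near. Qed.

End rotation_fields.

Section divergence_theorem.
Context {R : realType} {d : nat}.
Local Notation E := 'rV[R]_d.
Local Notation S := (@sphere R d).
Local Notation I := (I (@omega R d) S).

(** The divergence of [V] is the sum over i and j of the rotation derivatives x_i D_j - x_j D_i of
    x_i V_j. The x_i^2 add up to 1, and the remaining terms cancel by tangency and Euler's
    relation. *)
Lemma I_Dr_tangent (V : 'I_d -> E -> R) : (forall i, RS (V i)) ->
  (forall x, x != 0 -> \sum_i xh i x * V i x = 0) ->
  I (fun x => \sum_i Dr i (V i) x) = 0.
Proof.
move=> sV tV; have mS := @measurable_sphere R d.
pose h i j x := xh i x * Dr j (fun x => xh i x * V j x) x
  - xh j x * Dr i (fun x => xh i x * V j x) x.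
have sh i j : RS (h i j).
  by apply: RS_sub; apply: RS_mul; do ?exact: RS_xh; apply: RS_Dr; apply: RS_mul => //;
    exact: RS_xh.
have h0 i j : I (h i j) = 0.
  have [->|ij] := eqVneq i j.
    by rewrite (_ : h j j = fun=> 0) ?I_0//; apply/funext => x; rewrite /h subrr.
  by apply: I_rotation => //; apply: RS_mul => //; exact: RS_xh.
have E1 x : S x -> \sum_i Dr i (V i) x = \sum_i \sum_j h i j x.
  move=> Sx; have x0 := sphere_neq0 Sx.
  have sxV i j : Sm (fun x => xh i x * V j x).
    by apply: Sm_mul; apply: proj1; [exact: RS_xh|exact: sV].
  have dxV i j k : Dr k (fun x => xh i x * V j x) x =
      ((k == i)%:R - xh k x * xh i x) * V j x + xh i x * Dr k (V j) x.
    by rewrite DrM ?Dr_xh//; apply: proj1; [exact: RS_xh|exact: sV].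
  have T1 : \sum_i \sum_j xh i x * Dr j (fun x => xh i x * V j x) x =
      \sum_j Dr j (V j) x.
    rewrite exchange_big /=; apply: eq_bigr => j _.
    under eq_bigr => i _.
      rewrite dxV.
      rewrite (_ : _ * _ = (j == i)%:R * (xh i x * V j x) + (Dr j (V j) x - xh j x * V j x) * xh
        i x ^+ 2); last by ring.
      over.
    rewrite big_split /= -mulr_sumr sum_xh_sqr// mulr1.
    rewrite (bigD1 j)//= eqxx mul1r big1 ?addr0 => [|i ij]; first by ring.
    by rewrite eq_sym (negbTE ij) mul0r.
  have T2 : \sum_i \sum_j xh j x * Dr i (fun x => xh i x * V j x) x = 0.
    have AUX (a b c e : R) : a * ((1 - b * b) * c + b * e) = (1 - b * b) * (a * c) + a * (b * e)
      by ring.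
    under eq_bigr => i _.
      under eq_bigr => j _.
        rewrite dxV eqxx mulr1n.
        rewrite AUX.
        over.
      rewrite big_split /= -mulr_sumr tV// mulr0 add0r.
      over.
    rewrite exchange_big /= big1// => j _.
    by rewrite -mulr_sumr Euler_radial// mulr0.
  symmetry; rewrite /h; under eq_bigr => i _ do rewrite sumrB.
  by rewrite sumrB T1 T2 subr0.
rewrite (eq_I _ E1) I_sum//; last first.
  by move=> i; apply: L1on_sum => // j; exact: RS_L1.
by apply: big1 => i _; rewrite I_sum// ?big1// => j; exact: RS_L1.
Qed.

End divergence_theorem.

Section sphere_integrals.
Context {R : realType} {d : nat}.
Local Notation E := 'rV[R]_d.
Local Notation S := (@sphere R d).
Local Notation mu := (@omega R d).
Local Notation mS := (@measurable_sphere R d).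
Implicit Types (f g h : E -> R) (F G : E * E -> R) (K L : E -> E -> R) (x y : E).

(* Restating the integration lemmas for the sphere spares the unifier from
   unfolding the structures on [omega]. *)
Definition L1S f := L1on mu S f.
Definition L2S f := L2on mu S f.
Definition IS f : R := I mu S f.
Definition PL1S F := PL1 mu S F.
Definition schurS K := schur mu S K.
Definition OpS K f x : R := IS (fun y => K x y * f y).

Lemma ISE f : IS f = \int[mu]_(x in S) f x. Proof. by []. Qed.
Lemma L1S_meas f : L1S f -> measurable_fun setT f. Proof. exact: L1on_meas. Qed.
Lemma L1S_bounded M f : measurable_fun setT f -> (forall x, S x -> `|f x| <= M) -> L1S f.
Proof. exact: (@L1on_bounded _ _ _ _ _ mS M). Qed.
Lemma L1S_le f g : measurable_fun setT f -> L1S g ->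
  (forall x, S x -> `|f x| <= `|g x|) -> L1S f.
Proof. exact: (L1on_le mS). Qed.
Lemma L1S_RS f : RS f -> L1S f. Proof. exact: RS_L1. Qed.
Lemma L1S_D f g : L1S f -> L1S g -> L1S (fun x => f x + g x).
Proof. exact: (L1onD mS). Qed.
Lemma L1S_Z r f : L1S f -> L1S (fun x => r * f x). Proof. exact: (L1onZ mS). Qed.
Lemma L1S_B f g : L1S f -> L1S g -> L1S (fun x => f x - g x).
Proof. exact: (L1onB mS). Qed.
Lemma L1S_sum n (f : 'I_n -> E -> R) : (forall i, L1S (f i)) -> L1S (fun x => \sum_i f i x).
Proof. exact: (L1on_sum mS). Qed.
Lemma L1S_mul_bounded M f g : measurable_fun setT f -> (forall x, S x -> `|f x| <= M) ->
  L1S g -> L1S (fun x => f x * g x).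
Proof. exact: (L1on_mul_bounded mS). Qed.
Lemma L1S_norm f : L1S f -> L1S (fun x => `|f x|). Proof. exact: L1on_norm. Qed.
Lemma L1S_cst r : L1S (fun=> r). Proof. exact: (@L1on_cst _ _ _ _ _ mS r). Qed.
Lemma IS_add f g : L1S f -> L1S g -> IS (fun x => f x + g x) = IS f + IS g.
Proof. exact: (I_add mS). Qed.
Lemma IS_sub f g : L1S f -> L1S g -> IS (fun x => f x - g x) = IS f - IS g.
Proof. exact: (I_sub mS). Qed.
Lemma IS_scale r f : L1S f -> IS (fun x => r * f x) = r * IS f.
Proof. exact: (I_scale mS). Qed.
Lemma IS_opp f : L1S f -> IS (fun x => - f x) = - IS f. Proof. exact: (I_opp mS). Qed.
Lemma eq_IS f g : (forall x, S x -> f x = g x) -> IS f = IS g. Proof. exact: eq_I. Qed.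
Lemma IS_eq0 f : (forall x, S x -> f x = 0) -> IS f = 0. Proof. exact: (I_eq0 _ mS). Qed.
Lemma IS_sum n (f : 'I_n -> E -> R) : (forall i, L1S (f i)) ->
  IS (fun x => \sum_i f i x) = \sum_i IS (f i).
Proof. exact: (I_sum mS). Qed.
Lemma IS_le f g : L1S f -> L1S g -> (forall x, S x -> f x <= g x) -> IS f <= IS g.
Proof. exact: (I_le mS). Qed.
Lemma IS_ge0 f : (forall x, S x -> 0 <= f x) -> 0 <= IS f. Proof. exact: I_ge0. Qed.
Lemma IS_norm_le f g : L1S f -> L1S g -> (forall x, S x -> `|f x| <= g x) ->
  `|IS f| <= IS g.
Proof. exact: (I_norm_le mS). Qed.
Lemma IS_ae_eq f g : L1S f -> L1S g -> {ae mu, forall x, S x -> f x = g x} -> IS f = IS g.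
Proof. exact: (I_ae_eq mS). Qed.
Lemma IS_nneg_eq0 f : L1S f -> (forall x, S x -> 0 <= f x) -> IS f = 0 ->
  {ae mu, forall x, S x -> f x = 0}.
Proof. exact: (I_nneg_eq0 mS). Qed.
Lemma IS_dominated_ae (f_ : nat -> E -> R) f g :
  (forall n, measurable_fun setT (f_ n)) -> measurable_fun setT f -> L1S g ->
  {ae mu, forall x, S x -> (f_ n x @[n --> \oo] --> f x)} ->
  (forall n x, S x -> `|f_ n x| <= g x) -> IS (f_ n) @[n --> \oo] --> IS f.
Proof. exact: (I_dominated_ae mS). Qed.
Lemma IS_dominated (f_ : nat -> E -> R) f g :
  (forall n, measurable_fun setT (f_ n)) -> measurable_fun setT f -> L1S g ->
  (forall x, S x -> (f_ n x @[n --> \oo] --> f x)) ->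
  (forall n x, S x -> `|f_ n x| <= g x) -> IS (f_ n) @[n --> \oo] --> IS f.
Proof. exact: (I_dominated mS). Qed.

Lemma L2S_meas f : L2S f -> measurable_fun setT f. Proof. exact: L2on_meas. Qed.
Lemma L2S_sqr f : L2S f -> L1S (fun x => f x ^+ 2). Proof. exact: L2on_sqr. Qed.
Lemma L2S_bounded M f : measurable_fun setT f -> (forall x, S x -> `|f x| <= M) -> L2S f.
Proof. exact: (@L2on_bounded _ _ _ _ _ mS M). Qed.
Lemma L2S_mul f g : L2S f -> L2S g -> L1S (fun x => f x * g x).
Proof. exact: (L2on_mul mS). Qed.
Lemma L2S_cst r : L2S (fun=> r). Proof. exact: (@L2on_cst _ _ _ _ _ mS r). Qed.
Lemma L2S_L1S f : L2S f -> L1S f. Proof. exact: (L2on_L1on mS). Qed.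
Lemma L2S_D f g : L2S f -> L2S g -> L2S (fun x => f x + g x). Proof. exact: (L2onD mS). Qed.
Lemma L2S_Z r f : L2S f -> L2S (fun x => r * f x). Proof. exact: (L2onZ mS). Qed.
Lemma L2S_B f g : L2S f -> L2S g -> L2S (fun x => f x - g x). Proof. exact: (L2onB mS). Qed.
Lemma L2S_RS f : RS f -> L2S f.
Proof.
move=> sf; have [M fM] := RS_bounded sf.
by apply: (@L2S_bounded M) => //; exact: RS_measurable.
Qed.
Lemma L2S_mul_bounded M f g : measurable_fun setT f -> (forall x, S x -> `|f x| <= M) ->
  L2S g -> L2S (fun x => f x * g x).
Proof. exact: (L2on_mul_bounded mS). Qed.
Lemma IS_Cauchy_Schwarz f g : L2S f -> L2S g ->
  IS (fun x => f x * g x) ^+ 2 <= IS (fun x => f x ^+ 2) * IS (fun x => g x ^+ 2).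
Proof. exact: (I_Cauchy_Schwarz mS). Qed.

Lemma PL1S_fubini F : PL1S F ->
  IS (fun x => IS (fun y => F (x, y))) = IS (fun y => IS (fun x => F (x, y))).
Proof. exact: (PL1_fubini mS). Qed.
Lemma PL1S_ae F : PL1S F -> {ae mu, forall x, S x -> L1S (fun y => F (x, y))}.
Proof. exact: (PL1_ae mS). Qed.
Lemma PL1S_bounded_kernel M K f g : measurable_fun setT (fun z => K z.1 z.2) ->
  (forall x y, S x -> S y -> `|K x y| <= M) -> L1S f -> L1S g ->
  PL1S (fun z => f z.1 * K z.1 z.2 * g z.2).
Proof. exact: (PL1_bounded_kernel mS). Qed.
Lemma schurS_bounded M K : measurable_fun setT (fun z => K z.1 z.2) ->
  (forall x y, S x -> S y -> K x y = K y x) ->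
  (forall x y, S x -> S y -> `|K x y| <= M) -> schurS K.
Proof. exact: (@schur_bounded _ _ _ _ _ mS M). Qed.
Lemma PL1S_schur K f g : schurS K -> L2S f -> L2S g ->
  PL1S (fun z => f z.1 * K z.1 z.2 * g z.2).
Proof. exact: (PL1_schur mS). Qed.
Lemma OpS_meas K f : measurable_fun setT (fun z => K z.1 z.2) ->
  measurable_fun setT f -> measurable_fun setT (OpS K f).
Proof. exact: (Op_meas _ mS). Qed.
Lemma L1S_le_ae f g : measurable_fun setT f -> L1S g ->
  {ae mu, forall x, S x -> `|f x| <= g x} -> L1S f.
Proof. exact: (L1on_le_ae mS). Qed.
Lemma OpS_L2 K f : schurS K -> L2S f -> L2S (OpS K f). Proof. exact: (Op_L2 mS). Qed.
Lemma OpS_L2_le K f C : schurS K -> (forall x, S x -> IS (fun y => `|K x y|) <= C) ->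
  L2S f -> IS (fun x => OpS K f x ^+ 2) <= C ^+ 2 * IS (fun x => f x ^+ 2).
Proof. exact: (Op_L2_le mS). Qed.
Lemma OpS_sym K f g : schurS K -> L2S f -> L2S g ->
  IS (fun x => f x * OpS K g x) = IS (fun x => OpS K f x * g x).
Proof. exact: (Op_sym mS). Qed.
Lemma OpS_comp_bounded K L M x f : S x -> L1S (K x) ->
  measurable_fun setT (fun z => L z.1 z.2) ->
  (forall y z, S y -> S z -> `|L y z| <= M) -> L1S f ->
  IS (fun y => K x y * OpS L f y) = IS (fun z => IS (fun y => K x y * L y z) * f z).
Proof. exact: (Op_comp_bounded mS). Qed.
Lemma OpS_bounded_comp K L M x f : S x -> measurable_fun setT (fun z => K z.1 z.2) ->
  (forall y z, S y -> S z -> `|K y z| <= M) -> schurS L -> L2S f ->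
  IS (fun y => K x y * OpS L f y) = IS (fun z => IS (fun y => K x y * L y z) * f z).
Proof. exact: (Op_bounded_comp mS). Qed.
Lemma OpS_add_ae K f g : schurS K -> L2S f -> L2S g ->
  {ae mu, forall x, S x -> OpS K (fun y => f y + g y) x = OpS K f x + OpS K g x}.
Proof. exact: (Op_add_ae mS). Qed.
Lemma OpS_scale_ae K r f : schurS K -> L2S f ->
  {ae mu, forall x, S x -> OpS K (fun y => r * f y) x = r * OpS K f x}.
Proof. exact: (Op_scale_ae mS). Qed.
Lemma IS_fatou_ae (h_ : nat -> E -> R) h M : (forall n, L1S (h_ n)) ->
  (forall n x, S x -> 0 <= h_ n x) -> measurable_fun setT h ->
  (forall x, S x -> 0 <= h x) ->
  {ae mu, forall x, S x -> (h_ n x @[n --> \oo] --> h x)} ->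
  (forall n, IS (h_ n) <= M) -> L1S h /\ IS h <= M.
Proof. exact: (I_fatou_ae mS). Qed.
Lemma L2S_fast_Cauchy_cvg (f_ : nat -> E -> R) : (forall n, L2S (f_ n)) ->
  (forall n m, (n <= m)%N -> IS (fun x => (f_ m x - f_ n x) ^+ 2) <= 4^-1 ^+ n) ->
  exists f, L2S f /\ forall n, IS (fun x => (f_ n x - f x) ^+ 2) <= 4^-1 ^+ n.
Proof. exact: (L2_fast_Cauchy_cvg mS). Qed.
Lemma is_derive_IS (f df : R -> E -> R) (G : E -> R) (u v a : R) :
  u < a < v -> (forall s, u < s < v -> L1S (f s)) ->
  (forall s x, u < s < v -> S x -> is_derive s 1 (f ^~ x) (df s x)) ->
  L1S G -> (forall s x, u < s < v -> S x -> `|df s x| <= G x) ->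
  is_derive a 1 (fun s => IS (f s)) (IS (df a)).
Proof. exact: (is_derive_I mS). Qed.
Lemma IS_Dr_tangent (V : 'I_d -> E -> R) : (forall i, RS (V i)) ->
  (forall x, x != 0 -> \sum_i xh i x * V i x = 0) ->
  IS (fun x => \sum_i Dr i (V i) x) = 0.
Proof. exact: I_Dr_tangent. Qed.

End sphere_integrals.

(** * The Laplacian on the sphere *)

Section spherical_laplacian.
Context {R : realType} {d : nat}.
Local Notation E := 'rV[R]_d.
Local Notation S := (@sphere R d).
Implicit Types (f u v : E -> R) (x y : E).

Lemma RS_Sm f : RS f -> Sm f. Proof. by case. Qed.

(** The Laplace-Beltrami operator, as the sum of the squares of the tangential derivatives in
    ambient coordinates. *)
Definition lap f x : R := \sum_i Dr i (Dr i f) x.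

Definition gradp u v x : R := \sum_i Dr i u x * Dr i v x.

Lemma RS_lap f : RS f -> RS (lap f).
Proof. by move=> sf; apply: RS_sum => i; do 2 apply: RS_Dr. Qed.

Lemma RS_gradp u v : RS u -> RS v -> RS (gradp u v).
Proof. by move=> su sv; apply: RS_sum => i; apply: RS_mul; apply: RS_Dr. Qed.

Lemma gradpC u v x : gradp u v x = gradp v u x.
Proof. by apply: eq_bigr => i _; rewrite mulrC. Qed.

(** The divergence theorem for u grad v, which is tangent by Euler's relation. *)
Lemma Green1 u v : RS u -> RS v -> IS (fun x => u x * lap v x) = - IS (gradp u v).
Proof.
move=> su sv.
have sV i : RS (fun x => u x * Dr i v x) by apply: RS_mul => //; exact: RS_Dr.
have tV x : x != 0 -> \sum_i xh i x * (u x * Dr i v x) = 0.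
  move=> x0; under eq_bigr => i _ do rewrite mulrCA.
  by rewrite -mulr_sumr Euler_radial// mulr0.
have := IS_Dr_tangent sV tV.
rewrite (eq_IS (g := fun x => gradp u v x + u x * lap v x)).
  rewrite (IS_add (L1S_RS (RS_gradp su sv)) (L1S_RS (RS_mul su (RS_lap sv)))).
  by move/eqP; rewrite addrC addr_eq0 => /eqP.
move=> x /sphere_neq0 x0; rewrite mulr_sumr -big_split; apply: eq_bigr => i _.
by rewrite DrM//; apply: RS_Sm => //; exact: RS_Dr.
Qed.

Lemma Green2 u v : RS u -> RS v ->
  IS (fun x => u x * lap v x) = IS (fun x => lap u x * v x).
Proof.
move=> su sv; rewrite Green1// -(eq_IS (f := gradp v u)) => [|x _]; last exact: gradpC.
by rewrite -Green1//; apply: eq_IS => x _; rewrite mulrC.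
Qed.

Lemma lap_cst c x : lap (fun=> c) x = 0.
Proof.
apply: big1 => i _; rewrite (_ : Dr i (fun=> c) = fun=> 0) ?Dr_cst//.
by apply/funext => z; rewrite Dr_cst.
Qed.

Lemma IS_lap u : RS u -> IS (lap u) = 0.
Proof.
move=> su; have := Green2 (RS_cst 1) su.
rewrite (eq_IS (g := lap u)) => [->|x _]; last by rewrite mul1r.
by apply: IS_eq0 => x _; rewrite lap_cst mul0r.
Qed.

Definition td y x : R := dotp (unitv x) y.

Lemma tdE y x : S x -> td y x = dotp x y.
Proof. by move=> Sx; rewrite /td unitv_id. Qed.

Lemma RS_td y : RS (td y).
Proof. by apply: RS_sum => i; apply: RS_mul; [exact: RS_xh|exact: RS_cst]. Qed.

Lemma td_bound y x : S y -> x != 0 -> -1 <= td y x <= 1.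
Proof.
move=> Sy x0; have Sx := sphere_unitv x0.
by rewrite dotp_geN1// dotp_le1.
Qed.

Lemma Dr_td i y x : x != 0 -> Dr i (td y) x = y 0 i - td y x * xh i x.
Proof.
move=> x0; rewrite /td /dotp (Dr_sum (f := fun j x => unitv x 0 j * y 0 j))//; last first.
  by move=> j; apply: Sm_mul; [apply: RS_Sm; exact: RS_xh|exact: Sm_cst].
rewrite mulr_suml (eq_bigr (fun j => (i == j)%:R * y 0 j - unitv x 0 j * y 0 j * xh i x)).
  rewrite sumrB (bigD1 i)//= eqxx mul1r big1 ?addr0// => j ji.
  by rewrite eq_sym (negbTE ji) mul0r.
move=> j _; rewrite DrM//; [|by apply: RS_Sm; exact: RS_xh|exact: Sm_cst].
by rewrite Dr_cst mulr0 addr0 Dr_xh// /xh; ring.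
Qed.

Section zonal.
Variables (y : E) (k k1 k2 : R -> R).
Hypotheses (Sy : S y) (sk : Sm (fun x => k (td y x)))
  (sk1 : Sm (fun x => k1 (td y x)))
  (dk : forall t : R, -1 <= t <= 1 -> is_derive t 1 k (k1 t))
  (dk1 : forall t : R, -1 <= t <= 1 -> is_derive t 1 k1 (k2 t)).

Lemma RS_zonal : RS (fun x => k (td y x)).
Proof. by split=> // x; rewrite /td unitvK. Qed.

Lemma Dr_zonal i x : x != 0 ->
  Dr i (fun x => k (td y x)) x = k1 (td y x) * (y 0 i - td y x * xh i x).
Proof.
move=> x0; rewrite (Dr_comp (k := k) i (RS_Sm (RS_td y)) x0 (dk (td_bound Sy x0))).
by rewrite Dr_td.
Qed.

(** The Gegenbauer operator in t = x . y: the gradient of t has squared length 1 - t^2, and its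
    Laplacian is - (d - 1) t. *)
Lemma lap_zonal x : x != 0 -> lap (fun x => k (td y x)) x =
  (1 - td y x ^+ 2) * k2 (td y x) - (d%:R - 1) * td y x * k1 (td y x).
Proof.
move=> x0; have sx i : Sm (@xh R d i) by apply: RS_Sm; exact: RS_xh.
have std := RS_Sm (RS_td y).
rewrite /lap; under eq_bigr => i _.
  rewrite (Dr_ext i (g := fun x => k1 (td y x) * (y 0 i + (- td y x) * xh i x)))//; last first.
    by move=> z z0; rewrite Dr_zonal// mulNr.
  rewrite DrM//; last by apply: Sm_add; [exact: Sm_cst|apply: Sm_mul => //; exact: Sm_opp].
  rewrite (Dr_comp (k := k1) i std x0 (dk1 (td_bound Sy x0))).
  rewrite DrD//; [|exact: Sm_cst|by apply: Sm_mul => //; exact: Sm_opp].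
  rewrite Dr_cst DrM//; last exact: Sm_opp.
  rewrite Dr_xh// eqxx (Dr_comp (k := fun t => - t) i std x0 (is_deriveN (is_derive_id _ _))).
  rewrite Dr_td// add0r.
  rewrite (_ : _ + _ = k2 (td y x) * y 0 i ^+ 2 - (2 * td y x * k2 (td y x) + k1 (td y x)) *
    (unitv x 0 i * y 0 i) + (k2 (td y x) * td y x ^+ 2 + 2 * td y x * k1 (td y x)) * xh i x ^+ 2
    - td y x * k1 (td y x)); last first.
    by rewrite /xh mulr1n; ring.
  over.
rewrite !(big_split, sumrN) /= -!mulr_sumr sum_xh_sqr// sumr_const card_ord -/(td y x).
have -> : \sum_i y 0 i ^+ 2 = 1 by rewrite -(dotp_sphere Sy).
by rewrite -/(dotp _ _) -/(td y x) -mulr_natl; ring.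
Qed.

End zonal.

End spherical_laplacian.

(** * Newtonian and Poisson kernels *)

Section generating_function.
Context {R : realType}.
Implicit Types (r t s : R) (n : nat).

(* For [x] and [y] on the sphere and [t = x . y], [qs r t] is [|r x - y|^2], so
   that [kk] and [pk] below are the Newtonian and Poisson kernels. *)
Definition qs r t : R := 1 - 2 * r * t + r ^+ 2.

Definition qk r t : R := (Num.sqrt (qs r t))^-1.

Lemma qs_ge r t : -1 <= t <= 1 -> (1 - `|r|) ^+ 2 <= qs r t.
Proof.
move=> t1; have -> : (1 - `|r|) ^+ 2 = 1 - 2 * `|r| + r ^+ 2.
  by rewrite -[r ^+ 2]real_normK ?num_real//; ring.
rewrite /qs lerD2r lerD2l lerN2 -mulrA ler_pM2l ?ltr0n//.
apply: le_trans (ler_norm _) _; rewrite normrM -[leRHS]mulr1.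
by rewrite ler_wpM2l// ler_norml.
Qed.

Lemma qs_gt0 r t : `|r| < 1 -> -1 <= t <= 1 -> 0 < qs r t.
Proof. by move=> r1 t1; apply: lt_le_trans (qs_ge r t1); rewrite exprn_gt0// subr_gt0. Qed.

Lemma qk_ge0 r t : 0 <= qk r t.
Proof. by rewrite invr_ge0 sqrtr_ge0. Qed.

Lemma qk_sqr r t : 0 < qs r t -> qk r t ^+ 2 * qs r t = 1.
Proof.
by move=> q0; rewrite /qk exprVn sqr_sqrtr ?ltW// mulVf// gt_eqF.
Qed.

Lemma qk_le r t : `|r| < 1 -> -1 <= t <= 1 -> qk r t <= (1 - `|r|)^-1.
Proof.
move=> r1 t1; have r0 : 0 < 1 - `|r| by rewrite subr_gt0.
rewrite /qk lef_pV2 ?posrE// ?sqrtr_gt0 ?qs_gt0//.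
have -> : 1 - `|r| = Num.sqrt ((1 - `|r|) ^+ 2) by rewrite sqrtr_sqr [RHS]ger0_norm ?(ltW r0).
by rewrite ler_wsqrtr// qs_ge.
Qed.

Lemma qk_exp_bound n r t : `|r| < 1 -> -1 <= t <= 1 ->
  `|qk r t ^+ n| <= (1 - `|r|)^-1 ^+ n.
Proof.
move=> r1 t1; rewrite ger0_norm ?exprn_ge0 ?qk_ge0//.
by apply: lerXn2r; rewrite ?nnegrE ?qk_ge0 ?qk_le// invr_ge0 subr_ge0 ltW.
Qed.

Lemma qk0 t : qk 0 t = 1.
Proof. by rewrite /qk /qs mulr0 mul0r subr0 expr0n addr0 sqrtr1 invr1. Qed.

Lemma is_derive_sqr r : is_derive r 1 (fun r => r ^+ 2) (2 * r).
Proof.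
have := is_deriveM (is_derive_id r 1) (is_derive_id r 1).
rewrite (_ : id * id = fun r => r ^+ 2); last by apply/funext => s; rewrite expr2.
by move/is_derive_eq; apply; rewrite /GRing.scale /= mulr1; ring.
Qed.

Lemma is_derive_qk_t n r t : 0 < qs r t ->
  is_derive t 1 (fun t => qk r t ^+ n) (n%:R * r * qk r t ^+ n.+2).
Proof.
move=> q0.
have dq : is_derive t 1 (qs r) (- (2 * r)).
  have d1 : is_derive t 1 (fun t => 2 * r * t) (2 * r).
    by apply: (is_derive_eq (is_deriveZ (2 * r) (is_derive_id t 1))); rewrite /GRing.scale /= mulr1.
  have d2 := is_deriveD (is_deriveB (is_derive_cst (1 : R) t 1) d1) (is_derive_cst (r ^+ 2) t 1).
  by apply: (is_derive_eq d2); rewrite sub0r addr0.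
apply: (is_derive_eq (is_derive1_comp (is_derive_sqrtV n q0) dq)).
by rewrite /GRing.scale /= -/(qk r t); field.
Qed.

Lemma is_derive_qk_r n r t : 0 < qs r t ->
  is_derive r 1 (fun r => qk r t ^+ n) (n%:R * (t - r) * qk r t ^+ n.+2).
Proof.
move=> q0.
have dq : is_derive r 1 (qs ^~ t) (2 * (r - t)).
  have d1 : is_derive r 1 (fun r => (2 * t) * r) (2 * t).
    by apply: (is_derive_eq (is_deriveZ (2 * t) (is_derive_id r 1))); rewrite /GRing.scale /= mulr1.
  have d3 : is_derive r 1 (fun r => r ^+ 2) (2 * r).
    exact: is_derive_sqr.
  have d2 := is_deriveD (is_deriveB (is_derive_cst (1 : R) r 1) d1) d3.
  rewrite (_ : qs ^~ t = (cst 1 - (fun r => 2 * t * r)) + (fun r => r ^+ 2)); last first.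
    by apply/funext => s; rewrite /qs /= fctE /= mulrAC.
  by apply: (is_derive_eq d2); ring.
apply: (is_derive_eq (@is_derive1_comp R (fun s => (Num.sqrt s)^-1 ^+ n) (qs ^~ t) r _ _
  (is_derive_sqrtV n q0) dq)).
by rewrite /GRing.scale /= -/(qk r t); field.
Qed.

Lemma measurable_qk d (T : measurableType d) (f g : T -> R) : measurable_fun setT f ->
  measurable_fun setT g -> measurable_fun setT (fun x => qk (f x) (g x)).
Proof.
move=> mf mg.
apply: (eq_measurable_fun (fun x => Num.sqrt (qs (f x) (g x)) `^ (-1))).
  by move=> x _; rewrite powR_inv1// sqrtr_ge0.
apply: (measurableT_comp (measurable_powR _)).
apply: (@measurableT_comp _ _ _ _ _ _ (@Num.sqrt R)).
  by apply: continuous_measurable_fun => s; exact: sqrt_continuous.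
apply: measurable_funD; last exact: measurable_funX.
apply: measurable_funB; first exact: measurable_cst.
by apply: measurable_funM => //; apply: measurable_funM.
Qed.

End generating_function.

Section kernels.
Context {R : realType} (d : nat).
Implicit Types (r t s : R).
Local Notation n := (d - 2)%N.

Definition beta : R := n%:R / 2.

Definition kk r t : R := qk r t ^+ n.
Definition pk r t : R := (1 - r ^+ 2) * qk r t ^+ d.

Definition dkk r t : R := n%:R * (t - r) * qk r t ^+ n.+2.
Definition dpk r t : R :=
  - (2 * r) * qk r t ^+ d + (1 - r ^+ 2) * (d%:R * (t - r) * qk r t ^+ d.+2).

Lemma is_derive_kk r t : 0 < qs r t -> is_derive r 1 (kk ^~ t) (dkk r t).
Proof. exact: is_derive_qk_r. Qed.

Lemma is_derive_pk r t : 0 < qs r t -> is_derive r 1 (pk ^~ t) (dpk r t).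
Proof.
move=> q0.
have d1 : is_derive r 1 (fun r => 1 - r ^+ 2) (- (2 * r)).
  have d3 : is_derive r 1 (fun r => r ^+ 2) (2 * r).
    exact: is_derive_sqr.
  by apply: (is_derive_eq (is_deriveB (is_derive_cst (1 : R) r 1) d3)); rewrite sub0r.
apply: (is_derive_eq (is_deriveM d1 (is_derive_qk_r d q0))).
by rewrite /dpk /GRing.scale /=; ring.
Qed.

Hypothesis d2 : (2 <= d)%N.

Lemma qk_expd r t : qk r t ^+ d = qk r t ^+ n * qk r t ^+ 2.
Proof. by rewrite -exprD subnK. Qed.

(** With t = x . y, this is 2 r (t - r) = (1 - r^2) - |r x - y|^2, divided by |r x - y|^d. *)
Lemma r_dkk r t : 0 < qs r t -> r * dkk r t = beta * (pk r t - kk r t).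
Proof.
move=> q0; rewrite /dkk /pk /kk /beta qk_expd -[in qk r t ^+ n.+2]addn2 exprD.
have := qk_sqr q0; rewrite /qs; set q := qk r t; move: (q ^+ n) => a h.
apply/eqP; rewrite -subr_eq0; apply/eqP.
transitivity (n%:R / 2 * a * (1 - q ^+ 2 * (1 - 2 * r * t + r ^+ 2))); first by field.
by rewrite h subrr mulr0.
Qed.

(* This is the radial form of the Laplace equation for the Newtonian kernel. *)
Lemma laplace_kk r t : 0 < qs r t ->
  (1 - t ^+ 2) * (n%:R * r * (n.+2%:R * r * qk r t ^+ n.+4))
    - (d%:R - 1) * t * (n%:R * r * qk r t ^+ n.+2) =
  - (beta * (r * dpk r t + beta * (pk r t - kk r t))).
Proof.
move=> q0; rewrite /dpk /pk /kk /beta.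
have dE : d%:R = n%:R + 2 :> R by rewrite -natrD subnK.
have nE : n.+2%:R = n%:R + 2 :> R by rewrite -addn2 natrD.
have e2 : qk r t ^+ d.+2 = qk r t ^+ n * qk r t ^+ 2 * qk r t ^+ 2.
  by rewrite -addn2 exprD qk_expd.
have e3 : qk r t ^+ n.+2 = qk r t ^+ n * qk r t ^+ 2 by rewrite -exprD addn2.
have e4 : qk r t ^+ n.+4 = qk r t ^+ n * qk r t ^+ 2 * qk r t ^+ 2.
  by rewrite -!exprD -addnA addn4.
rewrite e2 e3 e4 nE qk_expd dE.
have := qk_sqr q0; rewrite /qs; set q := qk r t.
move: (q ^+ n) (q ^+ 2) (n%:R) => a Q m h.
apply/eqP; rewrite -subr_eq0; apply/eqP.
transitivity ((1 - Q * (1 - 2 * r * t + r ^+ 2)) *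
  (- (m ^+ 2 * a / 4) - a * m * (m + 2) * r * (t + r) / 2 * Q)); last first.
  by rewrite h subrr mul0r.
by field.
Qed.

End kernels.

(** * Bounded families and differentiation in the radius *)

Section bounded_measurable.
Context {R : realType} {d : nat}.
Local Notation E := 'rV[R]_d.
Local Notation S := (@sphere R d).
Implicit Types (f g F : E -> R) (x y z : E) (r s t : R).

Definition BM F := measurable_fun setT F /\ exists M, forall y, S y -> `|F y| <= M.

Lemma BM_L1 F : BM F -> L1S F.
Proof. by move=> [mF [M FM]]; exact: (L1S_bounded mF FM). Qed.

Lemma BM_L2 F : BM F -> L2S F.
Proof. by move=> [mF [M FM]]; exact: (L2S_bounded mF FM). Qed.

Lemma BM_cst r : BM (fun=> r).
Proof. by split; [exact: measurable_cst|exists `|r|]. Qed.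

Lemma BM_add F f : BM F -> BM f -> BM (fun y => F y + f y).
Proof.
move=> [mF [M FM]] [mf [N fN]]; split; first exact: measurable_funD.
exists (M + N) => y Sy; apply: le_trans (ler_normD _ _) _.
by apply: lerD; [exact: FM|exact: fN].
Qed.

Lemma BM_mul F f : BM F -> BM f -> BM (fun y => F y * f y).
Proof.
move=> [mF [M FM]] [mf [N fN]]; split; first exact: measurable_funM.
by exists (M * N) => y Sy; rewrite normrM ler_pM// ?FM ?fN.
Qed.

Lemma BM_scale r F : BM F -> BM (fun y => r * F y).
Proof. by move=> bF; apply: BM_mul => //; exact: BM_cst. Qed.

Lemma BM_opp F : BM F -> BM (fun y => - F y).
Proof.
move=> [mF [M FM]]; split; first exact: measurable_funN.
by exists M => y Sy; rewrite normrN FM.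
Qed.

Lemma BM_sub F f : BM F -> BM f -> BM (fun y => F y - f y).
Proof. by move=> bF bf; apply: BM_add => //; exact: BM_opp. Qed.

Lemma BM_mul_L1 F f : BM F -> L1S f -> L1S (fun y => F y * f y).
Proof. by move=> [mF [M FM]] Lf; exact: (L1S_mul_bounded mF FM Lf). Qed.

Lemma BM_RS f : RS f -> BM f.
Proof.
move=> sf; split; first exact: RS_measurable.
by have [M fM] := RS_bounded sf; exists M => y _.
Qed.

Lemma measurable_dotp2 d0 (T : measurableType d0) (f g : T -> E) :
  measurable_fun setT f -> measurable_fun setT g ->
  measurable_fun setT (fun w => dotp (f w) (g w)).
Proof.
move=> mf mg; apply: measurable_sum => i; apply: measurable_funM.
  by apply: (measurableT_comp (@measurable_rV_coord R d i)).
by apply: (measurableT_comp (@measurable_rV_coord R d i)).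
Qed.

Lemma measurable_dotpr x : measurable_fun setT (fun y : E => dotp x y).
Proof. by apply: measurable_dotp2; [exact: measurable_cst|exact: measurable_id]. Qed.

Lemma dotp_itv x y : S x -> S y -> -1 <= dotp x y <= 1.
Proof. by move=> Sx Sy; rewrite dotp_geN1// dotp_le1. Qed.

Lemma BM_dotp x : S x -> BM (fun y => dotp x y).
Proof.
move=> Sx; split; first exact: measurable_dotpr.
by exists 1 => y Sy; exact: dotp_norm_le1.
Qed.

Lemma BM_qk m r x : `|r| < 1 -> S x -> BM (fun y => qk r (dotp x y) ^+ m).
Proof.
move=> r1 Sx; split.
  by apply: measurable_funX; apply: measurable_qk; [exact: measurable_cst|exact: measurable_dotpr].
exists ((1 - `|r|)^-1 ^+ m) => y Sy.
by apply: qk_exp_bound => //; exact: dotp_itv.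
Qed.

Lemma BM_kk r x : `|r| < 1 -> S x -> BM (fun y => kk d r (dotp x y)).
Proof. exact: BM_qk. Qed.

Lemma BM_pk r x : `|r| < 1 -> S x -> BM (fun y => pk d r (dotp x y)).
Proof. by move=> r1 Sx; apply: BM_scale; exact: BM_qk. Qed.

Lemma BM_dkk r x : `|r| < 1 -> S x -> BM (fun y => dkk d r (dotp x y)).
Proof.
move=> r1 Sx; apply: BM_mul; last exact: BM_qk.
by apply: BM_scale; apply: BM_sub; [exact: BM_dotp|exact: BM_cst].
Qed.

Lemma BM_dpk r x : `|r| < 1 -> S x -> BM (fun y => dpk d r (dotp x y)).
Proof.
move=> r1 Sx; apply: BM_add; first by apply: BM_scale; exact: BM_qk.
apply: BM_scale; apply: BM_mul; last exact: BM_qk.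
by apply: BM_scale; apply: BM_sub; [exact: BM_dotp|exact: BM_cst].
Qed.

End bounded_measurable.

Section differentiation_under_the_integral.
Context {R : realType} {d : nat}.
Local Notation E := 'rV[R]_d.
Local Notation S := (@sphere R d).
Variables (u v : R).
Implicit Types (F G : R -> E -> R) (c : R -> R) (x y z : E) (r s t : R).

(** A family with its derivative in the parameter, both bounded uniformly in the parameter and on
    the sphere. The bound dominates the differentiation under the integral, and the class is closed
    under products. *)
Definition DB F (F' : R -> E -> R) := [/\ forall s, u < s < v -> measurable_fun setT (F s),
  forall s, u < s < v -> measurable_fun setT (F' s),
  exists M, forall s y, u < s < v -> S y -> `|F s y| <= M /\ `|F' s y| <= M &
  forall s y, u < s < v -> S y -> is_derive s 1 (F ^~ y) (F' s y)].

Lemma is_derive_DB F (F' : R -> E -> R) (f : E -> R) a : DB F F' -> L1S f -> u < a < v ->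
  is_derive a 1 (fun s => IS (fun y => F s y * f y)) (IS (fun y => F' a y * f y)).
Proof.
move=> [mF mF' [M FM] dF] Lf auv.
apply: (@is_derive_IS R d (fun s y => F s y * f y) (fun s y => F' s y * f y)
   (fun y => M * `|f y|) u v) => //.
- move=> s suv; apply: (@L1S_mul_bounded _ _ M) => //; first exact: mF.
  by move=> x Sx; case: (FM s x suv Sx).
- move=> s y suv Sy; have := is_deriveM (dF s y suv Sy) (is_derive_cst (f y) s 1).
  move/is_derive_eq; apply.
  by rewrite scaler0 add0r /GRing.scale /= mulrC.
- by apply: L1S_Z; exact: L1S_norm.
- move=> s y suv Sy; rewrite normrM ler_wpM2r//.
  by case: (FM s y suv Sy).
Qed.

Lemma DB_mul F (F' : R -> E -> R) G (G' : R -> E -> R) : DB F F' -> DB G G' ->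
  DB (fun s y => F s y * G s y) (fun s y => F' s y * G s y + F s y * G' s y).
Proof.
move=> [mF mF' [M FM] dF] [mG mG' [N GN] dG]; split.
- by move=> s suv; apply: measurable_funM; [exact: mF|exact: mG].
- move=> s suv; apply: measurable_funD; apply: measurable_funM.
  + exact: mF'.
  + exact: mG.
  + exact: mF.
  + exact: mG'.
- exists (`|M| * `|N| + `|M| * `|N|) => s y suv Sy.
  have [f1 f2] := FM s y suv Sy; have [g1 g2] := GN s y suv Sy.
  have {}f1 := le_trans f1 (ler_norm _); have {}f2 := le_trans f2 (ler_norm _).
  have {}g1 := le_trans g1 (ler_norm _); have {}g2 := le_trans g2 (ler_norm _).
  split.
    rewrite normrM; apply: (@le_trans _ _ (`|M| * `|N|)); first exact: ler_pM.
    by rewrite lerDl mulr_ge0.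
  by apply: le_trans (ler_normD _ _) _; rewrite !normrM; apply: lerD; exact: ler_pM.
- move=> s y suv Sy; apply: (is_derive_eq (is_deriveM (dF s y suv Sy) (dG s y suv Sy))).
  by rewrite /GRing.scale /=; ring.
Qed.

Lemma DB_fun c (c' : R -> R) M : (forall s, u < s < v -> is_derive s 1 c (c' s)) ->
  (forall s, u < s < v -> `|c s| <= M /\ `|c' s| <= M) ->
  DB (fun s _ => c s) (fun s _ => c' s).
Proof.
move=> dc cM; split.
- by move=> s _; exact: measurable_cst.
- by move=> s _; exact: measurable_cst.
- by exists M => s y suv _; exact: cM.
- by move=> s y suv _; exact: dc.
Qed.

Lemma DB_sub F (F' : R -> E -> R) G (G' : R -> E -> R) : DB F F' -> DB G G' ->
  DB (fun s y => F s y - G s y) (fun s y => F' s y - G' s y).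
Proof.
move=> [mF mF' [M FM] dF] [mG mG' [N GN] dG]; split.
- by move=> s suv; apply: measurable_funB; [exact: mF|exact: mG].
- by move=> s suv; apply: measurable_funB; [exact: mF'|exact: mG'].
- exists (M + N) => s y suv Sy.
  have [f1 f2] := FM s y suv Sy; have [g1 g2] := GN s y suv Sy.
  by split; apply: le_trans (ler_normB _ _) _; exact: lerD.
- by move=> s y suv Sy; apply: is_deriveB; [exact: dF|exact: dG].
Qed.

Section kernel.
Variables (c c' : R -> R) (rho M : R).
Hypotheses (rho1 : rho < 1)
  (dc : forall s, u < s < v -> is_derive s 1 c (c' s))
  (crho : forall s, u < s < v -> `|c s| <= rho)
  (cM : forall s, u < s < v -> `|c' s| <= M).

(** The radius moves along a curve [c] with |c| <= rho < 1, away from the singularity. Below, radii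
    proportional to the parameter and radii inversely proportional to it both occur. *)
Lemma DB_qk m x : S x -> DB (fun s y => qk (c s) (dotp x y) ^+ m)
  (fun s y => m%:R * (dotp x y - c s) * qk (c s) (dotp x y) ^+ m.+2 * c' s).
Proof.
move=> Sx.
have c1 s : u < s < v -> `|c s| < 1 by move=> suv; apply: le_lt_trans (crho suv) rho1.
have B s y k : u < s < v -> S y -> `|qk (c s) (dotp x y) ^+ k| <= (1 - rho)^-1 ^+ k.
  move=> suv Sy; apply: le_trans (qk_exp_bound k (c1 s suv) (dotp_itv Sx Sy)) _.
  have h1 := c1 s suv; have h2 := crho suv.
  have p1 : 0 < 1 - `|c s| by rewrite subr_gt0.
  have p2 : 0 < 1 - rho by rewrite subr_gt0.
  apply: lerXn2r; rewrite ?nnegrE ?invr_ge0 ?(ltW p1) ?(ltW p2)//.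
  by rewrite lef_pV2 ?posrE// lerD2l lerN2.
have mq k s : measurable_fun setT (fun y => qk (c s) (dotp x y) ^+ k).
  apply: measurable_funX; apply: measurable_qk; first exact: measurable_cst.
  exact: measurable_dotpr.
split.
- by move=> s suv; exact: mq.
- move=> s suv; apply: measurable_funM; last exact: measurable_cst.
  apply: measurable_funM; last exact: mq.
  apply: measurable_funM; first exact: measurable_cst.
  by apply: measurable_funB; [exact: measurable_dotpr|exact: measurable_cst].
- exists (`|(1 - rho)^-1 ^+ m| + `|m%:R * (1 + 1) * (1 - rho)^-1 ^+ m.+2 * M|) => s y suv Sy.
  split.
    by apply: (le_trans (B s y m suv Sy)); rewrite -[leLHS]addr0 lerD// ler_norm.
  rewrite -[leLHS]add0r lerD//; apply: le_trans (ler_norm _).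
  rewrite normrM; apply: ler_pM => //; last exact: cM.
  rewrite normrM; apply: ler_pM => //; last exact: B.
  rewrite normrM normr_nat; apply: ler_wpM2l => //.
  apply: le_trans (ler_normB _ _) _; apply: lerD; first exact: dotp_norm_le1.
  exact: ltW (c1 _ _).
- move=> s y suv Sy.
  have q0 := qs_gt0 (c1 s suv) (dotp_itv Sx Sy).
  exact: (is_derive_eq (is_derive1_comp (is_derive_qk_r m q0) (dc suv))).
Qed.

Lemma DB_kk x : S x -> DB (fun s y => kk d (c s) (dotp x y))
  (fun s y => dkk d (c s) (dotp x y) * c' s).
Proof. exact: DB_qk. Qed.

Lemma DB_ext F (F' G' : R -> E -> R) : (forall s y, F' s y = G' s y) -> DB F F' -> DB F G'.
Proof.
move=> E'; have -> : F' = G' by apply/funext => s; apply/funext => y.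
by [].
Qed.

Lemma DB_pk x : S x -> DB (fun s y => pk d (c s) (dotp x y))
  (fun s y => dpk d (c s) (dotp x y) * c' s).
Proof.
move=> Sx.
have h : DB (fun s _ => 1 - c s ^+ 2) (fun s _ => - (2 * c s) * c' s).
  apply: (@DB_fun _ _ (2 + 2 * `|M|)) => s suv.
    have d3 := is_derive1_comp (is_derive_sqr (c s)) (dc suv).
    by apply: (is_derive_eq (is_deriveB (is_derive_cst (1 : R) s 1) d3)); rewrite sub0r mulNr.
  have c1 : `|c s| <= 1 by apply: le_trans (crho suv) (ltW rho1).
  split.
    apply: le_trans (ler_normB _ _) _; rewrite normr1 normrX.
    rewrite (@le_trans _ _ 2)//; last by rewrite lerDl mulr_ge0.
    by rewrite -[leRHS]/(1 + 1) lerD2l exprn_ile1.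
  rewrite normrM normrN normrM [`|2|]ger0_norm//.
  rewrite -[leLHS]add0r lerD// ler_pM ?mulr_ge0//.
    by rewrite -[leRHS]mulr1 ler_wpM2l.
  exact: le_trans (cM suv) (ler_norm _).
by apply: DB_ext (DB_mul h (DB_qk d Sx)) => s y; rewrite /dpk; ring.
Qed.

End kernel.

End differentiation_under_the_integral.

(** * Integral identities between the kernels *)

Section kernel_identities.
Context {R : realType} {d : nat}.
Local Notation E := 'rV[R]_d.
Local Notation S := (@sphere R d).
Hypothesis d3 : (3 <= d)%N.
Local Notation n := (d - 2)%N.
Local Notation kk := (kk d).
Local Notation pk := (pk d).
Local Notation dkk := (dkk d).
Local Notation dpk := (dpk d).
Local Notation beta := (@beta R d).
Implicit Types (x y z : E) (r s t : R).

Lemma beta_gt0 : 0 < beta.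
Proof. by rewrite /beta divr_gt0// ltr0n subn_gt0. Qed.

Lemma d_ge2 : (2 <= d)%N. Proof. exact: ltnW. Qed.

Lemma qs_sphere r x y : `|r| < 1 -> S x -> S y -> 0 < qs r (dotp x y).
Proof. by move=> r1 Sx Sy; rewrite qs_gt0// dotp_itv. Qed.

Lemma Sm_qk m r y : `|r| < 1 -> S y -> Sm (fun x => qk r (td y x) ^+ m).
Proof.
move=> r1 Sy; apply: Sm_sqrtV => [x x0|].
  by rewrite qs_gt0// td_bound.
apply: Sm_add; last exact: Sm_cst.
apply: Sm_sub; first exact: Sm_cst.
by apply: Sm_mul; [exact: Sm_cst|apply: RS_Sm; exact: RS_td].
Qed.

Lemma RS_kk r y : `|r| < 1 -> S y -> RS (fun x => kk r (td y x)).
Proof. by move=> r1 Sy; apply: RS_zonal => //; exact: Sm_qk. Qed.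

Section derivatives_of_kk.
Variables (r : R) (y : E).
Hypotheses (r1 : `|r| < 1) (Sy : S y).

Let sk1 : Sm (fun x => n%:R * r * qk r (td y x) ^+ n.+2).
Proof. by apply: Sm_mul; [exact: Sm_cst|exact: Sm_qk]. Qed.

Let dk t : -1 <= t <= 1 -> is_derive t 1 (kk r) (n%:R * r * qk r t ^+ n.+2).
Proof. by move=> t1; apply: is_derive_qk_t; exact: qs_gt0. Qed.

Let dk1 t : -1 <= t <= 1 -> is_derive t 1 (fun t => n%:R * r * qk r t ^+ n.+2)
  (n%:R * r * (n.+2%:R * r * qk r t ^+ n.+4)).
Proof. by move=> t1; apply: is_deriveZ; apply: is_derive_qk_t; exact: qs_gt0. Qed.

Lemma Dr_kk i x : S x -> Dr i (fun x => kk r (td y x)) x =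
  n%:R * r * qk r (dotp x y) ^+ n.+2 * (y 0 i - dotp x y * x 0 i).
Proof.
move=> Sx; rewrite (Dr_zonal (k := kk r) Sy dk) ?sphere_neq0//.
by rewrite /xh /td unitv_id.
Qed.

Lemma lap_kk x : S x -> lap (fun x => kk r (td y x)) x =
  - (beta * (r * dpk r (dotp x y) + beta * (pk r (dotp x y) - kk r (dotp x y)))).
Proof.
move=> Sx; rewrite (lap_zonal Sy sk1 dk dk1) ?sphere_neq0// tdE//.
by rewrite laplace_kk ?d_ge2// qs_sphere.
Qed.

End derivatives_of_kk.

Lemma IS_scaler (f : E -> R) r : L1S f -> IS (fun y => f y * r) = r * IS f.
Proof. by move=> Lf; rewrite -IS_scale//; apply: eq_IS => y _; rewrite mulrC. Qed.

(* Both sides, as functions of [(rho r, rho s)], differ by a solution of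
   [rho N' = - (d - 2) N], by Green's formula. *)
Lemma pk_kk_swap r s x z : 0 <= r < 1 -> 0 <= s < 1 -> S x -> S z ->
  IS (fun y => pk r (dotp x y) * kk s (dotp z y)) =
  IS (fun y => kk r (dotp x y) * pk s (dotp z y)).
Proof.
move=> /andP[r0 r1] /andP[s0 s1] Sx Sz.
pose m := Num.max r s.
have m0 : 0 <= m by rewrite le_max r0.
have m1 : m < 1 by rewrite gt_max r1.
have rm : r <= m by rewrite le_max lexx.
have sm : s <= m by rewrite le_max lexx orbT.
(* The parameter has to pass 1 while the radii stay below 1: here v > 1 and v m = 2 m / (1 + m) <
   1. *)
pose v := 2 / (1 + m).
have v1 : 1 < v by rewrite ltr_pdivlMr; lra.
pose rho := v * m.
have rho1 : rho < 1 by rewrite /rho /v mulrAC ltr_pdivrMr; lra.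
have cb a t : 0 <= a <= m -> -1 < t < v -> `|t * a| <= rho.
  move=> /andP[a0 am] /andP[t1 t2]; rewrite normrM (ger0_norm a0).
  by apply: ler_pM => //; rewrite ler_norml; lra.
have dc a t : is_derive t 1 (fun t => t * a) a.
  have := is_deriveM (is_derive_id t 1) (is_derive_cst a t 1).
  by move/is_derive_eq; apply; rewrite scaler0 add0r /GRing.scale /= mulr1.
have DBk a w : 0 <= a <= m -> S w -> DB (-1) v (fun t y => kk (t * a) (dotp w y))
    (fun t y => dkk (t * a) (dotp w y) * a).
  move=> am Sw; apply: (@DB_kk R d (-1) v (fun t => t * a) (fun=> a) rho `|a|) => //.
  by move=> t tv; exact: cb.
have DBp a w : 0 <= a <= m -> S w -> DB (-1) v (fun t y => pk (t * a) (dotp w y))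
    (fun t y => dpk (t * a) (dotp w y) * a).
  move=> am Sw; apply: (@DB_pk R d (-1) v (fun t => t * a) (fun=> a) rho `|a|) => //.
  by move=> t tv; exact: cb.
have rr : 0 <= r <= m by rewrite r0.
have ss : 0 <= s <= m by rewrite s0.
have := DB_sub (DB_mul (DBp r x rr Sx) (DBk s z ss Sz)) (DB_mul (DBk r x rr Sx) (DBp s z ss Sz)).
set F := (fun t y => _ - _); set F' := (fun t y => _ - _) => DBF.
have dF t : -1 < t < v -> is_derive t 1 (fun t => IS (F t)) (IS (F' t)).
  move=> tv; have := is_derive_DB DBF (L1S_cst 1) tv.
  have e (G : R -> E -> R) t' : IS (fun y => G t' y * 1) = IS (G t').
    by apply: eq_IS => y _; rewrite mulr1.
  by rewrite e (_ : (fun t' => _) = fun t' => IS (F t'))//; apply/funext => t'; exact: e.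
pose N t := t ^+ n * IS (F t).
have dN t : -1 < t < v -> is_derive t 1 N (n%:R * t ^+ n.-1 * IS (F t) + t ^+ n * IS (F' t)).
  move=> tv; have dX : is_derive t 1 (fun t => t ^+ n) (n%:R * t ^+ n.-1).
    have := is_deriveX n (is_derive_id t 1); rewrite (_ : id ^+ n = fun t => t ^+ n).
      by move/is_derive_eq; apply; rewrite /GRing.scale /= mulr1.
    by apply/funext => t'; rewrite fctE.
  apply: (is_derive_eq (is_deriveM dX (dF t tv))).
  by rewrite /GRing.scale /=; ring.
(* The Laplace equation replaces the Laplacians in Green's formula by radial derivatives; the terms
   of lower order produce the multiple of [IS (F t)]. *)
have key t : 0 < t < 1 -> t * IS (F' t) = - (n%:R * IS (F t)).
  move=> /andP[t0 t1].
  have tr1 : `|t * r| < 1.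
    by apply: le_lt_trans (cb r t rr _) rho1; apply/andP; split; lra.
  have ts1 : `|t * s| < 1.
    by apply: le_lt_trans (cb s t ss _) rho1; apply/andP; split; lra.
  pose U := fun w => kk (t * r) (td x w); pose V := fun w => kk (t * s) (td z w).
  have sU : RS U by exact: RS_kk.
  have sV : RS V by exact: RS_kk.
  have G : IS (fun y => U y * lap V y - lap U y * V y) = 0.
    by rewrite (IS_sub (L1S_RS (RS_mul sU (RS_lap sV))) (L1S_RS (RS_mul (RS_lap sU) sV)))
      (Green2 sU sV) subrr.
  have bF : BM (F t).
    apply: BM_sub; apply: BM_mul; (exact: BM_pk || exact: BM_kk).
  have bF' : BM (F' t).
    apply: BM_sub; apply: BM_add; apply: BM_mul => //;
    do ?[exact: BM_pk|exact: BM_kk]; apply: BM_mul;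
    do ?[exact: BM_dpk|exact: BM_dkk|exact: BM_cst].
  have e1 : IS (fun y => (beta * t) * F' t y) =
      IS (fun y => (U y * lap V y - lap U y * V y) - 2 * beta ^+ 2 * F t y).
    apply: eq_IS => y Sy; rewrite /U /V !lap_kk// !tdE// !(dotpC y) /F /F'.
    have e2 := r_dkk d_ge2 (qs_sphere tr1 Sx Sy); have e3 := r_dkk d_ge2 (qs_sphere ts1 Sz Sy).
    move: e2 e3; set k1 := kk _ _; set k2 := kk _ _; set p1 := pk _ _; set p2 := pk _ _.
    set a1 := dkk _ _; set a2 := dkk _ _; set b1 := dpk _ _; set b2 := dpk _ _ => e2 e3.
    transitivity (beta * (t * r * b1 * k2 + p1 * (t * s * a2) - (t * r * a1) * p2 - k1 * (t * s
      * b2))); first by ring.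
    by rewrite e2 e3; ring.
  move: e1; rewrite (IS_scale _ (BM_L1 bF')).
  rewrite (IS_sub (L1S_RS (RS_sub (RS_mul sU (RS_lap sV)) (RS_mul (RS_lap sU) sV))) (BM_L1
    (BM_scale _ bF))).
  rewrite G (IS_scale _ (BM_L1 bF)).
  have -> : n%:R = 2 * beta by rewrite /beta; field.
  move=> h; apply: (mulfI (lt0r_neq0 beta_gt0)); move: h; rewrite -mulrA => ->; ring.
have N0 : N 0 = N 1.
  apply: (is_derive0_cst ler01) => [t /andP[t0 t1]|].
    apply: (is_derive_eq (dN t _)); first by apply/andP; split; lra.
    have t01 : 0 < t < 1 by rewrite t0.
    have n0 : (0 < n)%N by rewrite subn_gt0.
    rewrite -[in t ^+ n](prednK n0) exprS.
    transitivity (t ^+ n.-1 * (n%:R * IS (F t) + t * IS (F' t))); first by ring.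
    by rewrite key// subrr mulr0.
  apply: continuous_in_subspaceT => t; rewrite inE /= in_itv/= => /andP[t0 t1].
  have tv : -1 < t < v by apply/andP; split; lra.
  by apply: differentiable_continuous; apply/derivable1_diffP; case: (dN t tv).
(* At 0 the factor t^(d-2) vanishes, as d >= 3. *)
move: N0; rewrite /N expr0n subn_eq0 leqNgt d3 mul0r expr1n mul1r => /esym.
rewrite /F IS_sub.
- by move/eqP; rewrite subr_eq0 !mul1r => /eqP.
- by apply: BM_L1; apply: BM_mul; [apply: BM_pk|apply: BM_kk] => //; rewrite mul1r ger0_norm.
- by apply: BM_L1; apply: BM_mul; [apply: BM_kk|apply: BM_pk] => //; rewrite mul1r ger0_norm.
Qed.

Lemma kk0 t : kk 0 t = 1. Proof. by rewrite /kk qk0 expr1n. Qed.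

Lemma pk0 t : pk 0 t = 1.
Proof. by rewrite /pk qk0 expr1n expr0n subr0 mulr1. Qed.

Definition sphere_area : R := IS (fun _ : E => 1).
Local Notation W := sphere_area.

Lemma norm_lt1 r : 0 <= r < 1 -> `|r| < 1.
Proof. by move=> /andP[r0 r1]; rewrite ger0_norm. Qed.

(** The case s = 0 of the exchange, where the second kernel is 1 on both sides. *)
Lemma IS_pk_kk r x : 0 <= r < 1 -> S x ->
  IS (fun y => pk r (dotp x y)) = IS (fun y => kk r (dotp x y)).
Proof.
move=> r1 Sx; have z1 : 0 <= (0 : R) < 1 by rewrite lexx ltr01.
have := pk_kk_swap r1 z1 Sx Sx.
rewrite (eq_IS (g := fun y => pk r (dotp x y))) => [->|y _]; last by rewrite kk0 mulr1.
by apply: eq_IS => y _; rewrite pk0 mulr1.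
Qed.

Lemma is_derive_IS_kk r x (f : E -> R) : `|r| < 1 -> S x -> L1S f ->
  is_derive r 1 (fun r => IS (fun y => kk r (dotp x y) * f y))
    (IS (fun y => dkk r (dotp x y) * f y)).
Proof.
move=> r1 Sx Lf; pose rho := (1 + `|r|) / 2.
have rho1 : rho < 1 by rewrite /rho ltr_pdivrMr; lra.
have DBk : DB (- rho) rho (fun t y => kk t (dotp x y)) (fun t y => dkk t (dotp x y) * 1).
  apply: (@DB_kk R d _ _ (fun t => t) (fun=> 1) rho 1) => //.
    by move=> t trho; rewrite ler_norml; lra.
  by move=> t _; rewrite normr1.
have rr : - rho < r < rho by rewrite -ltr_norml /rho; lra.
apply: (is_derive_eq (is_derive_DB DBk Lf rr)).
by apply: eq_IS => y _; rewrite mulr1.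
Qed.

Lemma is_derive_IS_pk r x (f : E -> R) : `|r| < 1 -> S x -> L1S f ->
  is_derive r 1 (fun r => IS (fun y => pk r (dotp x y) * f y))
    (IS (fun y => dpk r (dotp x y) * f y)).
Proof.
move=> r1 Sx Lf; pose rho := (1 + `|r|) / 2.
have rho1 : rho < 1 by rewrite /rho ltr_pdivrMr; lra.
have DBp : DB (- rho) rho (fun t y => pk t (dotp x y)) (fun t y => dpk t (dotp x y) * 1).
  apply: (@DB_pk R d _ _ (fun t => t) (fun=> 1) rho 1) => //.
    by move=> t trho; rewrite ler_norml; lra.
  by move=> t _; rewrite normr1.
have rr : - rho < r < rho by rewrite -ltr_norml /rho; lra.
apply: (is_derive_eq (is_derive_DB DBp Lf rr)).
by apply: eq_IS => y _; rewrite mulr1.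
Qed.

Lemma r_IS_dkk r x (f : E -> R) : `|r| < 1 -> S x -> L1S f ->
  r * IS (fun y => dkk r (dotp x y) * f y) =
  beta * (IS (fun y => pk r (dotp x y) * f y) - IS (fun y => kk r (dotp x y) * f y)).
Proof.
move=> r1 Sx Lf.
have Lp := BM_mul_L1 (BM_pk r1 Sx) Lf; have Lk := BM_mul_L1 (BM_kk r1 Sx) Lf.
rewrite -(IS_scale _ (BM_mul_L1 (BM_dkk r1 Sx) Lf)) -(IS_sub Lp Lk) -(IS_scale _ (L1S_B Lp Lk)).
apply: eq_IS => y Sy; rewrite mulrA r_dkk ?d_ge2 ?qs_sphere//; ring.
Qed.

(** Newton's theorem that the potential of a homogeneous shell is constant inside: r d/dr of the
    integral is beta times the difference of the integrals of p_r and k_r, which is 0. At r = 0 the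
    kernel is 1. *)
Lemma IS_kk r x : 0 <= r < 1 -> S x -> IS (fun y => kk r (dotp x y)) = W.
Proof.
move=> /andP[r0 r1] Sx.
pose N t := IS (fun y => kk t (dotp x y) * 1).
have e t : N t = IS (fun y => kk t (dotp x y)) by apply: eq_IS => y _; rewrite mulr1.
have dN t : 0 <= t < 1 -> is_derive t 1 N (IS (fun y => dkk t (dotp x y) * 1)).
  by move=> t1; apply: is_derive_IS_kk => //; [exact: norm_lt1|exact: L1S_cst].
have : N 0 = N r.
  apply: (is_derive0_cst r0) => [t /andP[t0 tr]|].
    have t1 : 0 <= t < 1 by rewrite ltW// (lt_trans tr).
    apply: (is_derive_eq (dN t t1)); apply: (mulfI (lt0r_neq0 t0)).
    rewrite r_IS_dkk//; [|exact: norm_lt1|exact: L1S_cst].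
    have -> : IS (fun y => pk t (dotp x y) * 1) = IS (fun y => kk t (dotp x y) * 1).
      by rewrite -/(N t) e -IS_pk_kk//; apply: eq_IS => y _; rewrite mulr1.
    by rewrite subrr !mulr0.
  apply: continuous_in_subspaceT => t; rewrite inE /= in_itv/= => /andP[t0 tr].
  apply: differentiable_continuous; apply/derivable1_diffP.
  by case: (dN t _) => //; rewrite t0 (le_lt_trans tr).
by rewrite -e => <-; rewrite e; apply: eq_IS => y _; rewrite kk0.
Qed.

(** Differentiating the exchange formula in [s] turns the derivative of p_s into that of k_s, which
    [r_IS_dkk] expresses by p_s and k_s. *)
Lemma IS_kk_dpk r s x z : 0 <= r < 1 -> 0 < s < 1 -> S x -> S z ->
  s * IS (fun y => dpk s (dotp z y) * kk r (dotp x y)) =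
  beta * (IS (fun y => pk s (dotp z y) * pk r (dotp x y)) -
          IS (fun y => pk s (dotp z y) * kk r (dotp x y))).
Proof.
move=> rr /andP[s0 s1] Sx Sz.
have r1 := norm_lt1 rr.
have ss : 0 <= s < 1 by rewrite ltW.
have d1 := is_derive_IS_pk (norm_lt1 ss) Sz (BM_L1 (BM_kk r1 Sx)).
have d2 := is_derive_IS_kk (norm_lt1 ss) Sz (BM_L1 (BM_pk r1 Sx)).
have E0 : \forall t \near s, IS (fun y => kk t (dotp z y) * pk r (dotp x y)) =
    IS (fun y => pk t (dotp z y) * kk r (dotp x y)).
  near=> t; symmetry; apply: pk_kk_swap => //; apply/andP; split.
    by apply/ltW; near: t; exact: lt_nbhsr.
  by near: t; exact: lt_nbhsl.
have -> : IS (fun y => dpk s (dotp z y) * kk r (dotp x y)) =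
    IS (fun y => dkk s (dotp z y) * pk r (dotp x y)).
  rewrite -(@derive_val _ _ _ _ _ _ _ d1) -(@derive_val _ _ _ _ _ _ _ d2).
  by apply: near_eq_derive; apply: filterS E0.
rewrite r_IS_dkk//; [|exact: norm_lt1|exact: BM_L1 (BM_pk r1 Sx)].
by rewrite (pk_kk_swap ss rr Sz Sx).
Unshelve. all: by end_near. Qed.

(** The integral depends on the product of the radii only. Along the curve of radii (r s / w, w) the
    two contributions to the derivative cancel by [IS_kk_dpk]. *)
Lemma kk_pk_shift r s t x z : 0 <= r < 1 -> 0 < s -> s <= t -> t < 1 -> S x -> S z ->
  IS (fun y => kk r (dotp x y) * pk s (dotp z y)) =
  IS (fun y => kk (r * s / t) (dotp x y) * pk t (dotp z y)).
Proof.
move=> /andP[r0 r1] s0 st t1 Sx Sz.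
(* An interval around [s, t] on which both radii stay away from 1: at u the first radius is 2 r / (1
   + r), and v lies halfway between t and 1. *)
pose u := s * ((1 + r) / 2); pose v := (1 + t) / 2.
have us : u < s by rewrite /u gtr_pMr// ltr_pdivrMr; lra.
have u0 : 0 < u by rewrite /u mulr_gt0// divr_gt0; lra.
have tv : t < v by rewrite /v ltr_pdivlMr; lra.
have v1 : v < 1 by rewrite /v ltr_pdivrMr; lra.
pose c w := r * s * w^-1; pose c' w := r * s * (- w ^- 2).
pose rho := Num.max (2 * r / (1 + r)) v.
have rho1 : rho < 1.
  by rewrite gt_max v1 andbT ltr_pdivrMr; lra.
have w0 w : u < w < v -> 0 < w by move=> /andP[uw _]; apply: lt_trans uw.
have dc w : u < w < v -> is_derive w 1 c (c' w).
  move=> /w0 w_gt0; apply: is_deriveZ.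
  have := @is_deriveV R id w 1 1 (lt0r_neq0 w_gt0) (is_derive_id w 1).
  by move/is_derive_eq; apply; rewrite /GRing.scale /= mulr1.
have c0 w : 0 < w -> 0 <= c w by move=> w_gt0; rewrite /c !mulr_ge0 ?invr_ge0// ltW.
have cu w : u <= w -> c w <= 2 * r / (1 + r).
  move=> uw; have wp : 0 < w by apply: lt_le_trans uw.
  rewrite /c ler_pdivrMr//; apply: (@le_trans _ _ (2 * r / (1 + r) * u)); last first.
    by apply: ler_wpM2l => //; rewrite divr_ge0//; lra.
  by rewrite /u le_eqVlt; apply/orP; left; apply/eqP; field; lra.
have c1 w : u < w < v -> 0 <= c w < 1.
  move=> uv; rewrite c0 ?w0//=; apply: (le_lt_trans (cu w _)); first by case/andP: uv => /ltW.
  by rewrite ltr_pdivrMr; lra.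
have DBk : DB u v (fun w y => kk (c w) (dotp x y)) (fun w y => dkk (c w) (dotp x y) * c' w).
  apply: (@DB_kk R d u v c c' rho (r * s * u ^- 2)) => // w uv.
    rewrite ger0_norm; last by case/andP: (c1 w uv).
    by rewrite le_max cu//; case/andP: uv => /ltW.
  rewrite /c' normrM normrN !ger0_norm ?mulr_ge0 ?invr_ge0 ?exprn_ge0 ?(ltW s0) ?(ltW (w0 w uv))//.
  apply: ler_wpM2l; first by rewrite mulr_ge0// ltW.
  have wp := w0 w uv; rewrite lef_pV2 ?posrE ?exprn_gt0//.
  by apply: lerXn2r; rewrite ?nnegrE ?ltW//; case/andP: uv.
have DBp : DB u v (fun w y => pk w (dotp z y)) (fun w y => dpk w (dotp z y) * 1).
  apply: (@DB_pk R d u v (fun w => w) (fun=> 1) rho 1) => // w uv.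
    rewrite ger0_norm ?(ltW (w0 w uv))//.
    by rewrite le_max; apply/orP; right; case/andP: uv => _ /ltW.
  by rewrite normr1.
have := DB_mul DBk DBp; set F := (fun w y => _ * _); set F' := (fun w y => _ + _) => DBF.
have dF w : u < w < v -> is_derive w 1 (fun w => IS (F w)) (IS (F' w)).
  move=> uv; have := is_derive_DB DBF (L1S_cst 1) uv.
  have e (G : R -> E -> R) w' : IS (fun y => G w' y * 1) = IS (G w').
    by apply: eq_IS => y _; rewrite mulr1.
  by rewrite e (_ : (fun w' => _) = fun w' => IS (F w'))//; apply/funext => w'; exact: e.
have F'0 w : u < w < v -> IS (F' w) = 0.
  move=> uv; have w_gt0 := w0 w uv; have cw := c1 w uv.
  have ww : 0 < w < 1 by rewrite w_gt0 (lt_trans _ v1)//; case/andP: uv.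
  have cn := norm_lt1 cw.
  have wn : `|w| < 1 by apply: norm_lt1; case/andP: ww => /ltW -> ->.
  apply: (mulfI (lt0r_neq0 w_gt0)); rewrite mulr0.
  have b1 : BM (fun y => dkk (c w) (dotp x y) * pk w (dotp z y)).
    by apply: BM_mul; [exact: BM_dkk|exact: BM_pk].
  have b2 : BM (fun y => dpk w (dotp z y) * kk (c w) (dotp x y)).
    by apply: BM_mul; [exact: BM_dpk|exact: BM_kk].
  have bF' : BM (F' w).
    have -> : F' w = fun y => c' w * (dkk (c w) (dotp x y) * pk w (dotp z y)) + dpk w (dotp z y)
      * kk (c w) (dotp x y).
      by apply/funext => y; rewrite /F'; ring.
    by apply: BM_add => //; exact: BM_scale.
  rewrite -(IS_scale _ (BM_L1 bF')).
  rewrite (eq_IS (g := fun y => w * (dpk w (dotp z y) * kk (c w) (dotp x y)) - c w * (dkk (c w)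
    (dotp x y) * pk w (dotp z y)))); last first.
    by move=> y _; rewrite /F' /c' /c; field; rewrite gt_eqF.
  rewrite (IS_sub (L1S_Z _ (BM_L1 b2)) (L1S_Z _ (BM_L1 b1))).
  rewrite (IS_scale _ (BM_L1 b2)) (IS_scale _ (BM_L1 b1)) (IS_kk_dpk cw ww Sx Sz).
  rewrite (r_IS_dkk cn Sx (BM_L1 (BM_pk wn Sz))).
  have e1 : IS (fun y => pk w (dotp z y) * pk (c w) (dotp x y)) =
      IS (fun y => pk (c w) (dotp x y) * pk w (dotp z y)).
    by apply: eq_IS => y _; rewrite mulrC.
  have e2 : IS (fun y => pk w (dotp z y) * kk (c w) (dotp x y)) =
      IS (fun y => kk (c w) (dotp x y) * pk w (dotp z y)).
    by apply: eq_IS => y _; rewrite mulrC.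
  by rewrite e1 e2 subrr.
have : (fun w => IS (F w)) s = (fun w => IS (F w)) t.
  apply: (@is_derive0_cst R (fun w => IS (F w)) s t st) => [w /andP[sw wt]|].
    have uv : u < w < v by rewrite (lt_trans us sw) (lt_trans wt tv).
    by apply: (is_derive_eq (dF w uv)); exact: F'0.
  apply: continuous_in_subspaceT => w; rewrite inE /= in_itv/= => /andP[sw wt].
  have uv : u < w < v by rewrite (lt_le_trans us sw) (le_lt_trans wt tv).
  by apply: differentiable_continuous; apply/derivable1_diffP; case: (dF w uv).
have cs : c s = r by rewrite /c mulfK// gt_eqF.
by rewrite /F /= cs.
Qed.

End kernel_identities.

(** * The Poisson kernel as an approximate identity *)

Section approximate_identity.
Context {R : realType} {d : nat}.
Local Notation E := 'rV[R]_d.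
Local Notation S := (@sphere R d).
Hypothesis d3 : (3 <= d)%N.
Local Notation n := (d - 2)%N.
Local Notation kk := (kk d).
Local Notation pk := (pk d).
Local Notation W := (@sphere_area R d).
Implicit Types (x y z : E) (r s t : R).

(** This is |x - y| <= 2 |s x - y|, squared: both |s x - y| and 1 - s enter the triangle inequality,
    and 1 - s <= |s x - y|. *)
Lemma qs_cmp s t : 0 <= s <= 1 -> -1 <= t <= 1 -> 2 - 2 * t <= 4 * qs s t.
Proof.
move=> /andP[s0 s1] /andP[t0 t1]; rewrite -subr_ge0.
(* The difference is affine in [t] and is interpolated between its values at 1 and -1. *)
rewrite (_ : _ - _ = (1 + t) / 2 * (4 * (1 - s) ^+ 2) + (1 - t) / 2 * (4 * s ^+ 2 + 8 * s));
  last first.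
  by rewrite /qs; field.
by apply: addr_ge0; apply: mulr_ge0; do ?[lra|nra].
Qed.

Lemma qs1 t : qs 1 t = 2 - 2 * t :> R.
Proof. by rewrite /qs; ring. Qed.

Lemma qk_cmp s t : 0 <= s < 1 -> -1 <= t < 1 -> qk s t <= 2 * qk 1 t.
Proof.
move=> /andP[s0 s1] /andP[t0 t1].
have t01 : -1 <= t <= 1 by rewrite t0 ltW.
have q0 : 0 < qs s t by apply: qs_gt0 => //; rewrite ger0_norm.
have q1 : 0 < qs 1 t by rewrite qs1; lra.
have e : 2 = Num.sqrt (2 ^+ 2) :> R by rewrite sqrtr_sqr ger0_norm.
rewrite /qk ler_pdivlMr ?sqrtr_gt0// mulrC ler_pdivrMr ?sqrtr_gt0//.
rewrite e -sqrtrM// ler_wsqrtr// qs1; have := @qs_cmp s t; rewrite t01 s0 ltW// => /(_ isT isT).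
by rewrite (_ : 2 ^+ 2 = 4)//; ring.
Qed.

Lemma pk_ge0 r t : 0 <= r < 1 -> 0 <= pk r t.
Proof.
move=> /andP[r0 r1]; rewrite /pk mulr_ge0// ?exprn_ge0 ?qk_ge0//.
by rewrite subr_ge0 expr_le1// ltW.
Qed.

Lemma IS_pk r x : 0 <= r < 1 -> S x -> IS (fun y => pk r (dotp x y)) = W.
Proof. by move=> r1 Sx; rewrite IS_pk_kk// IS_kk. Qed.

(* AM-GM turns the Lipschitz bound into one by [e + |x - y|^2 / (4 e)], and
   [p_t |x - y|^2 <= 4 (1 - t^2) k_t]. *)
Lemma pk_approx t x L (h : E -> R) : 0 <= t < 1 -> S x -> 0 <= L -> measurable_fun setT h ->
  (forall y, S y -> `|h y - h x| <= L * enorm (x - y)) ->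
  `|IS (fun y => pk t (dotp x y) * h y) - W * h x| <= 2 * L * W * Num.sqrt (1 - t ^+ 2).
Proof.
move=> t1 Sx L0 mh hL; have /andP[t0 tl1] := t1.
have tn := norm_lt1 t1.
have e0 : 0 < 1 - t ^+ 2 by rewrite subr_gt0 expr_lt1.
set e := Num.sqrt _; have e1 : 0 < e by rewrite sqrtr_gt0.
have bp := BM_pk tn Sx; have bk := BM_kk tn Sx.
have bh : BM h.
  split=> //; exists (`|h x| + L * 2) => y Sy.
  rewrite -[h y](subrK (h x)) addrC; apply: le_trans (ler_normD _ _) _; rewrite lerD2l.
  apply: (le_trans (hL y Sy)); apply: ler_wpM2l => //.
  rewrite -(@ler_pXn2r _ 2)// ?nnegrE ?enorm_ge0// enorm_sub_sqr//.
  by have := dotp_geN1 Sx Sy; lra.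
have -> : W * h x = IS (fun y => pk t (dotp x y) * h x).
  by rewrite (IS_scaler _ (BM_L1 bp)) IS_pk// mulrC.
rewrite -(IS_sub (BM_L1 (BM_mul bp bh)) (BM_L1 (BM_mul bp (BM_cst _)))).
have -> : 2 * L * W * e = IS (fun y => (L * e) * pk t (dotp x y) + (L * e) * kk t (dotp x y)).
  rewrite (IS_add (L1S_Z _ (BM_L1 bp)) (L1S_Z _ (BM_L1 bk))).
  rewrite (IS_scale _ (BM_L1 bp)) (IS_scale _ (BM_L1 bk)) IS_pk// IS_kk//; ring.
apply: IS_norm_le => [||y Sy].
- by apply: BM_L1; apply: BM_sub; apply: BM_mul => //; exact: BM_cst.
- by apply: BM_L1; apply: BM_add; exact: BM_scale.
have txy := dotp_itv Sx Sy.
have p0 := pk_ge0 (dotp x y) t1.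
rewrite -mulrBr normrM (ger0_norm p0).
apply: (@le_trans _ _ (pk t (dotp x y) * (L * enorm (x - y)))).
  by apply: ler_wpM2l => //; exact: hL.
have amgm : enorm (x - y) <= e + (4 * e)^-1 * enorm (x - y) ^+ 2.
  rewrite -(@ler_pM2l _ (4 * e)) ?mulr_gt0// mulrDr mulrA mulfV ?mul1r;
    last by rewrite gt_eqF ?mulr_gt0.
  by have := sqr_ge0 (2 * e - enorm (x - y)); rewrite -subr_ge0; congr (_ <= _); ring.
have q0 := qs_sphere tn Sx Sy.
have h2 : pk t (dotp x y) * enorm (x - y) ^+ 2 <= 4 * e ^+ 2 * kk t (dotp x y).
  rewrite /pk (qk_expd (d_ge2 d3)) enorm_sub_sqr// (sqr_sqrtr (ltW e0)).
  rewrite (_ : 4 * _ * kk t (dotp x y) = (1 - t ^+ 2) * (qk t (dotp x y) ^+ n * qk t (dotp x y)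
    ^+ 2) * (4 * qs t (dotp x y))); last first.
    have := qk_sqr q0; rewrite /kk => qq; rewrite [RHS](_ : _ = 4 * (1 - t ^+ 2) * qk t (dotp x
      y) ^+ n * (qk t (dotp x y) ^+ 2 * qs t (dotp x y))); last by ring.
    by rewrite qq mulr1.
  apply: ler_wpM2l; first by rewrite !mulr_ge0 ?exprn_ge0 ?qk_ge0// ltW.
  by apply: qs_cmp => //; rewrite t0 ltW.
move: (pk t (dotp x y)) (kk t (dotp x y)) (enorm (x - y)) p0 amgm h2 => P K N p0 amgm h2.
rewrite mulrCA -!mulrA -mulrDr; apply: ler_wpM2l => //.
apply: (@le_trans _ _ (P * (e + (4 * e)^-1 * N ^+ 2))).
  exact: ler_wpM2l.
rewrite mulrDr mulrC lerD2l mulrCA -(@ler_pM2l _ (4 * e)) ?mulr_gt0//.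
rewrite !mulrA mulfV ?mul1r; last by rewrite gt_eqF ?mulr_gt0.
by move: h2; rewrite !expr2 !mulrA.
Qed.

(** Radii increasing to 1. The offset 2 keeps them at least 1/2, which allows division by them. *)
Definition rr (m : nat) : R := 1 - m.+2%:R^-1.

Lemma rr_itv m : 2^-1 <= rr m < 1.
Proof.
rewrite /rr ltrBlDr ltrDl invr_gt0 ltr0n /= andbT.
have : m.+2%:R^-1 <= 2^-1 :> R by rewrite lef_pV2 ?posrE// ler_nat.
by move: (m.+2%:R^-1) => a; lra.
Qed.

Lemma rr_itv0 m : 0 <= rr m < 1.
Proof. by case/andP: (rr_itv m) => h ->; rewrite andbT; lra. Qed.

Lemma rr_cvg : rr m @[m --> \oo] --> (1 : R).
Proof.
rewrite -[X in _ --> X]subr0; apply: cvgB; first exact: cvg_cst.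
by have := @cvg_harmonic R; rewrite -(cvg_shiftS (@harmonic R)).
Qed.

Lemma rr_cvg_cont (f : R -> R) : {for 1, continuous f} -> f (rr m) @[m --> \oo] --> f 1.
Proof. by move=> cf; apply: (cvg_comp rr f rr_cvg cf). Qed.

Lemma approx_identity x L (h : E -> R) : S x -> 0 <= L -> measurable_fun setT h ->
  (forall y, S y -> `|h y - h x| <= L * enorm (x - y)) ->
  IS (fun y => pk (rr m) (dotp x y) * h y) @[m --> \oo] --> W * h x.
Proof.
move=> Sx L0 mh hL.
apply/subr_cvg0/norm_cvg0P.
apply: (@squeeze_cvgr _ _ _ _ (fun=> 0) (fun m => 2 * L * W * Num.sqrt (1 - rr m ^+ 2))).
- by near=> m; rewrite normr_ge0/=; apply: pk_approx => //; exact: rr_itv0.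
- exact: cvg_cst.
- rewrite [X in _ --> X](_ : 0 = 2 * L * W * Num.sqrt (1 - 1 ^+ 2)); last first.
    by rewrite expr1n subrr sqrtr0 mulr0.
  apply: (@rr_cvg_cont (fun t => 2 * L * W * Num.sqrt (1 - t ^+ 2))).
  apply: cvgM; first exact: cvg_cst.
  apply: (@continuous_comp _ _ _ (fun t => 1 - t ^+ 2) (@Num.sqrt R)); last exact: sqrt_continuous.
  by apply: cvgB; [exact: cvg_cst|exact: exprn_continuous].
Unshelve. all: by end_near. Qed.

Lemma kk_lipschitz r t1 t2 : 0 <= r < 1 -> -1 <= t1 <= 1 -> -1 <= t2 <= 1 ->
  `|kk r t1 - kk r t2| <= n%:R * (1 - r)^-1 ^+ n.+2 * `|t1 - t2|.
Proof.
move=> rr0; have rn := norm_lt1 rr0; have /andP[r0 r1] := rr0.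
wlog t12 : t1 t2 / t1 < t2.
  move=> H h1 h2; have [t12|t12|->] := ltgtP t1 t2; last by rewrite !subrr normr0 mulr0.
    exact: H.
  by rewrite distrC (distrC t1); exact: H.
move=> /andP[a1 b1] /andP[a2 b2].
have dk t : t1 <= t <= t2 -> is_derive t 1 (kk r) (n%:R * r * qk r t ^+ n.+2).
  move=> /andP[h1 h2]; apply: is_derive_qk_t; apply: qs_gt0 => //.
  by rewrite (le_trans a1)//= (le_trans h2).
have [c ct E0] : exists2 c, c \in `]t1, t2[%R &
    kk r t2 - kk r t1 = n%:R * r * qk r c ^+ n.+2 * (t2 - t1).
  apply: MVT => // [t|]; first by rewrite in_itv/= => /andP[h1 h2]; apply: dk; rewrite !ltW.
  apply: continuous_in_subspaceT => t; rewrite inE /= in_itv/= => h.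
  by apply: differentiable_continuous; apply/derivable1_diffP; case: (dk t h).
rewrite distrC E0 (distrC t1) normrM ler_wpM2r// normrM ler_pM//.
  by rewrite normrM normr_nat ger0_norm// ler_piMr// ltW.
move: ct; rewrite in_itv/= => /andP[c1 c2].
have := qk_exp_bound n.+2 rn (t := c); rewrite (ger0_norm r0); apply.
by apply/andP; split; lra.
Qed.

Lemma dotp_le_enorm x z : S x -> `|dotp x z| <= enorm z.
Proof.
move=> Sx; have [->|z0] := eqVneq z 0.
  by rewrite /dotp big1 ?normr0 ?enorm_ge0// => i _; rewrite mxE mulr0.
rewrite -{1}(enorm_unitvK z) dotpZr normrM ger0_norm ?enorm_ge0//.
by rewrite ler_piMr ?enorm_ge0// dotp_norm_le1//; exact: sphere_unitv.
Qed.

(** By [kk_pk_shift] the second radius may be moved up to 1, where the Poisson kernel concentrates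
    at [z] while the first radius tends to r s. The first radii never exceed r, so one Lipschitz
    constant serves them all. *)
Lemma IS_kk_pk r s x z : 0 <= r < 1 -> 0 <= s < 1 -> S x -> S z ->
  IS (fun y => kk r (dotp x y) * pk s (dotp z y)) = W * kk (r * s) (dotp x z).
Proof.
move=> rr0 /andP[s0 s1] Sx Sz; have /andP[r0 r1] := rr0.
have [->|sn0] := eqVneq s 0.
  rewrite mulr0 kk0 mulr1 -(IS_kk d3 rr0 Sx).
  by apply: eq_IS => y _; rewrite pk0 mulr1.
have sgt0 : 0 < s by rewrite lt_def sn0.
set A := IS _; pose a m := W * kk (r * s / rr m) (dotp x z).
pose L : R := n%:R * (1 - r)^-1 ^+ n.+2.
have p1 : 0 < 1 - r by rewrite subr_gt0.
have L0 : 0 <= L by rewrite mulr_ge0// exprn_ge0// invr_ge0 ltW.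
have bnd m : s <= rr m -> `|A - a m| <= 2 * L * W * Num.sqrt (1 - rr m ^+ 2).
  move=> sm; have /andP[m0 m1] := rr_itv m.
  rewrite /A (kk_pk_shift d3 rr0 sgt0 sm m1 Sx Sz).
  rewrite (eq_IS (g := fun y => pk (rr m) (dotp z y) * kk (r * s / rr m) (dotp x y))); last first.
    by move=> y _; rewrite mulrC.
  have mp : 0 < rr m by lra.
  have q0 : 0 <= r * s / rr m by rewrite !mulr_ge0// invr_ge0 ltW.
  have q1 : r * s / rr m <= r.
    by rewrite -mulrA ler_piMr// ler_pdivrMr// mul1r.
  have qq : 0 <= r * s / rr m < 1 by rewrite q0 (le_lt_trans q1).
  apply: (@pk_approx (rr m) z L (fun y => kk (r * s / rr m) (dotp x y))) => //.
  - exact: rr_itv0.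
  - by case: (BM_kk (norm_lt1 qq) Sx).
  - move=> y Sy; apply: le_trans (kk_lipschitz qq (dotp_itv Sx Sy) (dotp_itv Sx Sz)) _.
    have p2 : 0 < 1 - r * s / rr m by rewrite subr_gt0 (le_lt_trans q1).
    have K1 : n%:R * (1 - r * s / rr m)^-1 ^+ n.+2 <= L.
      rewrite /L; move: n.+2 => k; apply: ler_wpM2l => //.
      apply: lerXn2r; rewrite ?nnegrE ?invr_ge0 ?(ltW p1) ?(ltW p2)//.
      by rewrite lef_pV2 ?posrE// lerD2l lerN2.
    apply: ler_pM K1 _ => //.
      by move: n.+2 => k; rewrite mulr_ge0// exprn_ge0// invr_ge0 ltW.
    by rewrite -dotpBr enormB; exact: dotp_le_enorm.
have c1 : a m @[m --> \oo] --> A.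
  apply/subr_cvg0/norm_cvg0P.
  apply: (@squeeze_cvgr _ _ _ _ (fun=> 0) (fun m => 2 * L * W * Num.sqrt (1 - rr m ^+ 2))).
  - near=> m; rewrite normr_ge0/= distrC; apply: bnd; near: m.
    apply: filterS (cvgr_gt _ rr_cvg _ s1) => m; exact: ltW.
  - exact: cvg_cst.
  - rewrite [X in _ --> X](_ : 0 = 2 * L * W * Num.sqrt (1 - 1 ^+ 2)); last first.
      by rewrite expr1n subrr sqrtr0 mulr0.
    apply: (@rr_cvg_cont (fun t => 2 * L * W * Num.sqrt (1 - t ^+ 2))).
    apply: cvgM; first exact: cvg_cst.
    apply: (@continuous_comp _ _ _ (fun t => 1 - t ^+ 2) (@Num.sqrt R));
      last exact: sqrt_continuous.
    by apply: cvgB; [exact: cvg_cst|exact: exprn_continuous].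
have rs1 : `|r * s| < 1 by rewrite normrM !ger0_norm// mulr_ilt1.
have c2 : a m @[m --> \oo] --> W * kk (r * s) (dotp x z).
  rewrite -[X in _ --> _ * kk X _]divr1.
  apply: (@rr_cvg_cont (fun t => W * kk (r * s / t) (dotp x z))).
  apply: cvgM; first exact: cvg_cst.
  apply: (@continuous_comp _ _ _ (fun t => r * s / t) (fun q => kk q (dotp x z))).
    by apply: cvgM; [exact: cvg_cst|apply: cvgV => //; exact: oner_neq0].
  apply: differentiable_continuous; apply/derivable1_diffP; rewrite divr1.
  by case: (is_derive_kk d (qs_sphere rs1 Sx Sz)).
exact: (cvg_unique _ c1 c2).
Unshelve. all: by end_near. Qed.

End approximate_identity.

(** * The singular kernel at radius 1 *)

Section singular_kernel.
Context {R : realType} {d : nat}.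
Local Notation E := 'rV[R]_d.
Local Notation S := (@sphere R d).
Local Notation mu := (@omega R d).
Hypothesis d3 : (3 <= d)%N.
Local Notation n := (d - 2)%N.
Local Notation kk := (kk d).
Local Notation pk := (pk d).
Local Notation dkk := (dkk d).
Local Notation beta := (@beta R d).
Local Notation W := (@sphere_area R d).
Implicit Types (x y z : E) (r s t : R).

Lemma norm_mul_lt1 r s : 0 <= r < 1 -> 0 <= s < 1 -> 0 <= r * s < 1.
Proof.
move=> /andP[r0 r1] /andP[s0 s1]; rewrite mulr_ge0//=.
exact: mulr_ilt1.
Qed.

Lemma IS_dkk_pk r s x z : 0 < r < 1 -> 0 <= s < 1 -> S x -> S z ->
  IS (fun y => dkk r (dotp x y) * pk s (dotp z y)) = W * (s * dkk (r * s) (dotp x z)).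
Proof.
move=> /andP[r0 r1] s1 Sx Sz.
have rr : 0 <= r < 1 by rewrite ltW.
have Lp := BM_L1 (BM_pk (norm_lt1 s1) Sz).
have d1 := is_derive_IS_kk (norm_lt1 rr) Sx Lp.
have ds : is_derive r 1 (fun r => r * s) s.
  have := is_deriveM (is_derive_id r 1) (is_derive_cst s r 1).
  by move/is_derive_eq; apply; rewrite scaler0 add0r /GRing.scale /= mulr1.
have q0 := qs_sphere (norm_lt1 (norm_mul_lt1 rr s1)) Sx Sz.
have d2 := is_deriveZ W (@is_derive1_comp R (fun q => kk q (dotp x z)) (fun r =>
  r * s) r _ _ (is_derive_kk d q0) ds).
rewrite -(@derive_val _ _ _ _ _ _ _ d1).
transitivity ('D_1 (fun r => W * kk (r * s) (dotp x z)) r); last first.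
  rewrite (@derive_val _ _ _ _ _ _ _ d2).
  by rewrite [in RHS](mulrC s).
apply: near_eq_derive; near=> t; apply: IS_kk_pk => //; apply/andP; split.
  by apply/ltW; near: t; exact: lt_nbhsr.
by near: t; exact: lt_nbhsl.
Unshelve. all: by end_near. Qed.

(** The relation r d/dr k_r = beta (p_r - k_r), applied to both sides of [IS_kk_pk]. *)
Lemma IS_pk_pk r s x z : 0 <= r < 1 -> 0 <= s < 1 -> S x -> S z ->
  IS (fun y => pk r (dotp x y) * pk s (dotp z y)) = W * pk (r * s) (dotp x z).
Proof.
move=> rr s1 Sx Sz; have [r0|r0] := eqVneq r 0.
  rewrite r0 mul0r pk0 mulr1 -(IS_pk d3 s1 Sz).
  by apply: eq_IS => y _; rewrite pk0 mul1r.
have rgt0 : 0 < r by case/andP: rr => h _; rewrite lt_def r0.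
have r01 : 0 < r < 1 by case/andP: rr => _ ->; rewrite rgt0.
have Lp := BM_L1 (BM_pk (norm_lt1 s1) Sz).
have := r_IS_dkk d3 (norm_lt1 rr) Sx Lp; rewrite IS_dkk_pk// IS_kk_pk//.
have rs := norm_lt1 (norm_mul_lt1 rr s1).
have := r_dkk (d_ge2 d3) (qs_sphere rs Sx Sz).
move: (dkk _ _) (pk (r * s) _) (kk _ _) (IS _) => a b c A h1 h2.
apply: (mulfI (lt0r_neq0 (@beta_gt0 R d d3))).
have {}h2 : beta * A = W * (r * s * a) + beta * (W * c).
  by apply/eqP; rewrite -subr_eq; apply/eqP; rewrite -mulrBr -h2; ring.
by rewrite h2 h1; ring.
Qed.

Lemma IS_indic (A : set E) : measurable A -> A `<=` S -> IS (\1_A : E -> R) = fine (mu A).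
Proof.
move=> mA AS; rewrite ISE /Rintegral integral_indic//; last exact: measurable_sphere.
by rewrite setIidl.
Qed.

(** At y = x the kernel k_r has the value (1 - r)^(2-d), while its integral is W for every r. So the
    mass of the point is at most W (1 - r)^(d-2). *)
Lemma omega_set1 x : S x -> mu [set x] = 0.
Proof.
move=> Sx; have mx := measurable_rV_set1 x.
have fx : mu [set x] \is a fin_num by apply: fin_num_measure.
suff e0 : fine (mu [set x]) = 0 by rewrite -(fineK fx) e0.
set c := fine _; have c0 : 0 <= c by rewrite fine_ge0.
have bnd r : 0 <= r < 1 -> c <= W * (1 - r) ^+ n.
  move=> r1; have /andP[r0 rl1] := r1; have p1 : 0 < 1 - r by rewrite subr_gt0.
  rewrite -ler_pdivrMr ?exprn_gt0// -(IS_kk d3 r1 Sx).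
  have bI : BM (\1_[set x] : E -> R).
    split; first exact: measurable_indic.
    by exists 1 => y _; rewrite indicE ger0_norm// lern1 leq_b1.
  have -> : c / (1 - r) ^+ n = IS (fun y => (1 - r) ^- n * \1_[set x] y).
    by rewrite (IS_scale _ (BM_L1 bI)) IS_indic// 1?mulrC// => _ ->.
  apply: IS_le => [||y Sy]; first exact: BM_L1 (BM_scale _ bI).
    exact: BM_L1 (BM_kk (norm_lt1 r1) Sx).
  rewrite indicE; have [|_] := boolP (y \in [set x]); last by rewrite mulr0 exprn_ge0// qk_ge0.
  rewrite inE => ->; rewrite mulr1 /kk dotp_sphere// /qk.
  rewrite (_ : qs r 1 = (1 - r) ^+ 2); last by rewrite /qs; ring.
  by rewrite sqrtr_sqr (ger0_norm (ltW p1)) exprVn.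
have : c <= W * (1 - 1) ^+ n.
  apply: (@cvgr_to_ge _ \oo _ _ (fun m => W * (1 - rr m) ^+ n)); last first.
    by near=> m; apply: bnd; exact: rr_itv0.
  apply: (@rr_cvg_cont _ (fun t => W * (1 - t) ^+ n)).
  apply: cvgM; first exact: cvg_cst.
  apply: (@continuous_comp _ _ _ (fun t => 1 - t) (fun t => t ^+ n)); last exact: exprn_continuous.
  by apply: cvgB; [exact: cvg_cst|exact: cvg_id].
by rewrite subrr expr0n subn_eq0 leqNgt d3 mulr0 => h; apply/eqP; rewrite eq_le h c0.
Unshelve. all: by end_near. Qed.

Lemma kk1_ge0 t : 0 <= kk 1 t.
Proof. by rewrite exprn_ge0// qk_ge0. Qed.

Lemma rr_norm m : `|rr m| < 1 :> R.
Proof. exact/norm_lt1/rr_itv0. Qed.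

Lemma qk_cvg k t : -1 <= t < 1 -> qk (rr m) t ^+ k @[m --> \oo] --> qk 1 t ^+ k.
Proof.
move=> /andP[t0 t1]; apply: (@rr_cvg_cont _ (fun r => qk r t ^+ k)).
apply: differentiable_continuous; apply/derivable1_diffP.
have q0 : 0 < qs 1 t by rewrite qs1; lra.
by case: (is_derive_qk_r k q0).
Qed.

Lemma kk_cvg t : -1 <= t < 1 -> kk (rr m) t @[m --> \oo] --> kk 1 t.
Proof. exact: qk_cvg. Qed.

Lemma kk_cmp s t : 0 <= s < 1 -> -1 <= t < 1 -> kk s t <= 2 ^+ n * kk 1 t.
Proof.
move=> s1 t1; rewrite /kk -exprMn; apply: lerXn2r; rewrite ?nnegrE ?qk_ge0 ?mulr_ge0 ?qk_ge0//.
exact: qk_cmp.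
Qed.

Lemma dotp_lt1 x y : S x -> S y -> y <> x -> -1 <= dotp x y < 1.
Proof.
move=> Sx Sy yx; rewrite dotp_geN1//= lt_neqAle dotp_le1// andbT.
by apply/negP => /eqP/(dotp_eq1 Sx Sy)/esym.
Qed.

Lemma ae_neq x : S x -> {ae mu, forall y, S y -> -1 <= dotp x y < 1}.
Proof.
move=> Sx; exists [set x]; split; [exact: measurable_rV_set1|exact: omega_set1|].
move=> y /= h; apply: contrapT => yx; apply: h => Sy; exact: dotp_lt1.
Qed.

(** Fatou's lemma for r tending to 1, as each k_r has integral W. Convergence fails only at the null
    set y = x, where [kk 1 1] is 0 because the inverse of 0 is 0. *)
Lemma kk1_L1 x : S x -> L1S (fun y => kk 1 (dotp x y)) /\ IS (fun y => kk 1 (dotp x y)) <= W.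
Proof.
move=> Sx; apply: (@IS_fatou_ae R d (fun m y => kk (rr m) (dotp x y))).
- by move=> m; exact: BM_L1 (BM_kk (rr_norm m) Sx).
- by move=> m y Sy; rewrite exprn_ge0// qk_ge0.
- by apply: measurable_funX; apply: measurable_qk; [exact: measurable_cst|exact: measurable_dotpr].
- by move=> y _; exact: kk1_ge0.
- by apply: filterS (ae_neq Sx) => y h Sy; exact/kk_cvg/h.
- by move=> m; rewrite (IS_kk d3)//; exact: rr_itv0.
Qed.

Lemma measurable_kernel (k : R -> R) : measurable_fun setT k ->
  measurable_fun setT (fun w : E * E => k (dotp w.1 w.2)).
Proof.
move=> mk; apply: (measurableT_comp mk).
by apply: measurable_dotp2; [exact: measurable_fst|exact: measurable_snd].
Qed.

Lemma measurable_qk_exp r k : measurable_fun setT (fun t => qk r t ^+ k).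
Proof. by apply: measurable_funX; apply: measurable_qk;
  [exact: measurable_cst|exact: measurable_id]. Qed.

Lemma measurable_pk r : measurable_fun setT (pk r).
Proof. by apply: measurable_funM; [exact: measurable_cst|exact: measurable_qk_exp]. Qed.

Lemma schur_kk1 : schurS (fun x y => kk 1 (dotp x y)).
Proof.
split; first exact: (measurable_kernel (measurable_qk_exp 1 n)).
  by move=> x y _ _; rewrite dotpC.
exists W => x Sx; have [L1k kW] := kk1_L1 Sx; split=> //.
by apply: le_trans kW; rewrite le_eqVlt; apply/orP; left; apply/eqP/eq_IS => y _;
  rewrite ger0_norm// kk1_ge0.
Qed.

Lemma schur_zonal (k : R -> R) M : measurable_fun setT k -> (forall t, -1 <= t <= 1 ->
  `|k t| <= M) ->
  schurS (fun x y => k (dotp x y)).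
Proof.
move=> mk kM; apply: (@schurS_bounded R d M); first exact: measurable_kernel.
  by move=> x y _ _; rewrite dotpC.
by move=> x y Sx Sy; apply: kM; exact: dotp_itv.
Qed.

Lemma schur_kk r : `|r| < 1 -> schurS (fun x y => kk r (dotp x y)).
Proof.
move=> r1; apply: (@schur_zonal (kk r) ((1 - `|r|)^-1 ^+ n)) => [|t t1].
  exact: measurable_qk_exp.
exact: qk_exp_bound.
Qed.

Lemma schur_pk r : `|r| < 1 -> schurS (fun x y => pk r (dotp x y)).
Proof.
move=> r1; apply: (@schur_zonal (pk r) (`|1 - r ^+ 2| * (1 - `|r|)^-1 ^+ d)) => [|t t1].
  exact: measurable_pk.
by rewrite normrM ler_wpM2l//; exact: qk_exp_bound.
Qed.

End singular_kernel.

(** * Layer operators *)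

Section layer_operators.
Context {R : realType} {d : nat}.
Local Notation E := 'rV[R]_d.
Local Notation S := (@sphere R d).
Local Notation mu := (@omega R d).
Hypothesis d3 : (3 <= d)%N.
Local Notation n := (d - 2)%N.
Local Notation kk := (kk d).
Local Notation pk := (pk d).
Local Notation dpk := (dpk d).
Local Notation beta := (@beta R d).
Local Notation W := (@sphere_area R d).
Implicit Types (x y z : E) (r s t : R) (f g phi : E -> R).

Definition Tk r f x : R := OpS (fun x y => kk r (dotp x y)) f x.
Definition Pk r f x : R := OpS (fun x y => pk r (dotp x y)) f x.

Lemma measurable_kk r : measurable_fun setT (kk r).
Proof. exact: measurable_qk_exp. Qed.

Lemma measurable_dpk r : measurable_fun setT (dpk r).
Proof.
have mq k : measurable_fun setT (fun t => qk r t ^+ k) by exact: measurable_qk_exp.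
apply: measurable_funD; first by apply: measurable_funM; [exact: measurable_cst|exact: mq].
apply: measurable_funM; first exact: measurable_cst.
apply: measurable_funM; last exact: mq.
apply: measurable_funM; first exact: measurable_cst.
by apply: measurable_funB; [exact: measurable_id|exact: measurable_cst].
Qed.

(* The dominating kernel is [2^(d-2) k_1]. *)
Lemma IS_kk_cvg x f : S x -> measurable_fun setT f -> L1S (fun y => kk 1 (dotp x y) * f y) ->
  IS (fun y => kk (rr m) (dotp x y) * f y) @[m --> \oo] --> IS (fun y => kk 1 (dotp x y) * f y).
Proof.
move=> Sx mf Lf.
have mk r : measurable_fun setT (fun y => kk r (dotp x y) * f y).
  apply: measurable_funM => //.
  exact: (measurableT_comp (measurable_kk r) (measurable_dotpr x)).
(* At y = x the domination fails, because [kk 1 1] is 0 by convention; the truncation removes this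
   null set. *)
pose F m y : R := if dotp x y < 1 then kk (rr m) (dotp x y) * f y else 0.
have aeF m : {ae mu, forall y, S y -> F m y = kk (rr m) (dotp x y) * f y}.
  by apply: filterS (ae_neq d3 Sx) => y h /h /andP[_ h1]; rewrite /F h1.
have mF m : measurable_fun setT (F m).
  apply: measurable_fun_if => //.
  - apply: measurable_fun_ltr; [exact: measurable_dotpr|exact: measurable_cst].
  - exact: measurable_funS (mk (rr m)).
have bF m y : S y -> `|F m y| <= 2 ^+ n * `|kk 1 (dotp x y) * f y|.
  move=> Sy; rewrite /F; case: ifPn => [h1|_]; last first.
    by rewrite normr0 mulr_ge0// exprn_ge0.
  have k0 r : 0 <= kk r (dotp x y) by rewrite exprn_ge0// qk_ge0.
  rewrite !normrM !(ger0_norm (k0 _)) mulrA ler_wpM2r//.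
  apply: kk_cmp => //; first exact: rr_itv0.
  by rewrite dotp_geN1.
have LF : L1S (fun y => 2 ^+ n * `|kk 1 (dotp x y) * f y|).
  by apply: L1S_Z; exact: L1S_norm.
have LFm m : L1S (F m).
  apply: (L1S_le (mF m) LF) => y Sy; rewrite [leRHS]ger0_norm ?bF//.
have e m : IS (fun y => kk (rr m) (dotp x y) * f y) = IS (F m).
  apply: IS_ae_eq => //.
    apply: (L1S_le_ae (mk _) LF); apply: filterS2 (aeF m) (aeF m) => y h1 h2 Sy.
    by rewrite -h1// bF.
  by apply: filterS (aeF m) => y h Sy; rewrite h.
under eq_fun do rewrite e.
apply: (IS_dominated_ae mF (mk 1) LF _ bF).
apply: filterS (ae_neq d3 Sx) => y h Sy; have /andP[h0 h1] := h Sy.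
rewrite /F; under eq_fun do rewrite h1.
by apply: cvgM; [apply: kk_cvg; rewrite h0|exact: cvg_cst].
Qed.

Lemma kk1_bounded_L1 x f : S x -> BM f -> L1S (fun y => kk 1 (dotp x y) * f y).
Proof.
move=> Sx bf; have [L1k _] := kk1_L1 d3 Sx.
have := BM_mul_L1 bf L1k.
by congr L1S; apply/funext => y; rewrite mulrC.
Qed.

Lemma IS_kk1_pk r x z : 0 <= r < 1 -> S x -> S z ->
  IS (fun y => kk 1 (dotp x y) * pk r (dotp z y)) = W * kk r (dotp x z).
Proof.
move=> r1 Sx Sz; have bp := BM_pk (norm_lt1 r1) Sz.
have c1 := IS_kk_cvg Sx (proj1 bp) (kk1_bounded_L1 Sx bp).
have c2 : IS (fun y => kk (rr m) (dotp x y) * pk r (dotp z y)) @[m --> \oo] -->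
  W * kk (1 * r) (dotp x z).
  under eq_fun => m do rewrite (IS_kk_pk d3 (rr_itv0 m) r1 Sx Sz).
  apply: (@rr_cvg_cont _ (fun t => W * kk (t * r) (dotp x z))).
  apply: cvgM; first exact: cvg_cst.
  apply: (@continuous_comp _ _ _ (fun t => t * r) (fun q => kk q (dotp x z))).
    by apply: cvgM; [exact: cvg_id|exact: cvg_cst].
  apply: differentiable_continuous; apply/derivable1_diffP; rewrite mul1r.
  by case: (is_derive_kk d (qs_sphere (norm_lt1 r1) Sx Sz)).
by rewrite -[in RHS](mul1r r); exact: (cvg_unique _ c1 c2).
Qed.

Lemma IS_kk1_dpk r x z : 0 < r < 1 -> S x -> S z ->
  IS (fun y => kk 1 (dotp x y) * (r * dpk r (dotp z y))) =
  beta * W * (pk r (dotp x z) - kk r (dotp x z)).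
Proof.
move=> r01 Sx Sz; have r1 : 0 <= r < 1 by case/andP: r01 => /ltW -> ->.
have bp := BM_scale r (BM_dpk (norm_lt1 r1) Sz).
have c1 := IS_kk_cvg Sx (proj1 bp) (kk1_bounded_L1 Sx bp).
pose A t := pk (r * t) (dotp z x) - kk (r * t) (dotp z x).
have c2 : IS (fun y => kk (rr m) (dotp x y) * (r * dpk r (dotp z y))) @[m --> \oo]
    --> beta * W * A 1.
  have e m : IS (fun y => kk (rr m) (dotp x y) * (r * dpk r (dotp z y))) = beta * W * A (rr m).
    have m1 := rr_itv0 (R := R) m; have mn := norm_lt1 m1.
    have bb : BM (fun y => dpk r (dotp z y) * kk (rr m) (dotp x y)).
      by apply: BM_mul; [apply: BM_dpk => //; exact: norm_lt1|exact: BM_kk].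
    rewrite (eq_IS (g := fun y => r * (dpk r (dotp z y) * kk (rr m) (dotp x y)))); last first.
      by move=> y _; ring.
    rewrite (IS_scale _ (BM_L1 bb)) (IS_kk_dpk d3 m1 r01 Sx Sz) (IS_pk_pk d3 r1 m1 Sz Sx).
    rewrite (eq_IS (f := fun y => pk r _ * _) (g := fun y =>
      kk (rr m) (dotp x y) * pk r (dotp z y))); last first.
      by move=> y _; rewrite mulrC.
    by rewrite (IS_kk_pk d3 m1 r1 Sx Sz) /A (mulrC (rr m)) (dotpC x z); ring.
  under eq_fun => m do rewrite e.
  apply: (@rr_cvg_cont _ (fun t => beta * W * A t)).
  apply: cvgM; first exact: cvg_cst.
  have rc : {for 1, continuous (fun t : R => r * t)} by apply: cvgM; [exact: cvg_cst|exact: cvg_id].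
  have q0 := qs_sphere (norm_lt1 r1) Sz Sx.
  apply: cvgB.
    apply: (@continuous_comp _ _ _ (fun t => r * t) (fun q => pk q (dotp z x)) _ rc).
    apply: differentiable_continuous; apply/derivable1_diffP; rewrite mulr1.
    by case: (is_derive_pk d q0).
  apply: (@continuous_comp _ _ _ (fun t => r * t) (fun q => kk q (dotp z x)) _ rc).
  apply: differentiable_continuous; apply/derivable1_diffP; rewrite mulr1.
  by case: (is_derive_kk d q0).
transitivity (beta * W * A 1); first exact: (cvg_unique _ c1 c2).
by rewrite /A mulr1 dotpC.
Qed.

Section pairing.
Variables (g phi : E -> R) (r e : R).
Hypotheses (Lg : L2S g) (sphi : RS phi) (r01 : 0 < r < 1) (e1 : e ^+ 2 = 1).

Let r1 : 0 <= r < 1. Proof. by case/andP: r01 => /ltW -> ->. Qed.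
Let rn : `|r| < 1. Proof. exact: norm_lt1. Qed.
Let bphi : BM phi. Proof. exact: BM_RS. Qed.

(** The second summand is chosen so that in [pairing_qkernel] the terms with P_r phi and T_r phi
    cancel for both signs of [e]. *)
Definition qkernel t := r * dpk r t + (1 - e) * beta * pk r t.

Let mq : measurable_fun setT qkernel.
Proof.
apply: measurable_funD; apply: measurable_funM => //; first exact: measurable_dpk.
exact: measurable_pk.
Qed.

Lemma BM_qkernel x : S x -> BM (fun y => qkernel (dotp x y)).
Proof. by move=> Sx; apply: BM_add; apply: BM_scale; [exact: BM_dpk|exact: BM_pk]. Qed.

Lemma dpk_bounded : exists M, forall t, -1 <= t <= 1 -> `|dpk r t| <= M.
Proof.
exists (`|2 * r| * (1 - `|r|)^-1 ^+ d + `|1 - r ^+ 2| * (d%:R * (1 + `|r|) * (1 - `|r|)^-1 ^+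
  d.+2)).
move=> t t1; apply: le_trans (ler_normD _ _) _; rewrite 2!normrM normrN.
apply: lerD; first by apply: ler_wpM2l => //; exact: qk_exp_bound.
apply: ler_wpM2l => //; rewrite 2!normrM; apply: ler_pM => //; last exact: qk_exp_bound.
rewrite normr_nat; apply: ler_wpM2l => //.
by apply: le_trans (ler_normB _ _) _; rewrite lerD2r ler_norml.
Qed.

Lemma qkernel_bounded : exists M, forall x y, S x -> S y -> `|qkernel (dotp x y)| <= M.
Proof.
have [M HM] := dpk_bounded.
exists (`|r| * M + `|(1 - e) * beta| * (`|1 - r ^+ 2| * (1 - `|r|)^-1 ^+ d)) => x y Sx Sy.
have txy := dotp_itv Sx Sy.
apply: le_trans (ler_normD _ _) _; rewrite (normrM r) (normrM (_ * _)).
apply: lerD; apply: ler_wpM2l => //; first exact: HM.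
by rewrite /pk normrM; apply: ler_wpM2l => //; exact: qk_exp_bound.
Qed.

Let schurq : schurS (fun x y => qkernel (dotp x y)).
Proof.
have [M HM] := qkernel_bounded; apply: (@schurS_bounded R d M) => //.
  exact: measurable_kernel.
by move=> x y _ _; rewrite dotpC.
Qed.

Let D x : R := OpS (fun x y => qkernel (dotp x y)) phi x.

(* By [lap_kk], the kernel [r dp_r/dr] is [- lap k_r / beta - beta (p_r - k_r)]. *)
Lemma qkernel_lap x : S x -> beta * D x =
  - (Tk r (lap phi) x) - beta ^+ 2 * (Pk r phi x - Tk r phi x)
  + (1 - e) * beta ^+ 2 * Pk r phi x.
Proof.
move=> Sx; have sk := RS_kk rn Sx.
have bl := BM_RS (RS_mul (RS_lap sk) sphi).
have bp := BM_mul (BM_pk rn Sx) bphi; have bk := BM_mul (BM_kk rn Sx) bphi.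
have G := Green2 sk sphi.
have -> : Tk r (lap phi) x = IS (fun y => lap (fun y => kk r (td x y)) y * phi y).
  by rewrite -G; apply: eq_IS => y Sy; rewrite tdE// dotpC.
rewrite /Pk /Tk /D /OpS -(IS_sub (BM_L1 bp) (BM_L1 bk)).
rewrite -(IS_scale _ (BM_L1 (BM_sub bp bk))) -(IS_scale _ (BM_L1 bp)) -(IS_opp (BM_L1 bl)).
rewrite -(IS_scale _ (BM_L1 (BM_mul (BM_qkernel Sx) bphi))).
rewrite -(IS_sub (BM_L1 (BM_opp bl)) (BM_L1 (BM_scale _ (BM_sub bp bk)))).
rewrite -(IS_add (BM_L1 (BM_sub (BM_opp bl) (BM_scale _ (BM_sub bp bk)))) (BM_L1 (BM_scale _ bp))).
apply: eq_IS => y Sy; rewrite (lap_kk d3 rn Sx Sy) (dotpC y) /qkernel; ring.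
Qed.

Lemma Tk1_qkernel x : S x -> OpS (fun x y => kk 1 (dotp x y)) D x =
  beta * W * (Pk r phi x - Tk r phi x) + (1 - e) * beta * W * Tk r phi x.
Proof.
move=> Sx; have [M HM] := qkernel_bounded.
have [L1k _] := kk1_L1 d3 Sx.
have -> : OpS (fun x y => kk 1 (dotp x y)) D x =
    IS (fun z => IS (fun y => kk 1 (dotp x y) * qkernel (dotp y z)) * phi z).
  exact: (@OpS_comp_bounded _ _ (fun x y => kk 1 (dotp x y)) (fun x y =>
    qkernel (dotp x y)) _ _ _ Sx L1k (measurable_kernel mq) HM (BM_L1 bphi)).
have bp := BM_mul (BM_pk rn Sx) bphi; have bk := BM_mul (BM_kk rn Sx) bphi.
rewrite /Pk /Tk /OpS -(IS_sub (BM_L1 bp) (BM_L1 bk)) -(IS_scale _ (BM_L1 (BM_sub bp bk))).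
rewrite -(IS_scale _ (BM_L1 bk)) -(IS_add (BM_L1 (BM_scale _ (BM_sub bp bk))) (BM_L1 (BM_scale _
  bk))).
apply: eq_IS => z Sz.
have b1 := BM_scale r (BM_dpk rn Sz); have b2 := BM_pk rn Sz.
rewrite (eq_IS (g := fun y => kk 1 (dotp x y) * (r * dpk r (dotp z y)) + (1 - e) * beta * (kk 1
  (dotp x y) * pk r (dotp z y)))); last first.
  by move=> y _; rewrite /qkernel (dotpC y z); ring.
rewrite (IS_add (kk1_bounded_L1 Sx b1) (L1S_Z _ (kk1_bounded_L1 Sx b2))).
rewrite (IS_scale _ (kk1_bounded_L1 Sx b2)) IS_kk1_dpk// IS_kk1_pk//.
ring.
Qed.

(** By symmetry of T the pairing is that of g with T D + e W D. Here T D = beta W (P_r - e T_r) phi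
    and beta D = - T_r (lap phi) - beta^2 (e P_r - T_r) phi, so that e^2 = 1 leaves only the term
    with lap phi. *)
Lemma pairing_qkernel :
  beta * IS (fun x => (Tk 1 g x + e * W * g x) * D x) =
  - (e * W * IS (fun x => g x * Tk r (lap phi) x)).
Proof.
have LD : L2S D by apply: OpS_L2 schurq (BM_L2 bphi).
have LT : L2S (Tk 1 g) := OpS_L2 (schur_kk1 d3) Lg.
have LP : L2S (Pk r phi) := OpS_L2 (schur_pk rn) (BM_L2 bphi).
have LK : L2S (Tk r phi) := OpS_L2 (schur_kk rn) (BM_L2 bphi).
have LL : L2S (Tk r (lap phi)) := OpS_L2 (schur_kk rn) (L2S_RS (RS_lap sphi)).
have LTD : L2S (OpS (fun x y => kk 1 (dotp x y)) D) := OpS_L2 (schur_kk1 d3) LD.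
rewrite (eq_IS (g := fun x => Tk 1 g x * D x + e * W * (g x * D x))); last by move=> x _; ring.
rewrite (IS_add (L2S_mul LT LD) (L1S_Z _ (L2S_mul Lg LD))) (IS_scale _ (L2S_mul Lg LD)).
rewrite -(OpS_sym (schur_kk1 d3) Lg LD) mulrDr -(IS_scale _ (L2S_mul Lg LTD)).
have LgP := L2S_mul Lg LP; have LgK := L2S_mul Lg LK; have LgL := L2S_mul Lg LL.
have h1 : IS (fun x => beta * (g x * OpS (fun x y => kk 1 (dotp x y)) D x)) =
    beta * (beta * W * (IS (fun x => g x * Pk r phi x) - IS (fun x => g x * Tk r phi x))
    + (1 - e) * beta * W * IS (fun x => g x * Tk r phi x)).
  rewrite -(IS_sub LgP LgK) -(IS_scale _ (L1S_B LgP LgK)) -(IS_scale _ LgK).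
  rewrite -(IS_add (L1S_Z _ (L1S_B LgP LgK)) (L1S_Z _ LgK)).
  rewrite -(IS_scale _ (L1S_D (L1S_Z _ (L1S_B LgP LgK)) (L1S_Z _ LgK))).
  by apply: eq_IS => x Sx; rewrite Tk1_qkernel//; ring.
have h2 : beta * IS (fun x => g x * D x) =
    - IS (fun x => g x * Tk r (lap phi) x)
    - beta ^+ 2 * (IS (fun x => g x * Pk r phi x) - IS (fun x => g x * Tk r phi x))
    + (1 - e) * beta ^+ 2 * IS (fun x => g x * Pk r phi x).
  rewrite -(IS_scale _ (L2S_mul Lg LD)) -(IS_opp LgL) -(IS_sub LgP LgK).
  rewrite -(IS_scale _ (L1S_B LgP LgK)) -(IS_scale _ LgP).
  have LN : L1S (fun x => - (g x * Tk r (lap phi) x)).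
    by have := L1S_Z (-1) LgL; congr L1S; apply/funext => x; rewrite mulN1r.
  rewrite -(IS_sub LN (L1S_Z _ (L1S_B LgP LgK))).
  rewrite -(IS_add (L1S_B LN (L1S_Z _ (L1S_B LgP LgK))) (L1S_Z _ LgP)).
  apply: eq_IS => x Sx.
  by rewrite mulrCA qkernel_lap//; ring.
rewrite h1.
have -> : beta * (e * W * IS (fun x => g x * D x)) = e * W * (beta * IS (fun x =>
  g x * D x)) by ring.
rewrite h2; move: (IS _) (IS _) (IS _) => A B C.
rewrite [LHS](_ : _ = - (e * W * A) + (1 - e ^+ 2) * (beta ^+ 2 * W * C)); last by ring.
by rewrite e1 subrr mul0r addr0.
Qed.

End pairing.

End layer_operators.

(** * Moments of functions vanishing on a cap *)

Section separated_pairing.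
Context {R : realType} {d : nat}.
Local Notation E := 'rV[R]_d.
Local Notation S := (@sphere R d).
Hypothesis d3 : (3 <= d)%N.
Implicit Types (x y z : E) (r s t : R) (phi : E -> R) (h : R -> R).

Variables (v : E -> R) (x0 : E) (c0 c : R).
Hypotheses (Lv : L1S v) (Sx0 : S x0) (c0c : c0 < c)
  (v0 : forall x, S x -> c0 < dotp x x0 -> v x = 0).

(** A point where [v] may be nonzero and a point where the test function may be nonzero are at
    distance at least c - c0; [tau] is the resulting bound on their scalar product. *)
Let tau : R := 1 - (c - c0) ^+ 2 / 2.

Lemma separated x y : S x -> S y -> dotp x x0 <= c0 -> c <= dotp y x0 -> dotp x y <= tau.
Proof.
move=> Sx Sy xc yc; have h := dotp_le_enorm (y - x) Sx0.
have h1 : c - c0 <= enorm (y - x).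
  apply: le_trans (le_trans (ler_norm _) h); rewrite dotpBr (dotpC x0) (dotpC x0); lra.
have h2 : (c - c0) ^+ 2 <= enorm (y - x) ^+ 2.
  by rewrite lerXn2r ?nnegrE ?enorm_ge0// subr_ge0 ltW.
by move: h2; rewrite enorm_sub_sqr// (dotpC y) /tau; lra.
Qed.

Lemma tau_lt1 : tau < 1.
Proof. by rewrite /tau gtrDl oppr_lt0 divr_gt0// exprn_gt0// subr_gt0. Qed.

Definition capped phi := RS phi /\ forall y, S y -> dotp y x0 < c -> phi y = 0.

Lemma capped_lap phi : capped phi -> capped (lap phi).
Proof.
move=> [sphi phi0]; split; first exact: RS_lap.
move=> y Sy yc; apply: big1 => i _.
have y0 := sphere_neq0 Sy.
have near_c : \forall z \near y, z != 0 /\ td x0 z < c.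
  have tc : \forall z \near y, td x0 z < c.
    have cy : td x0 z @[z --> y] --> td x0 y := Sm_continuous (RS_Sm (RS_td x0)) y0.
    by apply: (cvgr_lt _ cy); rewrite tdE.
  near=> z; split; near: z; [exact: near_off0|exact: tc].
have phiz z : z != 0 -> td x0 z < c -> phi z = 0.
  by move=> z0 zc; rewrite -(proj2 sphi); apply: phi0 => //; exact: sphere_unitv.
have Dphi : \forall z \near y, Dr i phi z = 0.
  have := near_join near_c; apply: filterS => z nz; rewrite /Dr.
  suff -> : partial i phi z = 0 by rewrite mulr0.
  rewrite -(@derive_cst R E R 0 z (delta_mx 0 i)); apply: near_eq_derive.
  by apply: filterS nz => u [u0 uc]; exact: phiz.
rewrite /Dr; suff -> : partial i (Dr i phi) y = 0 by rewrite mulr0.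
by rewrite -(@derive_cst R E R 0 y (delta_mx 0 i)); exact: near_eq_derive.
Unshelve. all: by end_near. Qed.

(* Truncation does not affect the pairing of [v] with a function [phi] that is
   supported in the smaller cap, and avoids the singularity of [h] at [1]. *)
Definition trunc h t : R := if t <= tau then h t else 0.

Definition BP h phi : R := IS (fun x => v x * IS (fun y => trunc h (dotp x y) * phi y)).

Definition HB h := measurable_fun setT h /\ exists M, forall t, -1 <= t <= tau -> `|h t| <= M.

Lemma trunc_bounded h : HB h -> exists2 M, 0 <= M &
  forall x y, S x -> S y -> `|trunc h (dotp x y)| <= M.
Proof.
move=> [mh [M HM]]; exists `|M| => // x y Sx Sy; rewrite /trunc.
case: ifPn => [xt|_]; last by rewrite normr0.
by apply: le_trans (ler_norm M); apply: HM; rewrite xt dotp_geN1.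
Qed.

Lemma measurable_trunc h : measurable_fun setT h -> measurable_fun setT (trunc h).
Proof.
move=> mh; apply: measurable_fun_if => //.
- by apply: measurable_fun_ler; [exact: measurable_id|exact: measurable_cst].
- exact: measurable_funS mh.
Qed.

Lemma BM_trunc h x : HB h -> S x -> BM (fun y => trunc h (dotp x y)).
Proof.
move=> hh Sx; have [M M0 HM] := trunc_bounded hh; split.
  exact: (measurableT_comp (measurable_trunc (proj1 hh)) (measurable_dotpr x)).
by exists M => y Sy; exact: HM.
Qed.

Lemma BM_trunc_Op h phi : HB h -> BM phi -> BM (fun x => IS (fun y => trunc h (dotp x y) * phi y)).
Proof.
move=> hh bphi; have [M M0 HM] := trunc_bounded hh; split.
  apply: (@OpS_meas _ _ (fun x y => trunc h (dotp x y))); last by case: bphi.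
  exact: (measurable_kernel (measurable_trunc (proj1 hh))).
exists (IS (fun y => M * `|phi y|)) => x Sx.
have Lp := BM_L1 bphi.
apply: IS_norm_le; [exact: BM_mul_L1 (BM_trunc hh Sx) Lp|exact: L1S_Z _ (L1S_norm Lp)|].
by move=> y Sy; rewrite normrM ler_wpM2r// HM.
Qed.

Lemma BP_L1 h phi : HB h -> BM phi ->
  L1S (fun x => v x * IS (fun y => trunc h (dotp x y) * phi y)).
Proof.
move=> hh bphi; have := BM_mul_L1 (BM_trunc_Op hh bphi) Lv.
by congr L1S; apply/funext => x; rewrite mulrC.
Qed.

Lemma BP_capped h phi : capped phi ->
  BP h phi = IS (fun x => v x * IS (fun y => h (dotp x y) * phi y)).
Proof.
move=> [sphi phi0]; apply: eq_IS => x Sx; have [xc|xc] := ltP c0 (dotp x x0).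
  by rewrite v0// !mul0r.
congr (_ * _); apply: eq_IS => y Sy; have [yc|yc] := ltP (dotp y x0) c.
  by rewrite phi0// !mulr0.
by rewrite /trunc separated.
Qed.

Lemma BP_ext h h' phi : (forall t, -1 <= t <= tau -> h t = h' t) -> BP h phi = BP h' phi.
Proof.
move=> hh; apply: eq_IS => x Sx; congr (_ * _); apply: eq_IS => y Sy.
by rewrite /trunc; case: ifPn => // xt; rewrite hh// xt dotp_geN1.
Qed.

Lemma HB_scale a h : HB h -> HB (fun t => a * h t).
Proof.
move=> [mh [M HM]]; split; first by apply: measurable_funM => //.
by exists (`|a| * M) => t t1; rewrite normrM ler_wpM2l// HM.
Qed.

Lemma HB_add h h' : HB h -> HB h' -> HB (fun t => h t + h' t).
Proof.
move=> [mh [M HM]] [mh' [N HN]]; split; first exact: measurable_funD.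
by exists (M + N) => t t1; apply: le_trans (ler_normD _ _) _; rewrite lerD ?HM ?HN.
Qed.

Lemma HB_mul h h' : HB h -> HB h' -> HB (fun t => h t * h' t).
Proof.
move=> [mh [M HM]] [mh' [N HN]]; split; first exact: measurable_funM.
by exists (M * N) => t t1; rewrite normrM ler_pM ?HM ?HN.
Qed.

Lemma HB_cst a : HB (fun=> a).
Proof. by split; [exact: measurable_cst|exists `|a|]. Qed.

Lemma HB_exp h k : HB h -> HB (fun t => h t ^+ k).
Proof.
move=> hh; elim: k => [|k IH]; first exact: HB_cst.
by have := HB_mul hh IH; congr HB; apply/funext => t; rewrite exprS.
Qed.

Lemma BP_scale a h phi : HB h -> BM phi -> BP (fun t => a * h t) phi = a * BP h phi.
Proof.
move=> hh bphi; rewrite /BP -(IS_scale _ (BP_L1 hh bphi)); apply: eq_IS => x Sx.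
rewrite (eq_IS (g := fun y => a * (trunc h (dotp x y) * phi y))); last first.
  by move=> y _; rewrite /trunc; case: ifP => _; ring.
rewrite IS_scale; first by ring.
exact: BM_L1 (BM_mul (BM_trunc hh Sx) bphi).
Qed.

Lemma BP_add h h' phi : HB h -> HB h' -> BM phi ->
  BP (fun t => h t + h' t) phi = BP h phi + BP h' phi.
Proof.
move=> hh hh' bphi; rewrite /BP -(IS_add (BP_L1 hh bphi) (BP_L1 hh' bphi)); apply: eq_IS => x Sx.
rewrite (eq_IS (g := fun y => trunc h (dotp x y) * phi y + trunc h' (dotp x y) * phi y));
  last first.
  by move=> y _; rewrite /trunc; case: ifP => _; ring.
by rewrite (IS_add (BM_L1 (BM_mul (BM_trunc hh Sx) bphi)) (BM_L1 (BM_mul (BM_trunc hh' Sx)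
  bphi))) mulrDr.
Qed.

Lemma BP_cvg (h_ : nat -> R -> R) h M phi : (forall m, measurable_fun setT (h_ m)) ->
  measurable_fun setT h -> BM phi ->
  (forall m t, -1 <= t <= tau -> `|h_ m t| <= M) ->
  (forall t, -1 <= t <= tau -> h_ m t @[m --> \oo] --> h t) ->
  BP (h_ m) phi @[m --> \oo] --> BP h phi.
Proof.
move=> mh_ mh bphi hM hcvg.
have hh_ m : HB (h_ m) by split=> //; exists M => t t1; exact: hM.
have hh : HB h.
  split=> //; exists M => t t1.
  apply: (@cvgr_to_le _ \oo _ _ (fun m => `|h_ m t|)).
    exact: cvg_norm (hcvg t t1).
  by near=> m; exact: hM.
have Lp := BM_L1 bphi.
have tM m x y : S x -> S y -> `|trunc (h_ m) (dotp x y)| <= `|M|.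
  move=> Sx Sy; rewrite /trunc; case: ifPn => [xt|_]; last by rewrite normr0.
  by apply: le_trans (ler_norm M); apply: hM; rewrite xt dotp_geN1.
have inner x : S x -> IS (fun y => trunc (h_ m) (dotp x y) * phi y) @[m --> \oo] -->
    IS (fun y => trunc h (dotp x y) * phi y).
  move=> Sx; apply: (@IS_dominated _ _ _ _ (fun y => `|M| * `|phi y|)).
  - by move=> m; exact: L1S_meas (BM_mul_L1 (BM_trunc (hh_ m) Sx) Lp).
  - exact: L1S_meas (BM_mul_L1 (BM_trunc hh Sx) Lp).
  - exact: L1S_Z _ (L1S_norm Lp).
  - move=> y Sy; apply: cvgM; last exact: cvg_cst.
    rewrite /trunc; case: ifPn => [xt|_]; last exact: cvg_cst.
    by apply: hcvg; rewrite xt dotp_geN1.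
  - by move=> m y Sy; rewrite normrM ler_wpM2r// tM.
apply: (@IS_dominated _ _ _ _ (fun x => IS (fun y => `|M| * `|phi y|) * `|v x|)).
- by move=> m; exact: L1S_meas (BP_L1 (hh_ m) bphi).
- exact: L1S_meas (BP_L1 hh bphi).
- exact: L1S_Z _ (L1S_norm Lv).
- by move=> x Sx; apply: cvgM; [exact: cvg_cst|exact: inner].
- move=> m x Sx; rewrite normrM mulrC ler_wpM2r//.
  apply: IS_norm_le; [exact: BM_mul_L1 (BM_trunc (hh_ m) Sx) Lp|exact: L1S_Z _ (L1S_norm Lp)|].
  by move=> y Sy; rewrite normrM ler_wpM2r// tM.
Unshelve. all: by end_near. Qed.

(** A bound for [qk (rr m)] on [-1, tau] uniform in m: by [qk_cmp] it is at most twice [qk 1], which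
    increases with t. *)
Let qb : R := 2 * qk 1 tau.

Lemma qk_tau t : -1 <= t <= tau -> qk 1 t <= qk 1 tau.
Proof.
move=> /andP[t0 tt]; have := tau_lt1 => t1.
rewrite /qk lef_pV2 ?posrE ?sqrtr_gt0 ?qs1; [|lra|lra].
by apply: ler_wsqrtr; lra.
Qed.

Lemma qk_rr_tau k m t : -1 <= t <= tau -> `|qk (rr m) t ^+ k| <= qb ^+ k.
Proof.
move=> /[dup] tt /andP[t0 t1]; have := tau_lt1 => tau1.
rewrite ger0_norm ?exprn_ge0 ?qk_ge0//; apply: lerXn2r.
- by rewrite nnegrE qk_ge0.
- by rewrite nnegrE mulr_ge0// qk_ge0.
- apply: (le_trans (qk_cmp (rr_itv0 m) _)); first by rewrite t0 (le_lt_trans t1).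
  by rewrite ler_wpM2l// qk_tau.
Qed.

Lemma HB_qk1 : HB (qk 1).
Proof.
split; first by apply: measurable_qk; [exact: measurable_cst|exact: measurable_id].
by exists (qk 1 tau) => t tt; rewrite ger0_norm ?qk_ge0// qk_tau.
Qed.

Section moments.
Hypothesis M0 : forall phi, capped phi -> BP (fun t => qk 1 t ^+ d) phi = 0.

(** Green's formula moves the Laplacian onto |x - y|^(-k), which is singular on the sphere. So it is
    applied to |r x - y|^(-k) with r < 1, and the limit is taken where the scalar product is at most
    [tau]. *)
Lemma BP_lap k phi : capped phi -> BP (fun t => qk 1 t ^+ k) (lap phi) =
  BP (fun t => (1 - t ^+ 2) * (k%:R * (k.+2%:R * qk 1 t ^+ k.+4))
     - (d%:R - 1) * t * (k%:R * qk 1 t ^+ k.+2)) phi.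
Proof.
move=> cphi; have [sphi _] := cphi; have clap := capped_lap cphi.
have bphi := BM_RS sphi; have blap := BM_RS (proj1 clap).
have tau1 := tau_lt1.
pose L r t : R := (1 - t ^+ 2) * (k%:R * r * (k.+2%:R * r * qk r t ^+ k.+4))
     - (d%:R - 1) * t * (k%:R * r * qk r t ^+ k.+2).
have e m : BP (fun t => qk (rr m) t ^+ k) (lap phi) = BP (L (rr m)) phi.
  rewrite (BP_capped _ clap) (BP_capped _ cphi); apply: eq_IS => x Sx; congr (_ * _).
  have sk : RS (fun y => qk (rr m) (td x y) ^+ k).
    by apply: (@RS_zonal _ _ x (fun t => qk (rr m) t ^+ k)); exact: Sm_qk (rr_norm m) Sx.
  transitivity (IS (fun y => qk (rr m) (td x y) ^+ k * lap phi y)).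
    by apply: eq_IS => y Sy; rewrite tdE// dotpC.
  rewrite (Green2 sk sphi); apply: eq_IS => y Sy; congr (_ * _).
  have sk1 : Sm (fun y => (fun t => k%:R * rr m * qk (rr m) t ^+ k.+2) (td x y)).
    by apply: Sm_mul; [exact: Sm_cst|exact: Sm_qk (rr_norm m) Sx].
  have dk (t : R) : -1 <= t <= 1 ->
      is_derive t 1 (fun t => qk (rr m) t ^+ k) (k%:R * rr m * qk (rr m) t ^+ k.+2).
    by move=> t1; apply: is_derive_qk_t; exact: qs_gt0 (rr_norm m) t1.
  have dk1 (t : R) : -1 <= t <= 1 ->
      is_derive t 1 (fun t => k%:R * rr m * qk (rr m) t ^+ k.+2)
        (k%:R * rr m * (k.+2%:R * rr m * qk (rr m) t ^+ k.+4)).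
    by move=> t1; apply: is_deriveZ; apply: is_derive_qk_t; exact: qs_gt0 (rr_norm m) t1.
  by rewrite (lap_zonal Sx sk1 dk dk1 (sphere_neq0 Sy)) /L tdE// (dotpC y).
have mq r j : measurable_fun setT (fun t => qk r t ^+ j) by exact: measurable_qk_exp.
have mL r : measurable_fun setT (L r).
  apply: measurable_funB; apply: measurable_funM => //.
  - by apply: measurable_funB => //; exact: measurable_funX.
  - by apply: measurable_funM => //; apply: measurable_funM.
  - by apply: measurable_funM.
have c1 : BP (fun t => qk (rr m) t ^+ k) (lap phi) @[m --> \oo] --> BP (fun t =>
  qk 1 t ^+ k) (lap phi).
  apply: (@BP_cvg (fun m t => qk (rr m) t ^+ k) (fun t => qk 1 t ^+ k) (qb ^+ k)) => //.
  - by move=> m t tt; exact: qk_rr_tau.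
  - by move=> t /andP[t0 t1]; apply: qk_cvg; rewrite t0 (le_lt_trans t1).
have rr1 m : `|rr m| <= 1 :> R by apply: ltW; exact: rr_norm.
have c2 : BP (L (rr m)) phi @[m --> \oo] --> BP (L 1) phi.
  apply: (@BP_cvg (fun m => L (rr m)) (L 1) ((1 + 1) * (k%:R * 1 * (k.+2%:R * 1 * qb ^+ k.+4)) +
    `|d%:R - 1| * 1 * (k%:R * 1 * qb ^+ k.+2))) => //.
  - move=> m t tt; have /andP[t0 t1] := tt.
    have tn : `|t| <= 1 by rewrite ler_norml; lra.
    have nM (a b A B : R) : `|a| <= A -> `|b| <= B -> `|a * b| <= A * B.
      by move=> h1 h2; rewrite normrM ler_pM.
    have nat_le (j : nat) : `|j%:R : R| <= j%:R by rewrite normr_nat.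
    apply: le_trans (ler_normB _ _) _; apply: lerD.
      apply: (nM); last by apply: (nM); apply: (nM) => //; [exact: nM|exact: qk_rr_tau].
      by apply: le_trans (ler_normB _ _) _; rewrite normr1 lerD2l normrX exprn_ile1.
    by apply: (nM); apply: (nM) => //; [exact: nM|exact: qk_rr_tau].
  - move=> t /andP[t0 t1].
    have tt : -1 <= t < 1 by rewrite t0 (le_lt_trans t1).
    apply: cvgB; apply: cvgM; do ?exact: cvg_cst.
      apply: cvgM; first by apply: cvgM; [exact: cvg_cst|exact: rr_cvg].
      by apply: cvgM; [apply: cvgM; [exact: cvg_cst|exact: rr_cvg]|exact: qk_cvg].
    by apply: cvgM; [apply: cvgM; [exact: cvg_cst|exact: rr_cvg]|exact: qk_cvg].
rewrite (_ : BP (fun t => _ - _) phi = BP (L 1) phi).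
  have {}c2 : BP (fun t => qk (rr m) t ^+ k) (lap phi) @[m --> \oo] --> BP (L 1) phi.
    by under eq_fun do rewrite e.
  exact: (cvg_unique _ c1 c2).
by apply: BP_ext => t _; rewrite /L !mulr1.
Qed.

(** On the sphere the Laplacian of |x - y|^(-k) is A |x - y|^(-k-2) + B |x - y|^(-k) with A = k (k +
    3 - d), and A is nonzero for k = d + 2 j. *)
Lemma moments0 j phi : capped phi -> BP (fun t => qk 1 t ^+ (d + j.*2)) phi = 0.
Proof.
elim: j phi => [|j IH] phi cphi; first by rewrite addn0 M0.
have bphi := BM_RS (proj1 cphi).
set k := (d + j.*2)%N in IH.
have -> : (d + j.+1.*2)%N = k.+2 by rewrite doubleS !addnS.
have := BP_lap k cphi; rewrite IH; last exact: capped_lap.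
pose A : R := k%:R * (k%:R + 3 - d%:R).
pose B : R := - (k%:R * k.+2%:R / 4) + (d%:R - 1) * k%:R / 2.
rewrite (@BP_ext _ (fun t => A * qk 1 t ^+ k.+2 + B * qk 1 t ^+ k)); last first.
  move=> t /andP[t0 t1]; have := tau_lt1 => tau1.
  have q0 : 0 < qs 1 t by rewrite qs1; lra.
  have := qk_sqr q0; rewrite qs1; set q := qk 1 t => h.
  have -> : q ^+ k.+4 = q ^+ k * q ^+ 2 * q ^+ 2 by rewrite -!exprD -addnA addn4.
  have -> : q ^+ k.+2 = q ^+ k * q ^+ 2 by rewrite -exprD addn2.
  have tE : q ^+ 2 * t = q ^+ 2 - 1 / 2 by move: h; move: (q ^+ 2) => Q h; lra.
  rewrite /A /B -[k.+2]addn2 natrD; move: (q ^+ k) (q ^+ 2) tE => a Q tE.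
  transitivity (k%:R * a * ((k%:R + 2) * (Q ^+ 2 - (Q * t) ^+ 2) - (d%:R - 1) * (Q * t)));
    first by ring.
  by rewrite tE; field.
have HBk j' : HB (fun t => qk 1 t ^+ j') by apply: HB_exp; exact: HB_qk1.
rewrite (BP_add (HB_scale A (HBk _)) (HB_scale B (HBk _)) bphi) !BP_scale//.
rewrite IH// mulr0 addr0 => /esym/eqP; rewrite mulf_eq0 => /orP[|/eqP//].
rewrite /A mulf_eq0 /k natrD => /orP[|].
  by rewrite -natrD pnatr_eq0 addn_eq0 => /andP[/eqP d0]; move: d3; rewrite d0.
have : (0 : R) <= j.*2%:R by [].
by move: (j.*2%:R) (d%:R) => a b a0 /eqP; lra.
Qed.

End moments.

End separated_pairing.

(** * Inverse square roots as limits of polynomials *)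

Section newton_inverse_square_root.
Context {R : realType}.
Implicit Types (a : R) (k : nat).

(* Newton's iteration for [1 / sqrt a], as polynomials in [a]. *)
Fixpoint newton k : {poly R} :=
  if k is k'.+1 then 2^-1 *: (newton k' * (3%:P - 'X * newton k' ^+ 2)) else 1.

Lemma newtonE k a : (newton k.+1).[a] =
  (newton k).[a] * (3 - a * (newton k).[a] ^+ 2) / 2.
Proof.
rewrite /= hornerZ hornerM hornerD hornerN hornerC hornerM hornerX horner_exp.
by rewrite mulrC.
Qed.

(** One step takes the error e = 1 - a y^2 to e (3 e + e^2) / 4. This is at most e^2, hence at most
    (1 - a) e, and it stays nonnegative, so the iterates remain below the limit. *)
Lemma newton_err k a : 0 < a <= 1 -> 0 < (newton k).[a] /\
  0 <= 1 - a * (newton k).[a] ^+ 2 <= (1 - a) ^+ k.+1.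
Proof.
move=> /andP[a0 a1]; elim: k => [|k [y0 /andP[e0 e1]]].
  by rewrite /= hornerC; split=> //; rewrite expr1n mulr1 expr1 subr_ge0 a1 lexx.
rewrite newtonE; move: (newton k).[a] y0 e0 e1 => y y0; set e := 1 - a * y ^+ 2 => e0 e1.
have e1' : e <= 1.
  by rewrite /e gerDl oppr_le0 mulr_ge0 ?sqr_ge0// ltW.
have ea : e <= 1 - a.
  apply: (le_trans e1); rewrite exprS ler_piMr ?subr_ge0// exprn_ile1 ?subr_ge0//.
  by rewrite gerBl ltW.
have -> : 3 - a * y ^+ 2 = 2 + e by rewrite /e; ring.
split; first by rewrite divr_gt0// mulr_gt0//; lra.
have -> : 1 - a * (y * (2 + e) / 2) ^+ 2 = e * ((3 * e + e ^+ 2) / 4).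
  transitivity (1 - (1 - e) * (1 + e / 2) ^+ 2); last by field.
  by rewrite /e; field.
have f0 : 0 <= (3 * e + e ^+ 2) / 4 by rewrite divr_ge0// addr_ge0 ?mulr_ge0 ?sqr_ge0.
rewrite mulr_ge0//= [leRHS]exprSr; apply: ler_pM => //.
have : e ^+ 2 <= e by rewrite expr2 ler_piMr.
by move: (e ^+ 2) => E; lra.
Qed.

Lemma newton_le k a : 0 < a <= 1 -> 0 <= (newton k).[a] <= (Num.sqrt a)^-1.
Proof.
move=> a01; have [y0 /andP[e0 _]] := newton_err k a01; have /andP[a0 _] := a01.
rewrite (ltW y0)/= -(sqrtrV (ltW a0)) -(ger0_norm (ltW y0)) -sqrtr_sqr; apply: ler_wsqrtr.
by rewrite -[leRHS]mulr1 ler_pdivlMl// -subr_ge0.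
Qed.

Lemma newton_cvg a : 0 < a <= 1 -> (newton k).[a] @[k --> \oo] --> (Num.sqrt a)^-1.
Proof.
move=> a01; have /andP[a0 a1] := a01.
have e (k : nat) : (newton k).[a] = Num.sqrt ((1 - (1 - a * (newton k).[a] ^+ 2)) / a).
  have [y0 _] := newton_err k a01.
  by rewrite subKr mulrC mulrA mulVf ?gt_eqF// mul1r sqrtr_sqr ger0_norm// ltW.
under eq_fun do rewrite e.
have -> : (Num.sqrt a)^-1 = Num.sqrt ((1 - 0) / a) by rewrite subr0 mul1r sqrtrV// ltW.
suff c : (1 - (1 - a * (newton k).[a] ^+ 2)) / a @[k --> \oo] --> (1 - 0) / a.
  exact: (cvg_comp _ _ c (@sqrt_continuous R _)).
apply: cvgM; last exact: cvg_cst.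
apply: cvgB; first exact: cvg_cst.
apply: (@squeeze_cvgr _ _ _ _ (fun=> 0) (fun k => (1 - a) ^+ k.+1)).
- by near=> k; case: (newton_err k a01).
- exact: cvg_cst.
- rewrite (cvg_shiftS (fun k => (1 - a) ^+ k)); apply: cvg_expr.
  by rewrite ger0_norm ?subr_ge0// ltrBlDr ltrDl.
Unshelve. all: by end_near. Qed.

End newton_inverse_square_root.

Section moments_at_the_centre.
Context {R : realType} {d : nat}.
Local Notation E := 'rV[R]_d.
Local Notation S := (@sphere R d).
Hypothesis d3 : (3 <= d)%N.
Implicit Types (x y z : E) (r s t : R) (phi : E -> R) (h : R -> R).

Section fixed_cap.
Variables (v : E -> R) (x0 : E) (c0 c : R).
Hypotheses (Lv : L1S v) (Sx0 : S x0) (c0c : c0 < c)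
  (v0 : forall x, S x -> c0 < dotp x x0 -> v x = 0).
Local Notation BP := (BP v c0 c).
Local Notation capped := (capped x0 c).
Hypothesis M0 : forall phi, capped phi -> BP (fun t => qk 1 t ^+ d) phi = 0.
Let tau : R := 1 - (c - c0) ^+ 2 / 2.
Local Notation HB := (HB c0 c).

Let HBq : HB (qk 1). Proof. exact: HB_qk1. Qed.

Lemma HB_horner h (P : {poly R}) : HB h -> HB (fun t => P.[h t]).
Proof.
move=> hh; elim/poly_ind: P => [|P b IH].
  by have := HB_cst c0 c 0; congr HB; apply/funext => t; rewrite horner0.
have := HB_add (HB_mul IH hh) (HB_cst c0 c b); congr HB.
by apply/funext => t; rewrite hornerMXaddC.
Qed.

Lemma BP_poly j (P : {poly R}) phi : capped phi ->
  BP (fun t => qk 1 t ^+ (d + j.*2) * P.[qk 1 t ^+ 2]) phi = 0.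
Proof.
move=> cphi; have bphi := BM_RS (proj1 cphi).
have HBk k : HB (fun t => qk 1 t ^+ k) by exact: HB_exp.
elim/poly_ind: P j => [|P b IH] j.
  rewrite (@BP_ext _ _ _ _ _ _ (fun t => 0 * qk 1 t ^+ 0)); last first.
    by move=> t _; rewrite horner0 mulr0 mul0r.
  by rewrite (BP_scale Lv _ (HBk _) bphi) mul0r.
rewrite (@BP_ext _ _ _ _ _ _ (fun t => qk 1 t ^+ (d + j.+1.*2) * P.[qk 1 t ^+ 2] + b * qk 1 t ^+
  (d + j.*2))); last first.
  move=> t _; rewrite hornerMXaddC doubleS !addnS.
  have -> : qk 1 t ^+ (d + j.*2).+2 = qk 1 t ^+ (d + j.*2) * qk 1 t ^+ 2 by rewrite -exprD addn2.
  by move: (qk 1 t ^+ (d + j.*2)) (qk 1 t ^+ 2) P.[_] => A B C; ring.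
rewrite (BP_add Lv (HB_mul (HBk _) (HB_horner P (HBk 2))) (HB_scale b (HBk _)) bphi).
by rewrite (BP_scale Lv _ (HBk _) bphi) IH (moments0 d3 Lv Sx0 c0c v0 M0)// mulr0 addr0.
Qed.

Let kappa : R := (c - c0) ^+ 2.
Let kappa0 : 0 < kappa. Proof. by rewrite exprn_gt0// subr_gt0. Qed.

(** Polynomials in |x - y|^(-2) that tend to |x - y| from below. The factor [kappa] brings the
    argument into (0, 1], where Newton's iteration converges. *)
Definition invw k : {poly R} := (Num.sqrt kappa)%:P * (newton k \Po (kappa%:P * 'X)).

Let w_pos t : -1 <= t <= tau -> 0 < qk 1 t /\ qk 1 t ^- 2 = 2 - 2 * t.
Proof.
move=> /andP[t0 t1]; have tau1 : tau < 1 by exact: tau_lt1.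
have q0 : 0 < qs 1 t by rewrite qs1; lra.
split; first by rewrite /qk invr_gt0 sqrtr_gt0.
by rewrite /qk exprVn invrK sqr_sqrtr ?ltW// qs1.
Qed.

Let kappa_w t : -1 <= t <= tau -> 0 < kappa * qk 1 t ^+ 2 <= 1.
Proof.
move=> tt; have [w0 wE] := w_pos tt; rewrite mulr_gt0 ?exprn_gt0 ?subr_gt0//=.
rewrite -[qk 1 t ^+ 2]invrK wE ler_pdivrMr ?mul1r.
  by case/andP: tt => _; rewrite /tau /kappa; lra.
by rewrite -wE invr_gt0 exprn_gt0.
Qed.

Let invwE k t : (invw k).[qk 1 t ^+ 2] =
  Num.sqrt kappa * (newton k).[kappa * qk 1 t ^+ 2].
Proof. by rewrite /invw hornerM hornerC horner_comp hornerM hornerC hornerX. Qed.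

Let sqrt_kw t : -1 <= t <= tau ->
  Num.sqrt kappa * (Num.sqrt (kappa * qk 1 t ^+ 2))^-1 = (qk 1 t)^-1.
Proof.
move=> tt; have [w0 wE] := w_pos tt.
have aux (K w : R) : 0 < K -> 0 < w -> Num.sqrt K * (Num.sqrt (K * w ^+ 2))^-1 = w^-1.
  move=> K0 {}w0; rewrite (sqrtrM _ (ltW K0)) sqrtr_sqr (ger0_norm (ltW w0)) invfM mulrA.
  by rewrite mulfV ?mul1r// gt_eqF// sqrtr_gt0.
exact: aux kappa0 w0.
Qed.

Lemma invw_le k t : -1 <= t <= tau -> 0 <= (invw k).[qk 1 t ^+ 2] <= (qk 1 t)^-1.
Proof.
move=> tt; have [w0 wE] := w_pos tt.
rewrite invwE -(sqrt_kw tt); have /andP[n0 n1] := newton_le k (kappa_w tt).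
by rewrite mulr_ge0 ?sqrtr_ge0//= ler_wpM2l ?sqrtr_ge0.
Qed.

(** Let z = |x - y|, so that 1 - z^2 / 2 = t. Then t^m is z^(-d) times z^d (1 - z^2 / 2)^m, and the
    second factor is a limit of polynomials in z^(-2). Approximating z itself, rather than z^2,
    covers odd d. *)
Lemma BP_exp m phi : capped phi -> BP (fun t => t ^+ m) phi = 0.
Proof.
move=> cphi; have bphi := BM_RS (proj1 cphi).
pose F k : {poly R} := invw k ^+ d * (1 - 2^-1 *: invw k ^+ 2) ^+ m.
have FE k s : (F k).[s] = (invw k).[s] ^+ d * (1 - 2^-1 * (invw k).[s] ^+ 2) ^+ m.
  by rewrite /F hornerM !horner_exp hornerD hornerC hornerN hornerZ horner_exp.
pose h_ k t := qk 1 t ^+ (d + 0.*2) * (F k).[qk 1 t ^+ 2].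
have h0 k : BP (h_ k) phi = 0 by exact: BP_poly.
suff : BP (h_ k) phi @[k --> \oo] --> BP (fun t => t ^+ m) phi.
  under eq_fun do rewrite h0; move=> c1.
  exact: (cvg_unique _ c1 (cvg_cst 0)).
have HBh k : HB (h_ k).
  by apply: HB_mul; [exact: HB_exp|apply: HB_horner; exact: HB_exp].
apply: (@BP_cvg _ _ v c0 c Lv h_ (fun t => t ^+ m) (3 ^+ m)) => //.
- by move=> k; case: (HBh k).
- move=> k t tt; rewrite /h_ FE addn0 mulrA -exprMn.
  have [w0 wE] := w_pos tt; have /andP[z0 z1] := invw_le k tt.
  have wz : 0 <= qk 1 t * (invw k).[qk 1 t ^+ 2] <= 1.
    rewrite mulr_ge0 ?(ltW w0)//= -[leRHS](mulfV (lt0r_neq0 w0)).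
    by rewrite ler_wpM2l// ltW.
  have z2 : (invw k).[qk 1 t ^+ 2] ^+ 2 <= 4.
    apply: (@le_trans _ _ ((qk 1 t)^-1 ^+ 2)).
      by apply: lerXn2r; rewrite ?nnegrE// invr_ge0 ltW.
    by rewrite exprVn wE; case/andP: tt => t0 _; lra.
  rewrite -[leRHS]mul1r normrM ler_pM// normrX.
    by case/andP: wz => h1 h2; rewrite ger0_norm// exprn_ile1.
  apply: lerXn2r; rewrite ?nnegrE//.
  have := sqr_ge0 (invw k).[qk 1 t ^+ 2].
  by move: z2; move: (_ ^+ 2) => Z h1 h2; rewrite ler_norml; lra.
- move=> t tt; have [w0 wE] := w_pos tt.
  have cz : (invw k).[qk 1 t ^+ 2] @[k --> \oo] --> (qk 1 t)^-1.
    under eq_fun do rewrite invwE.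
    rewrite -(sqrt_kw tt); apply: cvgM; first exact: cvg_cst.
    exact: newton_cvg (kappa_w tt).
  have -> : t ^+ m = qk 1 t ^+ (d + 0.*2) * ((qk 1 t)^-1 ^+ d * (1 - 2^-1 * (qk 1 t)^-1 ^+ 2) ^+ m).
    rewrite addn0 mulrA -exprMn mulfV ?gt_eqF// expr1n mul1r exprVn wE.
    by congr (_ ^+ _); field.
  rewrite /h_; under eq_fun do rewrite FE.
  apply: cvgM; first exact: cvg_cst.
  apply: cvgM; first exact: (cvg_comp _ _ cz (@exprn_continuous R d _)).
  suff c1 : 1 - 2^-1 * (invw k).[qk 1 t ^+ 2] ^+ 2 @[k --> \oo] --> 1 - 2^-1 * (qk 1 t)^-1 ^+ 2.
    exact: (cvg_comp _ _ c1 (@exprn_continuous R m _)).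
  apply: cvgB; first exact: cvg_cst.
  apply: cvgM; first exact: cvg_cst.
  exact: (cvg_comp _ _ cz (@exprn_continuous R 2 _)).
Qed.

End fixed_cap.

End moments_at_the_centre.

(** * Positivity of the area of caps *)

Section caps_have_positive_area.
Context {R : realType} {d : nat}.
Local Notation E := 'rV[R]_d.
Local Notation S := (@sphere R d).
Local Notation mu := (@omega R d).
Hypothesis d3 : (3 <= d)%N.
Local Notation W := (@sphere_area R d).
Local Notation pk := (pk d).
Implicit Types (x y z : E) (r s t : R) (phi : E -> R) (h : R -> R).

Lemma sphere_area_gt0 : 0 < W.
Proof.
have mP := @measurable_pball R d.
have d0 : (0 < d)%N by apply: leq_trans d3.
have := @ge0_integral_omega R d (fun=> 1) (@measurable_cst _ _ _ _ setT (1 : R)) (fun=> ler01).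
rewrite (I_EFin (@measurable_sphere R d) (L1on_cst (@omega R d) (@measurable_sphere R d) 1))
  integral_cst// mul1e.
(* The cube with sides [a, 2 a] misses the origin and lies in the ball, since d (2 a)^2 = 1 / d. *)
pose a : R := (2 * d%:R)^-1.
have a0 : 0 < a by rewrite invr_gt0 mulr_gt0// ltr0n.
pose C : set E := cube (fun=> `[a, 2 * a]%classic).
have mC : measurable C by apply: measurable_cube => i; exact: measurable_itv.
have CP : C `<=` @pball R d.
  move=> x Cx; have xi i : a <= x 0 i <= 2 * a by have := Cx i; rewrite /= in_itv.
  have x0 : x != 0.
    by apply/eqP => xE; have := xi (Ordinal d0); rewrite xE mxE; lra.
  rewrite /pball /= enorm_gt0//= -(@ler_pXn2r _ 2)// ?nnegrE ?enorm_ge0// enorm_sqr expr1n.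
  apply: (@le_trans _ _ (\sum_(i < d) (2 * a) ^+ 2)).
    apply: ler_sum => i _; rewrite -expr2; have /andP[h1 h2] := xi i.
    by apply: lerXn2r; rewrite ?nnegrE//; lra.
  rewrite sumr_const card_ord -[_ *+ d]mulr_natl.
  have D1 : 1 <= d%:R :> R by rewrite ler1n.
  rewrite /a; move: (d%:R) D1 => D D1; have D0 : 0 < D by lra.
  rewrite (_ : D * _ = D^-1); first by rewrite invf_le1.
  by field; rewrite gt_eqF.
have lC : lebesgue_rV d C = (a ^+ d)%:E.
  apply: lebesgue_rV_cube => i; first exact: measurable_itv.
  rewrite lebesgue_measure_itv/= lte_fin ifT; first by rewrite -EFinB; congr EFin; ring.
  lra.
have : (0 < d%:R%:E * lebesgue_rV d (@pball R d))%E.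
  rewrite mule_gt0 ?lte_fin ?ltr0n//; apply: (@lt_le_trans _ _ (lebesgue_rV d C)).
    by rewrite lC lte_fin exprn_gt0.
  by apply: le_measure; rewrite ?inE.
by move=> h e; move: h; rewrite -e lte_fin.
Qed.

(** The positive part of x0 . y - c is Lipschitz and positive at x0. If the cap were null, its
    Poisson integrals at x0 would all be 0, yet they tend to W times this positive value. *)
Lemma cap_not_null x0 c : S x0 -> c < 1 -> ~ {ae mu, forall y, S y -> dotp y x0 <= c}.
Proof.
move=> Sx0 c1 ae; pose h y : R := Num.max 0 (dotp x0 y - c).
have mh : measurable_fun setT h.
  apply: measurable_maxr; first exact: measurable_cst.
  by apply: measurable_funB; [exact: measurable_dotpr|exact: measurable_cst].
have hL y : S y -> `|h y - h x0| <= 1 * enorm (x0 - y).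
  move=> Sy; rewrite mul1r enormB; have := dotp_le_enorm (y - x0) Sx0.
  rewrite dotpBr /h; apply: le_trans.
  move: (dotp x0 y) (dotp x0 x0) => a b; rewrite /Num.max.
  by case: ifP; case: ifP => h1 h2; rewrite ler_norml; move: h1 h2; rewrite ?subr_gt0;
    case: (leP 0 (a - b)) => h3; rewrite ?(ger0_norm h3) ?(ltr0_norm h3); lra.
have c2 := approx_identity d3 Sx0 ler01 mh hL.
have h0 : {ae mu, forall y, S y -> h y = 0}.
  apply: filterS ae => y hy Sy; rewrite /h; apply/max_idPl.
  by rewrite subr_le0 dotpC hy.
have e m : IS (fun y => pk (rr m) (dotp x0 y) * h y) = 0.
  have bh : BM h.
    split=> //; exists (1 + `|c|) => y Sy; rewrite /h ger0_norm ?le_max ?lexx// ge_max.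
    rewrite addr_ge0//=; have := dotp_le1 Sx0 Sy; have := ler_norm (- c); rewrite normrN; lra.
  have bp := BM_pk (rr_norm m) Sx0.
  rewrite (@IS_ae_eq _ _ _ (fun=> 0) (BM_L1 (BM_mul bp bh)) (L1S_cst 0)) ?IS_eq0//.
  by apply: filterS h0 => y hy Sy; rewrite hy// mulr0.
have : W * h x0 = 0.
  have c3 : IS (fun y => pk (rr m) (dotp x0 y) * h y) @[m --> \oo] --> (0 : R).
    by under eq_fun do rewrite e; exact: cvg_cst.
  exact: (cvg_unique _ c2 c3).
move/eqP; rewrite mulf_eq0 (gt_eqF sphere_area_gt0) /h dotp_sphere//= => /eqP.
by rewrite /Num.max subr_gt0 c1; lra.
Qed.

End caps_have_positive_area.

(** * Moments at the centre of a cap *)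

Section moments_vanish.
Context {R : realType} {d : nat}.
Local Notation E := 'rV[R]_d.
Local Notation S := (@sphere R d).
Hypothesis d3 : (3 <= d)%N.
Implicit Types (x y z : E) (r s t : R) (phi : E -> R) (h : R -> R).

Definition mom (v : E -> R) m y : R := IS (fun x => v x * dotp x y ^+ m).

Lemma BM_dotp_exp m y : BM (fun x : E => dotp x y ^+ m).
Proof.
split; first by apply: measurable_funX; apply: measurable_dotp2;
  [exact: measurable_id|exact: measurable_cst].
exists (enorm y ^+ m) => x Sx; rewrite normrX.
by apply: lerXn2r; rewrite ?nnegrE ?enorm_ge0// dotp_le_enorm.
Qed.

Lemma mom_L1 (v : E -> R) m y : L1S v -> L1S (fun x => v x * dotp x y ^+ m).
Proof.
move=> Lv; have := BM_mul_L1 (BM_dotp_exp m y) Lv.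
by congr L1S; apply/funext => x; rewrite mulrC.
Qed.

Lemma mom_lipschitz (v : E -> R) m y z : L1S v -> S y -> S z ->
  `|mom v m y - mom v m z| <= m%:R * IS (fun x => `|v x|) * enorm (y - z).
Proof.
move=> Lv Sy Sz; rewrite /mom -(IS_sub (mom_L1 m y Lv) (mom_L1 m z Lv)).
have Ln := L1S_norm Lv.
rewrite mulrAC -(IS_scale _ Ln).
apply: IS_norm_le; [exact: L1S_B (mom_L1 m y Lv) (mom_L1 m z Lv)|exact: L1S_Z|].
move=> x Sx; rewrite -mulrBr normrM mulrC ler_wpM2r//.
apply: (@le_trans _ _ (m%:R * `|dotp x y - dotp x z|)); last first.
  by rewrite ler_wpM2l// -dotpBr dotp_le_enorm.
have a1 := dotp_norm_le1 Sx Sy; have b1 := dotp_norm_le1 Sx Sz.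
move: (dotp x y) (dotp x z) a1 b1 => a b a1 b1.
elim: m => [|m IH]; first by rewrite !expr0 subrr normr0 mul0r.
have -> : a ^+ m.+1 - b ^+ m.+1 = a * (a ^+ m - b ^+ m) + b ^+ m * (a - b) by rewrite !exprS; ring.
rewrite -natr1 mulrDl mul1r; apply: le_trans (ler_normD _ _) _; rewrite !normrM.
apply: lerD; first by apply: le_trans IH; rewrite ler_piMl.
by rewrite ler_piMl// normrX exprn_ile1.
Qed.

Lemma BM_mom (v : E -> R) m : L1S v -> BM (mom v m).
Proof.
move=> Lv; split.
  have -> : mom v m = OpS (fun y x => dotp x y ^+ m) v.
    by apply/funext => y; apply: eq_IS => x _; rewrite mulrC.
  apply: OpS_meas; last exact: L1S_meas.
  apply: measurable_funX; apply: measurable_dotp2; [exact: measurable_snd|exact: measurable_fst].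
exists (IS (fun x => `|v x|)) => y Sy.
apply: IS_norm_le => [||x Sx]; [exact: mom_L1|exact: L1S_norm|].
by rewrite normrM ler_piMr// normrX exprn_ile1// dotp_norm_le1.
Qed.

(** A nonzero moment at x0 would keep its sign on a small cap, contradicting [BP_exp] for a bump
    function supported there. The cap depends on the moment, so the hypothesis on pairings is made
    for every c > c0. *)
Lemma mom_centre (v : E -> R) x0 c0 : L1S v -> S x0 -> c0 < 1 ->
  (forall x, S x -> c0 < dotp x x0 -> v x = 0) ->
  (forall c phi, c0 < c -> capped x0 c phi -> BP v c0 c (fun t => qk 1 t ^+ d) phi = 0) ->
  forall m, mom v m x0 = 0.
Proof.
move=> Lv Sx0 c01 v0 M0 m; apply/eqP/negP => /negP Q0.
set eta := `|mom v m x0|; have eta0 : 0 < eta by rewrite normr_gt0.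
pose A := m%:R * IS (fun x => `|v x|).
have A0 : 0 <= A by rewrite mulr_ge0// IS_ge0.
(* Within distance e of x0 the moment varies by at most A e <= eta / 2. *)
pose e := eta / (2 * (A + 1)).
have e0 : 0 < e by rewrite divr_gt0// mulr_gt0// ltr_wpDl.
(* The first term keeps c above c0. By |y - x0|^2 = 2 - 2 y . x0 the second puts the cap within
   distance e of x0. *)
pose c := Num.max ((c0 + 1) / 2) (1 - e ^+ 2 / 2).
have c1 : c < 1.
  rewrite gt_max gtrDl oppr_lt0 divr_gt0 ?exprn_gt0// andbT; lra.
have c0c : c0 < c by rewrite lt_max; apply/orP; left; lra.
have ce : 2 - 2 * c <= e ^+ 2.
  have : 1 - e ^+ 2 / 2 <= c by rewrite le_max lexx orbT.
  by move: (e ^+ 2) => e2; lra.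
pose phi y : R := bump 1 (td x0 y - c).
have sphi : RS phi.
  split; last by move=> y; rewrite /phi /td unitvK.
  apply: Sm_bump; apply: Sm_sub; last exact: Sm_cst.
  by apply: RS_Sm; exact: RS_td.
have cphi : capped x0 c phi.
  split=> // y Sy yc; rewrite /phi bump_le0// tdE// subr_le0 ltW//.
have bphi := BM_RS sphi.
have := BP_exp d3 Lv Sx0 c0c v0 (fun f cf => M0 c f c0c cf) m cphi.
rewrite (BP_capped Sx0 c0c v0 _ cphi).
have mK : measurable_fun setT (fun w : E * E => dotp w.1 w.2 ^+ m).
  exact: (measurable_kernel (exprn_measurable m)).
have KM x y : S x -> S y -> `|dotp x y ^+ m| <= 1.
  by move=> Sx Sy; rewrite normrX exprn_ile1// dotp_norm_le1.
have FB := PL1S_fubini (@PL1S_bounded_kernel _ _ 1 (fun x y =>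
  dotp x y ^+ m) v phi mK KM Lv (BM_L1 bphi)).
have bm x : BM (fun y : E => dotp x y ^+ m).
  have := BM_dotp_exp m x; congr BM; apply/funext => y; by rewrite dotpC.
rewrite (eq_IS (g := fun x => IS (fun y => v x * dotp x y ^+ m * phi y))); last first.
  move=> x Sx; rewrite -(IS_scale _ (BM_L1 (BM_mul (bm x) bphi))).
  by apply: eq_IS => y _; ring.
rewrite FB /= => I0.
pose s := Num.sg (mom v m x0).
have s1 : `|s| = 1 by rewrite normr_sg Q0.
have Lphi := BM_L1 bphi.
have LQ : L1S (fun y => s * mom v m y * phi y).
  exact: BM_L1 (BM_mul (BM_scale s (BM_mom m Lv)) bphi).
have I1 : IS (fun y => mom v m y * phi y) = 0.
  rewrite -I0; apply: eq_IS => y Sy.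
  by rewrite mulrC -(IS_scale _ (mom_L1 m y Lv)); apply: eq_IS => x _; ring.
have E0 : IS (fun y => s * mom v m y * phi y) = 0.
  rewrite (eq_IS (g := fun y => s * (mom v m y * phi y))) => [|y _]; last by rewrite mulrA.
  by rewrite (IS_scale _ (BM_L1 (BM_mul (BM_mom m Lv) bphi))) I1 mulr0.
clear FB I0 I1 mK KM bm.
have phi0 y : 0 <= phi y by exact: bump1_ge0.
have : IS (fun y => eta / 2 * phi y) <= 0.
  rewrite -E0; apply: (IS_le (L1S_Z _ Lphi) LQ).
  move=> y Sy; have [yc|yc] := ltP (dotp y x0) c.
    by rewrite (proj2 cphi _ Sy yc) !mulr0.
  rewrite ler_wpM2r//.
  have h1 : enorm (y - x0) <= e.
    rewrite -(@ler_pXn2r _ 2)// ?nnegrE ?enorm_ge0 ?(ltW e0)// enorm_sub_sqr//.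
    by apply: le_trans ce; lra.
  have h2 := mom_lipschitz m Lv Sy Sx0.
  have h3 : A * enorm (y - x0) <= eta / 2.
    apply: (@le_trans _ _ (A * e)); first by rewrite ler_wpM2l.
    have A1 : 0 < A + 1 by rewrite ltr_wpDl.
    have eE : (A + 1) * e = eta / 2 by rewrite /e; field; rewrite gt_eqF.
    by rewrite -eE mulrDl mul1r lerDl ltW.
  have h4 : s * mom v m x0 = eta by rewrite /s /eta normrEsg.
  have h5 : `|s * (mom v m y - mom v m x0)| <= eta / 2.
    by rewrite normrM s1 mul1r (le_trans h2).
  move: h5; rewrite mulrBr h4 ler_norml => /andP[h5 _].
  by move: h5; move: (s * _) => a; lra.
rewrite (IS_scale _ Lphi) pmulr_rle0 ?divr_gt0// => phi_le0.
have Iphi0 : IS phi = 0 by apply/eqP; rewrite eq_le phi_le0 IS_ge0.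
apply: (cap_not_null d3 Sx0 c1).
apply: filterS (IS_nneg_eq0 Lphi (fun y _ => phi0 y) Iphi0) => y hy Sy.
rewrite leNgt; apply/negP => yc; have := hy Sy.
rewrite /phi tdE// => /eqP; rewrite gt_eqF//; apply: bump1_gt0.
by rewrite subr_gt0.
Qed.

End moments_vanish.

(** * Injectivity *)

Section orthogonal_to_Lipschitz_functions.
Context {R : realType} {d : nat}.
Local Notation E := 'rV[R]_d.
Local Notation S := (@sphere R d).
Local Notation mu := (@omega R d).
Implicit Types (x y z : E) (f g h : E -> R).

Definition lipf f := measurable_fun setT f /\ exists2 L, 0 <= L &
  forall x y, `|f x - f y| <= L * enorm (x - y).

(** A generating family for Dynkin's lemma: it is stable under intersections because Lipschitz
    functions with values in [0, 1] may be multiplied. *)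
Definition lip_pos : set (set E) := [set A | exists2 f, lipf f /\ (forall x, 0 <= f x <= 1) &
  A = [set x | 0 < f x]].

Lemma lip_pos_setI : setI_closed lip_pos.
Proof.
move=> A B [f [[mf [L L0 fL]] f01] ->] [g [[mg [M M0 gM]] g01] ->].
exists (fun x => f x * g x).
  split; last by move=> x; have /andP[f0 f1] := f01 x; have /andP[g0 g1] := g01 x;
    rewrite mulr_ge0//= mulr_ile1.
  split; first exact: measurable_funM.
  exists (L + M); first exact: addr_ge0.
  move=> x y; have -> : f x * g x - f y * g y = (f x - f y) * g x + f y * (g x - g y) by ring.
  apply: le_trans (ler_normD _ _) _; rewrite !normrM mulrDl.
  have /andP[f0 f1] := f01 y; have /andP[g0 g1] := g01 x.
  apply: lerD; first by rewrite (ger0_norm g0); apply: le_trans (fL x y); rewrite ler_piMr.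
  by rewrite (ger0_norm f0); apply: le_trans (gM x y); rewrite ler_piMl.
apply/seteqP; split=> x /=; first by case=> h1 h2; rewrite mulr_gt0.
have /andP[f0 f1] := f01 x; have /andP[g0 g1] := g01 x.
by move=> h; split; rewrite lt_def ?f0 ?g0 andbT; apply: contraTneq h => ->;
  rewrite ?mul0r ?mulr0 ltxx.
Qed.

(** The half-space x_i > a belongs to the family, by truncating x_i - a to [0, 1]. *)
Lemma measurable_lip_pos : @measurable _ E = <<s lip_pos >>.
Proof.
apply/seteqP; split; last first.
  apply: smallest_sub; first exact: sigma_algebra_measurable.
  move=> A [f [[mf _] _] ->].
  have := mf measurableT _ (measurable_itv `]0, +oo[); rewrite setTI.
  by congr measurable; apply/seteqP; split=> x /=; rewrite in_itv/= andbT.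
apply: smallest_sub; first exact: smallest_sigma_algebra.
rewrite -bigcup_seq; apply: bigcup_sub => i _ A [B mB <-] /=.
suff H : <<s @RGenOInfty.G R >> `<=` [set B | <<s lip_pos >> ((fun x : E => x 0 i) @^-1` B)].
  have e : @measurable _ R = <<s @RGenOInfty.G R >> by exact: RGenOInfty.measurableE.
  by rewrite setTI; apply: H; rewrite -e.
apply: smallest_sub => [|_ [a ->]].
  split => /=.
  - by rewrite preimage_set0; exact: sigma_algebra0.
  - by move=> C mC; rewrite setTD preimage_setC; exact: sigma_algebraC.
  - by move=> F mF; rewrite preimage_bigcup; exact: sigma_algebra_bigcup.
  apply: sub_sigma_algebra; exists (fun x => Num.min 1 (Num.max 0 (x 0 i - a))).
    split; last first.
      by move=> x; rewrite le_min ler01 le_max lexx/= ge_min lexx.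
    split.
      apply: measurable_minr; first exact: measurable_cst.
      apply: measurable_maxr; first exact: measurable_cst.
      by apply: measurable_funB; [exact: measurable_rV_coord|exact: measurable_cst].
    exists 1 => // x y; rewrite mul1r.
    have : `|x 0 i - y 0 i| <= enorm (x - y) by have := coord_le_enorm (x - y) i; rewrite !mxE.
    apply: le_trans; move: (x 0 i) (y 0 i) => {x y} x y; rewrite /Num.min /Num.max.
    have e1 := ler_norm (x - y); have e2 := ler_norm (y - x); rewrite (distrC y) in e2.
    rewrite ler_norml; case: (ltP 0 (x - a)) => h1; case: (ltP 0 (y - a)) => h2;
      do ?case: ltP => ?; lra.
  by apply/seteqP; split=> x /=; rewrite in_itv/= andbT lt_min ltr01 lt_max ltxx/= subr_gt0.
Qed.

(** The indicator function of the set f > 0 is the limit of the Lipschitz functions min(1, n f).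
    Dynkin's lemma passes to all measurable sets, in particular to the set where g >= 0. *)
Lemma orthogonal_lipschitz_eq0 g : L1S g ->
  (forall h, lipf h -> (exists M, forall x, `|h x| <= M) -> IS (fun x => g x * h x) = 0) ->
  {ae mu, forall x, S x -> g x = 0}.
Proof.
move=> Lg g0; have mg := L1S_meas Lg.
have bI A : measurable A -> BM (\1_A : E -> R).
  move=> mA; split; first exact: measurable_indic.
  by exists 1 => y _; rewrite indicE ger0_norm// lern1 leq_b1.
have LgI A : measurable A -> L1S (fun x => g x * \1_A x).
  move=> mA; have := BM_mul_L1 (bI A mA) Lg; congr L1S; apply/funext => x; exact: mulrC.
have key A : measurable A -> IS (fun x => g x * \1_A x) = 0.
  move=> mA; have mA' : <<s lip_pos >> A by rewrite -measurable_lip_pos.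
  apply: (@dynkin_induction _ _ lip_pos (fun A => IS (fun x =>
    g x * \1_A x) = 0) measurable_lip_pos lip_pos_setI _ _ _ _ _ mA').
  - have -> : (fun x => g x * \1_[set: E] x) = fun x => g x * 1.
      by apply/funext => x; rewrite indicT.
    apply: g0; last by exists 1 => x; rewrite normr1.
    split; first exact: measurable_cst.
    by exists 0 => // x y; rewrite subrr normr0 mul0r.
  - move=> B [f [[mf [L L0 fL]] f01] ->].
    pose h_ n x := Num.min 1 (n%:R * f x).
    have lh n : lipf (h_ n).
      split; first by apply: measurable_minr; [exact: measurable_cst|apply: measurable_funM =>
        //; exact: measurable_cst].
      exists (n%:R * L); first by rewrite mulr_ge0.
      move=> x y; apply: (@le_trans _ _ `|n%:R * f x - n%:R * f y|).
        rewrite /h_; move: (n%:R * f x) (n%:R * f y) => a b; rewrite /Num.min.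
        by have := ler_norm (a - b); have := ler_norm (b - a); rewrite (distrC b) ler_norml;
          case: (ltP 1 a) => h1; case: (ltP 1 b) => h2; lra.
      by rewrite -mulrBr normrM normr_nat -mulrA ler_wpM2l.
    have h01 n x : `|h_ n x| <= 1.
      have /andP[f0 _] := f01 x.
      by rewrite ger0_norm /h_ ?ge_min ?lexx// le_min ler01 mulr_ge0.
    have c : IS (fun x => g x * h_ n x) @[n --> \oo] --> IS (fun x => g x * \1_[set x | 0 < f x] x).
      apply: (@IS_dominated _ _ _ _ (fun x => `|g x|)).
      + by move=> n; apply: measurable_funM => //; case: (lh n).
      + apply: L1S_meas; apply: LgI.
        have := mf measurableT _ (measurable_itv `]0, +oo[); rewrite setTI.
        by congr measurable; apply/seteqP; split=> x /=; rewrite in_itv/= andbT.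
      + exact: L1S_norm.
      + move=> x _; apply: cvgM; first exact: cvg_cst.
        rewrite indicE; have [f0|f0] := ltP 0 (f x).
          rewrite mem_set//; apply: cvg_near_cst; near=> n; rewrite /h_; apply/min_idPl.
          by rewrite -ler_pdivrMr// mul1r; near: n; exact: nbhs_infty_ger.
        rewrite memNset/=; last by apply/negP; rewrite -leNgt.
        apply: cvg_near_cst; near=> n; rewrite /h_; have /andP[f1 _] := f01 x.
        have -> : f x = 0 by apply/eqP; rewrite eq_le f0.
        by rewrite mulr0; apply/min_idPr.
      + by move=> n x _; rewrite normrM ler_piMr.
    have e n : IS (fun x => g x * h_ n x) = 0 by apply: g0 => //; exists 1; exact: h01.
    have c0 : IS (fun x => g x * h_ n x) @[n --> \oo] --> (0 : R).
      by under eq_fun do rewrite e; exact: cvg_cst.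
    exact: (cvg_unique _ c c0).
  - move=> B mB B0.
    have gT : IS g = 0.
      rewrite (eq_IS (g := fun x => g x * 1)) => [|x _]; last by rewrite mulr1.
      apply: g0; last by exists 1 => x; rewrite normr1.
      split; first exact: measurable_cst.
      by exists 0 => // x y; rewrite subrr normr0 mul0r.
    rewrite (eq_IS (g := fun x => g x - g x * \1_B x)).
      by rewrite (IS_sub Lg (LgI _ mB)) gT B0 subrr.
    move=> x _; rewrite !indicE in_setC; case: (x \in B) => /=; ring.
  - move=> F mF tF F0.
    pose G n := \bigcup_(i in `I_n) F i.
    have mG n : measurable (G n) by apply: bigcup_measurable.
    have G0 n : IS (fun x => g x * \1_(G n) x) = 0.
      elim: n => [|n IH].
        by apply: IS_eq0 => x _; rewrite /G bigcup_mkord big_ord0 indic0 mulr0.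
      rewrite (eq_IS (g := fun x => g x * \1_(G n) x + g x * \1_(F n) x)).
        by rewrite (IS_add (LgI _ (mG n)) (LgI _ (mF n))) IH F0 addr0.
      move=> x _; rewrite -mulrDr; congr (_ * _); rewrite !indicE -natrD; congr (_%:R).
      have -> : G n.+1 = G n `|` F n by rewrite /G !bigcup_mkord big_ord_recr.
      rewrite in_setU; have [xF|_] := boolP (x \in F n); last by rewrite orbF addn0.
      rewrite memNset// => -[k /= kn xFk]; move: xF; rewrite inE => xF.
      have := tF k n Logic.I Logic.I; rewrite /= => h.
      have : k = n by apply: h; exists x.
      by move=> kE; move: kn; rewrite kE ltnn.
    have c : IS (fun x => g x * \1_(G n) x) @[n --> \oo] --> IS (fun x =>
      g x * \1_(\bigcup_k F k) x).
      apply: (@IS_dominated _ _ _ _ (fun x => `|g x|)).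
      + by move=> n; apply: L1S_meas; exact: LgI.
      + by apply: L1S_meas; apply: LgI; exact: bigcup_measurable.
      + exact: L1S_norm.
      + move=> x _; apply: cvgM; first exact: cvg_cst.
        rewrite !indicE; have [|xF] := boolP (x \in \bigcup_k F k).
          rewrite inE => -[k _ xFk]; apply: cvg_near_cst; near=> n.
          rewrite indicE mem_set//; exists k => //=; near: n; exact: nbhs_infty_gt.
        apply: cvg_near_cst; near=> n; rewrite indicE memNset// => -[k _ xFk].
        by move: xF; rewrite notin_setE; apply; exists k.
      + by move=> n x _; rewrite normrM ler_piMr// indicE ger0_norm// lern1 leq_b1.
    have c0 : IS (fun x => g x * \1_(G n) x) @[n --> \oo] --> (0 : R).
      by under eq_fun do rewrite G0; exact: cvg_cst.
    exact: (cvg_unique _ c c0).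
pose A := [set x | 0 <= g x].
have mA : measurable A.
  have := mg measurableT _ (measurable_itv `[0, +oo[); rewrite setTI.
  by congr measurable; apply/seteqP; split=> x /=; rewrite in_itv/= andbT.
have : IS (fun x => `|g x|) = 0.
  rewrite (eq_IS (g := fun x => 2 * (g x * \1_A x) - g x * \1_setT x)).
    by rewrite (IS_sub (L1S_Z _ (LgI _ mA)) (LgI _ measurableT)) (IS_scale _ (LgI _ mA)) !key//
      mulr0 subrr.
  move=> x _; rewrite indicT indicE; have [|] := boolP (x \in A); rewrite ?inE ?notin_setE /A /=.
    by move=> h; rewrite ger0_norm//; ring.
  by move=> /negP; rewrite -ltNge => h; rewrite ltr0_norm//; ring.
move/(IS_nneg_eq0 (L1S_norm Lg) (fun x _ => normr_ge0 _)); apply: filterS => x hx Sx.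
by apply/normr0_eq0/hx.
Unshelve. all: by end_near. Qed.

End orthogonal_to_Lipschitz_functions.

(** * The Poisson transform and the moments *)

Section poisson_transform.
Context {R : realType} {d : nat}.
Local Notation E := 'rV[R]_d.
Local Notation S := (@sphere R d).
Local Notation mu := (@omega R d).
Hypothesis d3 : (3 <= d)%N.
Local Notation W := (@sphere_area R d).
Local Notation pk := (pk d).
Implicit Types (x y z : E) (r s t : R) (phi v : E -> R) (h : R -> R).

(** The Poisson kernel is symmetric, so that g is orthogonal to P_r h for each Lipschitz function h,
    and P_r h tends to W h. *)
Lemma Pk_injective g : L1S g ->
  (forall r x, 0 <= r < 1 -> S x -> IS (fun y => pk r (dotp x y) * g y) = 0) ->
  {ae mu, forall x, S x -> g x = 0}.
Proof.
move=> Lg Pg0; apply: orthogonal_lipschitz_eq0 => // h [mh [L L0 hL]] [M hM].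
have bh : BM h by split=> //; exists M => y _; exact: hM.
have W0 := @sphere_area_gt0 R d d3.
pose P m x := IS (fun y => pk (rr m) (dotp x y) * h y).
have mK m := @measurable_kernel R d (pk (rr m)) (@measurable_pk R d (rr m)).
have KM m : exists M, forall x y, S x -> S y -> `|pk (rr m) (dotp x y)| <= M.
  exists (`|1 - rr m ^+ 2| * (1 - `|rr m|)^-1 ^+ d) => x y Sx Sy.
  by rewrite normrM ler_wpM2l// qk_exp_bound ?rr_norm// dotp_itv.
have PM m x : S x -> `|P m x| <= `|M| * W.
  move=> Sx; have bp := BM_pk (rr_norm m) Sx.
  rewrite -(IS_pk d3 (rr_itv0 m) Sx) -(IS_scale _ (BM_L1 bp)).
  apply: IS_norm_le; [exact: BM_L1 (BM_mul bp bh)|exact: L1S_Z _ (BM_L1 bp)|].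
  move=> y Sy; rewrite normrM mulrC (ger0_norm (pk_ge0 _ (rr_itv0 m))).
  by rewrite ler_wpM2r ?pk_ge0 ?rr_itv0// (le_trans (hM y))// ler_norm.
have mP m : measurable_fun setT (P m) by apply: OpS_meas.
have c : IS (fun x => g x * P m x) @[m --> \oo] --> IS (fun x => g x * (W * h x)).
  apply: (@IS_dominated _ _ _ _ (fun x => `|M| * W * `|g x|)).
  - by move=> m; apply: measurable_funM; [exact: L1S_meas|exact: mP].
  - by apply: measurable_funM; [exact: L1S_meas|apply: measurable_funM => //;
    exact: measurable_cst].
  - exact: L1S_Z _ (L1S_norm Lg).
  - move=> x Sx; apply: cvgM; first exact: cvg_cst.
    by apply: (approx_identity d3 Sx L0 mh) => y Sy; rewrite enormB; exact: hL.
  - by move=> m x Sx; rewrite normrM mulrC ler_wpM2r// PM.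
have e m : IS (fun x => g x * P m x) = 0.
  have [M' KM'] := KM m.
  have FB := PL1S_fubini (@PL1S_bounded_kernel R d M' (fun x y =>
    pk (rr m) (dotp x y)) g h (mK m) KM' Lg (BM_L1 bh)).
  transitivity (IS (fun x => IS (fun y => g x * pk (rr m) (dotp x y) * h y))).
    apply: eq_IS => x Sx; rewrite -(IS_scale _ (BM_L1 (BM_mul (BM_pk (rr_norm m) Sx) bh))).
    by apply: eq_IS => y _; ring.
  rewrite FB /=; apply: IS_eq0 => y Sy.
  transitivity (h y * IS (fun x => pk (rr m) (dotp y x) * g x));
    last by rewrite Pg0 ?mulr0// rr_itv0.
  rewrite -(IS_scale _ (BM_mul_L1 (BM_pk (rr_norm m) Sy) Lg)).
  by apply: eq_IS => x _; rewrite (dotpC y); ring.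
have c0 : IS (fun x => g x * P m x) @[m --> \oo] --> (0 : R).
  by under eq_fun do rewrite e; exact: cvg_cst.
have z0 : IS (fun x => g x * (W * h x)) = 0 by exact: (cvg_unique _ c c0).
move: z0; rewrite (eq_IS (g := fun x => W * (h x * g x))); last by move=> x _; ring.
rewrite (IS_scale _ (BM_mul_L1 bh Lg)) => /eqP; rewrite mulf_eq0 (gt_eqF W0)/= => /eqP <-.
by apply: eq_IS => x _; rewrite mulrC.
Qed.

(** The moment at x0 + t z is a polynomial in t that vanishes for small t > 0, by homogeneity. Its
    coefficient of t^m is the moment at z. *)
Lemma mom_everywhere v (O : set E) x0 m : L1S v -> open O -> O x0 -> x0 != 0 ->
  (forall x, O x -> x != 0 -> mom v m (unitv x) = 0) -> forall z, mom v m z = 0.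
Proof.
move=> Lv oO Ox0 x00 O0 z.
have hom x : O x -> x != 0 -> mom v m x = 0.
  move=> Ox xn0; rewrite -[0](mulr0 (enorm x ^+ m)) -(O0 x Ox xn0) /mom -(IS_scale _ (mom_L1 m _
    Lv)).
  by apply: eq_IS => y _; rewrite -{1}(enorm_unitvK x) dotpZr exprMn; ring.
pose co k := IS (fun x => v x * (dotp x x0 ^+ (m - k) * dotp x z ^+ k)).
have Lco k : L1S (fun x => v x * (dotp x x0 ^+ (m - k) * dotp x z ^+ k)).
  have := BM_mul_L1 (BM_mul (BM_dotp_exp (m - k) x0) (BM_dotp_exp k z)) Lv.
  by congr L1S; apply/funext => x; rewrite mulrC.
pose P := \poly_(k < m.+1) (co k *+ 'C(m, k)).
have PE t : P.[t] = mom v m (x0 + t *: z).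
  rewrite horner_poly /mom.
  rewrite (eq_IS (g := fun x => \sum_(k < m.+1) (('C(m, k)%:R * t ^+ k) * (v x * (dotp x x0 ^+
    (m - k) * dotp x z ^+ k))))).
    rewrite IS_sum => [|k]; last by apply: L1S_Z; exact: Lco.
    by apply: eq_bigr => k _; rewrite (IS_scale _ (Lco k)) -/(co k) -mulr_natl; ring.
  move=> x _; rewrite dotpDr dotpZr exprDn mulr_sumr; apply: eq_bigr => k _.
  by rewrite exprMn -mulr_natl; ring.
have [e e0 He] : exists2 e, 0 < e & forall t, 0 < t < e -> P.[t] = 0.
  have ct : x0 + t *: z @[t --> (0 : R)] --> x0.
    rewrite -[X in _ --> X]addr0 -(scale0r z); apply: cvgD; first exact: cvg_cst.
    by apply: cvgZl; exact: cvg_id.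
  have : \forall t \near (0 : R), O (x0 + t *: z) /\ x0 + t *: z != 0.
    have n1 : \forall y \near x0, O y /\ y != 0.
      near=> y; split; near: y; [exact: open_nbhs_nbhs|exact: near_off0].
    exact: (ct _ n1).
  move=> /nbhs_ballP[e /= e0 He]; exists e => // t /andP[t0 te].
  rewrite PE; have [|h1 h2] := He t; last exact: hom.
  by rewrite /ball /= sub0r normrN gtr0_norm.
have P0 : P = 0.
  (* These are m + 1 distinct roots, more than the degree; dividing by at least 2 keeps them below
     e. *)
  pose rs := [seq e / (k.+2)%:R | k <- iota 0 m.+1].
  apply: (@roots_geq_poly_eq0 _ P rs).
  - apply/allP => _ /mapP[k _ ->]; apply/rootP/He.
    by rewrite divr_gt0//= ltr_pdivrMr// ltr_pMr// ltr1n.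
  - rewrite map_inj_uniq ?iota_uniq// => i j /(mulfI (lt0r_neq0 e0))/invr_inj/eqP.
    by rewrite eqr_nat => /eqP[].
  - by rewrite size_map size_iota size_poly.
have : P`_m = 0 by rewrite P0 coef0.
rewrite coef_poly ltnSn binn mulr1n => <-.
by apply: eq_IS => x _; rewrite subnn expr0 mul1r.
Unshelve. all: by end_near. Qed.

(** The Poisson kernel is a limit of polynomials in the scalar product. Dividing |r x - y|^2 by (1 +
    r)^2 brings it into (0, 1], where Newton's iteration tends to (1 + r) / |r x - y|. *)
Lemma Pk_of_moments v r x : L1S v -> (forall m z, mom v m z = 0) -> 0 <= r < 1 -> S x ->
  IS (fun y => pk r (dotp x y) * v y) = 0.
Proof.
move=> Lv mom0 r1 Sx; have /andP[r0 rl1] := r1.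
have Lmom m : L1S (fun y => dotp x y ^+ m * v y).
  have := mom_L1 m x Lv; congr L1S; apply/funext => y.
  by rewrite mulrC dotpC.
have poly0 (P : {poly R}) : L1S (fun y => P.[dotp x y] * v y) /\ IS (fun y =>
  P.[dotp x y] * v y) = 0.
  have e : (fun y => P.[dotp x y] * v y) = fun y =>
    \sum_(k < size P) (P`_k * (dotp x y ^+ k * v y)).
    by apply/funext => y; rewrite horner_coef mulr_suml; apply: eq_bigr => k _; ring.
  rewrite e; have LZ k : L1S (fun y => P`_k * (dotp x y ^+ k * v y)) by exact: L1S_Z.
  split; first exact: L1S_sum.
  rewrite IS_sum//; apply: big1 => k _; rewrite (IS_scale _ (Lmom k)).
  rewrite (eq_IS (g := fun y => v y * dotp y x ^+ k)) => [|y _]; last by rewrite mulrC dotpC.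
  by rewrite -/(mom v k x) mom0 mulr0.
pose q := (1 + r) ^+ 2; have q0 : 0 < q by rewrite exprn_gt0//; lra.
pose a : {poly R} := q^-1 *: ((1 + r ^+ 2)%:P - (2 * r) *: 'X).
have aE t : a.[t] = qs r t / q.
  by rewrite /a hornerZ hornerD hornerN hornerZ hornerC hornerX /qs mulrC; congr (_ / _); ring.
have a01 t : -1 <= t <= 1 -> 0 < a.[t] <= 1.
  move=> t1; have qs0 := qs_gt0 (norm_lt1 r1) t1.
  rewrite aE divr_gt0//= ler_pdivrMr// mul1r /qs /q; case/andP: t1 => t0 t1; nra.
pose F k : {poly R} := (newton k \Po a) ^+ d.
have FE k t : (F k).[t] = (newton k).[a.[t]] ^+ d by rewrite /F horner_exp horner_comp.
pose C := ((1 + r) / (1 - r)) ^+ d.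
have sqE t : -1 <= t <= 1 -> (Num.sqrt a.[t])^-1 = (1 + r) * qk r t.
  move=> t1; have qs0 := qs_gt0 (norm_lt1 r1) t1.
  rewrite aE sqrtrM ?(ltW qs0)// sqrtrV ?(ltW q0)// /q sqrtr_sqr ger0_norm; last lra.
  by rewrite invfM invrK mulrC.
have c : IS (fun y => (F k).[dotp x y] * v y) @[k --> \oo] -->
    IS (fun y => ((1 + r) * qk r (dotp x y)) ^+ d * v y).
  apply: (@IS_dominated _ _ _ _ (fun y => C * `|v y|)).
  - by move=> k; apply: L1S_meas; case: (poly0 (F k)).
  - apply: measurable_funM; last exact: L1S_meas.
    apply: measurable_funX; apply: measurable_funM; first exact: measurable_cst.
    by apply: measurable_qk; [exact: measurable_cst|exact: measurable_dotpr].
  - exact: L1S_Z _ (L1S_norm Lv).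
  - move=> y Sy; have t1 := dotp_itv Sx Sy; apply: cvgM; last exact: cvg_cst.
    under eq_fun do rewrite FE.
    rewrite -(sqE _ t1); exact: (cvg_comp _ _ (newton_cvg (a01 _ t1)) (@exprn_continuous R d _)).
  - move=> k y Sy; have t1 := dotp_itv Sx Sy; rewrite normrM ler_wpM2r// FE normrX /C.
    have /andP[n0 n1] := newton_le k (a01 _ t1).
    have rp : 0 < 1 - r by lra.
    apply: lerXn2r; rewrite ?nnegrE// ?divr_ge0//; [lra|lra|].
    rewrite (ger0_norm n0); apply: (le_trans n1); rewrite (sqE _ t1) ler_wpM2l//; first lra.
    by have := qk_le (norm_lt1 r1) t1; rewrite (ger0_norm r0).
have c0 : IS (fun y => (F k).[dotp x y] * v y) @[k --> \oo] --> (0 : R).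
  have e k : IS (fun y => (F k).[dotp x y] * v y) = 0 by case: (poly0 (F k)).
  by under eq_fun do rewrite e; exact: cvg_cst.
have z0 : IS (fun y => ((1 + r) * qk r (dotp x y)) ^+ d * v y) = 0 by exact: (cvg_unique _ c c0).
have Lq : L1S (fun y => qk r (dotp x y) ^+ d * v y).
  exact: BM_mul_L1 (BM_qk d (norm_lt1 r1) Sx) Lv.
have e1 : IS (fun y => qk r (dotp x y) ^+ d * v y) = 0.
  apply: (mulfI (lt0r_neq0 (exprn_gt0 d (_ : 0 < 1 + r)))); first lra.
  rewrite -(IS_scale _ Lq) mulr0; apply: etrans z0; apply: eq_IS => y _.
  by rewrite exprMn mulrA.
rewrite (eq_IS (g := fun y => (1 - r ^+ 2) * (qk r (dotp x y) ^+ d * v y))); last first.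
  by move=> y _; rewrite mulrA.
by rewrite (IS_scale _ Lq) e1 mulr0.
Qed.

End poisson_transform.

Section injectivity_on_the_sphere.
Context {R : realType} {d : nat}.
Local Notation E := 'rV[R]_d.
Local Notation S := (@sphere R d).
Local Notation mu := (@omega R d).
Hypothesis d3 : (3 <= d)%N.
Local Notation n := (d - 2)%N.
Local Notation kk := (kk d).
Local Notation pk := (pk d).
Local Notation dpk := (dpk d).
Local Notation dkk := (dkk d).
Local Notation beta := (@beta R d).
Local Notation W := (@sphere_area R d).
Implicit Types (x y z : E) (r s t : R) (f g v phi : E -> R) (Sigma : set E).

(** The topology is that of the sup norm, which the Euclidean norm dominates, and |x - x0|^2 = 2 - 2
    x . x0 on the sphere. *)
Lemma sphere_open_cap Sigma x0 : sphere_open Sigma -> Sigma x0 ->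
  exists2 c0, c0 < 1 & forall x, S x -> c0 < dotp x x0 -> Sigma x.
Proof.
move=> [U oU ->] [Ux0 Sx0].
have /nbhs_ballP[e /= e0 He] : nbhs x0 U by exact: open_nbhs_nbhs.
exists (1 - e ^+ 2 / 2); first by rewrite gtrDl oppr_lt0 divr_gt0// exprn_gt0.
move=> x Sx xc; split=> //; apply: He; split=> // i j; rewrite ord1 /ball /=.
have h : enorm (x0 - x) ^+ 2 < e ^+ 2.
  rewrite enorm_sqr dotpBl !dotpBr (dotp_sphere Sx) (dotp_sphere Sx0) (dotpC x0); lra.
have : enorm (x0 - x) < e by rewrite -(ltr_pXn2r (n := 2)) ?nnegrE ?enorm_ge0// ltW.
by apply: le_lt_trans; have := coord_le_enorm (x0 - x) j; rewrite !mxE.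
Qed.

Lemma cvg_unitv x : x != 0 -> unitv y @[y --> x] --> unitv x.
Proof.
move=> x0; have cV : (fun y => (enorm y)^-1) y @[y --> x] --> (enorm x)^-1 :=
  Sm_continuous (@Sm_enormV R d) x0.
by have cx : y @[y --> (x : E)] --> (x : E) by []; exact: (cvgZ cV cx).
Qed.

Lemma closed_cap x0 c : closed (S `&` [set x | c <= dotp x x0]).
Proof.
have -> : S `&` [set x | c <= dotp x x0] = S `&` (fun x =>
  dotp (x - x0) (x - x0)) @^-1` [set t | t <= 1 + dotp x0 x0 - 2 * c].
  apply/seteqP; split=> x [Sx /= h]; split=> //=; move: h;
    rewrite dotpBl !dotpBr (dotp_sphere Sx) (dotpC x0 x); lra.
apply: closedI; first exact: compact_closed (@norm_hausdorff _ _) (@compact_sphere R d).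
have cB : continuous (fun x : E => x - x0).
  by move=> x; apply: continuousB; [move=> y; exact: cvg_id|exact: cst_continuous].
apply: closed_comp; last exact: closed_le.
move=> x _; apply: (@continuous_comp _ _ _ (fun x : E => x - x0) (fun x : E => dotp x x));
  last exact: continuous_dotp.
exact: cB.
Qed.

Lemma capped_Cc Sigma x0 c0 c phi : (forall x, S x -> c0 < dotp x x0 -> Sigma x) ->
  c0 < c -> capped x0 c phi -> Cc_infty Sigma phi.
Proof.
move=> Hc c0c [[sphi rphi] phi0].
have sub : closure (S `&` [set x | phi x != 0]) `<=` S `&` [set x | c <= dotp x x0].
  rewrite closureE; apply: smallest_sub; first exact: closed_cap.
  move=> x [Sx px]; split=> //=; rewrite leNgt; apply/negP => xc.
  by move: px; rewrite /= phi0 ?eqxx.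
split.
- have -> : smooth phi = smooth_on off0 phi; last exact: Sm_smooth_on.
  by rewrite /smooth (_ : radial_ext phi = phi)//; apply/funext.
- apply: (subclosed_compact _ (@compact_sphere R d)); first exact: closed_closure.
  by move=> x /sub[].
- by move=> x /sub[Sx xc]; apply: Hc => //; apply: lt_le_trans xc.
Qed.

Lemma Tk_bounded r phi M x : 0 <= r < 1 -> measurable_fun setT phi ->
  (forall y, S y -> `|phi y| <= M) -> S x -> `|Tk r phi x| <= M * W.
Proof.
move=> r1 mphi phiM Sx; have bk := BM_kk (norm_lt1 r1) Sx.
have bphi : BM phi by split=> //; exists M.
rewrite -(IS_kk d3 r1 Sx) -(IS_scale _ (BM_L1 bk)).
apply: IS_norm_le; [exact: BM_L1 (BM_mul bk bphi)|exact: L1S_Z _ (BM_L1 bk)|].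
move=> y Sy; have k0 : 0 <= kk r (dotp x y) by rewrite exprn_ge0// qk_ge0.
by rewrite normrM mulrC (ger0_norm k0) ler_wpM2r ?phiM.
Qed.

Lemma IS_Tk_cvg g phi : L2S g -> BM phi ->
  IS (fun x => g x * Tk (rr m) phi x) @[m --> \oo] --> IS (fun x => g x * Tk 1 phi x).
Proof.
move=> Lg bphi; have [mphi [M HM]] := bphi.
have mg := L2S_meas Lg.
apply: (@IS_dominated _ _ _ _ (fun x => M * W * `|g x|)).
- move=> m; apply: measurable_funM => //.
  exact: (OpS_meas (measurable_kernel (measurable_kk (rr m))) mphi).
- by apply: measurable_funM => //; exact: (OpS_meas (measurable_kernel (measurable_kk 1)) mphi).
- exact: L1S_Z _ (L1S_norm (L2S_L1S Lg)).
- move=> x Sx; apply: cvgM; first exact: cvg_cst.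
  exact: (IS_kk_cvg d3 Sx mphi (kk1_bounded_L1 d3 Sx bphi)).
- by move=> m x Sx; rewrite normrM mulrC ler_wpM2r// Tk_bounded// rr_itv0.
Qed.

(** Where the scalar product is at most [tau], the factor 1 - r^2 tends to 0 harmlessly, and only
    the derivative of this factor survives: [qkernel] tends to -2 |x - y|^(-d). On the other side of
    [pairing_qkernel] appears the pairing of T g with lap phi. *)
Lemma BP_qk_eq0 g v x0 c0 c phi e : L2S g -> e ^+ 2 = 1 -> L1S v ->
  {ae mu, forall x, S x -> v x = Tk 1 g x + e * W * g x} ->
  S x0 -> c0 < c -> (forall x, S x -> c0 < dotp x x0 -> v x = 0) ->
  capped x0 c phi -> IS (fun x => Tk 1 g x * lap phi x) = 0 ->
  BP v c0 c (fun t => qk 1 t ^+ d) phi = 0.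
Proof.
move=> Lg e1 Lv aev Sx0 c0c v0 cphi lap0; have [sphi _] := cphi.
have bphi := BM_RS sphi.
have rm01 m : 0 < (rr m : R) < 1 by have /andP[h ->] := @rr_itv R m; rewrite andbT; lra.
pose q m t := @qkernel R d (rr m) e t.
have mq m : measurable_fun setT (q m).
  apply: measurable_funD; apply: measurable_funM => //; first exact: measurable_dpk.
  exact: measurable_pk.
pose tau : R := 1 - (c - c0) ^+ 2 / 2.
have tau1 : tau < 1 := tau_lt1 c0c.
pose b k := (2 * qk 1 tau) ^+ k.
have b0 k : 0 <= b k by rewrite exprn_ge0// mulr_ge0// qk_ge0.
have qb k m t : -1 <= t <= tau -> `|qk (rr m) t ^+ k| <= b k by exact: qk_rr_tau.
have qM m t : -1 <= t <= tau ->
    `|q m t| <= 2 * b d + d%:R * 2 * b d.+2 + `|1 - e| * `|beta| * b d.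
  move=> /[dup] tt /andP[t0 t1].
  have /andP[r0 r1] := rm01 m.
  rewrite /q /qkernel /(dpk _ _) /(pk _ _); set r := rr m in r0 r1 *.
  have h1 := qb d m t tt; have h2 := qb d.+2 m t tt.
  have n1 : `|1 - r ^+ 2| <= 1 by rewrite ler_norml; nra.
  apply: le_trans (ler_normD _ _) _; apply: lerD.
    rewrite normrM (gtr0_norm r0); apply: le_trans (_ : 1 * _ <= _);
      first exact: (ler_wpM2r _ (ltW r1)).
    rewrite mul1r; apply: le_trans (ler_normD _ _) _; apply: lerD.
      rewrite normrM normrN; apply: ler_pM => //.
      by rewrite ger0_norm; lra.
    rewrite normrM -[leRHS]mul1r; apply: ler_pM => //.
    rewrite normrM; apply: ler_pM => //; rewrite normrM normr_nat ler_wpM2l//.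
    by rewrite ler_norml; lra.
  rewrite !normrM; apply: ler_wpM2l => //.
  by rewrite -[leRHS]mul1r; apply: ler_pM.
have qc t : -1 <= t <= tau -> q m t @[m --> \oo] --> -2 * qk 1 t ^+ d.
  move=> /andP[t0 t1]; have tt : -1 <= t < 1 by rewrite t0 (le_lt_trans t1).
  have c1 := @rr_cvg R.
  have -> : -2 * qk 1 t ^+ d = 1 * (- (2 * 1) * qk 1 t ^+ d +
      (1 - 1 ^+ 2) * (d%:R * (t - 1) * qk 1 t ^+ d.+2)) +
      (1 - e) * beta * ((1 - 1 ^+ 2) * qk 1 t ^+ d) by ring.
  have c2 : 1 - rr m ^+ 2 @[m --> \oo] --> (1 - 1 ^+ 2 : R).
    by apply: cvgB; [exact: cvg_cst|apply: cvgM].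
  apply: cvgD; apply: cvgM => //.
  - apply: cvgD; apply: cvgM => //.
    + by apply: cvgN; apply: cvgM => //; exact: cvg_cst.
    + exact: qk_cvg.
    + apply: cvgM; last exact: qk_cvg.
      by apply: cvgM; [exact: cvg_cst|apply: cvgB => //; exact: cvg_cst].
  - exact: cvg_cst.
  - by apply: cvgM => //; exact: qk_cvg.
have mh : measurable_fun setT (fun t => -2 * qk 1 t ^+ d : R).
  by apply: measurable_funM => //; exact: measurable_qk_exp.
have c1 := @BP_cvg _ _ v c0 c Lv q _ _ phi mq mh bphi qM qc.
have h m : beta * BP v c0 c (q m) phi = - (e * W * IS (fun x => g x * Tk (rr m) (lap phi) x)).
  rewrite -(pairing_qkernel d3 Lg sphi (rm01 m) e1) (BP_capped Sx0 c0c v0 _ cphi); congr (_ * _).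
  have LT : L2S (Tk 1 g) := OpS_L2 (schur_kk1 d3) Lg.
  have bD : BM (fun x => IS (fun y => q m (dotp x y) * phi y)).
    have [M HM] := @qkernel_bounded R d (rr m) e (rm01 m).
    split; first exact: (OpS_meas (measurable_kernel (mq m)) (proj1 bphi)).
    exists (IS (fun y => M * `|phi y|)) => x Sx.
    have bq := BM_qkernel e (rm01 m) Sx.
    apply: IS_norm_le; [exact: BM_L1 (BM_mul bq bphi)|exact: L1S_Z _ (L1S_norm (BM_L1 bphi))|].
    by move=> y Sy; rewrite normrM ler_wpM2r// HM.
  have Lu : L1S (fun x => Tk 1 g x + e * W * g x).
    exact: L1S_D (L2S_L1S LT) (L1S_Z _ (L2S_L1S Lg)).
  have e0 f : (fun x => f x * IS (fun y => q m (dotp x y) * phi y)) =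
      (fun x => IS (fun y => q m (dotp x y) * phi y) * f x).
    by apply/funext => x; rewrite mulrC.
  rewrite !e0; apply: (IS_ae_eq (BM_mul_L1 bD Lv) (BM_mul_L1 bD Lu)).
  by apply: filterS aev => x hx Sx; rewrite hx.
have c2 : beta * BP v c0 c (q m) phi @[m --> \oo] --> (0 : R).
  have -> : (0 : R) = - (e * W * IS (fun x => g x * Tk 1 (lap phi) x)).
    rewrite (OpS_sym (schur_kk1 d3) Lg (BM_L2 (BM_RS (RS_lap sphi)))).
    by rewrite -/(Tk 1 g) lap0 mulr0 oppr0.
  under eq_fun do rewrite h.
  apply: cvgN; apply: cvgM; first exact: cvg_cst.
  exact: IS_Tk_cvg Lg (BM_RS (RS_lap sphi)).
have c3 : beta * BP v c0 c (q m) phi @[m --> \oo] --> beta * BP v c0 c (fun t =>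
  -2 * qk 1 t ^+ d) phi.
  by apply: cvgM => //; exact: cvg_cst.
have z0 : beta * BP v c0 c (fun t => -2 * qk 1 t ^+ d) phi = 0 by exact: (cvg_unique _ c3 c2).
have Hq := HB_exp d (HB_qk1 c0c).
move: z0; rewrite (BP_scale Lv _ Hq bphi) => /eqP.
rewrite mulf_eq0 gt_eqF ?beta_gt0//= mulf_eq0 oppr_eq0 pnatr_eq0/= => /eqP; exact.
Qed.

(* The moments of [T g + e W g] vanish at the points of [Sigma], and they are
   polynomials, so they vanish everywhere. *)
Lemma trace_eq0 Sigma g e : Sigma !=set0 -> sphere_open Sigma ->
  L2S g -> e ^+ 2 = 1 ->
  {ae mu, forall x, Sigma x -> Tk 1 g x + e * W * g x = 0} ->
  (forall phi, RS phi -> Cc_infty Sigma phi -> IS (fun x => Tk 1 g x * lap phi x) = 0) ->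
  {ae mu, forall x, S x -> Tk 1 g x + e * W * g x = 0}.
Proof.
move=> [x1 Sx1] oS Lg e1 u0 lap0; pose u x := Tk 1 g x + e * W * g x.
have Lu : L1S u.
  exact: L1S_D (L2S_L1S (OpS_L2 (schur_kk1 d3) Lg)) (L1S_Z _ (L2S_L1S Lg)).
have SS x : Sigma x -> S x by move: oS => [U oU ->] [].
have mom0 x0 m : Sigma x0 -> mom u m x0 = 0.
  move=> Sx0; have [c0 c01 Hc] := sphere_open_cap oS Sx0.
  (* The function u vanishes on the cap only almost everywhere, whereas the lemmas on caps ask for
     every point. *)
  pose v x := if dotp x x0 <= c0 then u x else 0.
  have mv : measurable_fun setT v.
    apply: measurable_fun_if => //.
    - apply: measurable_fun_ler; last exact: measurable_cst.
      by apply: measurable_dotp2; [exact: measurable_id|exact: measurable_cst].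
    - by apply: measurable_funS (L1S_meas Lu).
  have vu : {ae mu, forall x, S x -> v x = u x}.
    apply: filterS u0 => x hx Sx; rewrite /v; case: leP => // xc.
    by rewrite /u hx//; exact: Hc.
  have Lv : L1S v.
    apply: (L1S_le_ae mv (L1S_norm Lu)); apply: filterS vu => x hx Sx.
    by rewrite hx.
  have <- : mom v m x0 = mom u m x0.
    apply: (IS_ae_eq (mom_L1 m x0 Lv) (mom_L1 m x0 Lu)).
    by apply: filterS vu => x hx Sx; rewrite hx.
  have v0 x : S x -> c0 < dotp x x0 -> v x = 0 by move=> _ xc; rewrite /v leNgt xc.
  apply: (mom_centre d3 Lv (SS _ Sx0) c01 v0) => c phi c0c cphi.
  apply: (BP_qk_eq0 Lg e1 Lv vu (SS _ Sx0) c0c v0 cphi).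
  exact: lap0 (proj1 cphi) (capped_Cc Hc c0c cphi).
have [U oU SU] := oS.
have momz m z : mom u m z = 0.
  (* The polynomial argument needs an open subset of R^d; the cone over Sigma is one. *)
  apply: (@mom_everywhere _ _ u [set x | x != 0 /\ U (unitv x)] x1 m Lu).
  - rewrite openE => x [x0 Ux].
    have nU : \forall y \near x, U (unitv y) by apply: (cvg_unitv x0); exact: open_nbhs_nbhs.
    by apply: filterS2 (near_off0 x0) nU => y y0 Uy.
  - have := Sx1; rewrite SU => -[Ux1 S1]; split; first exact: sphere_neq0.
    by rewrite /unitv S1 invr1 scale1r.
  - exact: sphere_neq0 (SS _ Sx1).
  - move=> x [x0 Ux] _; apply: mom0; rewrite SU; split=> //.
    exact: sphere_unitv.
apply: (Pk_injective d3 Lu) => r x r1 Sx.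
exact: (Pk_of_moments Lu momz r1 Sx).
Qed.

Lemma Pk_trace r e g x : 0 <= r < 1 -> L2S g -> S x ->
  IS (fun y => pk r (dotp x y) * (Tk 1 g y + e * W * g y)) =
  W * (IS (fun y => kk r (dotp x y) * g y) + e * IS (fun y => pk r (dotp x y) * g y)).
Proof.
move=> r1 Lg Sx; have rn := norm_lt1 r1; have bp := BM_pk rn Sx.
have LT : L2S (Tk 1 g) := OpS_L2 (schur_kk1 d3) Lg.
have L1 := BM_mul_L1 bp (L2S_L1S LT); have L2 := BM_mul_L1 bp (L2S_L1S Lg).
have Lk := BM_mul_L1 (BM_kk rn Sx) (L2S_L1S Lg).
rewrite (eq_IS (g := fun y => pk r (dotp x y) * Tk 1 g y + e * W * (pk r (dotp x y) * g y)));
  last first.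
  by move=> y _; ring.
rewrite (IS_add L1 (L1S_Z _ L2)) (IS_scale _ L2).
have [M KM] : exists M, forall y z, S y -> S z -> `|pk r (dotp y z)| <= M.
  exists (`|1 - r ^+ 2| * (1 - `|r|)^-1 ^+ d) => y z Sy Sz.
  by rewrite normrM ler_wpM2l//; apply: qk_exp_bound => //; exact: dotp_itv.
rewrite (@OpS_bounded_comp _ _ (fun x y => pk r (dotp x y)) (fun x y => kk 1 (dotp x y)) M x g Sx
  (measurable_kernel (@measurable_pk R d r)) KM (schur_kk1 d3) Lg).
rewrite (eq_IS (g := fun z => W * (kk r (dotp x z) * g z))) => [|z Sz].
  by rewrite (IS_scale _ Lk); ring.
rewrite mulrA (dotpC x z) -IS_kk1_pk//; congr (_ * _); apply: eq_IS => y _.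
by rewrite (dotpC y z) mulrC.
Qed.

(* Since [t d/dt T_t g = beta (P_t g - T_t g) = - k T_t g], the function
   [t^k T_t g] of [t] is constant. *)
Lemma trace_injective e k g : k%:R = beta * (1 + e) -> e ^+ 2 = 1 -> L2S g ->
  0 ^+ k * IS g = 0 ->
  {ae mu, forall x, S x -> Tk 1 g x + e * W * g x = 0} ->
  {ae mu, forall x, S x -> g x = 0}.
Proof.
move=> ke e1 Lg g0 ae; have L1 := L2S_L1S Lg.
have W0 := @sphere_area_gt0 R d d3.
have PT r x : 0 <= r < 1 -> S x ->
    IS (fun y => kk r (dotp x y) * g y) + e * IS (fun y => pk r (dotp x y) * g y) = 0.
  move=> r1 Sx; apply: (mulfI (lt0r_neq0 W0)); rewrite mulr0 -Pk_trace//.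
  have bp := BM_pk (norm_lt1 r1) Sx.
  have Lu : L1S (fun x => Tk 1 g x + e * W * g x).
    exact: L1S_D (L2S_L1S (OpS_L2 (schur_kk1 d3) Lg)) (L1S_Z _ L1).
  rewrite -[RHS](@IS_eq0 R d (fun=> 0))//.
  apply: (IS_ae_eq (BM_mul_L1 bp Lu) (@L1S_cst R d 0)).
  by apply: filterS ae => y hy Sy; rewrite hy// mulr0.
have T0 r x : 0 < r < 1 -> S x -> IS (fun y => kk r (dotp x y) * g y) = 0.
  move=> /andP[r0 r1] Sx; pose T t := IS (fun y => kk t (dotp x y) * g y).
  pose N t : R := t ^+ k * T t.
  have dN t : 0 <= t < 1 -> is_derive t 1 N
      (t ^+ k * IS (fun y => dkk t (dotp x y) * g y) + T t * (k%:R * t ^+ k.-1)).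
    move=> t1; have := is_derive_IS_kk (norm_lt1 t1) Sx L1 => dT.
    have dX : is_derive t 1 (fun t : R => t ^+ k) (k%:R * t ^+ k.-1).
      have := is_deriveX k (is_derive_id t 1); rewrite (_ : id ^+ k = fun t => t ^+ k) =>
        [/is_derive_eq|].
        by apply; rewrite /GRing.scale /= mulr1.
      by apply/funext => s; rewrite fctE.
    exact: is_deriveM.
  have : N 0 = N r.
    apply: (is_derive0_cst (ltW r0)) => [t /andP[t0 tr]|].
      have t1 : 0 <= t < 1 by rewrite ltW// (lt_trans tr).
      apply: (is_derive_eq (dN t t1)); apply: (mulfI (lt0r_neq0 t0)); rewrite mulr0.
      rewrite mulrDr mulrCA (r_IS_dkk d3 (norm_lt1 t1) Sx L1) -/(T t).
      set p := IS _; have Tp : T t = - (e * p) by apply/eqP; rewrite -addr_eq0 PT.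
      have -> : t * (T t * (k%:R * t ^+ k.-1)) = k%:R * t ^+ k * T t.
        by case: k {ke g0 N dN} => [|k]; rewrite ?exprS/=; ring.
      rewrite ke Tp; transitivity (beta * t ^+ k * p * (1 - e ^+ 2)); first by ring.
      by rewrite e1 subrr mulr0.
    apply: continuous_in_subspaceT => t; rewrite inE /= in_itv/= => /andP[t0 tr].
    apply: differentiable_continuous; apply/derivable1_diffP.
    by case: (dN t _) => //; rewrite t0 (le_lt_trans tr).
  (* As [0 ^+ 0] is 1, the hypothesis on [0 ^+ k * IS g] means zero mean for k = 0, which is e = -1;
     for k > 0 it always holds. *)
  have -> : N 0 = 0.
    rewrite /N -[RHS]g0; congr (_ * _); apply: eq_IS => y _.
    by rewrite kk0 mul1r.
  by move=> /esym/eqP; rewrite /N mulf_eq0 expf_eq0 (gt_eqF r0) andbF => /eqP.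
have e0 : e != 0 by apply: contra_eq_neq e1 => ->; rewrite expr0n eq_sym oner_eq0.
apply: (Pk_injective d3 L1) => r x; rewrite le_eqVlt => /andP[/predU1P[<-|r0] r1] Sx.
  have -> : IS (fun y => pk 0 (dotp x y) * g y) = IS g.
    by apply: eq_IS => y _; rewrite pk0 mul1r.
  case: k ke g0 {T0} => [_|k ke _]; first by rewrite expr0 mul1r.
  have := PT 0 x; rewrite lexx ltr01 => /(_ isT Sx).
  rewrite (eq_IS (g := g)) => [|y _]; last by rewrite kk0 mul1r.
  rewrite (eq_IS (f := fun y => pk 0 (dotp x y) * g y) (g := g)) => [|y _];
    last by rewrite pk0 mul1r.
  rewrite -[X in X + _]mul1r -mulrDl => /eqP; rewrite mulf_eq0 => /orP[/eqP h|/eqP//].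
  by move: ke => /eqP; rewrite h mulr0 pnatr_eq0.
have := PT r x; rewrite r1 ltW// => /(_ isT Sx).
rewrite T0 ?r0// add0r => /eqP; rewrite mulf_eq0 (negbTE e0) => /eqP; exact.
Qed.

End injectivity_on_the_sphere.

(** * Weak gradients of single layer potentials *)

Section bounded_kernels.
Context {R : realType} {d : nat}.
Local Notation E := 'rV[R]_d.
Local Notation S := (@sphere R d).
Implicit Types (x y z : E) (f g : E -> R) (A B : E -> E -> R).

Definition BK A := measurable_fun setT (fun w : E * E => A w.1 w.2) /\
  exists M, forall x y, S x -> S y -> `|A x y| <= M.

Lemma BK_transp A : BK A -> BK (fun x y => A y x).
Proof.
move=> [mA [M AM]]; split; last by exists M => x y Sx Sy; exact: AM.
exact: (measurableT_comp mA (@measurable_swap _ _ E E)).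
Qed.

Lemma BM_BK A x : BK A -> S x -> BM (A x).
Proof.
move=> [mA [M AM]] Sx; split; last by exists M => y Sy; exact: AM.
exact: (measurableT_comp mA (@pair1_measurable _ _ E E x)).
Qed.

Lemma BM_OpS A f : BK A -> L1S f -> BM (OpS A f).
Proof.
move=> bA Lf; have [mA [M AM]] := bA; split; first exact: (OpS_meas mA (L1S_meas Lf)).
exists (IS (fun y => M * `|f y|)) => x Sx; apply: IS_norm_le.
- exact: BM_mul_L1 (BM_BK bA Sx) Lf.
- exact: L1S_Z _ (L1S_norm Lf).
- by move=> y Sy; rewrite normrM ler_wpM2r// AM.
Qed.

Lemma OpS_adjoint A f g : BK A -> L1S f -> L1S g ->
  IS (fun x => g x * OpS A f x) = IS (fun y => f y * OpS (fun x y => A y x) g y).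
Proof.
move=> bA Lf Lg; have [mA [M AM]] := bA.
have FB := PL1S_fubini (@PL1S_bounded_kernel R d M A g f mA AM Lg Lf).
transitivity (IS (fun x => IS (fun y => g x * A x y * f y))).
  apply: eq_IS => x Sx; rewrite -(IS_scale _ (BM_mul_L1 (BM_BK bA Sx) Lf)).
  by apply: eq_IS => y _; ring.
rewrite FB /=; apply: eq_IS => y Sy.
rewrite -(IS_scale _ (BM_mul_L1 (BM_BK (BK_transp bA) Sy) Lg)).
by apply: eq_IS => x _; ring.
Qed.

(** The kernel of the adjoint of A composed with B; its quadratic form at f is the scalar product of
    A f and B f. *)
Definition gram A B y z : R := IS (fun x => A x y * B x z).

Lemma BM_gram A B y : BK A -> BK B -> S y -> BM (gram A B y).
Proof.
move=> bA bB Sy; have Ly := BM_L1 (BM_BK (BK_transp bA) Sy).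
have -> : gram A B y = OpS (fun z x => B x z) (fun x => A x y).
  by apply/funext => z; apply: eq_IS => x _; rewrite mulrC.
exact: BM_OpS (BK_transp bB) Ly.
Qed.

Lemma OpS_gram A B f y : BK A -> BK B -> L1S f -> S y ->
  OpS (fun x y => A y x) (OpS B f) y = IS (fun z => gram A B y z * f z).
Proof.
move=> bA [mB [M BM_]] Lf Sy; have Ly := BM_L1 (BM_BK (BK_transp bA) Sy).
exact: (OpS_comp_bounded Sy Ly mB BM_ Lf).
Qed.

Lemma IS_OpS_OpS A B f : BK A -> BK B -> L1S f ->
  IS (fun x => OpS A f x * OpS B f x) = IS (fun y => f y * OpS (fun x y => A y x) (OpS B f) y).
Proof.
move=> bA bB Lf; rewrite -(OpS_adjoint bA Lf (BM_L1 (BM_OpS bB Lf))).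
by apply: eq_IS => x _; rewrite mulrC.
Qed.

Lemma gram_L1 A B f : BK A -> BK B -> L1S f ->
  L1S (fun y => f y * OpS (fun x y => A y x) (OpS B f) y).
Proof.
move=> bA bB Lf; have := BM_mul_L1 (BM_OpS (BK_transp bA) (BM_L1 (BM_OpS bB Lf))) Lf.
by congr L1S; apply/funext => y; rewrite mulrC.
Qed.

End bounded_kernels.

Section gradient_kernel.
Context {R : realType} {d : nat}.
Local Notation E := 'rV[R]_d.
Local Notation S := (@sphere R d).
Hypothesis d3 : (3 <= d)%N.
Local Notation n := (d - 2)%N.
Local Notation kk := (kk d).
Local Notation pk := (pk d).
Local Notation dpk := (dpk d).
Local Notation beta := (@beta R d).
Implicit Types (x y z : E) (r s t : R) (f g v phi : E -> R).

(** The kernel of the gradient of T_r, written out rather than as a derivative, so that it is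
    visibly measurable in both variables. *)
Definition gk r (i : 'I_d) x y : R :=
  n%:R * r * qk r (dotp x y) ^+ n.+2 * (y 0 i - dotp x y * x 0 i).

Lemma gk_Dr r i x y : `|r| < 1 -> S x -> S y -> gk r i x y = Dr i (fun x => kk r (td y x)) x.
Proof. by move=> r1 Sx Sy; rewrite Dr_kk. Qed.

Lemma BK_zonal (k : R -> R) M : measurable_fun setT k -> (forall t, -1 <= t <= 1 -> `|k t| <= M) ->
  BK (fun x y : E => k (dotp x y)).
Proof.
move=> mk kM; split; first exact: measurable_kernel.
by exists M => x y Sx Sy; apply: kM; exact: dotp_itv.
Qed.

Lemma BK_qk r k : `|r| < 1 -> BK (fun x y : E => qk r (dotp x y) ^+ k).
Proof.
move=> r1; apply: (@BK_zonal (fun t => qk r t ^+ k) ((1 - `|r|)^-1 ^+ k));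
  first exact: measurable_qk_exp.
by move=> t t1; exact: qk_exp_bound.
Qed.

Lemma BK_mul (A B : E -> E -> R) : BK A -> BK B -> BK (fun x y => A x y * B x y).
Proof.
move=> [mA [M AM]] [mB [N BN]]; split; first exact: measurable_funM.
by exists (M * N) => x y Sx Sy; rewrite normrM ler_pM ?AM ?BN.
Qed.

Lemma BK_kk r : `|r| < 1 -> BK (fun x y : E => kk r (dotp x y)).
Proof. exact: BK_qk. Qed.

Lemma BK_cst c : BK (fun x y : E => c).
Proof. by split; [exact: measurable_cst|exists `|c|]. Qed.

Lemma BK_pk r : `|r| < 1 -> BK (fun x y : E => pk r (dotp x y)).
Proof. by move=> r1; apply: BK_mul; [exact: BK_cst|exact: BK_qk]. Qed.

Lemma BK_gk r i : `|r| < 1 -> BK (gk r i).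
Proof.
move=> r1; apply: BK_mul; first by apply: BK_mul; [exact: BK_cst|exact: BK_qk].
split.
  apply: measurable_funB; first exact: (measurableT_comp (@measurable_rV_coord R d i)
    measurable_snd).
  apply: measurable_funM; first by apply: measurable_dotp2;
    [exact: measurable_fst|exact: measurable_snd].
  exact: (measurableT_comp (@measurable_rV_coord R d i) measurable_fst).
have c1 x : S x -> `|x 0 i| <= 1 by move=> Sx; apply: le_trans (coord_le_enorm x i) _; rewrite Sx.
exists 2 => x y Sx Sy; apply: le_trans (ler_normB _ _) _; rewrite -[leRHS]/(1 + 1) lerD ?c1//.
by rewrite normrM mulr_ile1 ?c1// dotp_norm_le1.
Qed.

(** Green's formula puts a Laplacian on k_s, [lap_kk] turns it into s d/ds p_s and kernels, and
    [IS_kk_dpk] eliminates that derivative. *)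
Lemma gram_gk r s y z : 0 <= r < 1 -> 0 < s < 1 -> S y -> S z ->
  \sum_i gram (gk r i) (gk s i) y z =
  beta ^+ 2 * (gram (fun x y => pk r (dotp x y)) (fun x y => pk s (dotp x y)) y z -
               gram (fun x y => kk r (dotp x y)) (fun x y => kk s (dotp x y)) y z).
Proof.
move=> r1 s1 Sy Sz; have rn := norm_lt1 r1.
have ss : 0 <= s < 1 by case/andP: s1 => /ltW -> ->.
have sn := norm_lt1 ss.
have sk := RS_kk rn Sy; have tk := RS_kk sn Sz.
rewrite -IS_sum; last first.
  move=> i; have := BM_mul (BM_BK (BK_transp (BK_gk i rn)) Sy) (BM_BK (BK_transp (BK_gk i sn)) Sz).
  exact: BM_L1.
rewrite (eq_IS (g := gradp (fun x => kk r (td y x)) (fun x => kk s (td z x)))); last first.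
  by move=> x Sx; apply: eq_bigr => i _; rewrite !gk_Dr.
apply: oppr_inj; rewrite -(Green1 sk tk).
have Lpk := BM_L1 (BM_mul (BM_pk sn Sz) (BM_kk rn Sy)).
have Ldk := BM_L1 (BM_mul (BM_dpk sn Sz) (BM_kk rn Sy)).
have Lkk := BM_L1 (BM_mul (BM_kk sn Sz) (BM_kk rn Sy)).
rewrite (eq_IS (g := fun x => - beta * (s * (dpk s (dotp z x) * kk r (dotp y x)) +
  beta * (pk s (dotp z x) * kk r (dotp y x) - kk s (dotp z x) * kk r (dotp y x))))); last first.
  by move=> x Sx; rewrite (lap_kk d3 sn Sz Sx) tdE// (dotpC x z) (dotpC x y); ring.
have LB := L1S_Z beta (L1S_B Lpk Lkk).
rewrite (IS_scale _ (L1S_D (L1S_Z s Ldk) LB)) (IS_add (L1S_Z s Ldk) LB) (IS_scale _ Ldk).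
rewrite (IS_scale _ (L1S_B Lpk Lkk)) (IS_sub Lpk Lkk) (IS_kk_dpk d3 r1 s1 Sy Sz).
have -> : gram (fun x y => pk r (dotp x y)) (fun x y => pk s (dotp x y)) y z =
    IS (fun x => pk s (dotp z x) * pk r (dotp y x)).
  by apply: eq_IS => x _; rewrite (dotpC x) (dotpC x) mulrC.
have -> : gram (fun x y => kk r (dotp x y)) (fun x y => kk s (dotp x y)) y z =
    IS (fun x => kk s (dotp z x) * kk r (dotp y x)).
  by apply: eq_IS => x _; rewrite (dotpC x) (dotpC x) mulrC.
ring.
Qed.

Definition Fk r i f x : R := OpS (gk r i) f x.

Lemma IS_Fk_Fk r s f : 0 <= r < 1 -> 0 < s < 1 -> L1S f ->
  \sum_i IS (fun x => Fk r i f x * Fk s i f x) =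
  beta ^+ 2 * (IS (fun x => Pk r f x * Pk s f x) - IS (fun x => Tk r f x * Tk s f x)).
Proof.
move=> r1 s1 Lf; have rn := norm_lt1 r1.
have ss : 0 <= s < 1 by case/andP: s1 => /ltW -> ->.
have sn := norm_lt1 ss.
have bp t : `|t| < 1 -> BK (fun x y : E => pk t (dotp x y)) by exact: BK_pk.
have bk t : `|t| < 1 -> BK (fun x y : E => kk t (dotp x y)) by exact: BK_kk.
rewrite (IS_OpS_OpS (bp _ rn) (bp _ sn) Lf) (IS_OpS_OpS (bk _ rn) (bk _ sn) Lf).
under eq_bigr => i _ do rewrite (IS_OpS_OpS (BK_gk i rn) (BK_gk i sn) Lf).
rewrite -(IS_sub (gram_L1 (bp _ rn) (bp _ sn) Lf) (gram_L1 (bk _ rn) (bk _ sn) Lf)).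
rewrite -(IS_scale _ (L1S_B (gram_L1 (bp _ rn) (bp _ sn) Lf) (gram_L1 (bk _ rn) (bk _ sn) Lf))).
rewrite -IS_sum; last by move=> i; exact: gram_L1 (BK_gk i rn) (BK_gk i sn) Lf.
apply: eq_IS => y Sy.
have Lp := BM_mul_L1 (BM_gram (bp _ rn) (bp _ sn) Sy) Lf.
have Lk := BM_mul_L1 (BM_gram (bk _ rn) (bk _ sn) Sy) Lf.
rewrite -mulr_sumr -mulrBr mulrCA; congr (_ * _).
rewrite (OpS_gram (bp _ rn) (bp _ sn) Lf Sy) (OpS_gram (bk _ rn) (bk _ sn) Lf Sy) -(IS_sub Lp Lk).
under eq_bigr => i _ do rewrite (OpS_gram (BK_gk i rn) (BK_gk i sn) Lf Sy).
rewrite -(IS_scale _ (L1S_B Lp Lk)) -IS_sum; last first.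
  by move=> i; exact: BM_mul_L1 (BM_gram (BK_gk i rn) (BK_gk i sn) Sy) Lf.
apply: eq_IS => z Sz; rewrite -mulr_suml gram_gk//; ring.
Qed.

(* This is the divergence theorem for the field [k_r(x . y) V(x)]. *)
Lemma IS_Fk_weak r f (V : 'I_d -> E -> R) : 0 <= r < 1 -> L1S f -> (forall i, RS (V i)) ->
  (forall x, x != 0 -> \sum_i xh i x * V i x = 0) ->
  \sum_i IS (fun x => Fk r i f x * V i x) = - IS (fun x => Tk r f x * \sum_i Dr i (V i) x).
Proof.
move=> r1 Lf sV tV; have rn := norm_lt1 r1.
have bV i := BM_RS (sV i).
pose D x := \sum_i Dr i (V i) x.
have sD : RS D by apply: RS_sum => i; exact: RS_Dr.
have bD := BM_RS sD.
have e i : IS (fun x => Fk r i f x * V i x) = IS (fun y => f y * OpS (fun x y =>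
  gk r i y x) (V i) y).
  rewrite -(OpS_adjoint (BK_gk i rn) Lf (BM_L1 (bV i))).
  by apply: eq_IS => x _; rewrite mulrC.
under eq_bigr => i _ do rewrite e.
have LO i : L1S (fun y => f y * OpS (fun x y => gk r i y x) (V i) y).
  have := BM_mul_L1 (BM_OpS (BK_transp (BK_gk i rn)) (BM_L1 (bV i))) Lf.
  by congr L1S; apply/funext => y; rewrite mulrC.
rewrite -(IS_sum LO).
have -> : IS (fun x => Tk r f x * D x) = IS (fun y => f y * OpS (fun x y => kk r (dotp y x)) D y).
  rewrite -(OpS_adjoint (BK_kk rn) Lf (BM_L1 bD)).
  by apply: eq_IS => x _; rewrite mulrC.
have LD : L1S (fun y => f y * OpS (fun x y => kk r (dotp y x)) D y).
  have := BM_mul_L1 (BM_OpS (BK_transp (BK_kk rn)) (BM_L1 bD)) Lf.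
  by congr L1S; apply/funext => y; rewrite mulrC.
rewrite -(IS_opp LD); apply: eq_IS => y Sy; rewrite -mulr_sumr -mulrN; congr (_ * _).
have sk := RS_kk rn Sy.
have sU i : RS (fun x => kk r (td y x) * V i x) by exact: RS_mul.
have tU x : x != 0 -> \sum_i xh i x * (kk r (td y x) * V i x) = 0.
  move=> x0; under eq_bigr => i _ do rewrite mulrCA.
  by rewrite -mulr_sumr tV// mulr0.
apply/eqP; rewrite -addr_eq0 -(IS_sum (f := fun i x => gk r i x y * V i x)); last first.
  by move=> i; exact: BM_L1 (BM_mul (BM_BK (BK_transp (BK_gk i rn)) Sy) (bV i)).
have Lg : L1S (fun x => \sum_i gk r i x y * V i x).
  by apply: L1S_sum => i; exact: BM_L1 (BM_mul (BM_BK (BK_transp (BK_gk i rn)) Sy) (bV i)).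
have Lk : L1S (fun x => kk r (dotp x y) * D x).
  exact: BM_L1 (BM_mul (BM_BK (BK_transp (BK_kk rn)) Sy) bD).
apply/eqP; rewrite -(IS_add Lg Lk) -[RHS](IS_Dr_tangent sU tU); apply: eq_IS => x Sx.
rewrite mulr_sumr -big_split; apply: eq_bigr => i _ /=.
rewrite DrM ?sphere_neq0//; [|exact: RS_Sm|exact: RS_Sm].
by rewrite gk_Dr// tdE.
Qed.

Lemma Fk_tangent r f x : `|r| < 1 -> L1S f -> S x -> \sum_i x 0 i * Fk r i f x = 0.
Proof.
move=> r1 Lf Sx.
have L i : L1S (fun y => gk r i x y * f y) by exact: BM_mul_L1 (BM_BK (BK_gk i r1) Sx) Lf.
rewrite (eq_bigr (fun i => IS (fun y => x 0 i * (gk r i x y * f y)))); last first.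
  by move=> i _; rewrite (IS_scale _ (L i)).
rewrite -IS_sum => [|i]; last exact: L1S_Z.
apply: IS_eq0 => y Sy.
rewrite (eq_bigr (fun i => (n%:R * r * qk r (dotp x y) ^+ n.+2 * f y) * (x 0 i * y 0 i) -
   (n%:R * r * qk r (dotp x y) ^+ n.+2 * f y) * dotp x y * (x 0 i * x 0 i))); last first.
  by move=> i _; rewrite /gk; ring.
rewrite sumrB -!mulr_sumr -/(dotp x y) -/(dotp x x) (dotp_sphere Sx); ring.
Qed.

End gradient_kernel.

Section weak_gradient.
Context {R : realType} {d : nat}.
Local Notation E := 'rV[R]_d.
Local Notation S := (@sphere R d).
Local Notation mu := (@omega R d).
Hypothesis d3 : (3 <= d)%N.
Local Notation n := (d - 2)%N.
Local Notation pk := (pk d).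
Local Notation beta := (@beta R d).
Local Notation W := (@sphere_area R d).
Implicit Types (x y z : E) (r s t : R) (f g v phi : E -> R).

Lemma BM_Pk r f : `|r| < 1 -> L1S f -> BM (Pk r f).
Proof. by move=> r1 Lf; exact: BM_OpS (BK_pk r1) Lf. Qed.

Lemma IS_Pk_Pk r s f : 0 <= r < 1 -> 0 <= s < 1 -> L1S f ->
  IS (fun x => Pk r f x * Pk s f x) = W * IS (fun x => f x * Pk (r * s) f x).
Proof.
move=> r1 s1 Lf; have rn := norm_lt1 r1; have sn := norm_lt1 s1.
have rs : `|r * s| < 1.
  by rewrite normrM -[ltRHS]mulr1; apply: ltr_pM.
have LP : L1S (fun x => f x * Pk (r * s) f x).
  have := BM_mul_L1 (BM_Pk rs Lf) Lf.
  by congr L1S; apply/funext => x; rewrite mulrC.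
rewrite (IS_OpS_OpS (BK_pk rn) (BK_pk sn) Lf) -(IS_scale _ LP); apply: eq_IS => y Sy.
rewrite (OpS_gram (BK_pk rn) (BK_pk sn) Lf Sy) mulrCA; congr (_ * _).
rewrite -(IS_scale _ (BM_mul_L1 (BM_pk rs Sy) Lf)); apply: eq_IS => z Sz.
rewrite mulrA -(IS_pk_pk d3 r1 s1 Sy Sz); congr (_ * _); apply: eq_IS => x _.
by rewrite (dotpC y) (dotpC z).
Qed.

Lemma IS_Pk_sqr_le r f : 0 <= r < 1 -> L2S f ->
  IS (fun x => Pk r f x ^+ 2) <= W ^+ 2 * IS (fun x => f x ^+ 2).
Proof.
move=> r1 Lf; apply: (OpS_L2_le (schur_pk (norm_lt1 r1))) => // x Sx.
rewrite -(IS_pk d3 r1 Sx) le_eqVlt; apply/orP; left; apply/eqP/eq_IS => y _.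
by rewrite ger0_norm// pk_ge0.
Qed.

(* [P_u P_t = W P_(ut)], and [P_u / W] is a contraction. *)
Lemma IS_Pk_sqr_mono s t f : 0 <= s -> s <= t -> t < 1 -> L2S f ->
  IS (fun x => Pk s f x ^+ 2) <= IS (fun x => Pk t f x ^+ 2).
Proof.
move=> s0; rewrite le_eqVlt => /predU1P[->//|st] t1 Lf.
have Lf1 := L2S_L1S Lf.
have t0 : 0 < t := le_lt_trans s0 st; pose u := s / t.
have u1 : 0 <= u < 1 by rewrite divr_ge0//= ?(ltW t0)// ltr_pdivrMr// mul1r.
have tt : 0 <= t < 1 by rewrite ltW.
have ss : 0 <= s < 1 by rewrite s0 (lt_trans st).
have W0 := @sphere_area_gt0 R d d3.
have W2 : 0 < W ^+ 2 by apply: exprn_gt0.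
rewrite -(ler_pM2l W2).
apply: le_trans (IS_Pk_sqr_le u1 (BM_L2 (BM_Pk (norm_lt1 tt) Lf1))).
have LPs := BM_L1 (BM_mul (BM_Pk (norm_lt1 ss) Lf1) (BM_Pk (norm_lt1 ss) Lf1)).
rewrite -(IS_scale _ LPs) le_eqVlt; apply/orP; left; apply/eqP/eq_IS => x Sx.
rewrite -expr2 -exprMn; congr (_ ^+ 2).
have [mp [M pM]] := @BK_pk R d t (norm_lt1 tt).
have Lux := BM_L1 (BM_pk (norm_lt1 u1) Sx).
have -> : Pk u (Pk t f) x = IS (fun z => IS (fun y => pk u (dotp x y) * pk t (dotp y z)) * f z).
  exact: (@OpS_comp_bounded R d (fun x y => pk u (dotp x y)) (fun x y =>
    pk t (dotp x y)) M x f Sx Lux mp pM Lf1).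
rewrite -(IS_scale _ (BM_mul_L1 (BM_pk (norm_lt1 ss) Sx) Lf1)); apply: eq_IS => z Sz.
have -> : s = u * t by rewrite /u divfK// gt_eqF.
rewrite mulrA -(IS_pk_pk d3 u1 tt Sx Sz); congr (_ * _); apply: eq_IS => y _.
by rewrite (dotpC y).
Qed.

Let sum_le (b p1 p2 p3 q1 q2 q3 c X1 X2 X3 : R) : 0 <= b ->
  X1 = b * (p1 - q1) -> X2 = b * (p2 - q2) -> X3 = b * (p3 - q3) ->
  p1 - 2 * p2 + p3 <= c -> 0 <= q1 - 2 * q2 + q3 -> X1 - 2 * X2 + X3 <= b * c.
Proof.
move=> b0 -> -> -> h1 h2; have := ler_wpM2l b0 h1; have := mulr_ge0 b0 h2.
rewrite !mulrDr; lra.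
Qed.

Let sub_le (x y z : R) : x <= y -> x - 2 * y + z <= z - x.
Proof. lra. Qed.

Let quarter_le (c : R) k m : 0 < c -> (k <= m)%N -> 4^-1 ^+ m / c <= 4^-1 ^+ k / c.
Proof.
move=> c0 km; rewrite ler_wpM2r ?invr_ge0 ?(ltW c0)//; apply: ler_wiXn2l => //; lra.
Qed.

Let scale_le (b q : R) : 0 <= b -> 0 <= q -> b * (q / (b + 1)) <= q.
Proof.
move=> b0 q0; rewrite mulrA ler_pdivrMr; last lra.
by rewrite mulrDr mulr1 mulrC lerDl.
Qed.

Let squeeze (L p q e e' : R) : p <= L -> q <= L -> e' <= e -> L - p <= e -> L - q <= e' ->
  `|p - q| <= e.
Proof. by rewrite ler_norml; lra. Qed.

Let a f r : R := IS (fun x => Pk r f x ^+ 2).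

Lemma IS_sqr_sub f g : L2S f -> L2S g ->
  IS (fun x => (f x - g x) ^+ 2) =
  IS (fun x => f x * f x) - 2 * IS (fun x => f x * g x) + IS (fun x => g x * g x).
Proof.
move=> Lf Lg; have L1 := L2S_mul Lf Lf; have L2 := L2S_mul Lf Lg; have L3 := L2S_mul Lg Lg.
rewrite -(IS_scale _ L2) -(IS_sub L1 (L1S_Z 2 L2)) -(IS_add (L1S_B L1 (L1S_Z 2 L2)) L3).
by apply: eq_IS => x _; ring.
Qed.

(** For u^2 = s t, the scalar product of P_s f and P_t f is the squared norm of P_u f, and s <= u,
    so monotonicity bounds it from below by that of P_s f. *)
Lemma IS_Pk_diff_le s t f : 0 <= s -> s <= t -> t < 1 -> L2S f ->
  IS (fun x => (Pk s f x - Pk t f x) ^+ 2) <= a f t - a f s.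
Proof.
move=> s0 st t1 Lf; have Lf1 := L2S_L1S Lf.
have tt : 0 <= t < 1 by rewrite (le_trans s0).
have ss : 0 <= s < 1 by rewrite s0 (le_lt_trans st).
rewrite IS_sqr_sub; [|exact: BM_L2 (BM_Pk (norm_lt1 ss) Lf1)|exact: BM_L2 (BM_Pk (norm_lt1 tt)
  Lf1)].
rewrite -/(a f s) -/(a f t) IS_Pk_Pk//.
pose u := Num.sqrt (s * t).
have uu : u ^+ 2 = s * t by rewrite sqr_sqrtr// mulr_ge0 ?(le_trans s0).
have u0 : 0 <= u by rewrite sqrtr_ge0.
have u1 : u < 1 by rewrite -(ltr_pXn2r (n := 2)) ?nnegrE// uu expr1n; nra.
have us : s <= u by rewrite -(ler_pXn2r (n := 2)) ?nnegrE// uu expr2 ler_wpM2l.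
have -> : W * IS (fun x => f x * Pk (s * t) f x) = a f u.
  by rewrite -uu expr2 -IS_Pk_Pk ?u0.
exact: sub_le (IS_Pk_sqr_mono s0 us u1 Lf).
Qed.

Lemma BM_Fk r i f : `|r| < 1 -> L1S f -> BM (Fk r i f).
Proof. by move=> r1 Lf; exact: BM_OpS (BK_gk i r1) Lf. Qed.

(** Expanding the square by [IS_Fk_Fk], the part with T_s and T_t is minus the norm of a difference
    and is dropped. *)
Lemma IS_Fk_diff_le i s t f : 0 < s -> s <= t -> t < 1 -> L2S f ->
  IS (fun x => (Fk s i f x - Fk t i f x) ^+ 2) <= beta ^+ 2 * (a f t - a f s).
Proof.
move=> s0 st t1 Lf; have Lf1 := L2S_L1S Lf.
have t0 := lt_le_trans s0 st.
have tt : 0 <= t < 1 by rewrite ltW.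
have ss : 0 <= s < 1 by rewrite ltW// (le_lt_trans st).
have sn := norm_lt1 ss; have tn := norm_lt1 tt.
have s1 : 0 < s < 1 by rewrite s0 (le_lt_trans st).
have tp : 0 < t < 1 by rewrite t0.
have LF r j : `|r| < 1 -> L2S (Fk r j f) by move=> r1; exact: BM_L2 (BM_Fk j r1 Lf1).
have LP r : `|r| < 1 -> L2S (Pk r f) by move=> r1; exact: BM_L2 (BM_Pk r1 Lf1).
have LT r : `|r| < 1 -> L2S (Tk r f) by move=> r1; exact: BM_L2 (BM_OpS (BK_kk r1) Lf1).
apply: (@le_trans _ _ (\sum_j IS (fun x => (Fk s j f x - Fk t j f x) ^+ 2))).
  rewrite (bigD1 i)//= lerDl sumr_ge0// => j _.
  by apply: IS_ge0 => x _; exact: sqr_ge0.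
under eq_bigr => j _ do rewrite (IS_sqr_sub (LF s j sn) (LF t j tn)).
rewrite big_split/= sumrB -mulr_sumr.
have b2 : 0 <= beta ^+ 2 by exact: sqr_ge0.
have E r q : 0 <= r < 1 -> 0 < q < 1 -> \sum_j IS (fun x => Fk r j f x * Fk q j f x) =
    beta ^+ 2 * (IS (fun x => Pk r f x * Pk q f x) - IS (fun x => Tk r f x * Tk q f x)).
  by move=> h1 h2; exact: IS_Fk_Fk.
have h1 := IS_Pk_diff_le (ltW s0) st t1 Lf.
rewrite (IS_sqr_sub (LP s sn) (LP t tn)) in h1.
have h2 : 0 <= IS (fun x => (Tk s f x - Tk t f x) ^+ 2) by apply: IS_ge0 => x _; exact: sqr_ge0.
rewrite (IS_sqr_sub (LT s sn) (LT t tn)) in h2.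
exact: (sum_le b2 (E s s ss s1) (E s t ss tp) (E t t tt tp) h1 h2).
Qed.

Lemma IS_mul_cvg (g_ : nat -> E -> R) g phi : (forall m, L2S (g_ m)) -> L2S g -> BM phi ->
  (forall m, IS (fun x => (g_ m x - g x) ^+ 2) <= 4^-1 ^+ m) ->
  IS (fun x => g_ m x * phi x) @[m --> \oo] --> IS (fun x => g x * phi x).
Proof.
move=> Lg_ Lg bphi gM; have [_ [M phiM]] := bphi.
have Ld m : L2S (fun x => g_ m x - g x) by exact: L2S_B.
pose C := Num.sqrt (IS (fun x => phi x ^+ 2)).
have h m : `|IS (fun x => g x * phi x) - IS (fun x => g_ m x * phi x)| <= C * 2^-1 ^+ m.
  rewrite distrC -(IS_sub (L2S_mul (Lg_ m) (BM_L2 bphi)) (L2S_mul Lg (BM_L2 bphi))).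
  rewrite (eq_IS (g := fun x => phi x * (g_ m x - g x))); last by move=> x _; ring.
  have h := IS_Cauchy_Schwarz (BM_L2 bphi) (Ld m).
  have P0 : 0 <= IS (fun x => phi x ^+ 2) by apply: IS_ge0 => x _; exact: sqr_ge0.
  have {}h := le_trans h (ler_wpM2l P0 (gM m)).
  have C0 : 0 <= C * 2^-1 ^+ m by rewrite mulr_ge0 ?sqrtr_ge0// exprn_ge0.
  rewrite -ler_sqr ?nnegrE// real_normK ?num_real// exprMn /C sqr_sqrtr//.
  by apply: (le_trans h); rewrite -exprM mulnC exprM (_ : 2^-1 ^+ 2 = 4^-1)//; field.
apply/cvgrPdist_le => e e0.
have c0 : C * 2^-1 ^+ m @[m --> \oo] --> (0 : R).
  by apply: cvg_geometric; rewrite ger0_norm//; lra.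
have /cvgrPdist_le/(_ _ e0) := c0; apply: filterS => m.
rewrite sub0r normrN => hm; exact: le_trans (h m) (le_trans (ler_norm _) hm).
Qed.

Lemma weak_gradient_exists f : L2S f -> exists G : 'I_d -> E -> R,
  [/\ forall i, L2S (G i),
      {ae mu, forall x, S x -> \sum_i x 0 i * G i x = 0} &
      forall V : 'I_d -> E -> R, (forall i, RS (V i)) ->
        (forall x, x != 0 -> \sum_i xh i x * V i x = 0) ->
        \sum_i IS (fun x => G i x * V i x) = - IS (fun x => Tk 1 f x * \sum_i Dr i (V i) x)].
Proof.
move=> Lf; have Lf1 := L2S_L1S Lf.
have r01 m : 0 < (rr m : R) < 1.
  by have /andP[h ->] := @rr_itv R m; rewrite andbT; lra.
have r0 m : 0 <= (rr m : R) < 1 := @rr_itv0 R m.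
have rmono : {homo (@rr R) : m p / (m <= p)%N >-> m <= p}.
  move=> m p mp; rewrite lerD2l lerN2 lef_pV2 ?posrE// ler_nat.
  by rewrite ltnS.
pose A m := a f (rr m).
have Amono : nondecreasing_seq A.
  move=> m p mp; apply: IS_Pk_sqr_mono => //; [|exact: rmono|]; by case/andP: (r0 m) => //;
    case/andP: (r0 p).
have Acvg : cvgn A.
  apply: nondecreasing_is_cvgn => //; exists (W ^+ 2 * IS (fun x => f x ^+ 2)) => _ [m _ <-].
  exact: IS_Pk_sqr_le.
pose L := limn A.
have AL m : A m <= L by exact: nondecreasing_cvgn_le.
(* Dividing by c absorbs the factor beta^2 of the estimate for the gradients; adding 1 makes the
   divisor visibly positive. *)
pose c : R := beta ^+ 2 + 1.
have c0 : 0 < c by rewrite ltr_wpDl ?sqr_ge0.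
(* A subsequence along which the bounded monotone norms of P_r f approach their limit at the rate
   that the completeness lemma asks. N(k) >= k lets the radii still tend to 1. *)
have [N HN] : {N : nat -> nat & forall k, (k <= N k)%N /\ L - A (N k) <= 4^-1 ^+ k / c}.
  apply: (@choice _ _ (fun k m => (k <= m)%N /\ L - A m <= 4^-1 ^+ k / c)) => k.
  have e0 : 0 < 4^-1 ^+ k / c by rewrite divr_gt0 ?exprn_gt0.
  have /cvgrPdist_lt/(_ _ e0)[m _ Hm] := Acvg.
  exists (maxn k m); rewrite leq_maxl; split=> //.
  apply: le_trans (ler_norm _) (ltW (Hm _ _)); exact: leq_maxr.
have FC i p q : IS (fun x => (Fk (rr p) i f x - Fk (rr q) i f x) ^+ 2) <= beta ^+ 2 * `|A q - A p|.
  have [pq|/ltnW qp] := leqP p q.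
    rewrite ger0_norm ?subr_ge0 ?Amono//; apply: IS_Fk_diff_le => //; [|exact: rmono|].
      by case/andP: (r01 p).
    by case/andP: (r01 q).
  rewrite ler0_norm ?subr_le0 ?Amono// opprB (eq_IS (g := fun x =>
    (Fk (rr q) i f x - Fk (rr p) i f x) ^+ 2)).
    apply: IS_Fk_diff_le => //; [|exact: rmono|].
      by case/andP: (r01 q).
    by case/andP: (r01 p).
  by move=> x _; rewrite -sqrrN opprB.
have LF i m : L2S (Fk (rr m) i f) by exact: BM_L2 (BM_Fk i (norm_lt1 (r0 m)) Lf1).
have /choice[G HG] i : exists g, L2S g /\ forall k, IS (fun x =>
  (Fk (rr (N k)) i f x - g x) ^+ 2) <= 4^-1 ^+ k.
  apply: (@L2S_fast_Cauchy_cvg R d (fun k => Fk (rr (N k)) i f)) => // k m km.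
  apply: le_trans (FC i _ _) _.
  have [_ h1] := HN k; have [_ h2] := HN m.
  have h4 : `|A (N k) - A (N m)| <= 4^-1 ^+ k / c.
    exact: squeeze (AL (N k)) (AL (N m)) (quarter_le c0 km) h1 h2.
  apply: le_trans (ler_wpM2l (sqr_ge0 _) h4) _.
  exact: scale_le (sqr_ge0 _) (exprn_ge0 _ _).
have LG i : L2S (G i) by case: (HG i).
have Gc i k : IS (fun x => (Fk (rr (N k)) i f x - G i x) ^+ 2) <= 4^-1 ^+ k by case: (HG i).
have N_oo : N k @[k --> \oo] --> \oo.
  move=> P [m _ HP]; exists m => // k mk; apply: HP; rewrite /=.
  by apply: leq_trans (proj1 (HN k)).
exists G; split=> // [|V sV tV].
  (* The approximating gradients are tangent, so the normal component of the limit is bounded by its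
     distance to them. *)
  pose h x := \sum_i x 0 i * G i x.
  have Sx1 x i : S x -> `|x 0 i| <= 1 by move=> Sx; apply: le_trans (coord_le_enorm x i) _;
    rewrite Sx.
  have sqr_sum (u : 'I_d -> R) x : S x -> (\sum_i x 0 i * u i) ^+ 2 <= \sum_i u i ^+ 2.
    move=> Sx; have := dotp_le_enorm (\row_i u i) Sx; rewrite -ler_sqr ?nnegrE ?enorm_ge0//.
    rewrite real_normK ?num_real// enorm_sqr; congr (_ ^+ 2 <= _).
      by apply: eq_bigr => i _; rewrite mxE.
    by apply: eq_bigr => i _; rewrite !mxE.
  have mh : measurable_fun setT h.
    apply: measurable_sum => i; apply: measurable_funM; first exact: measurable_rV_coord.
    exact: L2S_meas.
  have Lh2 : L1S (fun x => h x ^+ 2).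
    apply: (L1S_le (measurable_funX 2 mh) (L1S_sum (fun i => L2S_sqr (LG i)))) => x Sx.
    rewrite ger0_norm ?sqr_ge0//; apply: le_trans (ler_norm _); exact: sqr_sum.
  have h0 : IS (fun x => h x ^+ 2) = 0.
    apply/eqP; rewrite eq_le IS_ge0 ?andbT => [|x _]; last exact: sqr_ge0.
    have hk k : IS (fun x => h x ^+ 2) <= d%:R * 4^-1 ^+ k.
      have Ld i : L1S (fun x => (Fk (rr (N k)) i f x - G i x) ^+ 2).
        exact: L2S_sqr (L2S_B (LF i (N k)) (LG i)).
      apply: (@le_trans _ _ (\sum_i IS (fun x => (Fk (rr (N k)) i f x - G i x) ^+ 2))).
        rewrite -(IS_sum Ld); apply: (IS_le Lh2 (L1S_sum Ld)) => x Sx.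
        have -> : h x = - \sum_i x 0 i * (Fk (rr (N k)) i f x - G i x).
          under eq_bigr => i _ do rewrite mulrBr.
          by rewrite sumrB (Fk_tangent (norm_lt1 (r0 _)) Lf1 Sx) sub0r opprK.
        by rewrite sqrrN; exact: sqr_sum.
      apply: le_trans (ler_sum _ (fun i _ => Gc i k)) _.
      by rewrite sumr_const card_ord mulr_natl.
    have c0' : d%:R * 4^-1 ^+ k @[k --> \oo] --> (0 : R).
      by apply: cvg_geometric; rewrite ger0_norm//; lra.
    by apply: (cvgr_to_ge c0'); apply: nearW => k; exact: hk.
  have := IS_nneg_eq0 Lh2 (fun x _ => sqr_ge0 (h x)) h0.
  by apply: filterS => x hx Sx; have := hx Sx => /eqP; rewrite sqrf_eq0 => /eqP.
have bV i := BM_RS (sV i).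
have sD : RS (fun x => \sum_i Dr i (V i) x) by apply: RS_sum => i; exact: RS_Dr.
have c1 : \sum_i IS (fun x => Fk (rr (N k)) i f x * V i x) @[k --> \oo] --> \sum_i IS (fun x =>
  G i x * V i x).
  apply: cvg_big => [|i _]; first exact: add_continuous.
  exact: IS_mul_cvg (fun k => LF i (N k)) (LG i) (bV i) (Gc i).
have c2 : - IS (fun x => Tk (rr (N k)) f x * \sum_i Dr i (V i) x) @[k --> \oo] -->
    - IS (fun x => Tk 1 f x * \sum_i Dr i (V i) x).
  apply: cvgN.
  have e r : 0 <= r < 1 -> IS (fun x => Tk r f x * \sum_i Dr i (V i) x) = IS (fun x =>
    f x * Tk r (fun x => \sum_i Dr i (V i) x) x).
    by move=> r1; rewrite (OpS_sym (schur_kk (norm_lt1 r1)) Lf (BM_L2 (BM_RS sD))).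
  rewrite -(OpS_sym (schur_kk1 d3) Lf (BM_L2 (BM_RS sD))).
  have := cvg_comp _ _ N_oo (IS_Tk_cvg d3 Lf (BM_RS sD)).
  apply: cvg_trans; apply: near_eq_cvg; apply: nearW => k.
  by rewrite /= e.
have e k : \sum_i IS (fun x => Fk (rr (N k)) i f x * V i x) = - IS (fun x =>
  Tk (rr (N k)) f x * \sum_i Dr i (V i) x).
  exact: IS_Fk_weak.
have c3 : \sum_i IS (fun x => Fk (rr (N k)) i f x * V i x) @[k --> \oo] -->
    - IS (fun x => Tk 1 f x * \sum_i Dr i (V i) x).
  by under eq_fun do rewrite e.
exact: (cvg_unique _ c1 c3).
Qed.

End weak_gradient.

(** * Double layer potentials *)

Section limit_at_zero.
Context {R : realType} {dT : measure_display} {T : measurableType dT}.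
Variable h : R -> T -> R.
Hypotheses (mh : forall e, 0 < e -> measurable_fun setT (h e))
  (hr : forall e x, 0 < e -> h e' x @[e' --> e^'+] --> h e x).

(** The points where the Cauchy criterion with tolerance 1/(k+1) fails at the rational parameters p
    and q below 1/(m+1). Rational parameters keep the unions countable. *)
Let bad k m (p q : rat) : set T :=
  if (0 < (ratr p : R) < m.+1%:R^-1) && (0 < (ratr q : R) < m.+1%:R^-1) then
    [set x | k.+1%:R^-1 < `|h (ratr p) x - h (ratr q) x|] else set0.

Let C : set T := \bigcap_k \bigcup_m ~` \bigcup_p \bigcup_q bad k m p q.

Let mC : measurable C.
Proof.
apply: bigcapT_measurable => k; apply: bigcupT_measurable => m; apply: measurableC.
apply: bigcupT_measurable_rat => p; apply: bigcupT_measurable_rat => q.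
rewrite /bad; case: ifPn => [/andP[/andP[p0 _] /andP[q0 _]]|_]; last exact: measurable0.
have mf : measurable_fun setT (fun x => `|h (ratr p) x - h (ratr q) x|).
  by apply: measurableT_comp => //; apply: measurable_funB; exact: mh.
have := mf measurableT _ (measurable_itv `]k.+1%:R^-1, +oo[%R).
rewrite setTI; congr measurable; apply/seteqP; split=> x /=; by rewrite in_itv/= andbT.
Qed.

Let good k x : C x -> exists2 m, True & forall p q : rat,
  0 < (ratr p : R) < m.+1%:R^-1 -> 0 < (ratr q : R) < m.+1%:R^-1 ->
  `|h (ratr p) x - h (ratr q) x| <= k.+1%:R^-1.
Proof.
move=> /(_ k Logic.I)[m _ H]; exists m => // p q hp hq; rewrite leNgt; apply/negP => bpq.
by apply: H; exists p => //; exists q => //; rewrite /bad hp hq.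
Qed.

Let good_real k x : C x -> exists2 m, True & forall a b : R,
  0 < a < m.+1%:R^-1 -> 0 < b < m.+1%:R^-1 -> `|h a x - h b x| <= k.+1%:R^-1.
Proof.
move=> /(@good k)[m _ H]; exists m => // a b /andP[a0 am] /andP[b0 bm].
have step (c : R) (u : R -> R) : 0 < c < m.+1%:R^-1 -> u e @[e --> c^'+] --> u c ->
    (forall q : rat, 0 < (ratr q : R) < m.+1%:R^-1 -> u (ratr q) <= k.+1%:R^-1) ->
      u c <= k.+1%:R^-1.
  move=> /andP[c0 cm] cu Hu; rewrite leNgt; apply/negP => uc.
  have n1 : \forall e \near c^'+, k.+1%:R^-1 < u e by exact: cvgr_gt uc.
  have [e e0 He] : exists2 e : R, 0 < e & forall t, c < t < c + e -> k.+1%:R^-1 < u t.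
    have /nbhs_ballP[e /= e0 He] := n1; exists e => // t /andP[t0 t1]; apply: He => //.
    by rewrite /ball/= ltr0_norm; lra.
  pose c1 := Num.min (c + e) m.+1%:R^-1.
  have cc1 : c < c1 by rewrite lt_min cm andbT; lra.
  have [q] := rat_in_itvoo cc1; rewrite in_itv/= lt_min => /andP[q0 /andP[q1 q2]].
  have := Hu q; rewrite (lt_trans c0 q0) q2 => /(_ isT); apply/negP; rewrite -ltNge.
  by apply: He; rewrite q0.
have hcont (c : R) f : 0 < c -> `|h e x - f| @[e --> c^'+] --> `|h c x - f|.
  by move=> c0; apply: cvg_norm; apply: cvgB; [exact: hr|exact: cvg_cst].
apply: (step a (fun e => `|h e x - h b x|)); [by rewrite a0|exact: hcont|] => p hp.
rewrite distrC; apply: (step b (fun e => `|h e x - h (ratr p) x|));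
  [by rewrite b0|exact: hcont|] => q hq.
exact: H.
Qed.

Let inv_cvg : m.+1%:R^-1 @[m --> \oo] --> (0 : R).
Proof. exact: cvg_harmonic. Qed.

Let small (e : R) : 0 < e -> exists k : nat, k.+1%:R^-1 < e.
Proof.
move=> e0; have /cvgrPdist_lt/(_ _ e0)[k _ Hk] := inv_cvg.
exists k; have := Hk k (leqnn k).
by rewrite /= sub0r normrN ger0_norm.
Qed.

Let C_cvg x : C x -> cvg (h e x @[e --> 0^'+]).
Proof.
move=> Cx; apply: cauchy_cvg; apply: cauchy_exP => e e0.
have [k ke] := small e0; have [m _ H] := good_real k Cx.
have m0 : 0 < m.+1%:R^-1 :> R by [].
move: (m.+1%:R^-1) m0 H => c m0 H.
exists (h (c / 2) x).
suff : \forall t \near 0^'+, `|h (c / 2) x - h t x| < e by [].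
near=> t; apply: le_lt_trans ke; apply: H; first by apply/andP; split; lra.
by apply/andP; split; near: t; [exact: nbhs_right_gt|exact: nbhs_right_lt].
Unshelve. all: by end_near. Qed.

Let cvg_C x : cvg (h e x @[e --> 0^'+]) -> C x.
Proof.
move=> /cvg_ex[l hl] k _.
have k0 : 0 < k.+1%:R^-1 / 2 :> R by rewrite divr_gt0.
have /cvgrPdist_lt/(_ _ k0)/nbhs_ballP[e /= e0 He] := hl.
have [m me] := small e0; exists m => // -[p _ [q _]].
rewrite /bad; case: ifPn => // /andP[/andP[p0 p1] /andP[q0 q1]] /=.
have hp : `|l - h (ratr p) x| < k.+1%:R^-1 / 2.
  by apply: He => //=; rewrite /ball/= sub0r normrN gtr0_norm//; exact: lt_trans me.
have hq : `|l - h (ratr q) x| < k.+1%:R^-1 / 2.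
  by apply: He => //=; rewrite /ball/= sub0r normrN gtr0_norm//; exact: lt_trans me.
apply/negP; rewrite -leNgt.
rewrite (splitr k.+1%:R^-1); apply: le_trans (ler_distD l _ _) _.
by rewrite lerD ?(ltW hq)// distrC ltW.
Qed.

(** [C] is the set of convergence: right continuity carries the Cauchy criterion from rational to
    real parameters. On [C] the limit runs along 1/(m+1); off [C] the value of [lim] is the default
    [point]. *)
Lemma measurable_lim_at_zero : measurable_fun setT (fun x => lim (h e x @[e --> 0^'+])).
Proof.
pose F m x : R := \1_C x * h m.+1%:R^-1 x + (1 - \1_C x) * (point : R).
apply: (@measurable_fun_cvg _ _ _ _ F).
  move=> m; apply: measurable_funD; apply: measurable_funM => //.
  - exact: mh.
  - by apply: measurable_funB.
move=> x _; rewrite /F indicE; have [Cx|nCx] := boolP (x \in C).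
  rewrite /=; under eq_fun do rewrite mul1r subrr mul0r addr0.
  have := C_cvg (set_mem Cx) => /cvg_at_rightP; apply; split=> // m.
rewrite /=; under eq_fun do rewrite mul0r add0r subr0 mul1r.
rewrite dvgP; first exact: cvg_cst.
by move=> /cvg_C/mem_set; exact/negP.
Qed.

End limit_at_zero.

Section double_layer_potential.
Context {R : realType} {d : nat}.
Local Notation E := 'rV[R]_d.
Local Notation S := (@sphere R d).
Local Notation mu := (@omega R d).
Hypothesis d3 : (3 <= d)%N.
Local Notation n := (d - 2)%N.
Local Notation kk := (kk d).
Local Notation W := (@sphere_area R d).
Implicit Types (x y z : E) (r s t e : R) (f g : E -> R).

Lemma omega_dE : omega_d d = W.
Proof.
rewrite /sphere_area ISE Rintegral_cst; last exact: measurable_sphere.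
by rewrite mul1r.
Qed.

Lemma enorm_sub_qk x y : S x -> S y -> (enorm (x - y))^-1 = qk 1 (dotp x y).
Proof.
move=> Sx Sy; congr (_^-1); rewrite /enorm; congr (Num.sqrt _).
by rewrite dotpBl !dotpBr (dotp_sphere Sx) (dotp_sphere Sy) (dotpC y) qs1; ring.
Qed.

Definition dlk x y : R := dotp y (x - y) / enorm (x - y) ^+ d.

(** For unit vectors y . (x - y) = - |x - y|^2 / 2, which turns the double layer kernel into a
    Newtonian one. At x = y both sides are 0, as the inverse of 0 is 0. *)
Lemma dlkE x y : S x -> S y -> dlk x y = - (kk 1 (dotp x y) / 2).
Proof.
move=> Sx Sy; rewrite /dlk -exprVn enorm_sub_qk//.
have -> : dotp y (x - y) = - (qs 1 (dotp x y) / 2).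
  by rewrite dotpBr (dotp_sphere Sy) (dotpC y) qs1; field.
have -> : qk 1 (dotp x y) ^+ d = qk 1 (dotp x y) ^+ n * qk 1 (dotp x y) ^+ 2.
  by rewrite -exprD subnK// ltnW.
rewrite /(kk _ _) mulNr; congr (- _); rewrite mulrAC; congr (_ / 2).
have [q0|q0] := eqVneq (qs 1 (dotp x y)) 0.
  rewrite q0 mul0r /qk q0 sqrtr0 invr0 expr0n.
  by move: d3; case: (d) => [|[|[|k]]].
have := enorm_sub_sqr Sx Sy; rewrite -enorm_sub_qk// => h.
have -> : qs 1 (dotp x y) = enorm (x - y) ^+ 2 by rewrite h qs1; ring.
have e0 : enorm (x - y) != 0.
  by apply: contraNneq q0 => e0; rewrite qs1; apply/eqP; rewrite e0 in h; rewrite expr0n/= in h;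
    lra.
by rewrite !exprVn -addn2 exprD; field; rewrite e0 expf_neq0.
Qed.

Lemma dlk_bound e x y : 0 < e -> e < enorm (x - y) -> S y -> `|dlk x y| <= e^-1 ^+ d.-1.
Proof.
move=> e0 xy Sy; have u0 := lt_trans e0 xy.
have dE (a : R) : a ^+ d = a * a ^+ d.-1 by rewrite -exprS prednK// (leq_trans _ d3).
rewrite /dlk normrM (ger0_norm (x := _^-1)) ?invr_ge0 ?exprn_ge0 ?enorm_ge0//.
apply: le_trans (ler_wpM2r _ (dotp_le_enorm (x - y) Sy)) _.
  by rewrite invr_ge0 exprn_ge0 ?enorm_ge0.
rewrite dE invfM mulrA divff ?gt_eqF// mul1r -exprVn.
apply: lerXn2r; rewrite ?nnegrE ?invr_ge0 ?(ltW u0) ?(ltW e0)//.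
by rewrite lef_pV2 ?posrE// ltW.
Qed.

Lemma measurable_sub_rV : measurable_fun setT (fun w : E * E => w.1 - w.2).
Proof.
apply: measurable_fun_rVP => i.
apply: (eq_measurable_fun (fun w : E * E => w.1 0 i - w.2 0 i)).
  by move=> w _; rewrite !mxE.
apply: measurable_funB.
  exact: (measurableT_comp (@measurable_rV_coord R d i) measurable_fst).
exact: (measurableT_comp (@measurable_rV_coord R d i) measurable_snd).
Qed.

Lemma measurable_enorm_sub : measurable_fun setT (fun w : E * E => enorm (w.1 - w.2)).
Proof. exact: (measurableT_comp (@measurable_enorm R d) measurable_sub_rV). Qed.

Lemma measurable_dlk : measurable_fun setT (fun w : E * E => dlk w.1 w.2).
Proof.
apply: measurable_funM.
  by apply: measurable_dotp2; [exact: measurable_snd|exact: measurable_sub_rV].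
apply: (eq_measurable_fun (fun w : E * E => (enorm (w.1 - w.2) ^+ d) `^ (-1))).
  by move=> w _; rewrite powR_inv1// exprn_ge0// enorm_ge0.
apply: (measurableT_comp (measurable_powR _)).
by apply: measurable_funX; exact: measurable_enorm_sub.
Qed.

Definition tdlk e x y : R := if e < enorm (x - y) then dlk x y else 0.

Lemma measurable_tdlk e : measurable_fun setT (fun w : E * E => tdlk e w.1 w.2).
Proof.
apply: measurable_fun_if => //.
- by apply: measurable_fun_ltr; [exact: measurable_cst|exact: measurable_enorm_sub].
- exact: measurable_funS measurable_dlk.
Qed.

Definition tdl f e x : R := - 1 / W * OpS (tdlk e) f x.

Lemma double_layerE f x : double_layer f x = lim (tdl f e x @[e --> 0^'+]).
Proof.
have -> : (fun e => tdl f e x) = fun e => - 1 / W *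
    \int[mu]_(y in S `&` [set y | e < enorm (x - y)]) (dlk x y * f y);
      last by rewrite /double_layer omega_dE.
apply/funext => e; rewrite Rintegral_mkcondr /tdl /OpS ISE; congr (_ * _); apply: eq_I => y Sy.
rewrite patchE /tdlk.
have -> : (y \in [set y0 | e < enorm (x - y0)]) = (e < enorm (x - y)).
  by apply/idP/idP => [/set_mem|h]; [|exact/mem_set].
case: ifP => [_|_]; first by [].
exact: mul0r.
Qed.

(** The truncation removes the points at distance exactly e as well, which makes it continuous in e
    from the right. *)
Lemma tdlk_cvg (u : nat -> R) e x y : (forall m, e < u m) -> u m @[m --> \oo] --> e ->
  tdlk (u m) x y @[m --> \oo] --> tdlk e x y.
Proof.
move=> eu ue; rewrite {2}/tdlk; case: ifPn => [xy|]; last first.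
  rewrite -leNgt => xy.
  have h m : tdlk (u m) x y = 0 by rewrite /tdlk ltNge (ltW (le_lt_trans xy (eu m))).
  by under eq_fun do rewrite h; exact: cvg_cst.
apply: cvg_near_cst.
have : \forall m \near \oo, u m < enorm (x - y) by exact: cvgr_lt ue _ xy.
by apply: filterS => m h; rewrite /tdlk h.
Qed.

Lemma tdl_right_continuous f e x : L1S f -> 0 < e -> tdl f e' x @[e' --> e^'+] --> tdl f e x.
Proof.
move=> Lf e0; apply: cvgM; first exact: cvg_cst.
apply/cvg_at_rightP => u [eu ue].
have mt e' : measurable_fun setT (fun y => tdlk e' x y * f y).
  apply: measurable_funM; last exact: L1S_meas.
  exact: (measurableT_comp (measurable_tdlk e') (@pair1_measurable _ _ E E x)).
apply: (@IS_dominated _ _ _ _ (fun y => e^-1 ^+ d.-1 * `|f y|)) => //.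
- exact: L1S_Z _ (L1S_norm Lf).
- by move=> y Sy; apply: cvgM; [exact: tdlk_cvg|exact: cvg_cst].
- move=> m y Sy; rewrite normrM ler_wpM2r//.
  rewrite /tdlk; case: ifPn => [xy|_]; last by rewrite normr0 exprn_ge0// invr_ge0 ltW.
  exact: dlk_bound e0 (lt_trans (eu m) xy) Sy.
Qed.

Lemma measurable_double_layer f : L1S f -> measurable_fun setT (double_layer f).
Proof.
move=> Lf; have -> : double_layer f = fun x => lim (tdl f e x @[e --> 0^'+]).
  by apply/funext => x; exact: double_layerE.
apply: measurable_lim_at_zero => [e e0|e x]; last exact: tdl_right_continuous.
apply: measurable_funM; first exact: measurable_cst.
exact: OpS_meas (measurable_tdlk e) (L1S_meas Lf).
Qed.

(** For almost every x the product k_1(x . y) f(y) is integrable in y, and it dominates the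
    truncated integrands, so the principal value is an ordinary integral. *)
Lemma double_layer_Tk f : L2S f ->
  {ae mu, forall x, S x -> double_layer f x = (2 * W)^-1 * Tk 1 f x}.
Proof.
move=> Lf; have Lf1 := L2S_L1S Lf.
have := PL1S_ae (PL1S_schur (schur_kk1 d3) (L2S_cst 1) Lf).
apply: filterS => x hx Sx; have {hx} Lk : L1S (fun y => kk 1 (dotp x y) * f y).
  by move: (hx Sx); congr L1S; apply/funext => y /=; rewrite mul1r.
rewrite double_layerE; apply: cvg_lim => //.
have -> : (2 * W)^-1 * Tk 1 f x = - 1 / W * (- 2^-1 * Tk 1 f x).
  by rewrite invfM; ring.
apply: cvgM; first exact: cvg_cst.
apply/cvg_at_rightP => u [u0 uc].
rewrite -(IS_scale _ Lk).
have mt e' : measurable_fun setT (fun y => tdlk e' x y * f y).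
  apply: measurable_funM; last exact: L1S_meas.
  exact: (measurableT_comp (measurable_tdlk e') (@pair1_measurable _ _ E E x)).
have Lk2 := L1S_Z (- 2^-1) Lk.
apply: (IS_dominated (fun m => mt (u m)) (L1S_meas Lk2) (L1S_norm Lk)) => [y Sy|m y Sy].
  rewrite mulrA; apply: cvgM; last exact: cvg_cst.
  have -> : - 2^-1 * kk 1 (dotp x y) = tdlk 0 x y.
    rewrite /tdlk; case: ifPn => [_|]; first by rewrite dlkE//; field.
    rewrite -leNgt => h; rewrite /(kk _ _) -enorm_sub_qk//.
    have -> : enorm (x - y) = 0 by apply/eqP; rewrite eq_le h enorm_ge0.
    rewrite invr0 expr0n; move: d3; case: (d) => [|[|[|k]]] // _.
    by rewrite mulr0.
  exact: tdlk_cvg.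
rewrite /tdlk; case: ifPn => [_|_]; last by rewrite mul0r normr0.
rewrite dlkE// !normrM normrN normrM ler_wpM2r// ler_piMr//.
by rewrite ger0_norm; lra.
Qed.

Lemma single_layer_Tk f x : S x -> single_layer f x = - 1 / (W * n%:R) * Tk 1 f x.
Proof.
move=> Sx; rewrite /single_layer omega_dE; congr (_ * _); apply: eq_I => y Sy.
by rewrite mulrC -exprVn enorm_sub_qk.
Qed.

End double_layer_potential.

(** * Surface gradients and densities *)

Section weak_surface_gradient.
Context {R : realType} {d : nat}.
Local Notation E := 'rV[R]_d.
Local Notation S := (@sphere R d).
Local Notation mu := (@omega R d).
Hypothesis d3 : (3 <= d)%N.
Local Notation n := (d - 2)%N.
Local Notation W := (@sphere_area R d).
Implicit Types (x y z : E) (f g chi u : E -> R) (Sigma : set E) (F V : E -> E).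

Lemma L2E f : L2 d f <-> L2S f.
Proof.
split=> [Lf|[mf [_ If]]].
  have mf : measurable_fun setT f by move: Lf; rewrite /L2 /= inE => /andP[/[!inE]].
  split=> //; split; first exact: measurable_funX.
  apply: (@integrableS _ _ _ _ setT) => //; first exact: measurable_sphere.
  exact: Lfun2_integrable_sqr.
rewrite /L2 /= inE; apply/andP; split; rewrite inE//=.
rewrite /finite_norm unlock poweR_lty//.
have mp : measurable_fun setT (fun x => (`|f x| `^ 2)%:E).
  apply/measurable_EFinP/(measurableT_comp (measurable_powR _)).
  exact: measurableT_comp.
rewrite (@ge0_negligible_integral _ _ _ mu setT (~` S)) ?setTD ?setCK//.
- move/integrableP : If => [_]; apply: le_lt_trans.
  rewrite le_eqVlt; apply/orP; left; apply/eqP/eq_integral => x _ /=.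
  by rewrite powR_mulrn// real_normK ?num_real// ger0_norm ?sqr_ge0.
- by apply: measurableC; exact: measurable_sphere.
- by move=> x _; rewrite lee_fin powR_ge0.
- exact: omega_setC_sphere.
Qed.

Lemma ae_on_sphere (Q : E -> Prop) : {ae mu, forall x, S x -> Q x} -> {ae mu, forall x, Q x}.
Proof. by move=> h; apply: filterS2 h (@ae_sphere R d) => x; apply. Qed.

Lemma radial_ext_id f x : S x -> radial_ext f x = f x.
Proof. by move=> Sx; rewrite /radial_ext unitv_id. Qed.

Lemma RS_radial_ext f : smooth f -> RS (radial_ext f).
Proof.
move=> sf; split; first exact: Sm_base.
move=> x; have [->|x0] := eqVneq x 0; first by rewrite /unitv scaler0.
by rewrite /radial_ext unitv_id//; exact: sphere_unitv.
Qed.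

Lemma sgradE chi i x : S x -> sgrad chi x 0 i = Dr i (radial_ext chi) x.
Proof. by move=> Sx; rewrite /sgrad mxE /Dr Sx mul1r. Qed.

Lemma radial_ext_sgrad chi i x : smooth chi -> x != 0 ->
  radial_ext (fun z => sgrad chi z 0 i) x = Dr i (radial_ext chi) x.
Proof.
move=> /RS_radial_ext/(RS_Dr i)[_ rD] x0.
by rewrite /radial_ext sgradE ?rD//; exact: sphere_unitv.
Qed.

Lemma smooth_tangent_sgrad chi : smooth chi -> smooth_tangent_field (sgrad chi).
Proof.
move=> schi; have sc := RS_radial_ext schi; split=> [i|x Sx].
  apply: Sm_smooth_on; apply: (Sm_ext (g := Dr i (radial_ext chi))).
    by move=> x x0; exact: radial_ext_sgrad.
  exact: RS_Sm (RS_Dr i sc).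
rewrite -(Euler_radial sc (sphere_neq0 Sx)); apply: eq_bigr => i _.
by rewrite sgradE// /xh unitv_id.
Qed.

Lemma sdiv_sgrad chi x : smooth chi -> S x -> sdiv (sgrad chi) x = lap (radial_ext chi) x.
Proof.
move=> schi Sx; apply: eq_bigr => i _.
rewrite /sgrad mxE -/(sgrad chi) [RHS]/(Dr i _ x) /Dr Sx mul1r; apply: near_eq_partial =>
  [z z0|]; [exact: radial_ext_sgrad|exact: sphere_neq0].
Qed.

Lemma sgrad_eq0 Sigma chi x : Cc_infty Sigma chi -> S x -> ~ Sigma x -> sgrad chi x = 0.
Proof.
move=> [_ _ KS] Sx nSx.
have nK : ~ closure (S `&` [set z | chi z != 0]) x by move/KS.
have [B nB AB] : exists2 B, nbhs x B & B `&` (S `&` [set z | chi z != 0]) = set0.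
  apply: contrapT => h; apply: nK => B nB; apply/set0P/eqP => AB.
  by apply: h; exists B => //; rewrite setIC.
have x0 := sphere_neq0 Sx.
have cu := cvg_unitv x0; rewrite unitv_id// in cu.
have nBu : \forall z \near x, B (unitv z) by exact: cu.
apply/rowP => i; rewrite !mxE -(@derive_cst R E R 0 x (delta_mx 0 i)).
apply: near_eq_derive; apply: filterS2 (near_off0 x0) nBu => z z0 Bz.
apply/eqP/negPn/negP => cz.
have : (B `&` (S `&` [set z | chi z != 0])) (unitv z).
  by split=> //; split=> //; exact: sphere_unitv.
by rewrite AB.
Qed.

Lemma Rintegral_sgrad Sigma F chi : Sigma `<=` S -> Cc_infty Sigma chi ->
  \int[mu]_(x in Sigma) dotp (F x) (sgrad chi x) = IS (fun x => dotp (F x) (sgrad chi x)).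
Proof.
move=> SS cchi; rewrite ISE Rintegral_mkcond [RHS]Rintegral_mkcond; congr Rintegral.
apply/funext => x; rewrite !patchE.
have [xS|xS] := boolP (x \in Sigma).
  by rewrite (mem_set (SS _ (set_mem xS))).
have [/set_mem Sx|//] := boolP (x \in S).
rewrite (sgrad_eq0 cchi Sx); last by move=> h; move: xS; rewrite mem_set.
by rewrite /dotp big1// => i _; rewrite mxE mulr0.
Qed.

(** [weak_sgrad] is a choice with default 0, so it obeys its defining property only once some weak
    gradient exists. The constant [c] is the factor between the single layer potential and T. *)
Lemma is_weak_sgrad_single_layer f : L2S f ->
  is_weak_sgrad (single_layer f) (weak_sgrad (single_layer f)).
Proof.
move=> Lf; apply: xgetPex; have [G [LG tG wG]] := weak_gradient_exists d3 Lf.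
pose c : R := - 1 / (W * n%:R).
exists (fun x => \row_i (c * G i x)); split.
- move=> i; apply/L2E; have := L2S_Z c (LG i).
  by congr L2S; apply/funext => x; rewrite mxE.
- apply: filterS tG => x hx Sx; rewrite -[RHS](mulr0 c) -(hx Sx) mulr_sumr.
  by apply: eq_bigr => i _; rewrite mxE mulrCA.
move=> V [sV tV].
pose V' i := radial_ext (fun x => V x 0 i).
have sV' i : RS (V' i) by exact: RS_radial_ext.
have tV' x : x != 0 -> \sum_i xh i x * V' i x = 0.
  by move=> x0; exact: tV (unitv x) (sphere_unitv x0).
have LGV i : L1S (fun x => c * (G i x * V' i x)) by exact: L1S_Z _ (L2S_mul (LG i) (L2S_RS (sV'
  i))).
have LT : L2S (Tk 1 f) := OpS_L2 (schur_kk1 d3) Lf.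
have sD : RS (fun x => \sum_i Dr i (V' i) x) by apply: RS_sum => i; exact: RS_Dr.
transitivity (IS (fun x => \sum_i c * (G i x * V' i x))).
  apply: eq_IS => x Sx; apply: eq_bigr => i _.
  by rewrite mxE /V' radial_ext_id// mulrA.
transitivity (- IS (fun x => c * (Tk 1 f x * \sum_i Dr i (V' i) x))); last first.
  congr (- _); apply: eq_IS => x Sx; rewrite single_layer_Tk// mulrA; congr (_ * _).
  by apply: eq_bigr => i _; rewrite mxE /Dr Sx mul1r.
rewrite (IS_sum LGV) (IS_scale _ (L2S_mul LT (L2S_RS sD))) -mulrN -wG// mulr_sumr.
apply: eq_bigr => i _.
by rewrite (IS_scale _ (L2S_mul (LG i) (L2S_RS (sV' i)))).
Qed.

Lemma single_layer_pairing f chi : L2S f -> smooth chi ->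
  IS (fun x => dotp (weak_sgrad (single_layer f) x) (sgrad chi x)) =
  (W * n%:R)^-1 * IS (fun x => Tk 1 f x * lap (radial_ext chi) x).
Proof.
move=> Lf schi; have [_ _ wF] := is_weak_sgrad_single_layer Lf.
rewrite ISE (wF _ (smooth_tangent_sgrad schi)).
have LT : L2S (Tk 1 f) := OpS_L2 (schur_kk1 d3) Lf.
rewrite [X in - X](@eq_IS _ _ _ (fun x => - 1 / (W * n%:R) * (Tk 1 f x * lap (radial_ext chi)
  x))); last first.
  by move=> x Sx; rewrite sdiv_sgrad// single_layer_Tk// mulrA.
rewrite (IS_scale _ (L2S_mul LT (L2S_RS (RS_lap (RS_radial_ext schi))))).
by rewrite mulNr mul1r mulNr opprK.
Qed.

End weak_surface_gradient.

Section tangential_divergence_free.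
Context {R : realType} {d : nat}.
Local Notation E := 'rV[R]_d.
Local Notation S := (@sphere R d).
Local Notation mu := (@omega R d).
Hypothesis d3 : (3 <= d)%N.
Local Notation n := (d - 2)%N.
Local Notation beta := (@beta R d).
Local Notation W := (@sphere_area R d).
Implicit Types (x y z : E) (f g chi u phi psi t : E -> R) (Sigma : set E) (F V : E -> E).

Let W0 : 0 < W. Proof. exact: sphere_area_gt0. Qed.

Let Wn0 : (W * n%:R)^-1 != 0.
Proof.
have n0 : (0 : R) < n%:R by rewrite ltr0n subn_gt0.
by rewrite invr_eq0 mulf_neq0// gt_eqF.
Qed.

Lemma L2S_double_layer f : L2S f -> L2S (double_layer f).
Proof.
move=> Lf; have mD := measurable_double_layer d3 (L2S_L1S Lf).
have LT : L2S (fun x => (2 * W)^-1 * Tk 1 f x) by exact: L2S_Z _ (OpS_L2 (schur_kk1 d3) Lf).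
split=> //; apply: (L1S_le_ae (measurable_funX 2 mD) (L2S_sqr LT)).
apply: filterS (double_layer_Tk d3 Lf) => x hx Sx.
by rewrite hx// ger0_norm ?sqr_ge0.
Qed.

Lemma L2S_Kplus f : L2S f -> L2S (Kplus f).
Proof. by move=> Lf; exact: L2S_D (L2S_double_layer Lf) (L2S_Z _ Lf). Qed.

Lemma L2S_Kminus f : L2S f -> L2S (Kminus f).
Proof. by move=> Lf; exact: L2S_B (L2S_double_layer Lf) (L2S_Z _ Lf). Qed.

Lemma Kplus_Tk f : L2S f ->
  {ae mu, forall x, S x -> Kplus f x = (2 * W)^-1 * (Tk 1 f x + W * f x)}.
Proof.
move=> Lf; apply: filterS (double_layer_Tk d3 Lf) => x hx Sx.
rewrite /Kplus hx// mulrDr; congr (_ + _).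
by rewrite mulrA invfM -(mulrA 2^-1) mulVf ?mulr1// gt_eqF.
Qed.

Lemma Kminus_Tk f : L2S f ->
  {ae mu, forall x, S x -> Kminus f x = (2 * W)^-1 * (Tk 1 f x - W * f x)}.
Proof.
move=> Lf; apply: filterS (double_layer_Tk d3 Lf) => x hx Sx.
rewrite /Kminus hx// mulrBr; congr (_ - _).
by rewrite mulrA invfM -(mulrA 2^-1) mulVf ?mulr1// gt_eqF.
Qed.

Lemma L2vec_normal (a : E -> R) F : L2S a -> L2vec F ->
  L2vec (fun x => a x *: x + F x).
Proof.
move=> La LF i; apply/L2E; have /L2E LFi := LF i.
have Lx : L2S (fun x => x 0 i * a x).
  apply: (@L2S_mul_bounded _ _ 1) => //; first exact: measurable_rV_coord.
  by move=> x Sx; apply: le_trans (coord_le_enorm x i) _; rewrite Sx.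
have := L2S_D Lx LFi; congr L2S; apply/funext => x.
by rewrite !mxE mulrC.
Qed.

Lemma L2vec_add F V : L2vec F -> L2vec V -> L2vec (F \+ V).
Proof.
move=> LF LV i; apply/L2E; have /L2E LFi := LF i; have /L2E LVi := LV i.
by have := L2S_D LFi LVi; congr L2S; apply/funext => x; rewrite !mxE.
Qed.

Lemma L1S_dotp_sgrad F chi : L2vec F -> smooth chi ->
  exists2 h, L1S h & forall x, S x -> dotp (F x) (sgrad chi x) = h x.
Proof.
move=> LF schi; exists (fun x => \sum_i F x 0 i * Dr i (radial_ext chi) x).
  apply: L1S_sum => i; have /L2E LFi := LF i.
  exact: L2S_mul LFi (L2S_RS (RS_Dr i (RS_radial_ext schi))).
by move=> x Sx; apply: eq_bigr => i _; rewrite sgradE.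
Qed.

Lemma IS_dotp_sgrad_add F V chi : L2vec F -> L2vec V -> smooth chi ->
  IS (fun x => dotp (F x + V x) (sgrad chi x)) =
  IS (fun x => dotp (F x) (sgrad chi x)) + IS (fun x => dotp (V x) (sgrad chi x)).
Proof.
move=> LF LV schi; have [h Lh hE] := L1S_dotp_sgrad LF schi.
have [k Lk kE] := L1S_dotp_sgrad LV schi.
rewrite (eq_IS hE) (eq_IS kE) -(IS_add Lh Lk); apply: eq_IS => x Sx.
by rewrite dotpDl hE// kE.
Qed.

Lemma dotp_normal_field (a b : R) (u v x : E) : S x ->
  dotp x (a *: x + u + (b *: x + v)) = a + b + (dotp x u + dotp x v).
Proof. by move=> Sx; rewrite !dotpDr !dotpZr (dotp_sphere Sx); ring. Qed.

Lemma dotp_tangent_field (a b : R) (u v x y : E) : dotp x y = 0 ->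
  dotp (a *: x + u + (b *: x + v)) y = dotp (u + v) y.
Proof. by move=> xy; rewrite !dotpDl !dotpZl xy; ring. Qed.

Lemma IS_Tk1_add f g h : L2S f -> L2S g -> L2S h ->
  IS (fun x => Tk 1 (f \+ g) x * h x) =
  IS (fun x => Tk 1 f x * h x) + IS (fun x => Tk 1 g x * h x).
Proof.
move=> Lf Lg Lh.
have LTf : L2S (Tk 1 f) := OpS_L2 (schur_kk1 d3) Lf.
have LTg : L2S (Tk 1 g) := OpS_L2 (schur_kk1 d3) Lg.
have LTs : L2S (Tk 1 (f \+ g)) := OpS_L2 (schur_kk1 d3) (L2S_D Lf Lg).
rewrite -(IS_add (L2S_mul LTf Lh) (L2S_mul LTg Lh)).
apply: (IS_ae_eq (L2S_mul LTs Lh) (L1S_D (L2S_mul LTf Lh) (L2S_mul LTg Lh))).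
apply: filterS (OpS_add_ae (schur_kk1 d3) Lf Lg) => x hx Sx.
by rewrite -mulrDl; congr (_ * _); exact: hx.
Qed.

Let normal_sum (w a b u v A B p q T : R) : u = 0 -> v = 0 ->
  a = w * (A - W * p) -> b = w * (B + W * q) -> T = A + B ->
  a + b + (u + v) = w * (T + W * (q - p)).
Proof. by move=> -> -> -> -> ->; ring. Qed.

(** The tangential parts of both fields are gradients of single layer potentials, so together they
    depend on phi + t only; in the normal part the terms with I/2 leave the difference t - phi. *)
Lemma tangent_divfreeP Sigma phi t : Sigma `<=` S -> L2S phi -> L2S t ->
  tangent_divfree_on Sigma (Bplus phi \+ Bminus t) <->
  {ae mu, forall x, Sigma x -> Tk 1 (phi \+ t) x + W * (t x - phi x) = 0} /\
  (forall chi, Cc_infty Sigma chi ->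
    IS (fun x => Tk 1 (phi \+ t) x * lap (radial_ext chi) x) = 0).
Proof.
move=> SS Lp Lt.
have wp := is_weak_sgrad_single_layer d3 Lp; have wt := is_weak_sgrad_single_layer d3 Lt.
have [LFp tp _] := wp; have [LFt tt _] := wt.
have Tadd := OpS_add_ae (schur_kk1 d3) Lp Lt.
have LV : L2vec (Bplus phi \+ Bminus t).
  exact: L2vec_add (L2vec_normal (L2S_Kminus Lp) LFp) (L2vec_normal (L2S_Kplus Lt) LFt).
have normal : {ae mu, forall x, Sigma x -> dotp x ((Bplus phi \+ Bminus t) x) =
    (2 * W)^-1 * (Tk 1 (phi \+ t) x + W * (t x - phi x))}.
  apply: filterS2 (filterI tp tt) (filterI (filterI (Kminus_Tk Lp) (Kplus_Tk Lt)) Tadd).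
  move=> x [h1 h2] [[h3 h4] h5] /SS Sx.
  transitivity (Kminus phi x + Kplus t x + (dotp x (weak_sgrad (single_layer phi) x) +
      dotp x (weak_sgrad (single_layer t) x))); first exact: dotp_normal_field.
  exact: (normal_sum (h1 Sx) (h2 Sx) (h3 Sx) (h4 Sx) (h5 Sx)).
have W2 : (2 * W)^-1 != 0 by rewrite invr_eq0 mulf_neq0 ?gt_eqF.
have divE chi : Cc_infty Sigma chi ->
    \int[mu]_(x in Sigma) dotp ((Bplus phi \+ Bminus t) x) (sgrad chi x) =
    (W * n%:R)^-1 * IS (fun x => Tk 1 (phi \+ t) x * lap (radial_ext chi) x).
  move=> cchi; have [schi _ _] := cchi.
  have Ll := L2S_RS (RS_lap (RS_radial_ext schi)).
  rewrite (Rintegral_sgrad _ SS cchi).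
  rewrite (eq_IS (g := fun x => dotp (weak_sgrad (single_layer phi) x + weak_sgrad (single_layer
    t) x) (sgrad chi x))); last first.
    by move=> x Sx; exact: dotp_tangent_field (proj2 (smooth_tangent_sgrad schi) x Sx).
  apply: etrans (IS_dotp_sgrad_add LFp LFt schi) _.
  apply: etrans (congr2 +%R (single_layer_pairing d3 Lp schi) (single_layer_pairing d3 Lt schi)) _.
  by rewrite -mulrDr; congr (_ * _); apply/esym; exact: IS_Tk1_add Lp Lt Ll.
split=> [[_ tan div]|[tan div]].
  split=> [|chi cchi].
    apply: filterS2 tan normal => x tx nx Sx; apply: (mulfI W2).
    by rewrite mulr0 -nx// tx.
  by apply: (mulfI Wn0); rewrite mulr0 -divE// div.
split=> //.
  by apply: filterS2 tan normal => x tx nx Sx; rewrite nx// tx// mulr0.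
by move=> chi cchi; rewrite divE// div// mulr0.
Qed.

Lemma DspaceP Sigma f : Sigma `<=` S -> Dspace Sigma f <->
  L2S f /\ forall chi, Cc_infty Sigma chi -> IS (fun x => Tk 1 f x * lap (radial_ext chi) x) = 0.
Proof.
move=> SS.
split=> [[/L2E Lf div]|[Lf div]]; split=> //; first 1 last.
- exact/L2E.
- move=> chi cchi; have [schi _ _] := cchi.
  by rewrite (Rintegral_sgrad _ SS cchi) single_layer_pairing// div// mulr0.
- move=> chi cchi; have [schi _ _] := cchi; apply: (mulfI Wn0).
  by rewrite mulr0 -single_layer_pairing// -(Rintegral_sgrad _ SS cchi) div.
Qed.

Lemma projL2_ae Sigma f g : projL2 Sigma f = projL2 Sigma g %[ae mu] ->
  {ae mu, forall x, Sigma x -> f x = g x}.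
Proof.
apply: filterS => x /(_ Logic.I) + Sx; rewrite /projL2 !patchE.
by rewrite (mem_set Sx).
Qed.

(** The integral of k_1 is read off from [IS_kk1_pk] at radius 0, where the Poisson kernel is 1. *)
Lemma Tk1_cst m x : S x -> Tk 1 (fun=> m) x = m * W.
Proof.
move=> Sx; have [Lk _] := kk1_L1 d3 Sx.
have z1 : 0 <= (0 : R) < 1 by rewrite lexx ltr01.
have := IS_kk1_pk d3 z1 Sx Sx; rewrite kk0 mulr1 => <-.
rewrite -IS_scale; last by move: Lk; congr L1S; apply/funext => y; rewrite pk0 mulr1.
by apply: eq_IS => y _; rewrite pk0 mulr1 mulrC.
Qed.

Let sum_eq0 (a b c : R) : a = b + c -> a = 0 -> b = 0 -> c = 0.
Proof. by move=> -> + b0; rewrite b0 add0r. Qed.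

(* [t] and [t'] are two solutions, and [f] and [f'] are the sums of the two
   densities that occur in the corresponding fields. *)
Lemma solution_unique Sigma e k f f' t t' : Sigma !=set0 -> sphere_open Sigma ->
  k%:R = beta * (1 + e) -> e ^+ 2 = 1 -> L2S f -> L2S t -> L2S t' ->
  (forall x, f' x = f x + (t' x - t x)) -> 0 ^+ k * IS (fun x => t' x - t x) = 0 ->
  {ae mu, forall x, Sigma x -> Tk 1 f' x - Tk 1 f x + e * W * (t' x - t x) = 0} ->
  (forall chi, Cc_infty Sigma chi -> IS (fun x => Tk 1 f x * lap (radial_ext chi) x) = 0) ->
  (forall chi, Cc_infty Sigma chi -> IS (fun x => Tk 1 f' x * lap (radial_ext chi) x) = 0) ->
  t' = t %[ae mu].
Proof.
move=> S0 oS ke e1 Lf Lt Lt' f'E D0 tan div div'.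
pose D x := t' x - t x; have LD : L2S D by exact: L2S_B.
have SS : Sigma `<=` S by move=> x; case: oS => [U _ ->] [].
have f'D : f' = (fun x => f x + D x) by apply/funext.
rewrite {}f'D {f'E} in tan div'.
have Tadd := OpS_add_ae (schur_kk1 d3) Lf LD.
have TD : {ae mu, forall x, Sigma x -> Tk 1 D x + e * W * D x = 0}.
  apply: filterS2 tan Tadd => x tx ax Sx; move: (tx Sx).
  by rewrite -/(D x) /Tk (ax (SS _ Sx)) => <-; ring.
have divD chi : RS chi -> Cc_infty Sigma chi -> IS (fun x => Tk 1 D x * lap chi x) = 0.
  move=> schi cchi; have h := IS_Tk1_add Lf LD (L2S_RS (RS_lap schi)).
  have rchi : radial_ext chi = chi by apply/funext; case: schi.
  have h1 := div _ cchi; have h2 := div' _ cchi; rewrite rchi in h1 h2.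
  exact: sum_eq0 h h2 h1.
have TD0 := trace_eq0 d3 S0 oS LD e1 TD divD.
have := ae_on_sphere (trace_injective d3 ke e1 LD D0 TD0).
by apply: filterS => x /eqP; rewrite subr_eq0 => /eqP.
Qed.

End tangential_divergence_free.

(** * Existence and uniqueness of the completing densities *)

Section solutions.
Context {R : realType} {d : nat}.
Local Notation E := 'rV[R]_d.
Local Notation S := (@sphere R d).
Local Notation mu := (@omega R d).
Hypothesis d3 : (3 <= d)%N.
Local Notation n := (d - 2)%N.
Local Notation beta := (@beta R d).
Local Notation W := (@sphere_area R d).
Variable Sigma : set E.
Hypotheses (S0 : Sigma !=set0) (oS : sphere_open Sigma).
Implicit Types (x : E) (f g phi psi t : E -> R).

Let W0 : 0 < W. Proof. exact: sphere_area_gt0. Qed.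

Let SS : Sigma `<=` S. Proof. by move=> x; case: oS => [U _ ->] []. Qed.

Let clear_scale (w T f p : R) : 0 < w -> (2 * w)^-1 * (T + w * f) = p -> T + w * (f - 2 * p) = 0.
Proof.
by move=> w0 <-; field; rewrite gt_eqF.
Qed.

(** With G the chosen preimage, phi + tau = G and tau - phi = G - 2 phi, so that tangency says (K +
    I/2) G = phi on Sigma. Uniqueness is the case e = 1, k = d - 2. *)
Lemma tau_pm_solution phi : Uplus Sigma phi ->
  unique_ae_in (L2 d) (fun t => tangent_divfree_on Sigma (Bplus phi \+ Bminus t)) (tau_pm Sigma
    phi).
Proof.
move=> [[/L2E Lp _] Gex].
pose G := inverse_on Sigma (Dspace Sigma) (@Kplus R d) (projL2 Sigma phi).
have [/(DspaceP d3 _ SS)[LG divG] /projL2_ae KG] :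
  is_preimage Sigma (Dspace Sigma) (@Kplus R d) (projL2 Sigma phi) G by exact: xgetPex Gex.
have Lt : L2S (tau_pm Sigma phi) by exact: L2S_B LG Lp.
have fE : phi \+ tau_pm Sigma phi = G by apply/funext => x; rewrite /= /tau_pm addrC subrK.
have tanG : {ae mu, forall x, Sigma x -> Tk 1 G x + W * (tau_pm Sigma phi x - phi x) = 0}.
  apply: filterS2 KG (Kplus_Tk d3 LG) => x h1 h2 Sx.
  have -> : tau_pm Sigma phi x - phi x = G x - 2 * phi x by rewrite /tau_pm -/G; ring.
  apply: clear_scale => //; rewrite -(h2 (SS Sx)); exact: h1.
split.
- exact/L2E.
- by apply/(tangent_divfreeP d3 SS Lp Lt); rewrite fE.
move=> t' /L2E Lt' /(tangent_divfreeP d3 SS Lp Lt')[tan' div'].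
apply: (@solution_unique R d d3 Sigma 1 n G (phi \+ t') _ _ S0 oS _ (expr1n _ _) LG Lt Lt' _ _ _
  divG div').
- by rewrite /beta; field.
- by move=> x; rewrite /= /tau_pm -/G; ring.
- by rewrite expr0n subn_eq0 leqNgt d3 mul0r.
- apply: filterS2 tan' tanG => x h1 h2 Sx.
  rewrite -[RHS](subrr 0) -{1}(h1 Sx) -(h2 Sx); ring.
Qed.

(** Here tau + psi = m - G. The constant m, which gives tau zero mean, drops out of both conditions:
    T m = m W cancels it in the normal part, and the Laplacian of a test function has integral 0.
    Tangency then says (K - I/2) G = psi on Sigma. Uniqueness is the case e = -1, k = 0. *)
Lemma tau_mp_solution psi : Uminus Sigma psi ->
  unique_ae_in (L2_0 d) (fun t => tangent_divfree_on Sigma (Bplus t \+ Bminus psi)) (tau_mp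
    Sigma psi).
Proof.
move=> [/L2E Lp Gex].
pose G := inverse_on Sigma (Dspace0 Sigma) (@Kminus R d) (projL2 Sigma psi).
have [[/(DspaceP d3 _ SS)[LG divG] [_ G0]] /projL2_ae KG] :
  is_preimage Sigma (Dspace0 Sigma) (@Kminus R d) (projL2 Sigma psi) G by exact: xgetPex Gex.
have {}G0 : IS G = 0 by [].
set m := mean psi.
have LNG : L2S (fun x => -1 * G x) by exact: L2S_Z.
have Lc : L2S (fun _ : E => m) := L2S_cst m.
have Lf : L2S ((fun x => -1 * G x) \+ (fun=> m)) by exact: L2S_D.
have Lt : L2S (tau_mp Sigma psi).
  have := L2S_D (L2S_B LNG Lp) Lc; congr L2S; apply/funext => x.
  by rewrite /tau_mp -/G mulN1r.
have fE : tau_mp Sigma psi \+ psi = (fun x => -1 * G x) \+ (fun=> m).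
  by apply/funext => x; rewrite /= /tau_mp -/G -/m; ring.
have TE : {ae mu, forall x, S x -> Tk 1 ((fun x => -1 * G x) \+ (fun=> m)) x = m * W - Tk 1 G x}.
  apply: filterS2 (OpS_add_ae (schur_kk1 d3) LNG Lc) (OpS_scale_ae (-1) (schur_kk1 d3) LG) =>
    x h1 h2 Sx.
  apply: etrans (h1 Sx) _; rewrite (h2 Sx) addrC mulN1r; congr (_ - _).
  exact: Tk1_cst.
have tanf : {ae mu, forall x, Sigma x ->
    Tk 1 ((fun x => -1 * G x) \+ (fun=> m)) x + W * (psi x - tau_mp Sigma psi x) = 0}.
  apply: filterS2 TE (filterI KG (Kminus_Tk d3 LG)) => x h1 [h2 h3] Sx.
  have e1 := h1 (SS Sx); have e2 := h2 Sx; have e3 := h3 (SS Sx).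
  have h : Tk 1 G x + W * (- G x - 2 * psi x) = 0.
    by apply: clear_scale => //; rewrite mulrN -e3.
  rewrite e1 /tau_mp -/G -/m; transitivity (- (Tk 1 G x + W * (- G x - 2 * psi x))); first by ring.
  by rewrite h oppr0.
have divf chi : Cc_infty Sigma chi ->
    IS (fun x => Tk 1 ((fun x => -1 * G x) \+ (fun=> m)) x * lap (radial_ext chi) x) = 0.
  move=> cchi; have [schi _ _] := cchi.
  have sl := RS_lap (RS_radial_ext schi); have Ll := L2S_RS sl.
  have LT : L2S (Tk 1 G) := OpS_L2 (schur_kk1 d3) LG.
  have L1 := L1S_RS sl; have L2 := L2S_mul LT Ll.
  transitivity (IS (fun x => m * W * lap (radial_ext chi) x - Tk 1 G x * lap (radial_ext chi) x)).
    apply: (IS_ae_eq (L2S_mul (OpS_L2 (schur_kk1 d3) Lf) Ll) (L1S_B (L1S_Z _ L1) L2)).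
    by apply: filterS TE => x h Sx; rewrite -mulrBl; congr (_ * _); exact: h.
  by rewrite (IS_sub (L1S_Z _ L1) L2) (IS_scale _ L1) divG// IS_lap ?mulr0 ?subr0//;
    exact: RS_radial_ext.
have t0 : IS (tau_mp Sigma psi) = 0.
  have L1 := L2S_L1S LNG; have L2 := L2S_L1S Lp; have L3 := L2S_L1S Lc.
  rewrite (eq_IS (g := fun x => (-1 * G x - psi x) + m)); last first.
    by move=> x _; rewrite /tau_mp -/G -/m mulN1r.
  rewrite (IS_add (L1S_B L1 L2) L3) (IS_sub L1 L2) (IS_scale _ (L2S_L1S LG)) G0 mulr0 sub0r.
  rewrite (eq_IS (f := fun=> m) (g := fun=> m * 1)) => [|x _]; last by rewrite mulr1.
  rewrite (IS_scale _ (@L1S_cst R d 1)) /m /mean omega_dE -/W mulrC mulrA divff ?gt_eqF// mul1r.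
  by rewrite addrC subrr.
split.
- by split; [exact/L2E|].
- by apply/(tangent_divfreeP d3 SS Lt Lp); rewrite fE.
move=> t' [/L2E Lt' t'0] /(tangent_divfreeP d3 SS Lt' Lp)[tan' div'].
have {}t'0 : IS t' = 0 by [].
apply: (@solution_unique R d d3 Sigma (-1) 0 _ (t' \+ psi) _ _ S0 oS _ _ Lf Lt Lt' _ _ _ divf div').
- by rewrite subrr mulr0.
- by rewrite sqrrN expr1n.
- by move=> x; rewrite /= /tau_mp -/G -/m; ring.
- by rewrite (IS_sub (L2S_L1S Lt') (L2S_L1S Lt)) t'0 t0 subrr mulr0.
- apply: filterS2 tan' tanf => x h1 h2 Sx.
  rewrite -[RHS](subrr 0) -{1}(h1 Sx) -(h2 Sx); ring.
Qed.

End solutions.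

Theorem corollary2p8 (R : realType) (d : nat) (Sigma : set 'rV[R]_d)
    (phi psi : 'rV[R]_d -> R) :
  (3 <= d)%N ->
  Sigma !=set0 -> sphere_open Sigma -> compactly_proper Sigma ->
  Uplus Sigma phi -> Uminus Sigma psi ->
  unique_ae_in (L2 d)
    (fun t => tangent_divfree_on Sigma (Bplus phi \+ Bminus t))
    (tau_pm Sigma phi) /\
  unique_ae_in (L2_0 d)
    (fun t => tangent_divfree_on Sigma (Bplus t \+ Bminus psi))
    (tau_mp Sigma psi).
Proof.
move=> d3 S0 oS _ Up Um.
by split; [exact: tau_pm_solution|exact: tau_mp_solution].
Qed.
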